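(* Let $H$ be a Hilbert space and let $T\in B(H)$ be a power bounded operator (i.e. $\sup_{n\geq 0}\|T^n\|<\infty$). The following assertions are equivalent. (i) $T$ is a Ritt operator which admits a bounded $H^\infty(B_\gamma)$ functional calculus for some $\gamma\in\bigl(0,\frac{\pi}{2}\bigr)$. (ii) $T$ and $T^*$ both satisfy uniform square function estimates, that is, there is a constant $C>0$ such that $\|x\|_{T,1}\leq C\|x\|$ and $\|y\|_{T^*,1}\leq C\|y\|$ for all $x,y\in H$. (iii) $T$ is a Ritt operator and $T$ is similar to a contraction, i.e. there is an invertible $V\in B(H)$ such that $\|V^{-1}TV\|\leq 1$.
   Context: Let $X$ be a complex Banach space and $B(X)$ the algebra of bounded operators on $X$; write $R(\lambda,T)=(\lambda I-T)^{-1}$. An operator $T\in B(X)$ is a Ritt operator if the two sets $\{T^n : n\geq 0\}$ and $\{n(T^n-T^{n-1}) : n\geq 1\}$ are bounded. For $\gamma\in(0,\frac{\pi}{2})$, $B_\gamma$ (Stolz domain) is the interior of the convex hull of $1$ and the disc $D(0,\sin\gamma)=\{|z|<\sin\gamma\}$. A Ritt operator $T$ is of type $\alpha\in(0,\frac{\pi}{2})$ if $\sigma(T)\subset\overline{B_\alpha}$ and for every $\beta\in(\alpha,\frac{\pi}{2})$ the set $\{(\lambda-1)R(\lambda,T) : \lambda\in\mathbb{C}\setminus\overline{B_\beta}\}$ is bounded (every Ritt operator is of some type $\alpha$). $H^\infty_0(B_\gamma)$ is the space of bounded holomorphic $\varphi\colon B_\gamma\to\mathbb{C}$ for which there are $s,c>0$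 with $|\varphi(\lambda)|\leq c|1-\lambda|^s$ on $B_\gamma$. If $T$ is a Ritt operator of type $\alpha<\gamma$ and $\varphi\in H^\infty_0(B_\gamma)$, set $\varphi(T)=\frac{1}{2\pi i}\int_{\partial B_\beta}\varphi(\lambda)R(\lambda,T)\,d\lambda$ with $\beta\in(\alpha,\gamma)$ and $\partial B_\beta$ oriented counterclockwise (independent of $\beta$). $T$ admits a bounded $H^\infty(B_\gamma)$ functional calculus if $T$ is of type $\alpha$ for some $\alpha<\gamma$ and there is $K>0$ with $\|\varphi(T)\|\leq K\sup_{\lambda\in B_\gamma}|\varphi(\lambda)|$ for all $\varphi\in H^\infty_0(B_\gamma)$. For $S\in B(H)$ on a Hilbert space $H$ and $x\in H$, $\|x\|_{S,1}=\bigl(\sum_{k=1}^{\infty}k\,\|S^{k-1}(I-S)(x)\|^2\bigr)^{1/2}\in[0,\infty]$. *)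

(* Defs.v *)
From Stdlib Require Import Reals Lra Lia FunctionalExtensionality.
From Stdlib Require Import PropExtensionality ProofIrrelevance ClassicalEpsilon.
From Coquelicot Require Import Coquelicot.
Open Scope R_scope.

(* Complex Banach spaces are Coquelicot's [CompleteNormedModule C_AbsRing];
   [is_linear] there includes boundedness.                                   *)

Lemma plus_minus_cancel (G : AbelianGroup) (a b : G) : plus (minus a b) b = a.
Proof. unfold minus; now rewrite <- plus_assoc, plus_opp_l, plus_zero_r. Qed.

Lemma minus_plus_plus (G : AbelianGroup) (a b c d : G) :
  minus (plus a b) (plus c d) = plus (minus a c) (minus b d).
Proof.
unfold minus; rewrite opp_plus, !plus_assoc; f_equal.
rewrite <- !plus_assoc; f_equal; apply plus_comm.
Qed.

Lemma third_pos (e : posreal) : 0 < e / 3.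
Proof. assert (H := cond_pos e); lra. Qed.

Section BoundedOperators.

Variable X : NormedModule C_AbsRing.

Record bounded_op : Type :=
  BoundedOp { bop_fun :> X -> X; bop_linear : is_linear bop_fun }.

Lemma bop_ext (S T : bounded_op) : (forall x, S x = T x) -> S = T.
Proof.
destruct S as [f Hf], T as [g Hg]; simpl; intros E.
assert (E' : f = g) by (apply functional_extensionality; exact E).
subst g; f_equal; apply proof_irrelevance.
Qed.

Definition bop_zero : bounded_op := BoundedOp (fun _ => zero) is_linear_zero.

Definition bop_one : bounded_op := BoundedOp (fun x => x) is_linear_id.

Definition bop_mult (S T : bounded_op) : bounded_op :=
  BoundedOp (fun x => S (T x))
    (is_linear_comp T S (bop_linear T) (bop_linear S)).

Lemma is_linear_add (f g : X -> X) :
  is_linear f -> is_linear g -> is_linear (fun x => plus (f x) (g x)).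
Proof.
intros Hf Hg.
exact (is_linear_comp _ _ (is_linear_prod f g Hf Hg) is_linear_plus).
Qed.

Definition bop_plus (S T : bounded_op) : bounded_op :=
  BoundedOp _ (is_linear_add S T (bop_linear S) (bop_linear T)).

Definition bop_opp (T : bounded_op) : bounded_op :=
  BoundedOp (fun x => opp (T x))
    (is_linear_comp T _ (bop_linear T) is_linear_opp).

Definition bop_scal (k : C) (T : bounded_op) : bounded_op :=
  BoundedOp (fun x => scal k (T x))
    (is_linear_comp T _ (bop_linear T) (is_linear_scal_r k Cmult_comm)).

Lemma bop_plus_comm (S T : bounded_op) : bop_plus S T = bop_plus T S.
Proof. apply bop_ext; intros x; apply plus_comm. Qed.

Lemma bop_plus_assoc (S T U : bounded_op) :
  bop_plus S (bop_plus T U) = bop_plus (bop_plus S T) U.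
Proof. apply bop_ext; intros x; apply plus_assoc. Qed.

Lemma bop_plus_zero_r (T : bounded_op) : bop_plus T bop_zero = T.
Proof. apply bop_ext; intros x; apply plus_zero_r. Qed.

Lemma bop_plus_opp_r (T : bounded_op) : bop_plus T (bop_opp T) = bop_zero.
Proof. apply bop_ext; intros x; apply (plus_opp_r (T x)). Qed.

Definition bop_AbelianMonoid_mixin :=
  AbelianMonoid.Mixin bounded_op bop_plus bop_zero bop_plus_comm bop_plus_assoc
    bop_plus_zero_r.

Canonical bop_AbelianMonoid :=
  AbelianMonoid.Pack bounded_op bop_AbelianMonoid_mixin bounded_op.

Definition bop_AbelianGroup_mixin :=
  AbelianGroup.Mixin bop_AbelianMonoid bop_opp bop_plus_opp_r.

Canonical bop_AbelianGroup :=
  AbelianGroup.Pack bounded_op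
    (AbelianGroup.Class _ bop_AbelianMonoid_mixin bop_AbelianGroup_mixin)
    bounded_op.

Lemma bop_mult_assoc (S T U : bounded_op) :
  bop_mult S (bop_mult T U) = bop_mult (bop_mult S T) U.
Proof. apply bop_ext; reflexivity. Qed.

Lemma bop_mult_one_r (T : bounded_op) : bop_mult T bop_one = T.
Proof. apply bop_ext; reflexivity. Qed.

Lemma bop_mult_one_l (T : bounded_op) : bop_mult bop_one T = T.
Proof. apply bop_ext; reflexivity. Qed.

Lemma bop_mult_distr_r (S T U : bounded_op) :
  bop_mult (plus S T) U = plus (bop_mult S U) (bop_mult T U).
Proof. apply bop_ext; reflexivity. Qed.

Lemma bop_mult_distr_l (S T U : bounded_op) :
  bop_mult S (plus T U) = plus (bop_mult S T) (bop_mult S U).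
Proof. apply bop_ext; intros x; apply (linear_plus S (bop_linear S)). Qed.

Definition bop_Ring_mixin :=
  Ring.Mixin bop_AbelianGroup bop_mult bop_one bop_mult_assoc bop_mult_one_r
    bop_mult_one_l bop_mult_distr_r bop_mult_distr_l.

Canonical bop_Ring :=
  Ring.Pack bounded_op (Ring.Class _ (AbelianGroup.class bop_AbelianGroup)
                   bop_Ring_mixin) bounded_op.

Lemma bop_scal_assoc (k l : C) (T : bounded_op) :
  bop_scal k (bop_scal l T) = bop_scal (mult k l) T.
Proof. apply bop_ext; intros x; exact (scal_assoc k l (T x)). Qed.

Lemma bop_scal_one (T : bounded_op) : bop_scal one T = T.
Proof. apply bop_ext; intros x; exact (scal_one (T x)). Qed.

Lemma bop_scal_distr_l (k : C) (S T : bounded_op) :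
  bop_scal k (plus S T) = plus (bop_scal k S) (bop_scal k T).
Proof. apply bop_ext; intros x; exact (scal_distr_l k (S x) (T x)). Qed.

Lemma bop_scal_distr_r (k l : C) (T : bounded_op) :
  bop_scal (plus k l) T = plus (bop_scal k T) (bop_scal l T).
Proof. apply bop_ext; intros x; exact (scal_distr_r k l (T x)). Qed.

Definition bop_ModuleSpace_mixin :=
  ModuleSpace.Mixin C_Ring bop_AbelianGroup bop_scal bop_scal_assoc
    bop_scal_one bop_scal_distr_l bop_scal_distr_r.

Canonical bop_ModuleSpace :=
  ModuleSpace.Pack C_Ring bounded_op
    (ModuleSpace.Class C_Ring bounded_op (AbelianGroup.class bop_AbelianGroup)
       bop_ModuleSpace_mixin) bounded_op.

Definition op_norm (T : bounded_op) : R :=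
  real (Lub_Rbar (fun r => exists x : X, norm x <= 1 /\ r = norm (T x))).

Lemma norm_zero_le1 : norm (zero : X) <= 1.
Proof.
apply Rle_trans with 0; [right; exact (norm_zero (V := X)) | exact Rle_0_1].
Qed.

Lemma norm_bop_zero (T : bounded_op) : norm (T zero) = 0.
Proof.
exact (eq_trans (f_equal norm (linear_zero T (bop_linear T)))
         (norm_zero (V := X))).
Qed.

Lemma op_norm_lub (T : bounded_op) :
  is_lub_Rbar (fun r => exists x : X, norm x <= 1 /\ r = norm (T x))
    (Finite (op_norm T)).
Proof.
unfold op_norm.
set (E := fun r => exists x : X, norm x <= 1 /\ r = norm (T x)).
destruct (linear_norm T (bop_linear T)) as [M [M0 HM]].
assert (HL : is_lub_Rbar E (Lub_Rbar E)) by apply Lub_Rbar_correct.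
assert (H0 : E 0).
{ exists zero.
split; [exact norm_zero_le1 | now rewrite norm_bop_zero]. }
destruct HL as [Hub Hlub].
assert (HMb : Rbar_le (Lub_Rbar E) M).
{ apply Hlub; intros r [x [Hx ->]]; simpl.
  apply Rle_trans with (1 := HM x).
  rewrite <- (Rmult_1_r M) at 2; apply Rmult_le_compat_l; lra. }
assert (H0b := Hub 0 H0).
destruct (Lub_Rbar E) as [l | |]; simpl in *; try easy.
Qed.

Lemma op_norm_ge0 (T : bounded_op) : 0 <= op_norm T.
Proof.
apply (proj1 (op_norm_lub T) 0); exists zero.
split; [exact norm_zero_le1 | now rewrite norm_bop_zero].
Qed.

Lemma op_norm_bound (T : bounded_op) (x : X) : norm (T x) <= op_norm T * norm x.
Proof.
destruct (Rle_lt_or_eq_dec 0 (norm x) (norm_ge_0 x)) as [Hx | Hx].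
- set (y := scal (RtoC (/ norm x)) x : X).
  assert (Ha : @abs C_AbsRing (RtoC (/ norm x)) = / norm x).
  { change (Cmod (RtoC (/ norm x)) = / norm x).
    rewrite Cmod_R; apply Rabs_pos_eq; left; now apply Rinv_0_lt_compat. }
  assert (Hy : norm y <= 1).
  { apply Rle_trans with (1 := norm_scal (V := X) (RtoC (/ norm x)) x).
    rewrite Ha, Rinv_l by lra; lra. }
  assert (HTy : norm (T y) <= op_norm T).
  { apply (proj1 (op_norm_lub T)); now exists y. }
  assert (Exy : x = scal (RtoC (norm x)) y).
  { unfold y; rewrite scal_assoc.
    change (mult (RtoC (norm x)) (RtoC (/ norm x)))
      with (Cmult (RtoC (norm x)) (RtoC (/ norm x))).
    rewrite <- RtoC_mult, Rinv_r by lra.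
    symmetry; exact (scal_one x). }
  rewrite Exy at 1; rewrite (linear_scal T (bop_linear T)).
  apply Rle_trans with (1 := norm_scal (V := X) (RtoC (norm x)) (T y)).
  change (@abs C_AbsRing (RtoC (norm x))) with (Cmod (RtoC (norm x))).
  rewrite Cmod_R, Rabs_pos_eq by lra.
  rewrite Rmult_comm; apply Rmult_le_compat_r; lra.
- rewrite <- Hx, (norm_eq_zero x (eq_sym Hx)).
  rewrite norm_bop_zero; lra.
Qed.

Lemma op_norm_le (T : bounded_op) (M : R) :
  0 <= M -> (forall x, norm (T x) <= M * norm x) -> op_norm T <= M.
Proof.
intros M0 HM; apply (proj2 (op_norm_lub T) M); intros r [x [Hx ->]]; simpl.
apply Rle_trans with (1 := HM x).
rewrite <- (Rmult_1_r M) at 2; now apply Rmult_le_compat_l.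
Qed.

Lemma op_norm_triangle (S T : bounded_op) :
  op_norm (plus S T) <= op_norm S + op_norm T.
Proof.
apply op_norm_le.
- assert (H1 := op_norm_ge0 S); assert (H2 := op_norm_ge0 T); lra.
- intros x; change (plus S T x) with (plus (S x) (T x)).
  eapply Rle_trans; [apply norm_triangle|].
  assert (H1 := op_norm_bound S x); assert (H2 := op_norm_bound T x); lra.
Qed.

Lemma op_norm_scal (k : C) (T : bounded_op) :
  op_norm (scal k T) <= @abs C_AbsRing k * op_norm T.
Proof.
apply op_norm_le.
- apply Rmult_le_pos; [apply abs_ge_0 | apply op_norm_ge0].
- intros x; change (scal k T x) with (scal k (T x)).
  apply Rle_trans with (1 := norm_scal (V := X) k (T x)).
  rewrite Rmult_assoc; apply Rmult_le_compat_l;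
    [apply abs_ge_0 | apply op_norm_bound].
Qed.

Lemma op_norm_eq0 (T : bounded_op) : op_norm T = 0 -> T = zero.
Proof.
intros E; apply bop_ext; intros x; apply norm_eq_zero.
assert (H := op_norm_bound T x); assert (H' := norm_ge_0 (T x)).
rewrite E in H; lra.
Qed.

Definition bop_ball (S : bounded_op) (e : R) (T : bounded_op) : Prop :=
  op_norm (minus T S) < e.

Lemma bop_ball_center (T : bounded_op) (e : posreal) : bop_ball T e T.
Proof.
unfold bop_ball; rewrite minus_eq_zero.
apply Rle_lt_trans with 0; [|apply cond_pos].
apply op_norm_le; [lra|]; intros x.
rewrite Rmult_0_l; right; exact (norm_zero (V := X)).
Qed.

Lemma bop_ball_sym (S T : bounded_op) (e : R) :
  bop_ball S e T -> bop_ball T e S.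
Proof.
unfold bop_ball; intros H; eapply Rle_lt_trans; [|exact H].
apply op_norm_le; [apply op_norm_ge0|]; intros x.
replace (norm (minus S T x)) with (norm (minus T S x)).
- apply op_norm_bound.
- change (norm (minus (T x) (S x)) = norm (minus (S x) (T x))).
  rewrite <- norm_opp, opp_minus; reflexivity.
Qed.

Lemma bop_ball_triangle (S T U : bounded_op) (e1 e2 : R) :
  bop_ball S e1 T -> bop_ball T e2 U -> bop_ball S (e1 + e2) U.
Proof.
unfold bop_ball; intros H1 H2.
rewrite (minus_trans T U S).
eapply Rle_lt_trans; [apply op_norm_triangle|]; lra.
Qed.

Definition bop_UniformSpace_mixin :=
  UniformSpace.Mixin bounded_op bop_zero bop_ball bop_ball_center bop_ball_sym
    bop_ball_triangle.

Canonical bop_UniformSpace :=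
  UniformSpace.Pack bounded_op bop_UniformSpace_mixin bounded_op.

Canonical bop_NormedModuleAux :=
  NormedModuleAux.Pack C_AbsRing bounded_op
    (NormedModuleAux.Class C_AbsRing bounded_op
       (ModuleSpace.class C_Ring bop_ModuleSpace) bop_UniformSpace_mixin)
    bounded_op.

Lemma bop_norm_ball (S T : bounded_op) (e : R) :
  op_norm (minus T S) < e -> ball S e T.
Proof. exact (fun H => H). Qed.

Lemma bop_ball_norm (S T : bounded_op) (e : posreal) :
  ball S e T -> op_norm (minus T S) < 1 * e.
Proof. rewrite Rmult_1_l; exact (fun H => H). Qed.

Definition bop_NormedModule_mixin :=
  NormedModule.Mixin C_AbsRing bop_NormedModuleAux op_norm 1 op_norm_triangle
    op_norm_scal bop_norm_ball bop_ball_norm op_norm_eq0.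

Canonical bop_NormedModule :=
  NormedModule.Pack C_AbsRing bounded_op
    (NormedModule.Class C_AbsRing bounded_op
       (NormedModuleAux.class C_AbsRing bop_NormedModuleAux)
       bop_NormedModule_mixin) bounded_op.

Lemma bop_complete_aux (limX : ((X -> Prop) -> Prop) -> X) :
  (forall G, ProperFilter G -> cauchy G ->
     forall eps : posreal, G (ball (limX G) eps)) ->
  forall F : (bounded_op -> Prop) -> Prop, ProperFilter F -> cauchy F ->
  exists A : bounded_op, forall eps : posreal, F (ball A eps).
Proof.
intros complX F PF CF.
assert (FF : Filter F) by apply PF.
assert (close2 : forall e : posreal,
  exists S : bounded_op, F (fun T => op_norm (minus T S) < e)) by exact CF.
set (Fx := fun x : X => filtermap (fun T : bounded_op => T x) F).
assert (PFx : forall x, ProperFilter (Fx x)) by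
  (intros x; apply filtermap_proper_filter; exact PF).
assert (Hlim : forall (x : X) (e : posreal),
  F (fun T : bounded_op => norm (minus (T x) (limX (Fx x) : X)) < e)).
{ intros x e.
  assert (CFx : cauchy (Fx x)).
  { intros d.
    assert (Hd : 0 < d / (norm x + 1)).
    { apply Rdiv_lt_0_compat; [apply cond_pos|].
      assert (H := norm_ge_0 x); lra. }
    destruct (close2 (mkposreal _ Hd)) as [S HS]; simpl in HS.
    exists (S x); unfold Fx, filtermap.
    revert HS; apply filter_imp; intros T HT.
    apply (norm_compat1 (S x) (T x) d).
    apply Rle_lt_trans with (op_norm (minus T S) * norm x).
    - exact (op_norm_bound (minus T S) x).
    - assert (H := norm_ge_0 x); assert (H' := op_norm_ge0 (minus T S)).
      apply Rle_lt_trans with (op_norm (minus T S) * (norm x + 1)).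
      + apply Rmult_le_compat_l; lra.
      + replace (pos d) with (d / (norm x + 1) * (norm x + 1))
          by (field; lra).
        apply Rmult_lt_compat_r; lra. }
  assert (Hn := norm_factor_gt_0 (V := X)).
  assert (Hd : 0 < e / norm_factor (V := X)) by
    (apply Rdiv_lt_0_compat; [apply cond_pos | exact Hn]).
  assert (HL := complX (Fx x) (PFx x) CFx (mkposreal _ Hd)).
  unfold Fx at 1, filtermap in HL.
  revert HL; apply filter_imp; intros T HT.
  assert (HT' := norm_compat2 _ _ _ HT); simpl in HT'.
  eapply Rlt_le_trans; [exact HT'|]; right; field; lra. }
assert (Hunif : forall e : posreal, exists S : bounded_op,
  F (fun T => op_norm (minus T S) < e) /\
  forall x, norm (minus (limX (Fx x) : X) (S x)) <= e * norm x).
{ intros e; destruct (close2 e) as [S HS]; exists S; split; [exact HS|].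
  intros x; apply le_epsilon; intros d Hd.
  assert (HF := filter_and _ _ HS (Hlim x (mkposreal d Hd))).
  destruct (filter_ex _ HF) as [T [H1 H2]]; simpl in H2.
  rewrite (minus_trans (T x)).
  eapply Rle_trans; [apply norm_triangle|].
  rewrite <- norm_opp, opp_minus.
  assert (H3 := op_norm_bound (minus T S) x).
  change (norm (minus (T x) (S x)) <= op_norm (minus T S) * norm x) in H3.
  assert (H4 : op_norm (minus T S) * norm x <= e * norm x)
    by (apply Rmult_le_compat_r; [apply norm_ge_0 | lra]).
  lra. }
set (L := fun x : X => (limX (Fx x) : X)).
assert (eq_of_small : forall a b : X,
  (forall e : posreal, norm (minus a b) <= e) -> a = b).
{ intros a b H.
  assert (H0 : norm (minus a b) = 0).
  { apply Rle_antisym; [|apply norm_ge_0].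
    apply le_epsilon; intros d Hd; rewrite Rplus_0_l.
    exact (H (mkposreal d Hd)). }
  assert (H1 := norm_eq_zero _ H0).
  rewrite <- (plus_zero_l b), <- H1; symmetry.
  exact (plus_minus_cancel _ a b). }
assert (Llin : is_linear L).
{ split.
  - intros x y; apply eq_of_small; intros e.
    set (d := mkposreal _ (third_pos e)).
    assert (HF := filter_and _ _ (Hlim (plus x y) d)
                    (filter_and _ _ (Hlim x d) (Hlim y d))).
    destruct (filter_ex _ HF) as [T [H1 [H2 H3]]].
    fold (L (plus x y)) in H1; fold (L x) in H2; fold (L y) in H3.
    rewrite (linear_plus T (bop_linear T)) in H1.
    rewrite (minus_trans (plus (T x) (T y))).
    replace (minus (plus (T x) (T y)) (plus (L x) (L y)))
      with (plus (minus (T x) (L x)) (minus (T y) (L y))).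
    + rewrite <- norm_opp, opp_minus in H1.
      eapply Rle_trans; [apply norm_triangle|].
      assert (H4 := norm_triangle (minus (T x) (L x)) (minus (T y) (L y))).
      refine (Rle_trans _ _ _ (Rplus_le_compat _ _ _ _ (Rlt_le _ _ H1)
        (Rle_trans _ _ _ H4 (Rplus_le_compat _ _ _ _ (Rlt_le _ _ H2)
          (Rlt_le _ _ H3)))) _).
      right; simpl; field.
    + symmetry; exact (minus_plus_plus _ (T x) (T y) (L x) (L y)).
  - intros k x; apply eq_of_small; intros e.
    assert (Ha : 0 <= @abs C_AbsRing k) by apply abs_ge_0.
    assert (Hd : 0 < e / (1 + @abs C_AbsRing k)) by
      (apply Rdiv_lt_0_compat; [apply cond_pos | lra]).
    set (d := mkposreal _ Hd).
    assert (HF := filter_and _ _ (Hlim (scal k x) d) (Hlim x d)).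
    destruct (filter_ex _ HF) as [T [H1 H2]].
    fold (L (scal k x)) in H1; fold (L x) in H2.
    rewrite (linear_scal T (bop_linear T)) in H1.
    rewrite (minus_trans (scal k (T x))).
    rewrite <- norm_opp, opp_minus in H1.
    eapply Rle_trans; [apply norm_triangle|].
    assert (H3 : norm (minus (scal k (T x)) (scal k (L x)))
                 <= @abs C_AbsRing k * norm (minus (T x) (L x))).
    { replace (minus (scal k (T x)) (scal k (L x)))
        with (scal k (minus (T x) (L x)))
        by exact (scal_minus_distr_l k (T x) (L x)).
      exact (norm_scal (V := X) k _). }
    assert (H4 : @abs C_AbsRing k * norm (minus (T x) (L x))
                 <= @abs C_AbsRing k * d)
      by (apply Rmult_le_compat_l; [exact Ha | exact (Rlt_le _ _ H2)]).
    refine (Rle_trans _ _ _ (Rplus_le_compat _ _ _ _ (Rlt_le _ _ H1)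
      (Rle_trans _ _ _ H3 H4)) _).
    right; simpl; field; lra.
  - destruct (Hunif (mkposreal 1 Rlt_0_1)) as [S [_ HS]]; simpl in HS.
    exists (1 + op_norm S); split.
    + assert (H := op_norm_ge0 S); lra.
    + intros x; fold (L x) in HS.
      assert (H1 := HS x); assert (H2 := op_norm_bound S x).
      assert (H3 : norm (L x) <= norm (minus (L x) (S x)) + norm (S x)).
      { replace (L x) with (plus (minus (L x) (S x)) (S x)) at 1.
        - apply norm_triangle.
        - exact (plus_minus_cancel _ (L x) (S x)). }
      fold (L x) in H1; lra. }
exists (BoundedOp L Llin); intros e.
set (d := mkposreal _ (third_pos e)).
destruct (Hunif d) as [S [H1 H2]].
revert H1; apply filter_imp; intros T HT.
change (op_norm (minus T (BoundedOp L Llin)) < e).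
apply Rle_lt_trans with (d + d);
  [| assert (He := cond_pos e); simpl; lra].
rewrite (minus_trans S).
eapply Rle_trans; [apply op_norm_triangle|].
apply Rplus_le_compat; [lra|].
apply op_norm_le; [apply Rlt_le, cond_pos|].
intros x; change (norm (minus (S x) (L x)) <= d * norm x).
rewrite <- norm_opp, opp_minus; apply H2.
Qed.

End BoundedOperators.

Section BoundedOperatorsComplete.

Variable X : CompleteNormedModule C_AbsRing.

Definition bop_lim (F : (bounded_op X -> Prop) -> Prop) : bounded_op X :=
  epsilon (inhabits (bop_zero X))
    (fun A : bounded_op X => forall eps : posreal, F (ball A eps)).

Lemma bop_lim_cauchy (F : (bounded_op X -> Prop) -> Prop) :
  ProperFilter F -> cauchy F -> forall eps : posreal, F (ball (bop_lim F) eps).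
Proof.
intros PF CF; unfold bop_lim.
exact (epsilon_spec (inhabits (bop_zero X))
         (fun A : bounded_op X => forall eps : posreal, F (ball A eps))
         (bop_complete_aux X lim complete_cauchy F PF CF)).
Qed.

Lemma bop_lim_close (F1 F2 : (bounded_op X -> Prop) -> Prop) :
  filter_le F1 F2 -> filter_le F2 F1 -> close (bop_lim F1) (bop_lim F2).
Proof.
intros H12 H21.
replace F2 with F1; [exact (ball_center (bop_lim F1))|].
apply functional_extensionality; intros P.
apply propositional_extensionality; split; [apply H21 | apply H12].
Qed.

Definition bop_CompleteSpace_mixin :=
  CompleteSpace.Mixin (bop_UniformSpace X) bop_lim bop_lim_cauchy bop_lim_close.

Canonical bop_CompleteSpace :=
  CompleteSpace.Pack (bounded_op X)
    (CompleteSpace.Class (bounded_op X) (bop_UniformSpace_mixin X)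
       bop_CompleteSpace_mixin)
    (bounded_op X).

Canonical bop_CompleteNormedModule :=
  CompleteNormedModule.Pack C_AbsRing (bounded_op X)
    (CompleteNormedModule.Class C_AbsRing (bounded_op X)
       (NormedModule.class C_AbsRing (bop_NormedModule X))
       bop_CompleteSpace_mixin) (bounded_op X).

End BoundedOperatorsComplete.

Arguments BoundedOp {X} _ _.
Arguments bop_fun {X} _ _.
Arguments op_norm {X} _.

(* Restriction of scalars from C to R, with unchanged carrier, norm and
   uniform structure.  It is not declared canonical: it is only needed to apply
   Coquelicot's Riemann integral, which requires a real normed module.       *)
Section Realify.

Variable V : CompleteNormedModule C_AbsRing.

Definition realify_scal (r : R) (v : V) : V := scal (RtoC r) v.

Lemma realify_scal_assoc (r s : R) (v : V) :
  realify_scal r (realify_scal s v) = realify_scal (mult r s) v.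
Proof.
unfold realify_scal; rewrite scal_assoc.
now change (mult r s) with (r * s); rewrite RtoC_mult.
Qed.

Lemma realify_scal_one (v : V) : realify_scal one v = v.
Proof. exact (scal_one v). Qed.

Lemma realify_scal_distr_l (r : R) (u v : V) :
  realify_scal r (plus u v) = plus (realify_scal r u) (realify_scal r v).
Proof. exact (scal_distr_l (RtoC r) u v). Qed.

Lemma realify_scal_distr_r (r s : R) (v : V) :
  realify_scal (plus r s) v = plus (realify_scal r v) (realify_scal s v).
Proof.
unfold realify_scal; change (plus r s) with (r + s).
rewrite RtoC_plus; exact (scal_distr_r (RtoC r) (RtoC s) v).
Qed.

Definition realify_ModuleSpace_mixin :=
  ModuleSpace.Mixin R_Ring _ realify_scal realify_scal_assoc realify_scal_one
    realify_scal_distr_l realify_scal_distr_r.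

Definition realify_NormedModuleAux : NormedModuleAux R_AbsRing :=
  NormedModuleAux.Pack R_AbsRing V
    (NormedModuleAux.Class R_AbsRing V
       (ModuleSpace.Class R_Ring V _ realify_ModuleSpace_mixin)
       (UniformSpace.class V)) V.

Lemma realify_norm_scal (r : R) (v : V) :
  norm (realify_scal r v) <= @abs R_AbsRing r * norm v.
Proof.
change (@abs R_AbsRing r) with (Rabs r); rewrite <- Cmod_R.
exact (norm_scal (RtoC r) v).
Qed.

Definition realify_NormedModule_mixin :=
  NormedModule.Mixin R_AbsRing realify_NormedModuleAux (@norm C_AbsRing V)
    (@norm_factor C_AbsRing V) norm_triangle realify_norm_scal norm_compat1
    norm_compat2 norm_eq_zero.

Definition realify : CompleteNormedModule R_AbsRing :=
  CompleteNormedModule.Pack R_AbsRing V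
    (CompleteNormedModule.Class R_AbsRing V
       (NormedModule.Class R_AbsRing V
          (NormedModuleAux.class R_AbsRing realify_NormedModuleAux)
          realify_NormedModule_mixin)
       (CompleteSpace.class V)) V.

End Realify.

Definition path_deriv (g : R -> C) (t : R) : C :=
  (Derive (fun u => fst (g u)) t, Derive (fun u => snd (g u)) t).

(* The (improper) integral of [f] along the path [g]; the end points are given
   by filters so that an end at which [f] is singular can be approached only. *)
Definition path_int {V : CompleteNormedModule C_AbsRing} (f : C -> V)
    (g : R -> C) (Fa Fb : (R -> Prop) -> Prop) : V :=
  RInt_gen (V := realify V) (fun t => scal (path_deriv g t) (f (g t))) Fa Fb.

Definition interior {U : UniformSpace} (A : U -> Prop) (x : U) : Prop :=
  locally x A.

Definition closure {U : UniformSpace} (A : U -> Prop) (x : U) : Prop :=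
  ~ locally x (fun y => ~ A y).

Definition convex (A : C -> Prop) : Prop :=
  forall (z w : C) (t : R), A z -> A w -> 0 <= t <= 1 ->
    A ((1 - t)%R * z + t * w)%C.

Definition convex_hull (A : C -> Prop) (z : C) : Prop :=
  forall B : C -> Prop, convex B -> (forall w, A w -> B w) -> B z.

Definition stolz (g : R) : C -> Prop :=
  interior (convex_hull (fun z : C => z = RtoC 1 \/ Cmod z < sin g)).

(* The two tangents from 1 to the circle of radius sin b centred at 0 touch it
   at sin b * exp(+/- i (PI/2 - b)).  Counterclockwise from 1, the boundary of
   [stolz b] is thus: the segment to the upper point, the arc from angle
   PI/2 - b to angle 3PI/2 + b, and the segment from the lower point to 1.
   Functions of H^infty_0 times a resolvent may be singular at 1, hence the
   improper integrals there.                                                 *)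
Definition circle_pt (r theta : R) : C := (r * cos theta, r * sin theta).

Definition segment (z w : C) (t : R) : C := ((1 - t)%R * z + t * w)%C.

Definition stolz_boundary_int {V : CompleteNormedModule C_AbsRing} (b : R)
    (f : C -> V) : V :=
  let up := circle_pt (sin b) (PI / 2 - b) in
  let low := circle_pt (sin b) (3 * PI / 2 + b) in
  plus (path_int f (segment 1 up) (at_right 0) (at_point 1))
    (plus (path_int f (circle_pt (sin b))
             (at_point (PI / 2 - b)) (at_point (3 * PI / 2 + b)))
          (path_int f (segment low 1) (at_point 0) (at_left 1))).

Section Ritt.

Context {X : CompleteNormedModule C_AbsRing}.

Definition is_inverse (A B : bounded_op X) : Prop :=
  mult A B = one /\ mult B A = one.

Definition invertible (A : bounded_op X) : Prop := exists B, is_inverse A B.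

Definition bop_inv (A : bounded_op X) : bounded_op X := iota (is_inverse A).

Lemma bop_inv_spec (A : bounded_op X) :
  invertible A -> is_inverse A (bop_inv A).
Proof.
intros [B HB].
apply (iota_correct (V := bop_CompleteNormedModule X) (is_inverse A)).
exists B; split; [exact HB|]; intros B' HB'.
transitivity (mult B' (mult A B)); [|rewrite (proj1 HB); apply mult_one_r].
rewrite mult_assoc, (proj2 HB'); symmetry; apply mult_one_l.
Qed.

Definition spectrum (T : bounded_op X) (l : C) : Prop :=
  ~ invertible (minus (scal l (one : bounded_op X)) T).

Definition resolvent (l : C) (T : bounded_op X) : bounded_op X :=
  bop_inv (minus (scal l (one : bounded_op X)) T).

Definition power_bounded (T : bounded_op X) : Prop :=
  exists M : R, forall n : nat, norm (pow_n T n) <= M.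

Definition ritt (T : bounded_op X) : Prop :=
  power_bounded T /\
  exists M : R, forall n : nat, (1 <= n)%nat ->
    norm (scal (RtoC (INR n)) (minus (pow_n T n) (pow_n T (n - 1)))) <= M.

Definition ritt_of_type (a : R) (T : bounded_op X) : Prop :=
  ritt T /\ 0 < a < PI / 2 /\
  (forall l : C, spectrum T l -> closure (stolz a) l) /\
  forall b : R, a < b < PI / 2 ->
    exists M : R, forall l : C, ~ closure (stolz b) l ->
      norm (scal (l - 1)%C (resolvent l T)) <= M.

(* Functions on [stolz g] are represented by total functions on C; only their
   values on [stolz g] are relevant.                                         *)
Definition Hinf0 (g : R) (phi : C -> C) : Prop :=
  (forall z, stolz g z -> ex_derive phi z) /\
  (exists M : R, forall z, stolz g z -> Cmod (phi z) <= M) /\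
  exists s c : R, 0 < s /\ 0 < c /\
    forall z, stolz g z -> Cmod (phi z) <= c * Rpower (Cmod (1 - z)%C) s.

Definition Hinf_norm (g : R) (phi : C -> C) : R :=
  real (Lub_Rbar (fun r => exists z, stolz g z /\ r = Cmod (phi z))).

Definition fun_calc (b : R) (phi : C -> C) (T : bounded_op X) : bounded_op X :=
  scal (/ (2 * PI * Ci))%C
    (stolz_boundary_int b (fun l => scal (phi l) (resolvent l T))).

Definition bounded_Hinf_calculus (g : R) (T : bounded_op X) : Prop :=
  exists a : R, a < g /\ ritt_of_type a T /\
  exists K : R, 0 < K /\
    forall (b : R) (phi : C -> C), a < b < g -> Hinf0 g phi ->
      norm (fun_calc b phi T) <= K * Hinf_norm g phi.

End Ritt.

Record Hilbert : Type := {
  hilbert_space :> CompleteNormedModule C_AbsRing;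
  inner : hilbert_space -> hilbert_space -> C;
  inner_plus_l : forall x y z,
    inner (plus x y) z = (inner x z + inner y z)%C;
  inner_scal_l : forall (k : C) x y, inner (scal k x) y = (k * inner x y)%C;
  inner_conj : forall x y, inner y x = Cconj (inner x y);
  inner_norm : forall x, inner x x = RtoC (norm x ^ 2) }.

Arguments inner {_} _ _.

Section HilbertOperators.

Context {H : Hilbert}.

Definition is_adjoint (T S : bounded_op H) : Prop :=
  forall x y : H, inner (T x) y = inner x (S y).

(* Exists and is unique by the Riesz representation theorem. *)
Definition adjoint (T : bounded_op H) : bounded_op H := iota (is_adjoint T).

Definition Rbar_sqrt (r : Rbar) : Rbar :=
  match r with Finite r => Finite (sqrt r) | r => r end.

(* The square function ||x||_{S,1}, with values in [0, +oo]. *)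
Definition sqfun_norm (S : bounded_op H) (x : H) : Rbar :=
  Rbar_sqrt (Lim_seq (fun n => sum_n_m (fun k =>
    INR k * norm (mult (pow_n S (k - 1)) (minus one S) x) ^ 2) 1 n)).

End HilbertOperators.

(* Main.v *)
(* Write A = I - T and d_j(x) = 2^j |T^(2^j) A x|.  For a power bounded T, the
   square function |x|_{T,1}^2 is comparable to the sum of the d_j(x)^2.

   (iii) => (ii): for a contraction U, |x|^2 dominates
   |(x + U x)/2|^2 + |(x - U x)/2|^2.  Iterating this with U = T^(2^j) and the
   means P_j of the T^n, n < 2^j, bounds the sum of the |(I - T^(2^j)) P_j x|^2
   = |2^j A P_j^2 x|^2.  The Ritt condition bounds d_j(x) by such a term plus a
   small multiple of an earlier d_i(x), which is absorbed.

   (ii) => (i) and (iii): put E_j = I - (I - u)^3 with u = T^(3 2^j).  Then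
   E_j - E_{j+1} is (T^(2^j) A)^3 times an operator of norm O(8^j).  If Phi
   commutes with T, the Cauchy-Schwarz inequality and the square function of T*
   therefore bound |Phi (E_i - E_j) x| by the supremum of 2^j |Phi T^(2^j) A|
   times the square function of x.  With Phi = I this shows that
   lim |E_j x|^2 + |x|_{T,1}^2 is the square of an equivalent Hilbert norm, for
   which T is a contraction.  With Phi = phi(T) it gives the bounded calculus,
   since the Cauchy integral bounds n phi(T) T^n A by a multiple of the
   supremum of phi.

   (i) => (ii): the sums of +/- 2^j z^(2^j) (1 - z) are bounded on Stolz domains
   uniformly in the signs.  Their values at T are the sums of
   +/- 2^j T^(2^j) A, and the parallelogram law provides signs for which the
   square of the norm of the sum at x is at least the sum of the d_j(x)^2. *)

Require Import Defs.
From Stdlib Require Import Reals Lra Lia FunctionalExtensionality.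
From Stdlib Require Import PropExtensionality ProofIrrelevance ClassicalEpsilon Classical.
From Stdlib Require Import ssreflect.
From Coquelicot Require Import Coquelicot.
Open Scope R_scope.

(** * Bounded operators *)

(* The structures are written out because Coquelicot's unification would pick
   convertible but syntactically different ones, depending on the context. *)
Notation "x +v y" := (@plus (NormedModule.AbelianMonoid C_AbsRing _) x y)
  (at level 50, left associativity).
Notation "x -v y" := (@minus (NormedModule.AbelianGroup C_AbsRing _) x y)
  (at level 50, left associativity).
Notation "k *v x" := (@scal C_Ring (NormedModule.ModuleSpace C_AbsRing _) k%C x)
  (at level 40, left associativity).
Notation "0v" := (@zero (NormedModule.AbelianMonoid C_AbsRing _)).
Notation "S +o T" := (@plus (bop_AbelianMonoid _) S T)
  (at level 50, left associativity).
Notation "S -o T" := (@minus (bop_AbelianGroup _) S T)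
  (at level 50, left associativity).
Notation "S *o T" := (@mult (bop_Ring _) S T)
  (at level 40, left associativity).
Notation "k *s T" := (@scal C_Ring (bop_ModuleSpace _) k%C T)
  (at level 40, left associativity).
Notation "T ^o n" := (@pow_n (bop_Ring _) T n) (at level 30, right associativity).
Notation "1o" := (@one (bop_Ring _)).
Notation "0o" := (@zero (bop_AbelianMonoid _)).
Notation onorm := (@norm C_AbsRing (bop_NormedModule _)).

(** The cube in E_j is dictated by the argument: with u = T^(3 2^j), E_j - E_{j+1} = u (I - u)^3 (3
    + 3u + u^2). Of the three factors I - u, one is paired with Phi, one acts on x and one moves to
    the other side as an adjoint; the exponent 3 2^j hands each of them its own T^(2^j). The square
    function vanishes on the fixed vectors of T, so it is no norm by itself; E_j fixes these
    vectors, which is why lim |E_j x| enters the new norm. For Phi = phi(T) the products Phi E_j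
    tend to 0 because phi vanishes at 1.

    The contour surrounds the spectrum and passes through 1, where the resolvent may be singular.
    Cauchy's theorem is therefore used through primitives on star-shaped domains that have a limit
    at 1. To evaluate the integral of (1 - z) R(z, T), the contour has to be pushed to infinity in a
    domain that is not simply connected; the substitution 1/z turns this exterior into a star-shaped
    domain around 0. The only multiplicativity of the calculus that enters is that of phi with
    powers of z. *)

Lemma vscal_norm {X : NormedModule C_AbsRing} (k : C) (x : X) :
  norm (k *v x) <= Cmod k * norm x.
Proof. exact (norm_scal (V := X) k x). Qed.

Lemma vsub_sym {X : NormedModule C_AbsRing} (x y : X) :
  norm (x -v y) = norm (y -v x).
Proof. rewrite -norm_opp opp_minus; reflexivity. Qed.

Lemma vadd_norm {X : NormedModule C_AbsRing} (x y : X) :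
  norm (x +v y) <= norm x + norm y.
Proof. exact (norm_triangle x y). Qed.

Lemma vsub_norm {X : NormedModule C_AbsRing} (x y : X) :
  norm (x -v y) <= norm x + norm y.
Proof. rewrite -(norm_opp y); apply vadd_norm. Qed.

Lemma vsubK {X : NormedModule C_AbsRing} (x y : X) : (x -v y) +v y = x.
Proof. exact (plus_minus_cancel _ x y). Qed.

Lemma vsub_trans {X : NormedModule C_AbsRing} (y x z : X) :
  norm (x -v z) <= norm (x -v y) + norm (y -v z).
Proof. rewrite (minus_trans y x z); apply vadd_norm. Qed.

Lemma vnorm_le_sub {X : NormedModule C_AbsRing} (x y : X) :
  norm x <= norm y + norm (x -v y).
Proof. rewrite -{1}(vsubK x y) Rplus_comm; apply vadd_norm. Qed.

(** The norm axiom is an inequality; applied to k and to 1/k it gives the equality. *)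
Lemma vscal_norm_eq {X : NormedModule C_AbsRing} (k : C) (x : X) :
  norm (k *v x) = Cmod k * norm x.
Proof.
apply Rle_antisym; first exact: vscal_norm.
case: (Ceq_dec k 0) => [-> | Hk].
  by rewrite Cmod_0 Rmult_0_l; apply norm_ge_0.
have P : 0 < Cmod k by apply Cmod_gt_0.
have E : x = (/ k) *v (k *v x).
  rewrite scal_assoc; change (mult (/ k)%C k) with (/ k * k)%C.
  rewrite Cinv_l //; symmetry; exact (scal_one x).
have := vscal_norm (/ k) (k *v x); rewrite -E Cmod_inv // => L.
apply (Rmult_le_compat_l (Cmod k)) in L; last lra.
by rewrite -Rmult_assoc Rinv_r in L; lra.
Qed.

Lemma vnorm0 {X : NormedModule C_AbsRing} : norm (0v : X) = 0.
Proof. exact (norm_zero (V := X)). Qed.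

Lemma vsub_eq0 {X : NormedModule C_AbsRing} (x y : X) :
  norm (x -v y) <= 0 -> x = y.
Proof.
move=> E; rewrite -(vsubK x y).
have N : x -v y = 0v by apply norm_eq_zero, Rle_antisym => //; apply norm_ge_0.
by rewrite N; exact (plus_zero_l y).
Qed.

Lemma onorm_mul {X : NormedModule C_AbsRing} (S T : bounded_op X) :
  onorm (S *o T) <= onorm S * onorm T.
Proof.
apply op_norm_le; first by apply Rmult_le_pos; apply (norm_ge_0 (V := bop_NormedModule X)).
move=> x; apply Rle_trans with (1 := op_norm_bound X S (T x)).
rewrite Rmult_assoc; apply Rmult_le_compat_l; [apply op_norm_ge0|].
apply op_norm_bound.
Qed.

Lemma onorm_mul_le {X : NormedModule C_AbsRing} (S T : bounded_op X) (a b : R) :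
  onorm S <= a -> onorm T <= b -> onorm (S *o T) <= a * b.
Proof.
move=> Ha Hb; apply Rle_trans with (1 := onorm_mul S T).
by apply Rmult_le_compat => //; apply op_norm_ge0.
Qed.

Lemma onorm_app {X : NormedModule C_AbsRing} (S : bounded_op X) (x : X) :
  norm (S x) <= onorm S * norm x.
Proof. apply op_norm_bound. Qed.

Lemma onorm_ge0 {X : NormedModule C_AbsRing} (S : bounded_op X) : 0 <= onorm S.
Proof. apply op_norm_ge0. Qed.

Lemma onorm_le {X : NormedModule C_AbsRing} (S : bounded_op X) (M : R) :
  0 <= M -> (forall x, norm (S x) <= M * norm x) -> onorm S <= M.
Proof. apply op_norm_le. Qed.

Lemma onorm_add {X : NormedModule C_AbsRing} (S T : bounded_op X) :
  onorm (S +o T) <= onorm S + onorm T.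
Proof. apply op_norm_triangle. Qed.

Lemma onorm_sub {X : NormedModule C_AbsRing} (S T : bounded_op X) :
  onorm (S -o T) <= onorm S + onorm T.
Proof. exact (vsub_norm (X := bop_NormedModule X) S T). Qed.

Lemma onorm_add_le {X : NormedModule C_AbsRing} (S T : bounded_op X) (a b : R) :
  onorm S <= a -> onorm T <= b -> onorm (S +o T) <= a + b.
Proof.
by move=> Ha Hb; apply Rle_trans with (1 := onorm_add S T); apply Rplus_le_compat.
Qed.

Lemma onorm_sub_le {X : NormedModule C_AbsRing} (S T : bounded_op X) (a b : R) :
  onorm S <= a -> onorm T <= b -> onorm (S -o T) <= a + b.
Proof.
by move=> Ha Hb; apply Rle_trans with (1 := onorm_sub S T); apply Rplus_le_compat.
Qed.

Lemma onorm_sub_sym {X : NormedModule C_AbsRing} (S T : bounded_op X) :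
  onorm (S -o T) = onorm (T -o S).
Proof. exact (vsub_sym (X := bop_NormedModule X) S T). Qed.

Lemma osub_trans {X : NormedModule C_AbsRing} (T S U : bounded_op X) :
  onorm (S -o U) <= onorm (S -o T) + onorm (T -o U).
Proof. exact (vsub_trans (X := bop_NormedModule X) T S U). Qed.

Lemma onorm_le_diff {X : NormedModule C_AbsRing} (S T : bounded_op X) :
  onorm S <= onorm T + onorm (S -o T).
Proof. exact (vnorm_le_sub (X := bop_NormedModule X) S T). Qed.

Lemma onorm0 {X : NormedModule C_AbsRing} : onorm (0o : bounded_op X) = 0.
Proof. exact (norm_zero (V := bop_NormedModule X)). Qed.

Lemma onorm_scal {X : NormedModule C_AbsRing} (k : C) (T : bounded_op X) :
  onorm (k *s T) <= Cmod k * onorm T.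
Proof. exact (op_norm_scal X k T). Qed.

Lemma onorm_scal_eq {X : NormedModule C_AbsRing} (k : C) (T : bounded_op X) :
  onorm (k *s T) = Cmod k * onorm T.
Proof. exact (vscal_norm_eq (X := bop_NormedModule X) k T). Qed.

Lemma onorm_one {X : NormedModule C_AbsRing} : onorm (1o : bounded_op X) <= 1.
Proof. by apply onorm_le => [|x]; [lra|rewrite Rmult_1_l; apply Rle_refl]. Qed.

Lemma opD {X : NormedModule C_AbsRing} (S : bounded_op X) (x y : X) :
  S (x +v y) = S x +v S y.
Proof. exact (linear_plus S (bop_linear _ S) x y). Qed.

Lemma opZ {X : NormedModule C_AbsRing} (S : bounded_op X) (k : C) (x : X) :
  S (k *v x) = k *v S x.
Proof. exact (linear_scal S (bop_linear _ S) k x). Qed.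

Lemma opB {X : NormedModule C_AbsRing} (S : bounded_op X) (x y : X) :
  S (x -v y) = S x -v S y.
Proof. exact (linear_minus S x y (bop_linear _ S)). Qed.

Lemma op0 {X : NormedModule C_AbsRing} (S : bounded_op X) : S 0v = 0v.
Proof. exact (linear_zero S (bop_linear _ S)). Qed.

Lemma opD_l {X : NormedModule C_AbsRing} (S T U : bounded_op X) :
  S *o (T +o U) = S *o T +o S *o U.
Proof. exact (mult_distr_l (K := bop_Ring X) S T U). Qed.

Lemma opD_r {X : NormedModule C_AbsRing} (S T U : bounded_op X) :
  (S +o T) *o U = S *o U +o T *o U.
Proof. exact (mult_distr_r (K := bop_Ring X) S T U). Qed.

Lemma op1_l {X : NormedModule C_AbsRing} (S : bounded_op X) : 1o *o S = S.
Proof. exact (mult_one_l (K := bop_Ring X) S). Qed.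

Lemma op1_r {X : NormedModule C_AbsRing} (S : bounded_op X) : S *o 1o = S.
Proof. exact (mult_one_r (K := bop_Ring X) S). Qed.

Lemma opA {X : NormedModule C_AbsRing} (S T U : bounded_op X) :
  S *o (T *o U) = S *o T *o U.
Proof. exact (mult_assoc (K := bop_Ring X) S T U). Qed.

Section Bicommutant.

Context {X : NormedModule C_AbsRing}.
Variable T : bounded_op X.

(* The bicommutant of [T] is a commutative ring, which makes [ring] available
   for identities between functions of one operator. *)
Record bicomm := Bicomm {
  bico :> bounded_op X;
  bicoP : forall S, S *o T = T *o S -> S *o bico = bico *o S }.

Lemma bicomm_eq (a b : bicomm) : bico a = bico b -> a = b.
Proof.
destruct a as [a Ha], b as [b Hb]; simpl => E; subst b; f_equal.
apply proof_irrelevance.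
Qed.

Definition bT : bicomm := Bicomm T (fun S H => H).

Lemma bicoP1 S : S *o T = T *o S -> S *o 1o = 1o *o S.
Proof. by rewrite op1_l op1_r. Qed.

Lemma bicoP0 S : S *o T = T *o S -> S *o 0o = 0o *o S.
Proof.
by move=> _; transitivity (0o : bounded_op X); [|symmetry];
  [exact (mult_zero_r (K := bop_Ring X) S)
  |exact (mult_zero_l (K := bop_Ring X) S)].
Qed.

Lemma bicoPD (a b : bicomm) S : S *o T = T *o S ->
  S *o (bico a +o bico b) = (bico a +o bico b) *o S.
Proof. by move=> HS; rewrite opD_l opD_r !bicoP. Qed.

Lemma bicoPN (a : bicomm) S : S *o T = T *o S ->
  S *o @opp (bop_AbelianGroup X) a = @opp (bop_AbelianGroup X) a *o S.
Proof.
move=> HS; transitivity (@opp (bop_AbelianGroup X) (S *o a)).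
  exact (eq_sym (opp_mult_r (K := bop_Ring X) S a)).
rewrite (bicoP a S HS).
exact (opp_mult_l (K := bop_Ring X) a S).
Qed.

Lemma bicoPM (a b : bicomm) S : S *o T = T *o S ->
  S *o (bico a *o bico b) = (bico a *o bico b) *o S.
Proof.
by move=> HS; rewrite opA (bicoP a S HS) -opA (bicoP b S HS) opA.
Qed.

Lemma bicoPZ (k : C) (a : bicomm) S : S *o T = T *o S ->
  S *o (k *s bico a) = (k *s bico a) *o S.
Proof.
move=> HS; apply bop_ext => x; change (S (k *v a x) = k *v a (S x)).
rewrite opZ; f_equal; exact (f_equal (fun U : bounded_op X => U x) (bicoP a S HS)).
Qed.

Lemma bicoPX (n : nat) S : S *o T = T *o S -> S *o (T ^o n) = (T ^o n) *o S.
Proof.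
move=> HS; elim: n => [|n IH]; first by apply bicoP1.
change (S *o (T *o T ^o n) = (T *o T ^o n) *o S).
by rewrite opA HS -opA IH opA.
Qed.

Definition b1 : bicomm := Bicomm 1o bicoP1.
Definition b0 : bicomm := Bicomm 0o bicoP0.
Definition badd (a b : bicomm) : bicomm := Bicomm _ (bicoPD a b).
Definition bopp (a : bicomm) : bicomm := Bicomm _ (bicoPN a).
Definition bmul (a b : bicomm) : bicomm := Bicomm _ (bicoPM a b).
Definition bscal (k : C) (a : bicomm) : bicomm := Bicomm _ (bicoPZ k a).
Definition bpow (n : nat) : bicomm := Bicomm _ (bicoPX n).

(* Convertible to the operator [bico a -o bico b]. *)
Definition bsub (a b : bicomm) : bicomm := badd a (bopp b).

Lemma bmul_comm (a b : bicomm) : bmul a b = bmul b a.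
Proof. by apply bicomm_eq; apply (bicoP b); symmetry; apply (bicoP a). Qed.

Lemma bicomm_ring : ring_theory b0 b1 badd bmul bsub bopp (@eq bicomm).
Proof.
split; intros; apply bicomm_eq.
- exact (plus_zero_l (G := bop_AbelianMonoid X) x).
- exact (plus_comm (G := bop_AbelianMonoid X) x y).
- exact (plus_assoc (G := bop_AbelianMonoid X) x y z).
- exact (op1_l x).
- exact (f_equal bico (bmul_comm x y)).
- exact (opA x y z).
- exact (opD_r x y z).
- reflexivity.
- exact (plus_opp_r (G := bop_AbelianGroup X) x).
Qed.

End Bicommutant.

Arguments bico {X T} _.
Arguments b1 {X T}.
Arguments b0 {X T}.
Arguments badd {X T} _ _.
Arguments bmul {X T} _ _.
Arguments bopp {X T} _.
Arguments bsub {X T} _ _.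
Arguments bscal {X T} _ _.
Arguments bpow {X T} _.
Arguments bicomm_eq {X T} _ _ _.

Section BicommRing.
Context {X : NormedModule C_AbsRing} {T : bounded_op X}.

Add Ring bicommring : (bicomm_ring T).

Lemma bpow_add (m n : nat) : bpow (T := T) (m + n) = bmul (bpow m) (bpow n).
Proof. apply bicomm_eq; exact (pow_n_plus T m n). Qed.

(** Makes a scalar multiple a product in the ring, where [ring] can move it. *)
Lemma bscalE (k : C) (a : bicomm T) : bscal k a = bmul (bscal k b1) a.
Proof. by apply bicomm_eq; apply bop_ext. Qed.


Fixpoint bgeo (m : nat) : bicomm T :=
  if m is S k then badd (bgeo k) (bpow k) else b0.

Lemma bpowS (k : nat) : bpow (T := T) (S k) = bmul (bT T) (bpow k).
Proof. by apply bicomm_eq. Qed.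

Lemma bgeoE (m : nat) : bmul (bsub b1 (bT T)) (bgeo m) = bsub b1 (bpow m).
Proof.
elim: m => [|m IH] /=.
  have -> : bpow (T := T) 0 = b1 by apply bicomm_eq.
  ring.
rewrite bpowS; transitivity (badd (bmul (bsub b1 (bT T)) (bgeo m))
  (bmul (bsub b1 (bT T)) (bpow m))); first ring.
rewrite IH; ring.
Qed.

Lemma bgeo_norm (M : R) (m : nat) :
  (forall n, onorm (T ^o n) <= M) -> onorm (bgeo m) <= INR m * M.
Proof.
move=> HM; elim: m => [|m IH].
  rewrite Rmult_0_l; apply onorm_le => [|x]; first lra.
  by rewrite Rmult_0_l; right; exact: vnorm0.
rewrite S_INR; apply Rle_trans with (1 := onorm_add (bgeo m) (bpow m)).
by move: (HM m) => /=; lra.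
Qed.

End BicommRing.

(** * Finite sums of real numbers *)

Lemma sq_le_sq (a b : R) : 0 <= a -> a <= b -> a ^ 2 <= b ^ 2.
Proof. by move=> *; apply pow_incr. Qed.

Fixpoint rsum (f : nat -> R) (n : nat) : R :=
  if n is S k then rsum f k + f k else 0.

Lemma rsum_le (f g : nat -> R) (n : nat) :
  (forall k, (k < n)%nat -> f k <= g k) -> rsum f n <= rsum g n.
Proof.
elim: n => [|n IH] Hfg /=; first lra.
have := IH (fun k Hk => Hfg k (Nat.lt_lt_succ_r _ _ Hk)).
by have := Hfg n (Nat.lt_succ_diag_r n); lra.
Qed.

Lemma rsum_ext (f g : nat -> R) (n : nat) :
  (forall k, (k < n)%nat -> f k = g k) -> rsum f n = rsum g n.
Proof.
elim: n => [|n IH] Hfg //=; rewrite IH; last by move=> k Hk; apply Hfg; lia.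
by rewrite Hfg.
Qed.

Lemma rsum_plus (f g : nat -> R) (n : nat) :
  rsum (fun k => f k + g k) n = rsum f n + rsum g n.
Proof. by elim: n => [|n /= ->]; [rewrite /=; ring | ring]. Qed.

Lemma rsum_mult (c : R) (f : nat -> R) (n : nat) :
  rsum (fun k => c * f k) n = c * rsum f n.
Proof. by elim: n => [|n /= ->]; [rewrite /=; ring | ring]. Qed.

Lemma rsum_add (f : nat -> R) (m n : nat) :
  rsum f (m + n) = rsum f m + rsum (fun k => f (m + k)%nat) n.
Proof.
elim: n => [|n IH]; first by rewrite Nat.add_0_r /=; ring.
by rewrite Nat.add_succ_r /= IH; ring.
Qed.

Lemma rsum_ge0 (f : nat -> R) (n : nat) :
  (forall k, (k < n)%nat -> 0 <= f k) -> 0 <= rsum f n.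
Proof.
elim: n => [|n IH] Hf /=; first lra.
have := IH (fun k Hk => Hf k (Nat.lt_lt_succ_r _ _ Hk)).
by have := Hf n (Nat.lt_succ_diag_r n); lra.
Qed.

Lemma rsum_const (c : R) (n : nat) : rsum (fun _ => c) n = INR n * c.
Proof. by elim: n => [|n IH]; [rewrite /=; ring | rewrite S_INR /= IH; ring]. Qed.

Lemma rsum_mono (f : nat -> R) (m n : nat) :
  (forall k, 0 <= f k) -> (m <= n)%nat -> rsum f m <= rsum f n.
Proof.
move=> Hf Hmn; have -> : n = (m + (n - m))%nat by lia.
rewrite rsum_add; have : 0 <= rsum (fun k => f (m + k)%nat) (n - m); last lra.
by apply rsum_ge0.
Qed.

Lemma INR_2pow (j : nat) : INR (2 ^ j) = 2 ^ j.
Proof. by rewrite pow_INR. Qed.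

(** For [vquadratic]: 1/2 is an atom for [ring] in the square-zero extension, so this scalar
    coefficient is computed in C. *)
Lemma Cquadratic (y z p : C) :
  ((y - p) * (y - p) * RtoC (/ 2) - (z - p) * (z - p) * RtoC (/ 2) - (y - z) * (z - p) =
   (y - z) * (y - z) * RtoC (/ 2))%C.
Proof. by apply injective_projections; rewrite /=; field. Qed.

(* Square-zero extension of C by a module: it turns [ring] into a decision
   procedure for identities between vectors. *)
Section SquareZero.

Context {X : NormedModule C_AbsRing}.

Record sqz := Sqz { sqz_c : C; sqz_v : X }.

Definition sqz_add (p q : sqz) := Sqz (sqz_c p + sqz_c q)%C (sqz_v p +v sqz_v q).
Definition sqz_opp (p : sqz) := Sqz (- sqz_c p)%C (@opp (NormedModule.AbelianGroup C_AbsRing X) (sqz_v p)).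
Definition sqz_sub (p q : sqz) := sqz_add p (sqz_opp q).
Definition sqz_mul (p q : sqz) :=
  Sqz (sqz_c p * sqz_c q)%C (sqz_c p *v sqz_v q +v sqz_c q *v sqz_v p).
Definition sqz_k (k : C) := Sqz k (0v : X).
Definition sqz_x (x : X) := Sqz 0 x.

Lemma vaddA (x y z : X) : x +v (y +v z) = x +v y +v z.
Proof. exact (plus_assoc x y z). Qed.

Lemma vaddC (x y : X) : x +v y = y +v x.
Proof. exact (plus_comm x y). Qed.

Lemma vadd0 (x : X) : x +v 0v = x.
Proof. exact (plus_zero_r x). Qed.

Lemma v0add (x : X) : 0v +v x = x.
Proof. exact (plus_zero_l x). Qed.

Lemma vscalA (k l : C) (x : X) : k *v (l *v x) = (k * l) *v x.
Proof. exact (scal_assoc k l x). Qed.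

Lemma vscalDr (k : C) (x y : X) : k *v (x +v y) = k *v x +v k *v y.
Proof. exact (scal_distr_l k x y). Qed.

Lemma vscalDl (k l : C) (x : X) : (k + l) *v x = k *v x +v l *v x.
Proof. exact (scal_distr_r k l x). Qed.

Lemma vscal1 (x : X) : RtoC 1 *v x = x.
Proof. exact (scal_one x). Qed.

Lemma vscal0 (k : C) : k *v (0v : X) = 0v.
Proof. exact (scal_zero_r k). Qed.

Lemma v0scal (x : X) : RtoC 0 *v x = 0v.
Proof. exact (scal_zero_l x). Qed.

Lemma vsubv (x : X) : x -v x = 0v.
Proof. exact (minus_eq_zero x). Qed.

Lemma sqz_ring : ring_theory (sqz_k 0) (sqz_k 1) sqz_add sqz_mul sqz_sub sqz_opp (@eq sqz).
Proof.
split=> [x|x y|x y z|x|x y|x y z|x y z|x y|x]; rewrite /sqz_sub /sqz_add /sqz_mul /sqz_opp /sqz_k /=.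
- case: x => c v /=; f_equal; [ring | exact: v0add].
- f_equal; [ring | exact: vaddC].
- f_equal; [ring | exact: vaddA].
- case: x => c v /=; f_equal; [ring | by rewrite vscal1 vscal0 vadd0].
- f_equal; [ring | exact: vaddC].
- f_equal; [ring |].
  rewrite !vscalDr !vscalA -vaddA; do 2 f_equal; f_equal; ring.
- f_equal; [ring |].
  rewrite !vscalDr !vscalDl -!vaddA; f_equal.
  by rewrite vaddA (vaddC (sqz_c y *v _)) -vaddA.
- by [].
- f_equal; [ring | exact: (plus_opp_r (sqz_v x))].
Qed.

Add Ring sqzring : sqz_ring.

Lemma sqz_x_inj (x y : X) : sqz_x x = sqz_x y -> x = y.
Proof. by case. Qed.

Lemma sqz_xD (x y : X) : sqz_x (x +v y) = sqz_add (sqz_x x) (sqz_x y).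
Proof. by rewrite /sqz_x /sqz_add /=; f_equal; ring. Qed.

Lemma sqz_xN (x : X) : sqz_x (@opp (NormedModule.AbelianGroup C_AbsRing X) x) = sqz_opp (sqz_x x).
Proof. by rewrite /sqz_x /sqz_opp /=; f_equal; ring. Qed.

Lemma sqz_xB (x y : X) : sqz_x (x -v y) = sqz_sub (sqz_x x) (sqz_x y).
Proof. by rewrite /minus sqz_xD sqz_xN. Qed.

Lemma sqz_xZ (k : C) (x : X) : sqz_x (k *v x) = sqz_mul (sqz_k k) (sqz_x x).
Proof.
rewrite /sqz_x /sqz_k /sqz_mul /=; f_equal; first by ring.
by rewrite v0scal vadd0.
Qed.

Lemma sqz_x0 : sqz_x 0v = sqz_k 0.
Proof. by []. Qed.

Lemma sqz_kD (k l : C) : sqz_k (k + l) = sqz_add (sqz_k k) (sqz_k l).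
Proof. by rewrite /sqz_k /sqz_add /= v0add. Qed.

Lemma sqz_kM (k l : C) : sqz_k (k * l) = sqz_mul (sqz_k k) (sqz_k l).
Proof. by rewrite /sqz_k /sqz_mul /= !vscal0 v0add. Qed.

Lemma sqz_kN (k : C) : sqz_k (- k) = sqz_opp (sqz_k k).
Proof.
rewrite /sqz_k /sqz_opp /=; f_equal.
by rewrite -[RHS]v0add; symmetry; apply (plus_opp_r (0v : X)).
Qed.

(** Pushes a vector identity into the extension; [sqz_x_inj] brings the equality found by [ring]
    back. *)
Definition sqzE := (sqz_xD, sqz_xB, sqz_xN, sqz_xZ, sqz_x0, sqz_kD, sqz_kM, sqz_kN).

Lemma vsub_subK (x y : X) : x -v (x -v y) = y.
Proof. apply sqz_x_inj; rewrite !sqzE; ring. Qed.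

Lemma vsubKr (x y : X) : (x +v y) -v x = y.
Proof. apply sqz_x_inj; rewrite !sqzE; ring. Qed.

Lemma vscalBr (k : C) (x y : X) : k *v (x -v y) = k *v x -v k *v y.
Proof. apply sqz_x_inj; rewrite !sqzE; ring. Qed.

Lemma vscalBl (k l : C) (x : X) : (k - l) *v x = k *v x -v l *v x.
Proof. apply sqz_x_inj; rewrite /Cminus !sqzE; ring. Qed.

Lemma vsub_mid (a b c d : X) : (a +v b) -v (a +v d) = (b -v c) +v (c -v d).
Proof. apply sqz_x_inj; rewrite !sqzE; ring. Qed.

Lemma vsub0 (x : X) : x -v 0v = x.
Proof. apply sqz_x_inj; rewrite !sqzE; ring. Qed.

Lemma vsub_flip (x y : X) : x -v y = RtoC (-1) *v (y -v x).
Proof.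
have -> : RtoC (-1) = (- RtoC 1)%C by rewrite -RtoC_opp.
apply sqz_x_inj; rewrite !sqzE; ring.
Qed.

Lemma vsub_cancel (a b c : X) : (a -v c) -v (b -v c) = a -v b.
Proof. apply sqz_x_inj; rewrite !sqzE; ring. Qed.

Lemma vsubD (a b c d : X) : (a +v b) -v (c +v d) = (a -v c) +v (b -v d).
Proof. apply sqz_x_inj; rewrite !sqzE; ring. Qed.

Lemma vsub_trans2 (a b c : X) : a -v c = (a -v b) +v (b -v c).
Proof. apply sqz_x_inj; rewrite !sqzE; ring. Qed.

Lemma vaffine_diff (y z p : C) (k l : X) :
  (k +v (y - p) *v l) -v (k +v (z - p) *v l) = (y - z) *v l.
Proof. apply sqz_x_inj; rewrite /Cminus !sqzE; ring. Qed.

Lemma vsub_assoc2 (a b c : X) : (a -v b) -v c = a -v (b +v c).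
Proof. apply sqz_x_inj; rewrite !sqzE; ring. Qed.

(** The increments b - a, c - b and a - c of a primitive around a triangle cancel, so each side may
    be corrected by its own increment. *)
Lemma vtri_cancel (s1 s2 s3 a b c : X) : s1 +v (s2 +v s3) =
  (s1 -v (b -v a)) +v ((s2 -v (c -v b)) +v (s3 -v (a -v c))).
Proof. apply sqz_x_inj; rewrite !sqzE; ring. Qed.

Lemma sqz_m1 : sqz_k (RtoC (-1)) = sqz_opp (sqz_k 1).
Proof. by rewrite -sqz_kN -RtoC_opp. Qed.

(* The p's are the half edges and the x's the inner edges of a triangle cut
   at its midpoints. *)
Lemma vquarter (p1 p2 p3 p4 p5 p6 x1 x2 x3 : X) :
  (p1 +v p2) +v ((p3 +v p4) +v (p5 +v p6)) =
  (((p1 +v (RtoC (-1) *v x1 +v p6)) +v (p2 +v (p3 +v RtoC (-1) *v x2))) +v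
   (RtoC (-1) *v x3 +v (p4 +v p5))) +v (x3 +v (x1 +v x2)).
Proof. apply sqz_x_inj; rewrite !sqzE !sqz_m1; ring. Qed.

(** The increment of the primitive of y -> k + (y - p) l differs from its linear part by a term of
    second order. *)
Lemma vquadratic (y z p : C) (k l : X) :
  (((y - p) *v k +v ((y - p) * (y - p) * RtoC (/ 2)) *v l) -v
   ((z - p) *v k +v ((z - p) * (z - p) * RtoC (/ 2)) *v l)) -v
    (y - z) *v (k +v (z - p) *v l) =
  ((y - z) * (y - z) * RtoC (/ 2)) *v l.
Proof.
set b := (_ * RtoC (/ 2))%C; set d := ((z - p) * _ * RtoC (/ 2))%C.
transitivity (((y - p) - (z - p) - (y - z)) *v k +v (b - d - (y - z) * (z - p)) *v l).
  by apply sqz_x_inj; rewrite /Cminus !sqzE; ring.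
have -> : ((y - p) - (z - p) - (y - z) = RtoC 0)%C by ring.
have -> : (b - d - (y - z) * (z - p) = (y - z) * (y - z) * RtoC (/ 2))%C.
  exact: Cquadratic.
by rewrite v0scal v0add.
Qed.

Lemma vtri_close (a b c : X) : a +v (b +v RtoC (-1) *v c) = 0v -> c -v a = b.
Proof.
move=> E; transitivity (b -v (a +v (b +v RtoC (-1) *v c))).
  by apply sqz_x_inj; rewrite !sqzE !sqz_m1; ring.
rewrite E; apply sqz_x_inj; rewrite !sqzE; ring.
Qed.

Lemma vsubKr2 (x y : X) : (x +v y) -v y = x.
Proof. apply sqz_x_inj; rewrite !sqzE; ring. Qed.

Lemma vsub_cancel2 (a b c : X) : (a -v b) -v (a -v c) = c -v b.
Proof. apply sqz_x_inj; rewrite !sqzE; ring. Qed.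

Lemma vcontour_add (a b c d e h : X) :
  (a +v (b -v c)) +v (d +v (e -v h)) = (a +v d) +v ((b +v e) -v (c +v h)).
Proof. apply sqz_x_inj; rewrite !sqzE; ring. Qed.

Lemma vcontour_cancel (u w l : X) : 0v = (u -v l) +v ((w -v u) -v (w -v l)).
Proof. apply sqz_x_inj; rewrite !sqzE; ring. Qed.

Lemma vadd_sub (x y : X) : x +v (y -v x) = y.
Proof. apply sqz_x_inj; rewrite !sqzE; ring. Qed.

Lemma vsub_cancel3 (a b c : X) : a -v b = (c -v b) -v (c -v a).
Proof. apply sqz_x_inj; rewrite !sqzE; ring. Qed.

Lemma vone_minus (z : C) (y t : X) : RtoC (-1) *v (z *v y -v t) +v (y -v t) = (1 - z) *v y.
Proof. apply sqz_x_inj; rewrite /Cminus !sqzE !sqz_m1; ring. Qed.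

Lemma vhalf (x : X) : RtoC (/ 2) *v x +v RtoC (/ 2) *v x = x.
Proof.
rewrite -vscalDl -RtoC_plus; have -> : / 2 + / 2 = 1 by field.
exact: vscal1.
Qed.

(** With a = D x, b = W (W x) and w = W x this is (I - W)^2 x = x - D x. *)
Lemma vsqrt_id (x a b : X) : let w := RtoC (/ 2) *v (a +v b) in
  (x -v w) -v (w -v b) = x -v a.
Proof.
move=> w; have E : w +v w = a +v b by exact: vhalf.
transitivity ((x -v (w +v w)) +v b); first by apply sqz_x_inj; rewrite !sqzE; ring.
rewrite E; apply sqz_x_inj; rewrite !sqzE; ring.
Qed.

End SquareZero.

(** * Hilbert space geometry *)

Lemma C_eq (z w : C) : Re z = Re w -> Im z = Im w -> z = w.
Proof. by move=> *; apply injective_projections. Qed.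

Section HilbertBasics.

Context {H : Hilbert}.
Implicit Types x y z : H.

Lemma innerDl x y z : inner (x +v y) z = (inner x z + inner y z)%C.
Proof. exact (inner_plus_l H x y z). Qed.

Lemma innerZl (k : C) x y : inner (k *v x) y = (k * inner x y)%C.
Proof. exact (inner_scal_l H k x y). Qed.

Lemma inner0l x : inner 0v x = 0.
Proof.
have E := innerDl 0v 0v x; rewrite (plus_zero_l (0v : H)) in E.
move: E; case: (inner 0v x) => p q [E1 E2]; apply C_eq; rewrite /Re /Im /= in E1 E2 *; lra.
Qed.

Lemma innerDr x y z : inner x (y +v z) = (inner x y + inner x z)%C.
Proof. by rewrite inner_conj innerDl Cplus_conj -!inner_conj. Qed.

Lemma innerZr (k : C) x y : inner x (k *v y) = (Cconj k * inner x y)%C.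
Proof. by rewrite inner_conj innerZl Cmult_conj -inner_conj. Qed.

Lemma vopp_scal {X : NormedModule C_AbsRing} (u : X) :
  @opp (NormedModule.AbelianGroup C_AbsRing X) u = (RtoC (-1)) *v u.
Proof.
replace (RtoC (-1)) with (@opp C_AbelianGroup (RtoC 1)).
- symmetry; exact (scal_opp_one u).
- by apply C_eq; rewrite /opp /=; ring.
Qed.

Lemma innerBl x y z : inner (x -v y) z = (inner x z - inner y z)%C.
Proof.
rewrite /minus innerDl vopp_scal innerZl.
by apply C_eq; rewrite /Re /Im /=; ring.
Qed.

Lemma innerBr x y z : inner x (y -v z) = (inner x y - inner x z)%C.
Proof.
rewrite /minus innerDr vopp_scal innerZr.
by apply C_eq; rewrite /Re /Im /=; ring.
Qed.

Lemma Re_inner_sym x y : Re (inner y x) = Re (inner x y).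
Proof. by rewrite inner_conj. Qed.

Lemma norm2_inner x : norm x ^ 2 = Re (inner x x).
Proof. by rewrite inner_norm. Qed.

Lemma norm2_add x y :
  norm (x +v y) ^ 2 = norm x ^ 2 + 2 * Re (inner x y) + norm y ^ 2.
Proof.
rewrite !norm2_inner innerDl !innerDr.
move: (Re_inner_sym x y); rewrite /Re /=; lra.
Qed.

Lemma norm2_sub x y :
  norm (x -v y) ^ 2 = norm x ^ 2 - 2 * Re (inner x y) + norm y ^ 2.
Proof.
rewrite !norm2_inner innerBl !innerBr.
move: (Re_inner_sym x y); rewrite /Re /=; lra.
Qed.

Lemma norm2_scal (k : C) x : norm (k *v x) ^ 2 = Cmod k ^ 2 * norm x ^ 2.
Proof.
rewrite (norm2_inner (k *v x)) innerZl innerZr inner_norm Cmod2_alt.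
by case: k => a b; rewrite /Re /Im /=; ring.
Qed.

Lemma parallelogram x y :
  norm (x +v y) ^ 2 + norm (x -v y) ^ 2 = 2 * norm x ^ 2 + 2 * norm y ^ 2.
Proof. rewrite norm2_add norm2_sub; ring. Qed.

(** The norm is given with its triangle inequality, and expanding |x + y|^2 in that inequality
    leaves this bound. *)
Lemma Re_inner_le x y : Re (inner x y) <= norm x * norm y.
Proof.
have Hx := norm_ge_0 x; have Hy := norm_ge_0 y.
have T2 : norm (x +v y) ^ 2 <= (norm x + norm y) ^ 2
  by apply pow_incr; split; [exact: norm_ge_0 | exact: vadd_norm].
rewrite norm2_add in T2; nra.
Qed.

(** Multiplying x by a number of modulus 1 makes the inner product real and nonnegative. *)
Lemma Cauchy_Schwarz x y : Cmod (inner x y) <= norm x * norm y.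
Proof.
case: (Ceq_dec (inner x y) 0) => [-> | E].
  by rewrite Cmod_0; apply Rmult_le_pos; apply norm_ge_0.
set c := inner x y in E *.
have P : 0 < Cmod c by apply Cmod_gt_0.
have N : RtoC (Cmod c) <> 0 by move=> E'; injection E'; lra.
set k := (Cconj c / RtoC (Cmod c))%C.
have Ek : Cmod k = 1.
  rewrite /k Cmod_div // Cmod_conj Cmod_R Rabs_pos_eq; [field|]; lra.
have := Re_inner_le (k *v x) y.
rewrite innerZl vscal_norm_eq Ek Rmult_1_l -/c.
have -> : (k * c)%C = RtoC (Cmod c); last by [].
have -> : (k * c)%C = ((c * Cconj c) / RtoC (Cmod c))%C by rewrite /k /Cdiv; ring.
by rewrite -Cmod2_conj RtoC_pow; field.
Qed.

Lemma inner_ext x y : (forall z, inner z x = inner z y) -> x = y.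
Proof.
move=> E; apply vsub_eq0.
have : norm (x -v y) ^ 2 = 0 by rewrite norm2_inner innerBr E /Re /=; ring.
move: (norm_ge_0 (x -v y)); nra.
Qed.

Lemma norm_le_inner x (M : R) :
  0 <= M -> (forall y, Re (inner x y) <= M * norm y) -> norm x <= M.
Proof.
move=> M0 E; have Ex := E x; rewrite -norm2_inner in Ex.
move: (norm_ge_0 x); nra.
Qed.

End HilbertBasics.

(** * Riesz representation and adjoints *)

Lemma cauchy_seq_cv {X : CompleteNormedModule C_AbsRing} (u : nat -> X) :
  (forall e : R, 0 < e -> exists N, forall n m, (N <= n)%nat -> (N <= m)%nat ->
    norm (u n -v u m) < e) ->
  exists l : X, forall e : R, 0 < e -> exists N, forall n, (N <= n)%nat ->
    norm (u n -v l) < e.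
Proof.
move=> HC.
have [|l Hl] := proj1 (filterlim_locally_cauchy (F := eventually) u).
- move=> e; case: (HC e (cond_pos e)) => N HN.
  exists (fun n => (N <= n)%nat); split; first by exists N.
  by move=> n m Hn Hm; apply (norm_compat1 (u n) (u m)); apply HN.
- exists l => e He.
  have [N HN] := proj1 (filterlim_locally_ball_norm u l) Hl (mkposreal e He).
  by exists N => n Hn; exact: (HN n Hn).
Qed.

Lemma quad_nonneg_lin_zero (d k : R) :
  0 <= k -> (forall t : R, 0 <= t * d + t ^ 2 * k) -> d = 0.
Proof.
(* At this t the polynomial equals -d^2 (k + 1) / (2k + 1)^2; the 1 in the denominator covers k =
   0. *)
intros Hk Ht; assert (E := Ht (- d / (2 * k + 1))).
assert (E' : 0 <= - d ^ 2 * (k + 1)).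
{ replace (- d ^ 2 * (k + 1)) with ((- d / (2 * k + 1) * d +
    (- d / (2 * k + 1)) ^ 2 * k) * (2 * k + 1) ^ 2) by (field; lra).
  apply Rmult_le_pos; [exact E | apply pow2_ge_0]. }
nra.
Qed.

Section Riesz.

Context {H : Hilbert}.

(** Direct method: J(x) = |x|^2/2 - Re f(x) is bounded below, minimizing sequences are Cauchy by the
    parallelogram law, and the vanishing of the first variation at the limit y says Re f(h) = Re <h,
    y>. *)
Theorem riesz (f : H -> C) :
  is_linear (U := H) (V := C_NormedModule) f ->
  exists y : H, forall x, f x = inner x y.
Proof.
intros Lf.
assert (fD : forall x y, f (x +v y) = (f x + f y)%C)
  by exact (linear_plus f Lf).
assert (fS : forall (k : C) x, f (k *v x) = (k * f x)%C)
  by exact (linear_scal f Lf).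
destruct (linear_norm f Lf) as [M [M0 HM]].
assert (HM' : forall x, Re (f x) <= M * norm x).
{ intros x; apply Rle_trans with (2 := HM x).
  apply Rle_trans with (1 := Rle_abs _).
  change (norm (f x)) with (Cmod (f x)); apply re_le_Cmod. }
set (J := fun x : H => norm x ^ 2 / 2 - Re (f x)).
destruct (completeness (fun r => exists x, r = - J x)) as [l [Hub Hlub]].
- exists (M ^ 2 / 2); intros r [x ->]; unfold J.
  assert (E := HM' x); assert (S := pow2_ge_0 (norm x - M)); nra.
- exists (- J 0v); now exists zero.
- assert (Jge : forall x, - l <= J x).
  { intros x; assert (E := Hub (- J x) (ex_intro _ x eq_refl)); lra. }
  assert (Hn : forall n : nat, exists x, J x < - l + / INR (S n)).
  { intros n; assert (P : 0 < / INR (S n)) by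
      (apply Rinv_0_lt_compat, lt_0_INR; lia).
    apply NNPP; intros C.
    assert (B : l <= l - / INR (S n)); [|lra].
    apply Hlub; intros r [x ->]; apply Rnot_lt_le; intros L; apply C.
    exists x; lra. }
  set (u := fun n => proj1_sig (constructive_indefinite_description _ (Hn n))).
  assert (Hu : forall n, J (u n) < - l + / INR (S n)).
  { intros n; exact (proj2_sig (constructive_indefinite_description _ (Hn n))). }
  assert (small : forall e, 0 < e -> exists N, forall n, (N <= n)%nat ->
      J (u n) < - l + e).
  { intros e He; destruct (archimed_cor1 e He) as [N [HN HN0]].
    exists N; intros n Hle; apply Rlt_le_trans with (1 := Hu n).
    apply Rplus_le_compat_l; left; eapply Rle_lt_trans; [|exact HN].
    apply Rinv_le_contravar; [now apply lt_0_INR | apply le_INR; lia]. }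
  (* At the midpoint of x and z, J is at least the infimum -l; the parallelogram law turns this into
     a bound on |x - z|. *)
  assert (par : forall x z, norm (x -v z) ^ 2 <= 4 * (J x + J z + 2 * l)).
  { intros x z; assert (E := Jge (RtoC (/ 2) *v (x +v z))).
    unfold J in E at 1; rewrite norm2_scal fS fD Cmod_R in E.
    rewrite -> Rabs_pos_eq in E by lra.
    assert (E2 := parallelogram x z).
    unfold J; unfold Re in *; simpl fst in *; nra. }
  destruct (cauchy_seq_cv u) as [y Hy].
  { intros e He.
    destruct (small (e ^ 2 / 8)) as [N HN]; [assert (0 < e ^ 2) by nra; lra|].
    exists N; intros n m Hn' Hm'.
    assert (E := par (u n) (u m)); assert (E1 := HN n Hn'); assert (E2 := HN m Hm').
    assert (G := norm_ge_0 (u n -v u m)).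
    assert (norm (u n -v u m) ^ 2 < e ^ 2) by lra; nra. }
  assert (key : forall h, Re (f h) = Re (inner h y)).
  { intros h.
    enough (E : Re (inner y h) - Re (f h) = 0)
      by (rewrite Re_inner_sym in E; lra).
    apply quad_nonneg_lin_zero with (k := norm h ^ 2 / 2);
      [assert (S := pow2_ge_0 (norm h)); lra|].
    (* The variation is taken at u_n instead of y. The defect of J(u_n) and the error in the inner
       product are at most e/2 each. *)
    intros t; apply le_epsilon; intros e He.
    assert (Gh := norm_ge_0 h).
    destruct (small (e / 2) ltac:(lra)) as [N1 HN1].
    assert (Hd : 0 < e / 2 / (Rabs t * norm h + 1)).
    { apply Rdiv_lt_0_compat; [lra|].
      assert (S := Rmult_le_pos _ _ (Rabs_pos t) Gh); lra. }
    destruct (Hy _ Hd) as [N2 HN2].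
    set (n := (N1 + N2)%nat).
    assert (E1 := HN1 n ltac:(unfold n; lia)).
    assert (E2 := HN2 n ltac:(unfold n; lia)).
    assert (E3 := Jge (u n +v RtoC t *v h)).
    unfold J in E3; rewrite norm2_add norm2_scal fD fS innerZr in E3.
    rewrite Cmod_R pow2_abs in E3.
    unfold J in E1.
    assert (E4 : Re (inner (u n) h) * t <= Re (inner y h) * t + e / 2).
    { assert (C : Cmod (inner (u n -v y) h) <= norm (u n -v y) * norm h)
        by apply Cauchy_Schwarz.
      rewrite innerBl in C.
      assert (C2 := re_le_Cmod (inner (u n) h - inner y h)%C).
      assert (C3 : Rabs t * norm h * norm (u n -v y) <= e / 2).
      { apply Rle_trans with ((Rabs t * norm h + 1) *
          (e / 2 / (Rabs t * norm h + 1))).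
        - apply Rmult_le_compat; try lra.
          + apply Rmult_le_pos; [apply Rabs_pos | lra].
          + apply norm_ge_0.
        - right; field.
          assert (S := Rmult_le_pos _ _ (Rabs_pos t) Gh); lra. }
      assert (C4 : Rabs t * Rabs (Re (inner (u n) h - inner y h)) <= e / 2).
      { eapply Rle_trans; [|exact C3].
        rewrite Rmult_assoc; apply Rmult_le_compat_l; [apply Rabs_pos|].
        rewrite Rmult_comm; lra. }
      rewrite -Rabs_mult in C4.
      assert (C5 := Rle_abs (t * Re (inner (u n) h - inner y h))).
      unfold Re in *; simpl in *; lra. }
    unfold Re, Im, Cconj, Cmult, RtoC in *; simpl in *; lra. }
  exists y; intros x; apply injective_projections.
  + exact (key x).
  (* The imaginary part of f(x) is minus the real part of f(i x). *)
  + assert (E := key (Ci *v x)); rewrite fS innerZl in E.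
    unfold Re, Ci in E; simpl in E; lra.
Qed.

(** Riesz for each fixed y; conjugate linearity of q in y makes the representing vector linear in
    y. *)
Lemma riesz_form (q : H -> H -> C) (M : R) :
  0 <= M ->
  (forall x y z, q (x +v y) z = (q x z + q y z)%C) ->
  (forall (k : C) x z, q (k *v x) z = (k * q x z)%C) ->
  (forall x y z, q x (y +v z) = (q x y + q x z)%C) ->
  (forall (k : C) x z, q x (k *v z) = (Cconj k * q x z)%C) ->
  (forall x y, Cmod (q x y) <= M * norm x * norm y) ->
  exists S : bounded_op H, forall x y, q x y = inner x (S y).
Proof.
intros M0 D1 S1 D2 S2 B.
assert (E : forall y, exists z, forall x, q x y = inner x z).
{ intros y; apply riesz; split.
  - intros x x'; apply D1.
  - intros k x; apply S1.
  - exists (M * norm y + 1); assert (G := norm_ge_0 y); split; [nra|].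
    intros x; change (norm (q x y)) with (Cmod (q x y)).
    assert (E := B x y); assert (G' := norm_ge_0 x); nra. }
set (s := fun y => proj1_sig (constructive_indefinite_description _ (E y))).
assert (Hs : forall y x, q x y = inner x (s y)).
{ intros y; exact (proj2_sig (constructive_indefinite_description _ (E y))). }
assert (Ls : is_linear s).
{ split.
  - intros x y; apply inner_ext; intros z.
    rewrite innerDr -!Hs; apply D2.
  - intros k x; apply inner_ext; intros z.
    rewrite innerZr -!Hs; apply S2.
  - exists (M + 1); split; [lra|]; intros y.
    assert (Gy := norm_ge_0 y).
    apply Rle_trans with (M * norm y); [|nra].
    apply norm_le_inner; [nra|]; intros z.
    rewrite Re_inner_sym -Hs.
    apply Rle_trans with (1 := Rle_abs _).
    apply Rle_trans with (1 := re_le_Cmod _).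
    apply Rle_trans with (1 := B z y); right; ring. }
exists (BoundedOp s Ls); intros x y; apply Hs.
Qed.

(** [adjoint] is a definite description: existence comes from [riesz_form], uniqueness from
    [inner_ext]. *)
Lemma adjointP (T : bounded_op H) : is_adjoint T (adjoint T).
Proof.
apply (iota_correct (V := bop_CompleteNormedModule H) (is_adjoint T)).
destruct (riesz_form (fun x y => inner (T x) y) (onorm T) (onorm_ge0 T))
  as [S HS].
- intros x y z; rewrite opD; apply innerDl.
- intros k x z; rewrite opZ; apply innerZl.
- intros x y z; apply innerDr.
- intros k x z; apply innerZr.
- intros x y; apply Rle_trans with (1 := Cauchy_Schwarz (T x) y).
  apply Rmult_le_compat_r; [apply norm_ge_0 | apply onorm_app].
- exists S; split; [exact HS|].
  intros S' HS'; apply bop_ext; intros y; apply inner_ext; intros z.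
  rewrite -HS'; symmetry; apply HS.
Qed.

Lemma adjoint_unique (T S : bounded_op H) : is_adjoint T S -> adjoint T = S.
Proof.
intros HS; apply bop_ext; intros y; apply inner_ext; intros z.
rewrite -HS; symmetry; apply adjointP.
Qed.

Lemma inner_adjoint (T : bounded_op H) (x y : H) :
  inner (T x) y = inner x (adjoint T y).
Proof. apply adjointP. Qed.

Lemma adjoint_adjoint (T : bounded_op H) : adjoint (adjoint T) = T.
Proof.
apply adjoint_unique; intros x y.
now rewrite inner_conj -inner_adjoint -inner_conj.
Qed.

Lemma adjoint_one : adjoint (1o : bounded_op H) = 1o.
Proof. now apply adjoint_unique. Qed.

Lemma adjoint_mult (S T : bounded_op H) :
  adjoint (mult S T) = mult (adjoint T) (adjoint S).
Proof.
apply adjoint_unique; intros x y.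
change (inner (S (T x)) y = inner x (adjoint T (adjoint S y))).
now rewrite !inner_adjoint.
Qed.

Lemma adjoint_plus (S T : bounded_op H) :
  adjoint (plus S T) = plus (adjoint S) (adjoint T).
Proof.
apply adjoint_unique; intros x y.
change (inner (S x +v T x) y = inner x (adjoint S y +v adjoint T y)).
now rewrite innerDl innerDr !inner_adjoint.
Qed.

Lemma adjoint_minus (S T : bounded_op H) :
  adjoint (minus S T) = minus (adjoint S) (adjoint T).
Proof.
apply adjoint_unique; intros x y.
change (inner (S x -v T x) y = inner x (adjoint S y -v adjoint T y)).
now rewrite innerBl innerBr !inner_adjoint.
Qed.

Lemma adjoint_scal (k : C) (T : bounded_op H) :
  adjoint (k *s T) = Cconj k *s adjoint T.
Proof.
apply adjoint_unique; intros x y.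
change (inner (k *v T x) y = inner x (Cconj k *v adjoint T y)).
rewrite innerZl innerZr inner_adjoint; f_equal.
destruct k; apply injective_projections; simpl; ring.
Qed.

Lemma adjoint_pow (T : bounded_op H) (n : nat) :
  adjoint (T ^o n) = adjoint T ^o n.
Proof.
induction n as [|n IH]; [exact adjoint_one|].
change (adjoint (T *o T ^o n) = adjoint T *o adjoint T ^o n).
rewrite adjoint_mult IH.
exact (f_equal bico (bmul_comm (adjoint T) (bpow n) (bT (adjoint T)))).
Qed.

Lemma norm_adjoint_le (T : bounded_op H) : onorm (adjoint T) <= onorm T.
Proof.
apply op_norm_le; [apply onorm_ge0|]; intros y.
assert (Gy := norm_ge_0 y); assert (GT := onorm_ge0 T).
apply norm_le_inner; [nra|]; intros z.
rewrite Re_inner_sym -inner_adjoint.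
apply Rle_trans with (1 := Re_inner_le _ _).
assert (E := onorm_app T z); nra.
Qed.

Lemma norm_adjoint (T : bounded_op H) : onorm (adjoint T) = onorm T.
Proof.
apply Rle_antisym; [apply norm_adjoint_le|].
rewrite -{1}(adjoint_adjoint T); apply norm_adjoint_le.
Qed.

End Riesz.

(** * Square functions of contractions *)

Section RingIds.
Context {X : NormedModule C_AbsRing} {T : bounded_op X}.
Add Ring bicommring2 : (bicomm_ring T).
Implicit Types a b c u : bicomm T.

Lemma bfactor a b : bsub a (bmul b a) = bmul a (bsub b1 b).
Proof. ring. Qed.

Lemma orbit_comm (k : nat) :
  bmul (bmul (bpow k) (bsub b1 (bT T))) (bT T) = bmul (bpow (1 + k)) (bsub b1 (bT T)).
Proof. rewrite bpowS; ring. Qed.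

Lemma bhalf : badd (bscal (/ 2) b1) (bscal (/ 2) b1) = b1 :> bicomm T.
Proof.
apply bicomm_eq; apply bop_ext => x /=.
transitivity ((/ 2 + / 2)%C *v x); first exact (eq_sym (scal_distr_r _ _ x)).
have -> : (/ 2 + / 2)%C = 1 by field.
exact (scal_one x).
Qed.

(* [dmean j] is the mean of the powers T^n, n < 2^j. *)
Fixpoint dmean (j : nat) : bicomm T :=
  if j is S k then bmul (bscal (/ 2) b1) (bmul (badd b1 (bpow (2 ^ k))) (dmean k))
  else b1.

Lemma bpow_double (j : nat) :
  bpow (T := T) (2 ^ S j) = bmul (bpow (2 ^ j)) (bpow (2 ^ j)).
Proof. by rewrite -bpow_add; f_equal; rewrite /=; lia. Qed.

(** P_j is the product of the (I + T^(2^i))/2 with i < j, so (1 - p)(1 + p) = 1 - p^2 telescopes. *)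
Lemma dmeanE (j : nat) :
  bmul (bscal (RtoC (2 ^ j)) b1) (bmul (bsub b1 (bT T)) (dmean j)) =
  bsub b1 (bpow (2 ^ j)).
Proof.
elim: j => [|j IH].
  have -> : bpow (T := T) (2 ^ 0) = bT T by apply bicomm_eq; exact (op1_r T).
  have -> : bscal (RtoC (2 ^ 0)) b1 = b1 :> bicomm T.
    by apply bicomm_eq; apply bop_ext => x; exact (scal_one x).
  rewrite /=; ring.
rewrite bpow_double; set p := bpow (2 ^ j) in IH *; rewrite /= -/p.
have -> : bscal (RtoC (2 * 2 ^ j)) b1 =
  badd (bscal (RtoC (2 ^ j)) b1) (bscal (RtoC (2 ^ j)) b1) :> bicomm T.
  apply bicomm_eq; apply bop_ext => x.
  transitivity ((RtoC (2 ^ j) + RtoC (2 ^ j))%C *v x).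
    have -> : (RtoC (2 ^ j) + RtoC (2 ^ j))%C = RtoC (2 * 2 ^ j)
      by rewrite -RtoC_plus; f_equal; ring.
    by [].
  exact (scal_distr_r _ _ (x : X)).
set s := bscal (RtoC (2 ^ j)) b1 in IH *; set h := bscal (/ 2) b1.
transitivity (bmul (bmul (badd h h) (badd b1 p)) (bmul s (bmul (bsub b1 (bT T)) (dmean j)))).
  ring.
by rewrite IH bhalf; ring.
Qed.

Lemma dmean_step (j : nat) :
  bsub (dmean j) (dmean (S j)) =
  bmul (bscal (/ 2) b1) (bmul (bsub b1 (bpow (2 ^ j))) (dmean j)).
Proof.
rewrite /=; set h := bscal (/ 2) b1.
transitivity (bsub (bmul (badd h h) (dmean j))
  (bmul h (bmul (badd b1 (bpow (2 ^ j))) (dmean j)))); last ring.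
by rewrite bhalf; ring.
Qed.

Lemma bpow_mul_sub (k j : nat) :
  bmul (bpow k) (bsub b1 (bpow j)) = bmul (bmul (bpow k) (bsub b1 (bT T))) (bgeo j).
Proof. by rewrite -bgeoE; ring. Qed.

End RingIds.
Arguments orbit_comm {X} T k.

(** Names the constants for the later estimates and shifts the index: [ritt] bounds n (T^n -
    T^(n-1)), while n T^n (I - T) makes sense at n = 0 too. *)
Definition ritt_bounds {X : NormedModule C_AbsRing} (T : bounded_op X) (M C : R) :=
  1 <= M /\ 0 <= C /\ (forall n, onorm (T ^o n) <= M) /\
  (forall n, INR n * onorm (T ^o n *o (1o -o T)) <= C).

Lemma ritt_bounded {X : CompleteNormedModule C_AbsRing} (T : bounded_op X) :
  ritt T -> exists M C, ritt_bounds T M C.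
Proof.
move=> [[M HM] [C HC]].
have HC' : forall n, INR n * onorm (T ^o n *o (1o -o T)) <= C.
  move=> n; have := HC (S n) (le_n_S _ _ (Nat.le_0_l n)).
  rewrite Nat.sub_succ Nat.sub_0_r.
  move=> HC2; have {HC2} : onorm (RtoC (INR (S n)) *s (T *o T ^o n -o T ^o n)) <= C by [].
  rewrite onorm_scal_eq Cmod_R Rabs_pos_eq; last exact: pos_INR.
  rewrite onorm_sub_sym.
  have -> : T ^o n -o T *o T ^o n = T ^o n *o (1o -o T).
    exact (f_equal bico (bfactor (bpow n) (bT T))).
  rewrite S_INR; have := onorm_ge0 (T ^o n *o (1o -o T)); lra.
exists (Rmax 1 M), C; split; [exact: Rmax_l|split; [|split]] => //.
  by have := HC' 0%nat; rewrite /=; lra.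
by move=> n; apply Rle_trans with (2 := Rmax_r 1 M); exact: HM.
Qed.

Section RingIds2.
Context {X : NormedModule C_AbsRing} {T : bounded_op X}.
Add Ring bicommring3 : (bicomm_ring T).

Lemma dmean_split (k j : nat) :
  bmul (bpow k) (bsub b1 (dmean (S j))) =
  badd (bmul (bpow k) (bsub b1 (dmean j)))
    (bmul (bscal (/ 2) b1)
       (bmul (bmul (bmul (bpow (T := T) k) (bsub b1 (bT T))) (bgeo (2 ^ j))) (dmean j))).
Proof.
rewrite -bpow_mul_sub.
transitivity (badd (bmul (bpow k) (bsub b1 (dmean j)))
   (bmul (bpow k) (bsub (dmean j) (dmean (T := T) (S j))))); first ring.
rewrite dmean_step; ring.
Qed.

(** Splits along I = P^2 + (I + P)(I - P). In the remainder one T^k makes I - P small, and the other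
    stays with I - T to form an earlier term of the sequence. *)
Lemma band_split (k j : nat) :
  bmul (bpow (k + k)) (bsub b1 (bT T)) =
  badd (bmul (bpow (k + k)) (bmul (dmean j) (bmul (bsub b1 (bT T)) (dmean j))))
    (bmul (bmul (badd b1 (dmean j)) (bmul (bpow k) (bsub b1 (dmean j))))
       (bmul (bpow k) (bsub b1 (bT T)))).
Proof. by rewrite bpow_add; ring. Qed.

Lemma bmul_rearr (s a p : bicomm T) :
  bmul (bmul s (bmul a p)) p = bmul s (bmul p (bmul a p)).
Proof. ring. Qed.

End RingIds2.

Lemma bico_mul_app {X : NormedModule C_AbsRing} {T : bounded_op X} (a b : bicomm T) x :
  bmul a b x = a (b x).
Proof. by []. Qed.

Lemma onorm_half {X : NormedModule C_AbsRing} {T : bounded_op X} :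
  onorm (bscal (/ 2) (b1 (T := T))) <= / 2.
Proof.
apply Rle_trans with (1 := onorm_scal (/ 2)%C (1o : bounded_op X)).
have -> : (/ 2)%C = RtoC (/ 2) by rewrite RtoC_inv.
rewrite Cmod_R Rabs_pos_eq; last lra.
have := onorm_one (X := X); lra.
Qed.

Section Contraction.
Context {H : Hilbert} (T : bounded_op H).
Hypothesis T1 : forall n, onorm (T ^o n) <= 1.

Let psi (j : nat) : bicomm T := bmul (bsub b1 (bpow (2 ^ j))) (dmean j).

(** The induction step is the parallelogram law at y = P_J x and T^(2^J) y, whose norm is at most
    that of y; the factor 4 clears the halves. *)
Lemma dmean_energy (x : H) (J : nat) :
  rsum (fun j => norm (psi j x) ^ 2) J + 4 * norm (dmean (T := T) J x) ^ 2
  <= 4 * norm x ^ 2.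
Proof.
elim: J => [|J IH] /=; first by rewrite Rplus_0_l; apply Rle_refl.
set y := dmean (T := T) J x in IH *.
set z := (T ^o (2 ^ J)) y.
change (rsum (fun j => norm (psi j x) ^ 2) J + norm (y -v z) ^ 2 +
  4 * norm ((/ 2)%C *v (y +v z)) ^ 2 <= 4 * norm x ^ 2).
have Hz : norm z <= norm y.
  apply Rle_trans with (1 := onorm_app (T ^o (2 ^ J)) y).
  have := T1 (2 ^ J); have := norm_ge_0 y; nra.
have := sq_le_sq _ _ (norm_ge_0 z) Hz.
have -> : (/ 2)%C = RtoC (/ 2) by rewrite RtoC_inv.
rewrite norm2_scal Cmod_R Rabs_pos_eq; last lra.
have := parallelogram y z; lra.
Qed.

Lemma dmean_norm (j : nat) : onorm (dmean (T := T) j) <= 1.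
Proof.
apply onorm_le => [|x]; first lra.
have := dmean_energy x j.
have : 0 <= rsum (fun j => norm (psi j x) ^ 2) j.
  by apply rsum_ge0 => k _; apply pow2_ge_0.
have := norm_ge_0 x; have := norm_ge_0 (dmean (T := T) j x); nra.
Qed.

Variable C : R.
Hypothesis HC : forall n, INR n * onorm (T ^o n *o (1o -o T)) <= C.

(** I - P_j is a sum of steps P_i - P_{i+1}, and T^k (P_i - P_{i+1}) is half of T^k (I - T) times a
    sum of 2^i powers of T times P_i. After multiplication by k each step costs at most C 2^i /
    2. *)
Lemma dmean_approx (k j : nat) :
  INR k * onorm (bmul (bpow k) (bsub b1 (dmean (T := T) j))) <= C * 2 ^ j.
Proof.
have C0 : 0 <= C by have := HC 0; rewrite /=; lra.
have K0 := pos_INR k.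
elim: j => [|j IH].
  have -> : bico (bmul (bpow k) (bsub b1 (dmean (T := T) 0))) = 0o.
    apply bop_ext => x; change ((T ^o k) (x -v x) = 0v).
    rewrite (minus_eq_zero x); exact: op0.
  rewrite (norm_zero (V := bop_NormedModule H)); lra.
rewrite dmean_split /=.
set a := bmul (bpow k) (bsub b1 (dmean j)) in IH *.
set b := bmul (bpow k) (bsub b1 (bT T)).
set c := bmul (bscal (/ 2) b1) (bmul (bmul b (bgeo (2 ^ j))) (dmean j)).
have L5 := bgeo_norm (T := T) 1 (2 ^ j) T1; rewrite INR_2pow in L5.
have P := pow_lt 2 j ltac:(lra).
have Nb := onorm_ge0 b.
have Lc : onorm c <= / 2 * ((onorm b * (2 ^ j * 1)) * 1).
  apply onorm_mul_le; first exact: onorm_half.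
  apply onorm_mul_le; last exact: dmean_norm.
  by apply onorm_mul_le => //; apply Rle_refl.
have L8 : INR k * onorm b <= C := HC k.
apply Rle_trans with (INR k * (onorm a + onorm c)).
  apply Rmult_le_compat_l => //; exact: onorm_add.
have : INR k * onorm c <= / 2 * 2 ^ j * C; last by nra.
apply Rle_trans with (/ 2 * 2 ^ j * (INR k * onorm b)); last nra.
apply Rle_trans with (INR k * (/ 2 * (onorm b * (2 ^ j * 1) * 1))); last by right; ring.
by apply Rmult_le_compat_l.
Qed.


(** In the first term of [band_split], P_j (I - T) P_j is 2^-j times [psi j]. *)
Lemma dmean_low (k j : nat) (x : H) :
  norm ((T ^o (k + k) *o (1o -o T)) x) <=
  / 2 ^ j * norm (psi j x) +
  2 * onorm (bmul (bpow k) (bsub b1 (dmean (T := T) j))) *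
    norm ((T ^o k *o (1o -o T)) x).
Proof.
have P := pow_lt 2 j ltac:(lra).
set v := bmul (dmean (T := T) j) (bmul (bsub b1 (bT T)) (dmean j)).
have Ev : norm (v x) = / 2 ^ j * norm (psi j x).
  have -> : psi j = bscal (RtoC (2 ^ j)) v.
    rewrite /psi -dmeanE [RHS]bscalE /v; set s := bscal (RtoC (2 ^ j)) b1.
    exact: bmul_rearr.
  change (norm (v x) = / 2 ^ j * norm (RtoC (2 ^ j) *v v x)).
  rewrite vscal_norm_eq Cmod_R Rabs_pos_eq; [field|]; lra.
rewrite -Ev.
have -> : (T ^o (k + k) *o (1o -o T)) x = (T ^o (k + k)) (v x) +v
   (bmul (badd b1 (dmean (T := T) j)) (bmul (bpow k) (bsub b1 (dmean j))))
   ((T ^o k *o (1o -o T)) x).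
  exact (f_equal (fun a : bicomm T => a x) (band_split (T := T) k j)).
apply Rle_trans with (1 := vadd_norm _ _).
apply Rplus_le_compat.
  apply Rle_trans with (1 := onorm_app _ _).
  have := T1 (k + k); have := norm_ge_0 (v x); nra.
apply Rle_trans with (1 := onorm_app _ _).
apply Rmult_le_compat_r; first exact: norm_ge_0.
apply onorm_mul_le; last exact: Rle_refl.
apply Rle_trans with (1 := onorm_add _ _).
have := dmean_norm j; have := onorm_one (X := H); rewrite /=; lra.
Qed.

Let d (x : H) (i : nat) : R := 2 ^ i * norm ((T ^o (2 ^ i) *o (1o -o T)) x).

(** With k = 2^(r+j) the coefficient of the earlier term is 4 |T^k (I - P_j)| <= 4 C / 2^r, which is
    at most 1/2 by the choice of r. *)
Lemma dyadic_step (r j : nat) (x : H) : 16 * C <= 2 ^ S r ->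
  d x (S r + j) ^ 2 <= 2 * (2 ^ S r) ^ 2 * norm (psi j x) ^ 2 + / 2 * d x (r + j) ^ 2.
Proof.
move=> Hr.
have P := pow_lt 2 j ltac:(lra); have Pr := pow_lt 2 r ltac:(lra).
set k := (2 ^ (r + j))%nat.
have Ek : INR k = 2 ^ r * 2 ^ j by rewrite INR_2pow pow_add.
have L := dmean_low k j x.
have A := dmean_approx k j.
rewrite Ek in A.
set e := onorm _ in A L; have e0 : 0 <= e by apply onorm_ge0.
have A' : 8 * e <= 1.
  have : 2 ^ r * e <= C by nra.
  rewrite /= in Hr; nra.
rewrite /d; have -> : (2 ^ (S r + j) = k + k)%nat by rewrite /k /=; lia.
set w := norm ((T ^o (k + k) *o (1o -o T)) x) in L *.
set u := norm ((T ^o k *o (1o -o T)) x) in L *.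
set p := norm (psi j x) in L *.
have w0 : 0 <= w by apply norm_ge_0.
have u0 : 0 <= u by apply norm_ge_0.
have p0 : 0 <= p by apply norm_ge_0.
have E2 : 2 ^ (S r + j) = 2 * (2 ^ r * 2 ^ j) by rewrite pow_add /=; ring.
rewrite E2 (pow_add 2 r j).
have B : 2 * (2 ^ r * 2 ^ j) * w <= 2 ^ S r * p + / 2 * (2 ^ r * 2 ^ j * u).
  apply Rle_trans with (2 * (2 ^ r * 2 ^ j) * (/ 2 ^ j * p + 2 * e * u)).
    apply Rmult_le_compat_l => //; nra.
  have -> : 2 * (2 ^ r * 2 ^ j) * (/ 2 ^ j * p + 2 * e * u) =
    2 ^ S r * p + 4 * e * (2 ^ r * 2 ^ j * u) by rewrite /=; field; lra.
  have : 0 <= 2 ^ r * 2 ^ j * u by apply Rmult_le_pos; nra.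
  nra.
have W0 : 0 <= 2 * (2 ^ r * 2 ^ j) * w by apply Rmult_le_pos; nra.
have := sq_le_sq _ _ W0 B.
set a := 2 ^ S r * p; set b := 2 ^ r * 2 ^ j * u => Q.
have -> : 2 * (2 ^ S r) ^ 2 * p ^ 2 = 2 * a ^ 2 by rewrite /a; ring.
(* This is (a + b/2)^2 <= 2 a^2 + b^2/2. *)
have := pow2_ge_0 (a - / 2 * b); nra.
Qed.

(** Summing the recursion bounds the part D of the sum beyond index r by 8 R2 |x|^2 plus half of
    d_r^2 + D; as D is a finite sum, D/2 can be subtracted from both sides. *)
Lemma contraction_dyadic :
  exists K, 0 <= K /\ forall x J, rsum (fun i => d x i ^ 2) J <= K * norm x ^ 2.
Proof.
have [r Hr] : exists r : nat, 16 * C <= 2 ^ S r.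
  have [r Hr] := Pow_x_infinity 2 ltac:(rewrite Rabs_pos_eq; lra) (16 * C).
  exists r; have := Hr (S r) ltac:(lia).
  by rewrite Rabs_pos_eq; [lra | apply pow_le; lra].
set R2 := (2 ^ S r) ^ 2.
have R0 : 0 <= R2 by apply pow2_ge_0.
have D1 : forall x i, (i <= r)%nat -> d x i ^ 2 <= R2 * norm x ^ 2.
  move=> x i Hi; have -> : R2 * norm x ^ 2 = (2 ^ S r * norm x) ^ 2 by rewrite /R2; ring.
  have P := pow_lt 2 i ltac:(lra).
  have N := norm_ge_0 x.
  have L := onorm_app (T ^o (2 ^ i) *o (1o -o T)) x.
  have L2 : onorm (T ^o (2 ^ i) *o (1o -o T)) <= 1 * (1 + 1).
    apply onorm_mul_le => //; apply Rle_trans with (1 := onorm_sub _ _).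
    have : onorm T <= 1 by rewrite -(op1_r T); exact: (T1 1%nat).
    have := onorm_one (X := H); lra.
  apply sq_le_sq; rewrite /d; first by apply Rmult_le_pos; [lra | apply norm_ge_0].
  have -> : 2 ^ S r * norm x = 2 ^ r * (2 * norm x) by rewrite /=; ring.
  apply Rmult_le_compat; [lra | apply norm_ge_0 | apply Rle_pow => //; lra | nra].
(* The first r + 1 terms; twice the 8 R2 coming from the energy bound; twice the half of the term at
   r. *)
exists (R2 * INR (S r) + 16 * R2 + R2); split.
  have := pos_INR (S r); nra.
move=> x J.
apply Rle_trans with (rsum (fun i => d x i ^ 2) (S r + J)).
  by apply rsum_mono; [move=> k; apply pow2_ge_0 | lia].
rewrite rsum_add.
have S1 : rsum (fun i => d x i ^ 2) (S r) <= INR (S r) * (R2 * norm x ^ 2).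
  rewrite -rsum_const; apply rsum_le => i Hi; apply D1; lia.
set D := rsum (fun k => d x (S r + k) ^ 2) J.
have S2 : D <= 2 * R2 * rsum (fun j => norm (psi j x) ^ 2) J +
   / 2 * rsum (fun k => d x (r + k) ^ 2) J.
  rewrite -!rsum_mult -rsum_plus; apply rsum_le => i _; exact: dyadic_step.
have S3 : rsum (fun k => d x (r + k) ^ 2) J <= d x r ^ 2 + D.
  apply Rle_trans with (rsum (fun k => d x (r + k) ^ 2) (1 + J)).
    by apply rsum_mono; [move=> k; apply pow2_ge_0 | lia].
  rewrite rsum_add; right; rewrite {1}/rsum Rplus_0_l Nat.add_0_r; f_equal.
  apply rsum_ext => k _; by have -> : (r + (1 + k) = S r + k)%nat by lia.
have S4 := D1 x r (Nat.le_refl r).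
have S5 := dmean_energy x J.
have S6 := pow2_ge_0 (norm (dmean (T := T) J x)).
have : 2 * R2 * rsum (fun j => norm (psi j x) ^ 2) J <= 2 * R2 * (4 * norm x ^ 2).
  apply Rmult_le_compat_l; first lra.
  move: S5 S6; rewrite /=; lra.
lra.
Qed.

End Contraction.

(** * Dyadic form of the square function *)

Section Dyadic.
Variables (u : nat -> R) (M : R).
Hypothesis M1 : 1 <= M.
Hypothesis u0 : forall k, 0 <= u k.
Hypothesis uM : forall k m, u (k + m)%nat <= M * u k.

(** On the block 2^j <= k < 2^(j+1) the weights are at most 2^(j+1), and u k is at most M times its
    value at the left end. *)
Lemma dyadic_block_le (j : nat) :
  rsum (fun i => INR (S (2 ^ j + i)) * u (2 ^ j + i)%nat ^ 2) (2 ^ j) <=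
  2 * M ^ 2 * (2 ^ j * u (2 ^ j)%nat) ^ 2.
Proof.
have P := pow_lt 2 j ltac:(lra).
apply Rle_trans with (rsum (fun _ => 2 * 2 ^ j * (M * u (2 ^ j)%nat) ^ 2) (2 ^ j)).
  apply rsum_le => i Hi; apply Rmult_le_compat.
  - exact: pos_INR.
  - exact: pow2_ge_0.
  - have -> : 2 * 2 ^ j = INR (2 ^ j + 2 ^ j) by rewrite plus_INR INR_2pow; ring.
    apply le_INR; lia.
  - exact: sq_le_sq.
rewrite rsum_const INR_2pow; right; ring.
Qed.

(** The same block, compared with the value of u at its right end. *)
Lemma dyadic_block_ge (j : nat) :
  (2 ^ S j * u (2 ^ S j)%nat) ^ 2 <=
  4 * M ^ 2 * rsum (fun i => INR (S (2 ^ j + i)) * u (2 ^ j + i)%nat ^ 2) (2 ^ j).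
Proof.
have P := pow_lt 2 j ltac:(lra).
rewrite -rsum_mult.
apply Rle_trans with (rsum (fun _ => 4 * 2 ^ j * u (2 ^ S j)%nat ^ 2) (2 ^ j)).
  rewrite rsum_const INR_2pow; right; rewrite /=; ring.
apply rsum_le => i Hi.
have -> : (2 ^ S j = (2 ^ j + i) + (2 ^ j - i))%nat by rewrite /=; lia.
have Q := sq_le_sq _ _ (u0 _) (uM (2 ^ j + i) (2 ^ j - i)).
have L : 2 ^ j <= INR (S (2 ^ j + i)) by rewrite -INR_2pow; apply le_INR; lia.
have Q2 := pow2_ge_0 (u (2 ^ j + i)%nat).
have := pow2_ge_0 (u ((2 ^ j + i) + (2 ^ j - i))%nat).
set v := u _ in Q *; set w := u _ in Q Q2 *; set s := INR _ in L *.
have -> : 4 * M ^ 2 * (s * w ^ 2) = 4 * s * (M * w) ^ 2 by ring.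
nra.
Qed.

Lemma weighted_le_dyadic (J : nat) :
  rsum (fun k => INR (S k) * u k ^ 2) (2 ^ J) <=
  u 0%nat ^ 2 + 2 * M ^ 2 * rsum (fun j => (2 ^ j * u (2 ^ j)%nat) ^ 2) J.
Proof.
elim: J => [|J IH]; first by rewrite /=; lra.
have -> : (2 ^ S J = 2 ^ J + 2 ^ J)%nat by rewrite /=; lia.
rewrite rsum_add; have := dyadic_block_le J.
rewrite [rsum _ (S J)]/=; rewrite /= in IH *; lra.
Qed.

Lemma dyadic_le_weighted (J : nat) :
  rsum (fun j => (2 ^ j * u (2 ^ j)%nat) ^ 2) (S J) <=
  4 * M ^ 2 * rsum (fun k => INR (S k) * u k ^ 2) (2 ^ J).
Proof.
elim: J => [|J IH].
  have := sq_le_sq _ _ (u0 _) (uM 0 1); have := pow2_ge_0 (M * u 0%nat).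
  rewrite /=; nra.
have -> : (2 ^ S J = 2 ^ J + 2 ^ J)%nat by rewrite /=; lia.
rewrite rsum_add Rmult_plus_distr_l; have := dyadic_block_ge J.
have -> : forall f n, rsum f (S n) = rsum f n + f n by [].
lra.
Qed.

End Dyadic.

Section SquareFunction.
Context {H : Hilbert}.

Definition orbit (T : bounded_op H) (x : H) (k : nat) : R :=
  norm ((T ^o k *o (1o -o T)) x).

(** Partial sums of the squared square function, with the index shifted to start at 0. *)
Definition weighted (T : bounded_op H) (x : H) (n : nat) : R :=
  rsum (fun k => INR (S k) * orbit T x k ^ 2) n.

Definition dyadic (T : bounded_op H) (x : H) (j : nat) : R :=
  2 ^ j * orbit T x (2 ^ j).

(** The partial sums increase, so their limit is at most c^2 exactly when they all are. This trades
    the extended real value for bounds on finite sums. *)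
Lemma sqfun_le (T : bounded_op H) (x : H) (c : R) : 0 <= c ->
  Rbar_le (sqfun_norm T x) c <-> forall n, weighted T x n <= c ^ 2.
Proof.
move=> c0; rewrite /sqfun_norm; set u := fun n : nat => _.
have Eu : forall n, u n = weighted T x n.
  elim=> [|n IH]; first by rewrite /u /weighted /= sum_n_m_zero.
  rewrite /u sum_n_Sm; last lia.
  change (u n + INR (S n) * norm (((T ^o (S n - 1)) *o (1o -o T)) x) ^ 2 = weighted T x (S n)).
  by rewrite IH Nat.sub_succ Nat.sub_0_r.
have incr : forall n, u n <= u (S n).
  move=> n; rewrite !Eu /weighted /=.
  have := Rmult_le_pos _ _ (pos_INR (S n)) (pow2_ge_0 (orbit T x n)).
  rewrite /=; lra.
have pos : forall n, 0 <= u n.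
  move=> n; rewrite Eu; apply rsum_ge0 => k _.
  by apply Rmult_le_pos; [exact: pos_INR | exact: pow2_ge_0].
have HL := Lim_seq_correct u (ex_lim_seq_incr u incr).
split.
- move=> Hc n; rewrite -Eu.
  move: HL Hc; case: (Lim_seq u) => [l | | ] HL //= Hc.
  + have L := is_lim_seq_incr_compare u l HL incr.
    apply Rle_trans with (1 := L n).
    have l0 : 0 <= l by apply Rle_trans with (2 := L 0%nat).
    rewrite -(sqrt_sqrt l l0).
    have := sqrt_pos l; nra.
  + have /= B := is_lim_seq_le (fun _ => 0) u 0 m_infty pos (is_lim_seq_const 0) HL.
    by case: B.
- move=> Hn.
  have B1 := is_lim_seq_le u (fun _ => c ^ 2) (Lim_seq u) (c ^ 2)
    (fun n => eq_ind_r (fun r => r <= c ^ 2) (Hn n) (Eu n)) HL (is_lim_seq_const _).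
  have B2 := is_lim_seq_le (fun _ => 0) u 0 (Lim_seq u) pos (is_lim_seq_const 0) HL.
  move: B1 B2; case: (Lim_seq u) => [l | | ] //= B1 B2.
  rewrite -(sqrt_Rsqr c c0); apply sqrt_le_1_alt; rewrite /Rsqr; lra.
Qed.

Variables (T : bounded_op H) (M : R).
Hypothesis M1 : 1 <= M.
Hypothesis HM : forall n, onorm (T ^o n) <= M.

Lemma orbit_shift (x : H) (k m : nat) : orbit T x (k + m) <= M * orbit T x k.
Proof.
rewrite /orbit Nat.add_comm.
have -> : (T ^o (m + k) *o (1o -o T)) x = (T ^o m) ((T ^o k *o (1o -o T)) x).
  by rewrite (pow_n_plus T m k).
apply Rle_trans with (1 := onorm_app _ _).
by apply Rmult_le_compat_r; [exact: norm_ge_0 |].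
Qed.

Lemma orbit_ge0 (x : H) (k : nat) : 0 <= orbit T x k.
Proof. exact: norm_ge_0. Qed.

Lemma orbit0 (x : H) : orbit T x 0 <= (1 + M) * norm x.
Proof.
apply Rle_trans with (1 := onorm_app _ _).
apply Rmult_le_compat_r; first exact: norm_ge_0.
rewrite -(Rmult_1_l (1 + M)); apply onorm_mul_le; first exact: onorm_one.
apply Rle_trans with (1 := onorm_sub _ _).
have : onorm T <= M by rewrite -(op1_r T); exact: (HM 1%nat).
have := onorm_one (X := H); lra.
Qed.

Lemma weighted_of_dyadic (K : R) (x : H) : 0 <= K ->
  (forall J, rsum (fun j => dyadic T x j ^ 2) J <= K * norm x ^ 2) ->
  forall n, weighted T x n <= ((1 + M) ^ 2 + 2 * M ^ 2 * K) * norm x ^ 2.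
Proof.
move=> K0 HK n.
(* n <= 2^n, so complete dyadic blocks cover the sum. *)
apply Rle_trans with (weighted T x (2 ^ n)).
  apply rsum_mono => [k|]; last by have := Nat.pow_gt_lin_r 2 n ltac:(lia); lia.
  by apply Rmult_le_pos; [exact: pos_INR | exact: pow2_ge_0].
apply Rle_trans with (1 := weighted_le_dyadic _ M (orbit_ge0 x) (orbit_shift x) n).
have := sq_le_sq _ _ (orbit_ge0 x 0) (orbit0 x).
have := HK n; rewrite -/(dyadic T x); have := pow2_ge_0 M.
set a := rsum _ _; set b := norm x ^ 2 => *.
have : 2 * M ^ 2 * a <= 2 * M ^ 2 * (K * b) by apply Rmult_le_compat_l; lra.
rewrite /b; nra.
Qed.

Lemma dyadic_of_weighted (c : R) (x : H) :
  (forall n, weighted T x n <= c) ->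
  forall J, rsum (fun j => dyadic T x j ^ 2) J <= 4 * M ^ 2 * c.
Proof.
move=> Hc J.
apply Rle_trans with (rsum (fun j => dyadic T x j ^ 2) (S J)).
  by apply rsum_mono; [move=> k; exact: pow2_ge_0 | lia].
apply Rle_trans with (1 := dyadic_le_weighted _ M (orbit_ge0 x) (orbit_shift x) J).
apply Rmult_le_compat_l; [have := pow2_ge_0 M; lra | exact: Hc].
Qed.

End SquareFunction.

(** The finite, dyadic form in which uniform square function estimates are handled;
    [sq_bound_estimate] relates it to [sqfun_norm]. *)
Definition square_estimate {H : Hilbert} (T : bounded_op H) : Prop :=
  exists K, 0 <= K /\ forall x J,
    rsum (fun j => dyadic T x j ^ 2) J <= K * norm x ^ 2.

Definition sq_bound {H : Hilbert} (T : bounded_op H) (c : R) : Prop :=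
  forall x : H, Rbar_le (sqfun_norm T x) (c * norm x).

Lemma sq_bound_estimate {H : Hilbert} (T : bounded_op H) :
  power_bounded T ->
  (exists c, 0 < c /\ sq_bound T c) <-> square_estimate T.
Proof.
move=> [M' HM'].
set M := Rmax 1 M'.
have M1 : 1 <= M by exact: Rmax_l.
have HM : forall n, onorm (T ^o n) <= M.
  by move=> n; apply Rle_trans with (1 := HM' n); exact: Rmax_r.
split.
- move=> [c [c0 Hc]]; exists (4 * M ^ 2 * c ^ 2); split.
    by have := pow2_ge_0 M; have := pow2_ge_0 c; nra.
  move=> x J.
  have -> : 4 * M ^ 2 * c ^ 2 * norm x ^ 2 = 4 * M ^ 2 * (c * norm x) ^ 2 by ring.
  apply (dyadic_of_weighted T M HM); apply sqfun_le; last exact: Hc.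
  by apply Rmult_le_pos; [lra | exact: norm_ge_0].
- move=> [K [K0 HK]].
  set L := (1 + M) ^ 2 + 2 * M ^ 2 * K.
  have L0 : 0 < L by rewrite /L; have := pow2_ge_0 M; nra.
  have sL := sqrt_lt_R0 L L0.
  exists (sqrt L); split => // x.
  apply sqfun_le => [|n]; first by apply Rmult_le_pos; [lra | exact: norm_ge_0].
  rewrite Rpow_mult_distr -Rsqr_pow2 Rsqr_sqrt; last lra.
  exact: (weighted_of_dyadic T M HM K x K0 (HK x) n).
Qed.

(** * Square functions under similarity *)

Lemma pow_conj {X : NormedModule C_AbsRing} (T V W : bounded_op X) (n : nat) :
  V *o W = 1o -> W *o V = 1o ->
  (W *o (T *o V)) ^o n = W *o (T ^o n *o V).
Proof.
move=> VW WV; elim: n => [|n IH].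
  by change ((1o : bounded_op X) = W *o (1o *o V)); rewrite op1_l.
change (W *o (T *o V) *o (W *o (T *o V)) ^o n = W *o (T *o T ^o n *o V)).
rewrite IH; apply bop_ext => x.
have E := f_equal (fun S : bounded_op X => S (((T ^o n) *o V) x)) VW.
change (V (W (((T ^o n) *o V) x)) = ((T ^o n) *o V) x) in E.
change (W (T (V (W (((T ^o n) *o V) x)))) = W (T (((T ^o n) *o V) x))).
by rewrite E.
Qed.

Lemma orbit_op_conj {X : NormedModule C_AbsRing} (T V W : bounded_op X) (n : nat) :
  V *o W = 1o -> W *o V = 1o ->
  (W *o (T *o V)) ^o n *o (1o -o W *o (T *o V)) = W *o (T ^o n *o (1o -o T) *o V).
Proof.
move=> VW WV; rewrite pow_conj //; apply bop_ext => x.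
have E := f_equal (fun S : bounded_op X => S x) VW.
have E' : forall y, V (W y) = y := fun y => f_equal (fun S : bounded_op X => S y) VW.
change (W ((T ^o n) (V (x -v W (T (V x))))) = W ((T ^o n) (V x -v T (V x)))).
by rewrite opB E'.
Qed.

Lemma adjoint_orbit_op {H : Hilbert} (T : bounded_op H) (n : nat) :
  adjoint T ^o n *o (1o -o adjoint T) = adjoint (T ^o n *o (1o -o T)).
Proof.
rewrite adjoint_mult adjoint_minus adjoint_one adjoint_pow.
exact (f_equal bico (bmul_comm (adjoint T) (bpow n) (bsub b1 (bT _)))).
Qed.

(** S = W T V is a contraction that inherits the Ritt bound, and T^n (I - T) x = V S^n (I - S) W x,
    so the estimate for S at W x transfers at the cost of |V|^2 |W|^2. *)
Lemma similar_contraction_square {H : Hilbert} (T V W : bounded_op H) (C : R) :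
  (forall n, INR n * onorm (T ^o n *o (1o -o T)) <= C) ->
  V *o W = 1o -> W *o V = 1o -> onorm (W *o (T *o V)) <= 1 ->
  square_estimate T.
Proof.
move=> HC VW WV H1.
set S := W *o (T *o V) in H1 *.
have S1 : forall n, onorm (S ^o n) <= 1.
  elim=> [|n IH]; first exact: onorm_one.
  by rewrite -(Rmult_1_l 1); apply (onorm_mul_le S (S ^o n)).
have C0 : 0 <= C by have := HC 0%nat; rewrite /=; lra.
have HS : forall n, INR n * onorm (S ^o n *o (1o -o S)) <= onorm W * (C * onorm V).
  move=> n; rewrite /S orbit_op_conj //.
  have L := onorm_mul_le W (T ^o n *o (1o -o T) *o V) _ _ (Rle_refl _)
    (onorm_mul (T ^o n *o (1o -o T)) V).
  apply Rle_trans with (1 := Rmult_le_compat_l _ _ _ (pos_INR n) L).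
  have -> : INR n * (onorm W * (onorm (T ^o n *o (1o -o T)) * onorm V)) =
    onorm W * (INR n * onorm (T ^o n *o (1o -o T)) * onorm V) by ring.
  apply Rmult_le_compat_l; first exact: onorm_ge0.
  by apply Rmult_le_compat_r; first exact: onorm_ge0.
have [K [K0 HK]] := contraction_dyadic S S1 _ HS.
exists (onorm V ^ 2 * (K * onorm W ^ 2)); split.
  by apply Rmult_le_pos; [|apply Rmult_le_pos => //]; exact: pow2_ge_0.
move=> x J.
apply Rle_trans with (rsum (fun j => onorm V ^ 2 * dyadic S (W x) j ^ 2) J).
  apply rsum_le => j _.
  rewrite -Rpow_mult_distr; apply sq_le_sq.
    by apply Rmult_le_pos; [apply pow_le; lra | exact: norm_ge_0].
  rewrite /dyadic.
  have -> : onorm V * (2 ^ j * orbit S (W x) (2 ^ j)) =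
    2 ^ j * (onorm V * orbit S (W x) (2 ^ j)) by ring.
  apply Rmult_le_compat_l; first by apply pow_le; lra.
  rewrite /orbit /S orbit_op_conj //.
  set A := T ^o (2 ^ j) *o (1o -o T).
  have E' : forall y, V (W y) = y := fun y => f_equal (fun S : bounded_op H => S y) VW.
  have -> : A x = V (W (A (V (W x)))) by rewrite !E'.
  exact: onorm_app.
rewrite rsum_mult.
have -> : onorm V ^ 2 * (K * onorm W ^ 2) * norm x ^ 2 =
   onorm V ^ 2 * (K * (onorm W * norm x) ^ 2) by ring.
apply Rmult_le_compat_l; first exact: pow2_ge_0.
apply Rle_trans with (1 := HK (W x) J).
apply Rmult_le_compat_l => //; apply sq_le_sq; [exact: norm_ge_0 | exact: onorm_app].
Qed.

(** For T* the similarity is given by W* and V* in exchanged roles, and the Ritt constant is the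
    same. *)
Theorem similar_contraction_squares {H : Hilbert} (T V W : bounded_op H) :
  ritt T -> V *o W = 1o -> W *o V = 1o -> onorm (W *o (T *o V)) <= 1 ->
  square_estimate T /\ square_estimate (adjoint T).
Proof.
move=> RT VW WV H1.
have [M [C [_ [_ [_ HC]]]]] := ritt_bounded T RT; split.
  exact: similar_contraction_square HC VW WV H1.
apply (similar_contraction_square _ (adjoint W) (adjoint V) C).
- by move=> n; rewrite adjoint_orbit_op norm_adjoint.
- by rewrite -adjoint_mult VW adjoint_one.
- by rewrite -adjoint_mult WV adjoint_one.
- have -> : adjoint V *o (adjoint T *o adjoint W) = adjoint (W *o (T *o V)).
    by rewrite !adjoint_mult opA.
  by rewrite norm_adjoint.
Qed.

(** * Telescoping along dyadic powers *)

Lemma rsum_Cauchy_Schwarz (a b : nat -> R) (n : nat) :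
  rsum (fun k => a k * b k) n ^ 2 <=
  rsum (fun k => a k ^ 2) n * rsum (fun k => b k ^ 2) n.
Proof.
elim: n => [|n IH]; first by rewrite /=; lra.
rewrite [rsum _ (S n)]/= [rsum (fun k => a k ^ 2) (S n)]/= [rsum (fun k => b k ^ 2) (S n)]/=.
have HA : 0 <= rsum (fun k => a k ^ 2) n by apply rsum_ge0 => k _; exact: pow2_ge_0.
have HB : 0 <= rsum (fun k => b k ^ 2) n by apply rsum_ge0 => k _; exact: pow2_ge_0.
move: IH HA HB; set s := rsum _ _; set A := rsum _ _; set B := rsum _ _ => IH HA HB.
move: (a n) (b n) => x y.
(* The cross term of the induction step: s^2 <= A B, and 4 A B x^2 y^2 <= (A y^2 + B x^2)^2. *)
have Q : 2 * s * (x * y) <= A * y ^ 2 + B * x ^ 2.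
  have Z : 0 <= A * y ^ 2 + B * x ^ 2.
    by have := pow2_ge_0 x; have := pow2_ge_0 y; nra.
  apply Rle_trans with (1 := Rle_abs _).
  apply Rsqr_incr_0_var => //.
  rewrite -Rsqr_abs !Rsqr_pow2.
  have := pow2_ge_0 (A * y ^ 2 - B * x ^ 2).
  have : s ^ 2 * (x * y) ^ 2 <= A * B * (x * y) ^ 2.
    by apply Rmult_le_compat_r => //; exact: pow2_ge_0.
  nra.
rewrite /= in IH Q *; nra.
Qed.

Section TeleRing.
Context {X : NormedModule C_AbsRing} {T : bounded_op X}.
Add Ring bicommring4 : (bicomm_ring T).

(** Spelled as a cube of T^(2^j), so that [tele_step] can give one copy to each factor I - T;
    [tele_uE] is the single power. *)
Definition tele_u (j : nat) : bicomm T :=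
  bmul (bpow (2 ^ j)) (bmul (bpow (2 ^ j)) (bpow (2 ^ j))).

Definition tele (j : nat) : bicomm T :=
  let w := bsub b1 (tele_u j) in bsub b1 (bmul w (bmul w w)).

Definition orbit_b (j : nat) : bicomm T := bmul (bpow (2 ^ j)) (bsub b1 (bT T)).

(** The cofactor in [tele_step]: s^3 (3 + 3u + u^2), where (I - T) s = I - u. *)
Definition tele_G (j : nat) : bicomm T :=
  let s := bgeo (3 * 2 ^ j) in let u := tele_u j in
  bmul (bmul s (bmul s s))
    (badd (badd b1 (badd b1 b1)) (badd (bmul (badd b1 (badd b1 b1)) u) (bmul u u))).

Lemma tele_uE (j : nat) : tele_u j = bpow (3 * 2 ^ j).
Proof. by rewrite /tele_u -!bpow_add; f_equal; lia. Qed.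

(** Passing from j to j + 1 squares u, and (1 - u^2)^3 - (1 - u)^3 = u (1 - u)^3 (3 + 3u + u^2). *)
Lemma tele_step (j : nat) :
  bsub (tele j) (tele (S j)) =
  bmul (orbit_b j) (bmul (tele_G j) (bmul (orbit_b j) (orbit_b j))).
Proof.
have Eu : tele_u (S j) = bmul (tele_u j) (tele_u j).
  by rewrite !tele_uE -bpow_add; f_equal; rewrite /=; lia.
have Ew := bgeoE (T := T) (3 * 2 ^ j); rewrite -tele_uE in Ew.
rewrite /tele Eu.
set u := tele_u j in Ew *.
have E1 : u = bmul (bpow (2 ^ j)) (bmul (bpow (2 ^ j)) (bpow (2 ^ j))) by [].
transitivity (bmul u (bmul (bmul (bsub b1 u) (bmul (bsub b1 u) (bsub b1 u)))
  (badd (badd b1 (badd b1 b1)) (badd (bmul (badd b1 (badd b1 b1)) u) (bmul u u))))).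
  ring.
rewrite -Ew /orbit_b /tele_G -/u {1}E1; set s := bgeo _; set p := bpow _.
ring.
Qed.

Definition tele0_c : bicomm T :=
  let a := bsub b1 (bT T) in let s := bgeo 3 in
  bmul (bmul a a) (bmul s (bmul s s)).

(** I - E_0 = (I - T^3)^3 is divisible by I - T, so the start of the telescoping is controlled by
    the term |(I - T) x| of the square function. *)
Lemma tele0_factor : bsub b1 (tele 0) = bmul tele0_c (bsub b1 (bT T)).
Proof.
have Ew := bgeoE (T := T) 3.
have -> : tele 0 = bsub b1 (bmul (bsub b1 (bpow 3)) (bmul (bsub b1 (bpow 3)) (bsub b1 (bpow 3)))).
  by rewrite /tele tele_uE.
by rewrite -Ew /tele0_c; ring.
Qed.

Lemma tele0_c_norm (M : R) : (forall n, onorm (T ^o n) <= M) ->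
  onorm tele0_c <= ((1 + M) * (1 + M)) * (3 * M * (3 * M * (3 * M))).
Proof.
move=> HM; have H1 := onorm_one (X := X).
have HA : onorm (bsub b1 (bT T)) <= 1 + M.
  by apply onorm_sub_le => //; rewrite -(op1_r T); exact: (HM 1%nat).
have Hs : onorm (bgeo (T := T) 3) <= 3 * M.
  by apply Rle_trans with (1 := bgeo_norm M 3 HM); right; rewrite /=; ring.
apply onorm_mul_le; first exact: onorm_mul_le.
by apply onorm_mul_le => //; exact: onorm_mul_le.
Qed.

(** 1 - w^3 = (1 - w)(1 + w + w^2) with u = 1 - w. The factor u is a high power of T, so Phi E_j is
    small as soon as Phi T^n is. *)
Lemma tele_expand (j : nat) : let w := bsub b1 (tele_u j) in
  tele j = bmul (tele_u j) (badd b1 (badd w (bmul w w))).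
Proof. rewrite /tele; ring. Qed.

Lemma bsub_trans (a b c : bicomm T) : bsub a c = badd (bsub a b) (bsub b c).
Proof. ring. Qed.

Lemma tele_rest (j : nat) : b1 = badd (bsub b1 (tele 0)) (badd (bsub (tele 0) (tele j)) (tele j)).
Proof. ring. Qed.

(** 189 is 27 times 7: s is a sum of 3 2^j powers of T, so s^3 contributes 27 M^3 8^j, and 3 + 3u +
    u^2 contributes 7 M. *)
Lemma tele_G_norm (M : R) (j : nat) : 1 <= M -> (forall n, onorm (T ^o n) <= M) ->
  onorm (tele_G j) <= 189 * M ^ 4 * (2 ^ j) ^ 3.
Proof.
move=> M1 HM.
have P := pow_lt 2 j ltac:(lra).
have Hs : onorm (bgeo (T := T) (3 * 2 ^ j)) <= 3 * 2 ^ j * M.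
  apply Rle_trans with (1 := bgeo_norm M _ HM).
  by rewrite mult_INR INR_2pow; apply Rle_refl || (right; rewrite /=; ring).
have H1 := onorm_one (X := X).
have H3 : onorm (badd b1 (badd b1 (b1 (T := T)))) <= 3.
  have -> : 3 = 1 + (1 + 1) by ring.
  by apply onorm_add_le => //; exact: onorm_add_le.
have Hu : onorm (tele_u j) <= M by rewrite tele_uE; exact: HM.
have Huu : onorm (bmul (tele_u j) (tele_u j)) <= M.
  by rewrite tele_uE -bpow_add; exact: HM.
have Hb : onorm (badd (badd b1 (badd b1 b1)) (badd (bmul (badd b1 (badd b1 b1)) (tele_u j)) (bmul (tele_u j) (tele_u j)))) <= 7 * M.
  apply Rle_trans with (3 + (3 * M + M)); last lra.
  by apply onorm_add_le => //; apply onorm_add_le => //; exact: onorm_mul_le.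
apply Rle_trans with ((3 * 2 ^ j * M * (3 * 2 ^ j * M * (3 * 2 ^ j * M))) * (7 * M)).
  apply onorm_mul_le => //; apply onorm_mul_le => //; exact: onorm_mul_le.
right; ring.
Qed.

Definition tele_w (j : nat) : bicomm T :=
  badd b1 (badd (bsub b1 (tele_u j)) (bmul (bsub b1 (tele_u j)) (bsub b1 (tele_u j)))).

Lemma tele_w_norm (M : R) (j : nat) : (forall n, onorm (T ^o n) <= M) ->
  onorm (tele_w j) <= 1 + ((1 + M) + (1 + M) * (1 + M)).
Proof.
move=> HM; have H1 := onorm_one (X := X).
have Hu : onorm (tele_u j) <= M by rewrite tele_uE; exact: HM.
have Hw : onorm (bsub b1 (tele_u j)) <= 1 + M.
  exact: onorm_sub_le.
by apply onorm_add_le => //; apply onorm_add_le => //; exact: onorm_mul_le.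
Qed.

End TeleRing.

Section Telescope.
Context {H : Hilbert} (T : bounded_op H) (M K : R).
Hypothesis M1 : 1 <= M.
Hypothesis K_ge0 : 0 <= K.
Hypothesis HM : forall n, onorm (T ^o n) <= M.
Hypothesis HK : forall y J, rsum (fun j => dyadic (adjoint T) y j ^ 2) J <= K * norm y ^ 2.
Variables (Phi : bounded_op H) (b : R).
Hypothesis Phi_comm : Phi *o T = T *o Phi.
Hypothesis Phi_orbit : forall j, 2 ^ j * onorm (Phi *o orbit_b (T := T) j) <= b.

(** One of the three orbit factors is absorbed by Phi, one acts on x and one moves to y as an
    adjoint; the 8^j of [tele_G] gives each of them its 2^j. *)
Lemma tele_term (j : nat) (x y : H) :
  Re (inner (Phi (bsub (tele j) (tele (T := T) (S j)) x)) y) <=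
  189 * M ^ 4 * b * (dyadic T x j * dyadic (adjoint T) y j).
Proof.
have P := pow_lt 2 j ltac:(lra).
rewrite tele_step.
set B := orbit_b j; set G := tele_G j.
have -> : Phi (bmul B (bmul G (bmul B B)) x) = B (G ((Phi *o B) (B x))).
  have EB := bicoP T B Phi Phi_comm; have EG := bicoP T G Phi Phi_comm.
  transitivity ((Phi *o B) (G (B (B x)))); first by [].
  rewrite {1}EB; change (B ((Phi *o G) (B (B x))) = B (G ((Phi *o B) (B x)))).
  by rewrite EG.
rewrite inner_adjoint.
apply Rle_trans with (1 := Re_inner_le _ _).
have -> : norm (adjoint B y) = orbit (adjoint T) y (2 ^ j).
  by rewrite /orbit adjoint_orbit_op.
have L1 : norm (G ((Phi *o B) (B x))) <=
  189 * M ^ 4 * (2 ^ j) ^ 3 * (onorm (Phi *o B) * orbit T x (2 ^ j)).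
  apply Rle_trans with (1 := onorm_app _ _).
  apply Rmult_le_compat; try exact: norm_ge_0; first exact: tele_G_norm.
  exact: onorm_app.
have o1 := orbit_ge0 T x (2 ^ j); have o2 := orbit_ge0 (adjoint T) y (2 ^ j).
apply Rle_trans with (1 := Rmult_le_compat_r _ _ _ o2 L1).
rewrite /dyadic; move: o1 o2 (Phi_orbit j); rewrite -/B.
set p := orbit T x _; set q := orbit _ y _; set r := onorm _; set m := 2 ^ j in P * => o1 o2 Hb.
have -> : 189 * M ^ 4 * m ^ 3 * (r * p) * q = 189 * M ^ 4 * (m * r) * (m * p * (m * q)) by ring.
apply Rmult_le_compat_r; first by apply Rmult_le_pos; apply Rmult_le_pos; lra.
by apply Rmult_le_compat_l => //; have := pow_le M 4; lra.
Qed.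

(** Duality with y = v, the vector to be estimated: summation and Cauchy-Schwarz bound |v|^4 by a
    constant times |v|^2, and |v|^2 cancels. *)
Lemma tele_bound (J n : nat) (x : H) :
  norm (Phi (bsub (tele J) (tele (T := T) (J + n)) x)) ^ 2 <=
  (189 * M ^ 4 * b) ^ 2 * K * rsum (fun i => dyadic T x (J + i) ^ 2) n.
Proof.
set c := 189 * M ^ 4 * b.
have E : forall y, Re (inner (Phi (bsub (tele J) (tele (T := T) (J + n)) x)) y) <=
  c * rsum (fun i => dyadic T x (J + i) * dyadic (adjoint T) y (J + i)) n.
  move=> y; elim: n => [|n IH].
    rewrite Nat.add_0_r /= Rmult_0_r.
    have -> : Phi (bsub (tele J) (tele (T := T) J) x) = 0v.
      by change (Phi (tele (T := T) J x -v tele (T := T) J x) = 0v); rewrite (minus_eq_zero (tele (T := T) J x)); exact: op0.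
    by rewrite inner0l; apply Rle_refl.
  rewrite [rsum _ (S n)]/= Rmult_plus_distr_l.
  have -> : Phi (bsub (tele J) (tele (T := T) (J + S n)) x) =
    Phi (bsub (tele J) (tele (T := T) (J + n)) x) +v
    Phi (bsub (tele (J + n)) (tele (T := T) (S (J + n))) x).
    rewrite -opD Nat.add_succ_r; f_equal.
    exact (f_equal (fun a : bicomm T => a x) (bsub_trans (tele J) (tele (J + n)) (tele (S (J + n))))).
  rewrite innerDl; have := tele_term (J + n) x y; rewrite -/c.
  move: IH; rewrite /Re /=; lra.
have E2 := E (Phi (bsub (tele J) (tele (T := T) (J + n)) x)).
rewrite -norm2_inner in E2.
set v := Phi _ in E2 *.
set D := rsum (fun i => dyadic T x (J + i) ^ 2) n.
set s := rsum _ n in E2.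
have D0 : 0 <= D by apply rsum_ge0 => k _; exact: pow2_ge_0.
have b0 : 0 <= b.
  apply Rle_trans with (2 := Phi_orbit 0); rewrite Rmult_1_l; exact: onorm_ge0.
have c0 : 0 <= c by rewrite /c; have := pow_le M 4; nra.
have K0 : s ^ 2 <= D * (K * norm v ^ 2).
  apply Rle_trans with (1 := rsum_Cauchy_Schwarz _ _ n).
  apply Rmult_le_compat_l => //.
  apply Rle_trans with (2 := HK v (J + n)).
  rewrite rsum_add; have : 0 <= rsum (fun j => dyadic (adjoint T) v j ^ 2) J; last lra.
  by apply rsum_ge0 => k _; exact: pow2_ge_0.
have K1 : (norm v ^ 2) ^ 2 <= c ^ 2 * s ^ 2.
  rewrite -Rpow_mult_distr; apply sq_le_sq => //; exact: pow2_ge_0.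
have N := norm_ge_0 v.
have K2 : (norm v ^ 2) * norm v ^ 2 <= (c ^ 2 * K * D) * norm v ^ 2.
  have := Rmult_le_compat_l _ _ _ (pow2_ge_0 c) K0; lra.
case: (Rle_lt_or_eq_dec 0 _ (pow2_ge_0 (norm v))) => V; last first.
  rewrite -V; apply Rmult_le_pos => //; apply Rmult_le_pos; first exact: pow2_ge_0.
  exact: K_ge0.
exact: Rmult_le_reg_r V K2.
Qed.

End Telescope.

(** * Similarity to a contraction *)

Lemma pow_small (r e : R) : 0 <= r < 1 -> 0 < e -> exists N, forall n, (N <= n)%nat -> r ^ n < e.
Proof.
move=> [r0 r1] e0.
have [|N HN] := pow_lt_1_zero r _ e e0; first by rewrite Rabs_pos_eq.
exists N => n Hn; have := HN n Hn.
by rewrite Rabs_pos_eq //; apply pow_le.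
Qed.

Lemma geometric_cv {X : CompleteNormedModule C_AbsRing} (u : nat -> X) (c r : R) :
  0 <= r < 1 -> (forall n, norm (u (S n) -v u n) <= c * r ^ n) ->
  exists l : X, forall e : R, 0 < e -> exists N, forall n, (N <= n)%nat ->
    norm (u n -v l) < e.
Proof.
move=> [r0 r1] Hu; apply cauchy_seq_cv.
have c0 : 0 <= c.
  have := Hu 0%nat; have := norm_ge_0 (u 1%nat -v u 0%nat); rewrite /=; lra.
(* Multiplied by 1 - r, the geometric series telescopes without divisions. *)
have B : forall n k, (1 - r) * norm (u (n + k)%nat -v u n) <= c * r ^ n * (1 - r ^ k).
  move=> n; elim=> [|k IH].
    by rewrite Nat.add_0_r (minus_eq_zero (u n)) (norm_zero (V := X)) /=; lra.
  rewrite Nat.add_succ_r.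
  have T := vsub_trans (u (n + k)%nat) (u (S (n + k))) (u n).
  have L := Hu (n + k)%nat; rewrite pow_add in L; rewrite /= in IH *.
  have : (1 - r) * norm (u (S (n + k)) -v u (n + k)%nat) <= (1 - r) * (c * (r ^ n * r ^ k)).
    by apply Rmult_le_compat_l; lra.
  have : (1 - r) * norm (u (S (n + k)) -v u n) <= (1 - r) * (norm (u (S (n + k)) -v u (n + k)%nat) + norm (u (n + k)%nat -v u n)).
    by apply Rmult_le_compat_l; lra.
  lra.
move=> e e0.
have [N HN] := pow_small r (e * (1 - r) / (2 * (c + 1))) (conj r0 r1)
  ltac:(apply Rdiv_lt_0_compat; nra).
have small : forall n, (N <= n)%nat -> norm (u n -v u N) < e / 2.
  move=> n Hn; have := B N (n - N)%nat; have -> : (N + (n - N) = n)%nat by lia.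
  have := HN N (Nat.le_refl N); have := pow_le r (n - N) r0; have := pow_le r N r0.
  set p := r ^ N; set q := r ^ (n - N); set v := norm _ => p0 q0 Hp Hv.
  have Hp' : 2 * (c + 1) * p < e * (1 - r).
    have -> : e * (1 - r) = 2 * (c + 1) * (e * (1 - r) / (2 * (c + 1))) by field; lra.
    by apply Rmult_lt_compat_l; lra.
  have : c * p * (1 - q) <= c * p.
    have := Rmult_le_pos _ _ (Rmult_le_pos _ _ c0 p0) q0; lra.
  move=> Hc; have : (1 - r) * v < (1 - r) * (e / 2); last by apply Rmult_lt_reg_l; lra.
  nra.
exists N => n m Hn Hm.
have := vsub_trans (u N) (u n) (u m); have := small n Hn; have := small m Hm.
rewrite (vsub_sym (u N)); lra.
Qed.

Lemma op_cv_eq {X : NormedModule C_AbsRing} (S T : bounded_op X) :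
  (forall e, 0 < e -> onorm (S -o T) <= e) -> S = T.
Proof.
move=> E; apply (vsub_eq0 (X := bop_NormedModule X) S T).
by apply le_epsilon => e e0; rewrite Rplus_0_l; apply E.
Qed.

(** The partial geometric sums converge in norm, and their products with I - D on either side are I
    - D^n. *)
Lemma neumann {X : CompleteNormedModule C_AbsRing} (D : bounded_op X) (d : R) :
  onorm D <= d -> d < 1 ->
  exists N : bounded_op X, is_inverse (1o -o D) N /\ onorm N <= / (1 - d).
Proof.
move=> HD d1.
have d0 : 0 <= d by apply Rle_trans with (2 := HD); exact: onorm_ge0.
have Dn : forall n, onorm (D ^o n) <= d ^ n.
  elim=> [|n IH]; first exact: onorm_one.
  exact: (onorm_mul_le D (D ^o n)).
set u := fun n => bico (bgeo (T := D) n).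
have uS : forall n, norm (minus (u (S n)) (u n)) = onorm (D ^o n).
  move=> n; congr norm; apply bop_ext => x.
  change ((u n x +v (D ^o n) x) -v u n x = (D ^o n) x).
  exact: vsubKr.
have [|N HN] := geometric_cv (X := bop_CompleteNormedModule X) u 1 d (conj d0 d1).
  by move=> n; rewrite Rmult_1_l uS.
have D1 : onorm (1o -o D) <= 2.
  have -> : 2 = 1 + 1 by ring.
  apply onorm_sub_le; [exact: onorm_one | lra].
have small : forall e, 0 < e -> exists n, onorm (u n -o (N : bounded_op X)) < e /\ d ^ n < e.
  move=> e e0; have [N1 H1] := HN e e0; have [N2 H2] := pow_small d e (conj d0 d1) e0.
  by exists (N1 + N2)%nat; split; [apply H1 | apply H2]; lia.
have E : forall n, (1o -o D) *o u n = 1o -o D ^o n.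
  by move=> n; exact (f_equal bico (bgeoE (T := D) n)).
have E' : forall n, u n *o (1o -o D) = 1o -o D ^o n.
  by move=> n; rewrite -E; exact (f_equal bico (bmul_comm D (bgeo n) (bsub b1 (bT D)))).
have dist1 : forall n, onorm ((1o -o D ^o n) -o 1o) <= d ^ n.
  move=> n; apply Rle_trans with (2 := Dn n); rewrite onorm_sub_sym.
  right; congr norm; exact: (vsub_subK (X := bop_NormedModule X)).
exists N; split; [split|].
- apply op_cv_eq => e e0; have [n [Hn1 Hn2]] := small (e / 4) ltac:(lra).
  apply Rle_trans with (1 := osub_trans ((1o -o D) *o u n) ((1o -o D) *o N) 1o).
  have -> : (1o -o D) *o N -o (1o -o D) *o u n = (1o -o D) *o (N -o u n).
    by apply bop_ext => x; symmetry; exact: (opB (1o -o D)).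
  have L := onorm_mul_le (1o -o D) (N -o u n) _ _ D1 (Rle_refl _).
  rewrite (onorm_sub_sym N) in L.
  have := dist1 n; rewrite -E; lra.
- apply op_cv_eq => e e0; have [n [Hn1 Hn2]] := small (e / 4) ltac:(lra).
  apply Rle_trans with (1 := osub_trans (u n *o (1o -o D)) (N *o (1o -o D)) 1o).
  have -> : N *o (1o -o D) -o u n *o (1o -o D) = (N -o u n) *o (1o -o D) by exact: bop_ext.
  have L := onorm_mul_le (N -o u n) (1o -o D) _ _ (Rle_refl _) D1.
  rewrite (onorm_sub_sym N) in L.
  have := dist1 n; rewrite -E'; lra.
- have Bu : forall n, onorm (u n) <= / (1 - d) * (1 - d ^ n).
    elim=> [|n IH].
      by rewrite /= Rminus_diag Rmult_0_r; right; exact: onorm0.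
    apply Rle_trans with (/ (1 - d) * (1 - d ^ n) + d ^ n).
      by apply (onorm_add_le (u n) (D ^o n)).
    by right; rewrite /=; field; lra.
  apply le_epsilon => e e0; have [n [Hn1 _]] := small e e0.
  have := onorm_le_diff N (u n).
  rewrite (onorm_sub_sym N) => L.
  have := Bu n; have I := Rinv_0_lt_compat (1 - d) ltac:(lra).
  have := Rmult_le_pos _ _ (Rlt_le _ _ I) (pow_le d n d0); lra.
Qed.

(** * Self-adjoint operators, square roots and limits of forms *)

Section SelfAdjoint.
Context {H : Hilbert}.

Definition self_adjoint (S : bounded_op H) := forall x y, inner (S x) y = inner x (S y).

(** Polarization and the parallelogram law give B (|x|^2 + |y|^2)/2; replacing y by t y with t =
    |x|/|y| makes the two squares equal. *)
Lemma self_adjoint_Re (S : bounded_op H) (B : R) : self_adjoint S ->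
  (forall x, Rabs (Re (inner (S x) x)) <= B * norm x ^ 2) ->
  forall x y, Re (inner (S x) y) <= B * norm x * norm y.
Proof.
move=> SA HB.
have pol : forall x y, 4 * Re (inner (S x) y) =
    Re (inner (S (x +v y)) (x +v y)) - Re (inner (S (x -v y)) (x -v y)).
  move=> x y; rewrite opD opB !innerBl !innerBr !innerDl !innerDr.
  have : Re (inner (S y) x) = Re (inner (S x) y) by rewrite SA Re_inner_sym.
  rewrite /Re /=; lra.
have half : forall x y, Re (inner (S x) y) <= B / 2 * (norm x ^ 2 + norm y ^ 2).
  move=> x y; have := pol x y; have P := parallelogram x y.
  have := HB (x +v y); have := HB (x -v y).
  have := Rle_abs (Re (inner (S (x +v y)) (x +v y))).
  have := Rle_abs (- Re (inner (S (x -v y)) (x -v y))); rewrite Rabs_Ropp.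
  have := f_equal (Rmult B) P; lra.
move=> x y.
case: (Rle_lt_or_eq_dec 0 (norm x) (norm_ge_0 x)) => Hx; last first.
  have -> : x = 0v by apply norm_eq_zero.
  by rewrite op0 inner0l (norm_zero (V := H)) Rmult_0_r Rmult_0_l; apply Rle_refl.
case: (Rle_lt_or_eq_dec 0 (norm y) (norm_ge_0 y)) => Hy; last first.
  have -> : y = 0v by apply norm_eq_zero.
  by rewrite SA op0 inner_conj inner0l (norm_zero (V := H)) Rmult_0_r /Re /=; lra.
set t := norm x / norm y.
have t0 : 0 < t by apply Rdiv_lt_0_compat.
have := half x (RtoC t *v y).
rewrite innerZr norm2_scal Cmod_R pow2_abs.
have -> : Re (Cconj t * inner (S x) y)%C = t * Re (inner (S x) y) by rewrite /Re /=; ring.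
have E : t ^ 2 * norm y ^ 2 = norm x ^ 2 by rewrite /t; field; lra.
rewrite E => L; apply (Rmult_le_reg_l t) => //.
have -> : t * (B * norm x * norm y) = B * norm x ^ 2 by rewrite /t; field; lra.
lra.
Qed.

Lemma self_adjoint_norm (S : bounded_op H) (B : R) : 0 <= B -> self_adjoint S ->
  (forall x, Rabs (Re (inner (S x) x)) <= B * norm x ^ 2) -> onorm S <= B.
Proof.
move=> B0 SA HB; apply onorm_le => // x; apply norm_le_inner.
  by apply Rmult_le_pos => //; exact: norm_ge_0.
exact: self_adjoint_Re.
Qed.

(* The fixed point R of R = (D + R^2)/2 satisfies (I - R)^2 = I - D. *)
Lemma sqrt_one_minus (D : bounded_op H) (d : R) :
  self_adjoint D -> onorm D <= d -> d < 1 ->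
  exists W : bounded_op H, self_adjoint W /\ invertible W /\ W *o W = 1o -o D.
Proof.
move=> SD HD d1.
have d0 : 0 <= d by apply Rle_trans with (2 := HD); exact: onorm_ge0.
(* The smaller root of 2 r = d + r^2: the iteration keeps norms at most r, and there it contracts by
   the factor r < 1. *)
set r := 1 - sqrt (1 - d).
have s0 : 0 < sqrt (1 - d) by apply sqrt_lt_R0; lra.
have s2 : sqrt (1 - d) * sqrt (1 - d) = 1 - d by apply sqrt_sqrt; lra.
have r01 : 0 <= r < 1 by split; [have : sqrt (1 - d) <= 1 by nra|]; rewrite /r; lra.
have rE : d + r * r = 2 * r by rewrite /r; lra.
set f := fun S : bounded_op H => RtoC (/ 2) *s (D +o S *o S).
set u := fix u n := if n is S k then f (u k) else (0o : bounded_op H).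
have hs : forall S : bounded_op H, onorm (RtoC (/ 2) *s S) = / 2 * onorm S.
  by move=> S; rewrite onorm_scal_eq Cmod_R Rabs_pos_eq //; lra.
have ur : forall n, onorm (u n) <= r.
  elim=> [|n IH]; first by rewrite onorm0; lra.
  rewrite [u _]/= hs; have := onorm_add_le _ _ _ _ HD (onorm_mul_le _ _ _ _ IH IH); lra.
have uSA : forall n, self_adjoint (u n).
  elim=> [|n IH] x y.
    by change (inner (0v : H) y = inner x (0v : H)); rewrite (inner_conj _ 0v) !inner0l; apply C_eq; rewrite /Re /Im /=; ring.
  change (inner (RtoC (/ 2) *v (D x +v u n (u n x))) y = inner x (RtoC (/ 2) *v (D y +v u n (u n y)))).
  rewrite innerZl innerZr innerDl innerDr SD !IH; f_equal; apply C_eq; rewrite /Re /Im /=; ring.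
have fl : forall (S S' : bounded_op H) a b, onorm S <= a -> onorm S' <= a -> onorm (S -o S') <= b ->
    onorm (f S -o f S') <= a * b.
  move=> S S' a b Ha Ha' Hb.
  have -> : f S -o f S' = RtoC (/ 2) *s (S *o (S -o S') +o (S -o S') *o S').
    apply bop_ext => x.
    change (RtoC (/ 2) *v (D x +v S (S x)) -v RtoC (/ 2) *v (D x +v S' (S' x)) =
      RtoC (/ 2) *v (S (S x -v S' x) +v (S (S' x) -v S' (S' x)))).
    rewrite opB -vscalBr; f_equal; exact: vsub_mid.
  rewrite hs.
  have := onorm_add_le _ _ _ _ (onorm_mul_le _ _ _ _ Ha Hb) (onorm_mul_le _ _ _ _ Hb Ha'); lra.
have [|W HW] := geometric_cv (X := bop_CompleteNormedModule H) u (d / 2) r r01.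
  elim=> [|n IH].
    have -> : norm (minus (u 1%nat) (u 0%nat)) = onorm (RtoC (/ 2) *s D).
      congr norm; apply bop_ext => x.
      change (RtoC (/ 2) *v (D x +v 0v) -v 0v = RtoC (/ 2) *v D x).
      by rewrite vadd0; exact: vsub0.
    rewrite hs /=; lra.
  have := fl (u (S n)) (u n) r _ (ur (S n)) (ur n) IH.
  rewrite [r ^ S n]/=; have -> : r * (d / 2 * r ^ n) = d / 2 * (r * r ^ n) by ring.
  exact.
have HW' : forall e, 0 < e -> exists n, onorm (u n -o W) < e /\ onorm (u (S n) -o W) < e.
  by move=> e e0; have [N HN] := HW e e0; exists N; split; apply HN; lia.
have Wr : onorm W <= r.
  apply le_epsilon => e e0; have [n [Hn _]] := HW' e e0.
  have := onorm_le_diff W (u n); rewrite onorm_sub_sym; have := ur n; lra.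
have Wfix : W = f W.
  apply op_cv_eq => e e0; have [n [Hn1 Hn2]] := HW' (e / 2) ltac:(lra).
  have := osub_trans (u (S n)) W (f W).
  have := fl (u n) W r _ (ur n) Wr (Rlt_le _ _ Hn1).
  rewrite (onorm_sub_sym W (u (S n))).
  have : r * (e / 2) <= e / 2 by nra.
  change (u (S n)) with (f (u n)) in Hn2 |- *; lra.
have WSA : self_adjoint W.
  move=> x y; suff L1 : W = adjoint W by rewrite inner_adjoint -L1.
  apply op_cv_eq => e e0; have [n [Hn _]] := HW' (e / 2) ltac:(lra).
  have Eu : adjoint (u n) = u n by apply adjoint_unique; exact: uSA.
  have := osub_trans (u n) W (adjoint W).
  rewrite -{2}Eu -adjoint_minus norm_adjoint (onorm_sub_sym W (u n)); lra.
exists (1o -o W); split; [|split].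
- move=> x y; change (inner (x -v W x) y = inner x (y -v W y)).
  by rewrite innerBl innerBr WSA.
- by have [N [HN _]] := neumann W r Wr ltac:(lra); exists N.
- apply bop_ext => x.
  change ((x -v W x) -v W (x -v W x) = x -v D x).
  have E := f_equal (fun S : bounded_op H => S x) Wfix.
  change (W x = RtoC (/ 2) *v (D x +v W (W x))) in E.
  rewrite opB {1 2}E; exact: vsqrt_id.
Qed.

End SelfAdjoint.

Lemma lim_seq_ext_eq (u v : nat -> R) (a b : R) :
  (forall n, u n = v n) -> is_lim_seq u a -> is_lim_seq v b -> a = b.
Proof.
move=> E Hu Hv; have Hv' := is_lim_seq_ext u v a E Hu.
have := is_lim_seq_unique _ _ Hv'; rewrite (is_lim_seq_unique _ _ Hv).
by case.
Qed.

(** Only the quadratic forms are assumed to converge. Polarization recovers the limits of <S_n x,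
    y>, a bounded sesquilinear form that Riesz represents by an operator. *)
Lemma form_limit {H : Hilbert} (S : nat -> bounded_op H) (L : H -> R) (B : R) :
  0 <= B -> (forall n, self_adjoint (S n)) ->
  (forall n x, 0 <= Re (inner (S n x) x) <= B * norm x ^ 2) ->
  (forall x, is_lim_seq (fun n => Re (inner (S n x) x)) (L x)) ->
  exists G : bounded_op H, self_adjoint G /\ forall x, Re (inner (G x) x) = L x.
Proof.
move=> B0 SA HB HL.
set bR := fun x y : H => / 4 * (L (x +v y) - L (x -v y)).
have limR : forall x y, is_lim_seq (fun n => Re (inner (S n x) y)) (bR x y).
  move=> x y.
  have := is_lim_seq_scal_l _ (/ 4) _ (is_lim_seq_minus' _ _ _ _ (HL (x +v y)) (HL (x -v y))).
  apply is_lim_seq_ext => n.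
  rewrite opD opB !innerBl !innerBr !innerDl !innerDr.
  have : Re (inner (S n y) x) = Re (inner (S n x) y) by rewrite SA Re_inner_sym.
  rewrite /Re /=; lra.
have limI : forall x y, is_lim_seq (fun n => Im (inner (S n x) y)) (bR x (Ci *v y)).
  move=> x y; have := limR x (Ci *v y); apply is_lim_seq_ext => n.
  by rewrite innerZr /Re /Im /=; ring.
(* The second component uses Im <S x, y> = Re <S x, i y>. *)
set q := fun x y : H => (bR x y, bR x (Ci *v y)) : C.
(* Identities for q are checked for each n and passed to the limit, which determines q. *)
have qE : forall x y (a b : R) (f : nat -> C), (forall n, inner (S n x) y = f n) ->
    is_lim_seq (fun n => Re (f n)) a -> is_lim_seq (fun n => Im (f n)) b -> q x y = (a, b).
  move=> x y a b f E Ha Hb; apply C_eq; rewrite /q.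
  - by apply (lim_seq_ext_eq _ _ _ _ (fun n => f_equal Re (E n)) (limR x y) Ha).
  - by apply (lim_seq_ext_eq _ _ _ _ (fun n => f_equal Im (E n)) (limI x y) Hb).
have HR : forall n x y, Rabs (Re (inner (S n x) y)) <= B * norm x * norm y.
  move=> n x y.
  have A : forall x, Rabs (Re (inner (S n x) x)) <= B * norm x ^ 2.
    by move=> z; rewrite Rabs_pos_eq; case: (HB n z).
  apply Rabs_le; split; last exact: self_adjoint_Re.
  have := self_adjoint_Re (S n) B (SA n) A x (RtoC (-1) *v y).
  rewrite innerZr vscal_norm_eq Cmod_R Rabs_Ropp Rabs_R1 /Re /=; lra.
have bRle : forall x y, Rabs (bR x y) <= B * norm x * norm y.
  move=> x y; have La := is_lim_seq_abs _ _ (limR x y).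
  exact: (is_lim_seq_le _ (fun _ => B * norm x * norm y) _ (B * norm x * norm y)
    (fun n => HR n x y) La (is_lim_seq_const _)).
have [||||||G HG] := riesz_form q (2 * B).
- lra.
- move=> x y z; apply (qE _ _ _ _ (fun n => (inner (S n x) z + inner (S n y) z)%C)).
  + by move=> n; rewrite opD innerDl.
  + exact: (is_lim_seq_plus' _ _ _ _ (limR x z) (limR y z)).
  + exact: (is_lim_seq_plus' _ _ _ _ (limI x z) (limI y z)).
- move=> k x z; apply (qE _ _ _ _ (fun n => (k * inner (S n x) z)%C)).
  + by move=> n; rewrite opZ innerZl.
  + exact: (is_lim_seq_minus' _ _ _ _ (is_lim_seq_scal_l _ _ _ (limR x z)) (is_lim_seq_scal_l _ _ _ (limI x z))).
  + exact: (is_lim_seq_plus' _ _ _ _ (is_lim_seq_scal_l _ _ _ (limI x z)) (is_lim_seq_scal_l _ _ _ (limR x z))).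
- move=> x y z; apply (qE _ _ _ _ (fun n => (inner (S n x) y + inner (S n x) z)%C)).
  + by move=> n; rewrite innerDr.
  + exact: (is_lim_seq_plus' _ _ _ _ (limR x y) (limR x z)).
  + exact: (is_lim_seq_plus' _ _ _ _ (limI x y) (limI x z)).
- move=> k x z; apply (qE _ _ _ _ (fun n => (Cconj k * inner (S n x) z)%C)).
  + by move=> n; rewrite innerZr.
  + exact: (is_lim_seq_minus' _ _ _ _ (is_lim_seq_scal_l _ _ _ (limR x z)) (is_lim_seq_scal_l _ _ _ (limI x z))).
  + exact: (is_lim_seq_plus' _ _ _ _ (is_lim_seq_scal_l _ _ _ (limI x z)) (is_lim_seq_scal_l _ _ _ (limR x z))).
- move=> x y.
  have L1 := bRle x y; have L2 := bRle x (Ci *v y).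
  rewrite vscal_norm_eq Cmod_Ci Rmult_1_l in L2.
  have -> : q x y = (RtoC (bR x y) + Ci * RtoC (bR x (Ci *v y)))%C.
    by apply C_eq; rewrite /Re /Im /=; ring.
  apply Rle_trans with (1 := Cmod_triangle _ _).
  rewrite Cmod_mult Cmod_Ci !Cmod_R; lra.
have qsym : forall x y, Cconj (q y x) = q x y.
  move=> x y; symmetry; apply (qE _ _ _ _ (fun n => Cconj (inner (S n y) x))).
  + by move=> n; rewrite SA -inner_conj.
  + exact: limR.
  + exact: (proj1 (is_lim_seq_opp _ _) (limI y x)).
exists G; split=> [x y|x].
- by rewrite inner_conj -HG qsym HG.
- rewrite Re_inner_sym -HG /q /Re /=.
  apply (lim_seq_ext_eq _ _ _ _ (fun n => eq_refl) (limR x x) (HL x)).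
Qed.

Lemma power_bound_ge1 {X : CompleteNormedModule C_AbsRing} (T : bounded_op X) :
  power_bounded T -> exists M, 1 <= M /\ forall n, onorm (T ^o n) <= M.
Proof.
move=> [M HM]; exists (Rmax 1 M); split; first exact: Rmax_l.
by move=> n; apply Rle_trans with (1 := HM n); exact: Rmax_r.
Qed.

(** A single term of the square function is enough: if 2^j <= n < 2^(j+1), the dyadic term at j
    bounds n |T^n (I - T) x| up to the factor 2 M. *)
Lemma square_estimate_ritt {H : Hilbert} (T : bounded_op H) :
  power_bounded T -> square_estimate T -> ritt T.
Proof.
move=> PB [K [K0 HK]]; split=> //.
have [M [M1 HM]] := power_bound_ge1 T PB.
set c := 2 * M * sqrt K.
have c0 : 0 <= c by rewrite /c; have := sqrt_pos K; nra.
have HA : onorm (1o -o T) <= 1 + M.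
  by apply onorm_sub_le; [exact: onorm_one | rewrite -(op1_r T); exact: (HM 1%nat)].
have one_x : forall n x, (0 < n)%nat -> INR n * orbit T x n <= c * norm x.
  move=> n x n0.
  have [L1 L2] := Nat.log2_spec n n0.
  set j := Nat.log2 n in L1 L2.
  have D : dyadic T x j <= sqrt K * norm x.
    apply Rsqr_incr_0_var; last by apply Rmult_le_pos; [exact: sqrt_pos | exact: norm_ge_0].
    rewrite !Rsqr_pow2 Rpow_mult_distr -(Rsqr_pow2 (sqrt K)) Rsqr_sqrt //.
    apply Rle_trans with (2 := HK x (S j)).
    rewrite [rsum _ _]/=; have : 0 <= rsum (fun j => dyadic T x j ^ 2) j.
      by apply rsum_ge0 => k _; exact: pow2_ge_0.
    rewrite /=; lra.
  have U : orbit T x n <= M * orbit T x (2 ^ j).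
    have -> : n = (2 ^ j + (n - 2 ^ j))%nat by lia.
    exact: orbit_shift.
  have N : INR n <= 2 * 2 ^ j.
    have -> : 2 * 2 ^ j = INR (2 ^ S j) by rewrite INR_2pow.
    by apply le_INR; lia.
  apply Rle_trans with (2 * 2 ^ j * (M * orbit T x (2 ^ j))).
    apply Rmult_le_compat => //; [exact: pos_INR | exact: orbit_ge0].
  rewrite /c /dyadic in D *; nra.
have HC : forall n, (0 < n)%nat -> INR n * onorm (T ^o n *o (1o -o T)) <= c.
  move=> n n0; have n1 : 0 < INR n by apply lt_0_INR.
  have -> : c = INR n * (c / INR n) by field; lra.
  apply Rmult_le_compat_l; first lra.
  apply onorm_le => [|x]; first by apply Rdiv_le_0_compat.
  apply (Rmult_le_reg_l (INR n)) => //.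
  apply Rle_trans with (1 := one_x n x n0); right; field; lra.
(* With n = m + 1 the quantity to bound is (m + 1) |T^m (I - T)|; the extra M (1 + M) pays for the
   shift and covers m = 0. *)
exists (c + M * (1 + M)) => n n1.
have -> : (n = S (n - 1))%nat by lia.
set m := (n - 1)%nat; rewrite Nat.sub_succ Nat.sub_0_r.
change (onorm (RtoC (INR (S m)) *s (T *o T ^o m -o T ^o m)) <= c + M * (1 + M)).
rewrite onorm_scal_eq Cmod_R Rabs_pos_eq; last exact: pos_INR.
rewrite onorm_sub_sym.
have -> : T ^o m -o T *o T ^o m = T ^o m *o (1o -o T).
  exact (f_equal bico (bfactor (bpow m) (bT T))).
rewrite S_INR Rmult_plus_distr_r Rmult_1_l; apply Rplus_le_compat; last exact: onorm_mul_le.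
case: m => [|m]; first by rewrite Rmult_0_l.
apply HC; lia.
Qed.

Section Similarity.
Context {H : Hilbert} (T : bounded_op H) (M C K1 K2 : R).
Hypothesis HR : ritt_bounds T M C.
Hypothesis K1_ge0 : 0 <= K1.
Hypothesis K2_ge0 : 0 <= K2.
Hypothesis HK1 : forall x J, rsum (fun j => dyadic T x j ^ 2) J <= K1 * norm x ^ 2.
Hypothesis HK2 : forall y J,
  rsum (fun j => dyadic (adjoint T) y j ^ 2) J <= K2 * norm y ^ 2.

Let M1 : 1 <= M := proj1 HR.
Let HM : forall n, onorm (T ^o n) <= M := proj1 (proj2 (proj2 HR)).

(** [tele_bound] with Phi = I: the distance of E_n x and E_m x is controlled by a piece of the
    convergent series of the squared dyadic terms. *)
Lemma tele_cauchy (x : H) : exists l : H, forall e, 0 < e ->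
  exists N, forall n, (N <= n)%nat -> norm (tele (T := T) n x -v l) < e.
Proof.
have [s Hs] : ex_finite_lim_seq (rsum (fun j => dyadic T x j ^ 2)).
  apply (ex_finite_lim_seq_incr _ (K1 * norm x ^ 2)); last exact: HK1.
  by move=> n; rewrite /=; have := pow2_ge_0 (dyadic T x n); rewrite /=; lra.
have Phi1 : forall j, 2 ^ j * onorm ((1o : bounded_op H) *o orbit_b (T := T) j) <= C.
  move=> j; rewrite op1_l -INR_2pow; exact: (proj2 (proj2 (proj2 HR))).
have Phic : (1o : bounded_op H) *o T = T *o 1o by rewrite op1_l op1_r.
have TB := tele_bound T M K2 M1 K2_ge0 HM HK2 1o C Phic Phi1.
set c := (189 * M ^ 4 * C) ^ 2 * K2 in TB.
have c0 : 0 <= c by apply Rmult_le_pos => //; exact: pow2_ge_0.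
apply cauchy_seq_cv => e e0.
have d0 : 0 < e ^ 2 / (4 * (c + 1)) by apply Rdiv_lt_0_compat; nra.
have [N HN'] := proj2 (is_lim_seq_spec _ s) Hs (mkposreal _ d0).
have HN : forall n, (N <= n)%nat ->
  Rabs (rsum (fun j => dyadic T x j ^ 2) n - s) < e ^ 2 / (4 * (c + 1)) := HN'.
have one : forall n m, (N <= n)%nat -> (n <= m)%nat ->
    norm (tele (T := T) n x -v tele (T := T) m x) < e.
  move=> n m Hn Hm; have := TB n (m - n)%nat x.
  have -> : (n + (m - n) = m)%nat by lia.
  have A := rsum_add (fun j => dyadic T x j ^ 2) n (m - n)%nat.
  have Em : (n + (m - n) = m)%nat by lia.
  rewrite Em in A.
  have B1 := HN n Hn; have B2 := HN m ltac:(lia).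
  have B3 : rsum (fun i => dyadic T x (n + i) ^ 2) (m - n) <= 2 * (e ^ 2 / (4 * (c + 1))).
    have [B3 B4] := Rabs_def2 _ _ B1; have [B5 B6] := Rabs_def2 _ _ B2.
    rewrite A in B5 B6; lra.
  change ((1o : bounded_op H) (bsub (tele n) (tele (T := T) m) x)) with (tele (T := T) n x -v tele (T := T) m x).
  move=> L; have : norm (tele (T := T) n x -v tele (T := T) m x) ^ 2 < e ^ 2.
    apply Rle_lt_trans with (1 := L).
    apply Rle_lt_trans with (c * (2 * (e ^ 2 / (4 * (c + 1))))); first by apply Rmult_le_compat_l.
    have -> : c * (2 * (e ^ 2 / (4 * (c + 1)))) = e ^ 2 * (c / (2 * (c + 1))) by field; lra.
    suff Hc : c / (2 * (c + 1)) < 1.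
      have e2 : 0 < e ^ 2 by apply pow_lt.
      by rewrite -{2}(Rmult_1_r (e ^ 2)); apply Rmult_lt_compat_l.
    apply (Rmult_lt_reg_r (2 * (c + 1))); first lra.
    by rewrite /Rdiv Rmult_assoc Rinv_l; lra.
  have := norm_ge_0 (tele (T := T) n x -v tele (T := T) m x); nra.
exists N => n m Hn Hm.
case: (Nat.le_ge_cases n m) => Hnm; first exact: one.
by rewrite vsub_sym; apply one.
Qed.


Let c0 : R := ((1 + M) * (1 + M)) * (3 * M * (3 * M * (3 * M))).
Let cw : R := 1 + ((1 + M) + (1 + M) * (1 + M)).

Lemma tele_op_norm (n : nat) : onorm (tele (T := T) n) <= M * cw.
Proof.
rewrite tele_expand; apply onorm_mul_le; first by rewrite tele_uE; exact: HM.
exact: (tele_w_norm M n HM).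
Qed.

(** E_n contains T^(3 2^n), so E_n (I - T) = O(2^-n). Hence lim E_n x does not change when x is
    replaced by T x. *)
Lemma tele_vanish (n : nat) (x : H) :
  norm (tele (T := T) n ((1o -o T) x)) <= cw * C * norm x * / 2 ^ n.
Proof.
have P := pow_lt 2 n ltac:(lra).
rewrite tele_expand.
set w := badd b1 _.
have -> : bmul (tele_u n) w ((1o -o T) x) = w ((tele_u (T := T) n *o (1o -o T)) x).
  exact (f_equal (fun a : bicomm T => a ((1o -o T) x)) (bmul_comm T (tele_u n) w)).
have cw0 : 0 <= cw by rewrite /cw; nra.
have Hu : 2 ^ n * onorm (tele_u (T := T) n *o (1o -o T)) <= C.
  rewrite tele_uE; apply Rle_trans with (2 := proj2 (proj2 (proj2 HR)) (3 * 2 ^ n)%nat).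
  apply Rmult_le_compat_r; first exact: onorm_ge0.
  rewrite mult_INR INR_2pow /=; lra.
have L1 : norm ((tele_u (T := T) n *o (1o -o T)) x) <= C * / 2 ^ n * norm x.
  apply Rle_trans with (1 := onorm_app _ _).
  apply Rmult_le_compat_r; first exact: norm_ge_0.
  apply (Rmult_le_reg_l (2 ^ n)) => //.
  by apply Rle_trans with (1 := Hu); right; field; lra.
apply Rle_trans with (1 := onorm_app _ _).
apply Rle_trans with (cw * (C * / 2 ^ n * norm x)); last by right; ring.
apply Rmult_le_compat => //; [exact: onorm_ge0 | exact: norm_ge_0 | exact: (tele_w_norm M n HM)].
Qed.

(** x = (I - E_0) x + (E_0 - E_n) x + E_n x. The square function bounds the first two parts, and the
    3 comes from squaring a sum of three terms. This is the lower bound for the new norm. *)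
Lemma tele_lower (n : nat) (x : H) : (0 < n)%nat ->
  norm x ^ 2 <= 3 * (c0 ^ 2 + (189 * M ^ 4 * C) ^ 2 * K2 * (4 * M ^ 2) + 1) *
    (norm (tele (T := T) n x) ^ 2 + weighted T x (2 ^ n)).
Proof.
move=> n0.
have Phi1 : forall j, 2 ^ j * onorm ((1o : bounded_op H) *o orbit_b (T := T) j) <= C.
  move=> j; rewrite op1_l -INR_2pow; exact: (proj2 (proj2 (proj2 HR))).
have Phic : (1o : bounded_op H) *o T = T *o 1o by rewrite op1_l op1_r.
have TB := tele_bound T M K2 M1 K2_ge0 HM HK2 1o C Phic Phi1 0 n x.
have W0 : forall k, 0 <= INR (S k) * orbit T x k ^ 2.
  by move=> k; apply Rmult_le_pos; [exact: pos_INR | exact: pow2_ge_0].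
have W1 : orbit T x 0 ^ 2 <= weighted T x (2 ^ n).
  apply Rle_trans with (weighted T x 1); first by rewrite /weighted /=; lra.
  apply rsum_mono => //; have := Nat.pow_nonzero 2 n ltac:(lia); lia.
have W2 : rsum (fun j => dyadic T x (0 + j) ^ 2) n <= 4 * M ^ 2 * weighted T x (2 ^ n).
  have := dyadic_le_weighted (orbit T x) M (orbit_ge0 T x) (orbit_shift T M HM x) n.
  apply Rle_trans; apply (rsum_mono (fun j => dyadic T x j ^ 2)); last lia.
  by move=> k; exact: pow2_ge_0.
set c := (189 * M ^ 4 * C) ^ 2 * K2 in TB *.
have cc : 0 <= c by apply Rmult_le_pos => //; exact: pow2_ge_0.
set W := weighted T x (2 ^ n) in W1 W2 *.
set D := rsum _ n in W2 TB.
set v1 := (bsub b1 (tele (T := T) 0)) x.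
set v2 := (1o : bounded_op H) (bsub (tele 0) (tele (T := T) (0 + n)) x) in TB.
set v3 := tele (T := T) n x.
have E : x = v1 +v (v2 +v v3).
  move: (f_equal (fun a : bicomm T => a x) (tele_rest n)).
  change (0 + n)%nat with n in v2.
  have -> : bico (b1 (T := T)) x = x by [].
  have -> : badd (bsub b1 (tele 0)) (badd (bsub (tele 0) (tele n)) (tele (T := T) n)) x =
    v1 +v (v2 +v v3) by [].
  by [].
have N1 : norm v1 <= c0 * orbit T x 0.
  rewrite /v1 tele0_factor bico_mul_app.
  apply Rle_trans with (1 := onorm_app _ _).
  apply Rmult_le_compat_r; first exact: norm_ge_0.
  exact: tele0_c_norm.
have N1' : norm v1 ^ 2 <= c0 ^ 2 * W.
  apply Rle_trans with ((c0 * orbit T x 0) ^ 2); first by apply sq_le_sq; [exact: norm_ge_0|].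
  rewrite Rpow_mult_distr; apply Rmult_le_compat_l => //; exact: pow2_ge_0.
have N2 : norm v2 ^ 2 <= c * (4 * M ^ 2 * W).
  by apply Rle_trans with (1 := TB); apply Rmult_le_compat_l.
have N3 : norm x <= norm v1 + (norm v2 + norm v3).
  rewrite {1}E; apply Rle_trans with (1 := vadd_norm _ _).
  by apply Rplus_le_compat_l; exact: vadd_norm.
have N4 : norm x ^ 2 <= (norm v1 + (norm v2 + norm v3)) ^ 2 by apply sq_le_sq => //; exact: norm_ge_0.
have Wp : 0 <= W by apply rsum_ge0.
have N5 : (norm v1 + (norm v2 + norm v3)) ^ 2 <= 3 * (norm v1 ^ 2 + norm v2 ^ 2 + norm v3 ^ 2).
  have := pow2_ge_0 (norm v1 - norm v2); have := pow2_ge_0 (norm v1 - norm v3).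
  have := pow2_ge_0 (norm v2 - norm v3); nra.
have Q1 := pow2_ge_0 (norm v3); have Q2 := pow2_ge_0 c0; have Q3 := pow2_ge_0 M.
have Q4 : 0 <= (c0 ^ 2 + c * (4 * M ^ 2)) * norm v3 ^ 2 by apply Rmult_le_pos => //; nra.
nra.
Qed.

(** Turns the partial sums of the square function into forms of self-adjoint operators, the input of
    [form_limit]. *)
Fixpoint gram (n : nat) : bounded_op H :=
  if n is S k then
    gram k +o RtoC (INR (S k)) *s
      (adjoint (T ^o k *o (1o -o T)) *o (T ^o k *o (1o -o T)))
  else 0o.

Lemma gram_self_adjoint (n : nat) : self_adjoint (gram n).
Proof.
elim: n => [|n IH] x y.
  by change (inner (0v : H) y = inner x (0v : H)); rewrite (inner_conj _ 0v) !inner0l; apply C_eq; rewrite /Re /Im /=; ring.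
set A := T ^o n *o (1o -o T).
change (inner (gram n x +v RtoC (INR (S n)) *v (adjoint A (A x))) y =
  inner x (gram n y +v RtoC (INR (S n)) *v (adjoint A (A y)))).
rewrite innerDl innerDr innerZl innerZr IH.
rewrite -(inner_adjoint A) (inner_adjoint (adjoint A)) adjoint_adjoint.
by apply C_eq; rewrite /Re /Im /=; ring.
Qed.

Lemma gram_weighted (n : nat) (x : H) : Re (inner (gram n x) x) = weighted T x n.
Proof.
elim: n => [|n IH].
  by change (Re (inner (0v : H) x) = 0); rewrite inner0l.
set A := T ^o n *o (1o -o T).
change (Re (inner (gram n x +v RtoC (INR (S n)) *v (adjoint A (A x))) x) =
  weighted T x n + INR (S n) * norm (A x) ^ 2).
rewrite innerDl innerZl (inner_adjoint (adjoint A)) adjoint_adjoint norm2_inner -IH.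
by move: (INR (S n)) => s; rewrite /Re /=; ring.
Qed.

(** The square L of the new norm is the form of a positive operator G. With W the square root of
    G/b, |W x|^2 = L(x)/b, so W carries the new norm to the given one and W T W^-1 is a
    contraction. *)
Theorem similar_to_contraction : exists V W : bounded_op H,
  is_inverse V W /\ onorm (W *o (T *o V)) <= 1.
Proof.
set l := fun x => proj1_sig (constructive_indefinite_description _ (tele_cauchy x)).
have Hl : forall x e, 0 < e -> exists N, forall n, (N <= n)%nat -> norm (tele (T := T) n x -v l x) < e.
  by move=> x; exact: (proj2_sig (constructive_indefinite_description _ (tele_cauchy x))).
have norm_lim : forall (u : nat -> H) (z : H),
    (forall e, 0 < e -> exists N, forall n, (N <= n)%nat -> norm (u n -v z) < e) ->
    is_lim_seq (fun n => norm (u n) ^ 2) (norm z ^ 2).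
  move=> u z Hu.
  have A : is_lim_seq (fun n => norm (u n)) (norm z).
    apply is_lim_seq_spec => e; have [N HN] := Hu e (cond_pos e).
    exists N => n Hn; have := HN n Hn.
    have := vnorm_le_sub (u n) z; have := vnorm_le_sub z (u n).
    rewrite (vsub_sym z) => L1 L2 L3; apply Rabs_def1; lra.
  have := is_lim_seq_mult' _ _ _ _ A A; have -> : norm z * norm z = norm z ^ 2 by ring.
  by apply is_lim_seq_ext => n; ring.
set B1 := (1 + M) ^ 2 + 2 * M ^ 2 * K1.
have WB : forall x n, weighted T x n <= B1 * norm x ^ 2.
  by move=> x; exact: (weighted_of_dyadic T M HM K1 x K1_ge0 (HK1 x)).
have Wlim : forall x, ex_finite_lim_seq (weighted T x).
  move=> x; apply (ex_finite_lim_seq_incr _ (B1 * norm x ^ 2)); last exact: WB.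
  move=> n; have := Rmult_le_pos _ _ (pos_INR (S n)) (pow2_ge_0 (orbit T x n)).
  by rewrite /weighted [rsum _ (S n)]/=; rewrite /=; lra.
set Lw := fun x => proj1_sig (constructive_indefinite_description _ (Wlim x)).
have HLw : forall x, is_lim_seq (weighted T x) (Lw x).
  by move=> x; exact: (proj2_sig (constructive_indefinite_description _ (Wlim x))).
set S := fun n => adjoint (tele (T := T) n) *o tele (T := T) n +o gram (2 ^ n).
have S_q : forall n x, Re (inner (S n x) x) = norm (tele (T := T) n x) ^ 2 + weighted T x (2 ^ n).
  move=> n x.
  change (Re (inner (adjoint (tele (T := T) n) (tele (T := T) n x) +v gram (2 ^ n) x) x) =
    norm (tele (T := T) n x) ^ 2 + weighted T x (2 ^ n)).
  rewrite innerDl (inner_adjoint (adjoint _)) adjoint_adjoint norm2_inner -gram_weighted.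
  by rewrite /Re.
have Wlim2 : forall x, is_lim_seq (fun n => weighted T x (2 ^ n)) (Lw x).
  move=> x; apply (is_lim_seq_subseq (weighted T x) (Lw x) (fun n => (2 ^ n)%nat)); last exact: HLw.
  apply eventually_subseq => n; rewrite /=; have := Nat.pow_nonzero 2 n ltac:(lia); lia.
set L := fun x => norm (l x) ^ 2 + Lw x.
have S_lim : forall x, is_lim_seq (fun n => Re (inner (S n x) x)) (L x).
  move=> x.
  have := is_lim_seq_plus' _ _ _ _ (norm_lim _ _ (Hl x)) (Wlim2 x).
  by apply is_lim_seq_ext => n; rewrite S_q.
have S_sa : forall n, self_adjoint (S n).
  move=> n x y.
  change (inner (adjoint (tele (T := T) n) (tele (T := T) n x) +v gram (2 ^ n) x) y =
   inner x (adjoint (tele (T := T) n) (tele (T := T) n y) +v gram (2 ^ n) y)).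
  rewrite innerDl innerDr gram_self_adjoint; f_equal.
  by rewrite -inner_adjoint (inner_adjoint (adjoint _)) adjoint_adjoint.
set B := (M * cw) ^ 2 + B1.
have B0 : 0 <= B.
  rewrite /B /B1; have := pow2_ge_0 (M * cw); have := pow2_ge_0 (1 + M); have := pow2_ge_0 M; nra.
have S_b : forall n x, 0 <= Re (inner (S n x) x) <= B * norm x ^ 2.
  move=> n x; rewrite S_q; split.
    apply Rplus_le_le_0_compat; first exact: pow2_ge_0.
    by apply rsum_ge0 => k _; apply Rmult_le_pos; [exact: pos_INR | exact: pow2_ge_0].
  rewrite /B Rmult_plus_distr_r; apply Rplus_le_compat; last exact: WB.
  rewrite -Rpow_mult_distr; apply sq_le_sq; first exact: norm_ge_0.
  apply Rle_trans with (1 := onorm_app _ _).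
  apply Rmult_le_compat_r; [exact: norm_ge_0 | exact: tele_op_norm].
have [G [Gsa GL]] := form_limit S L B B0 S_sa S_b S_lim.
set c3 := 3 * (c0 ^ 2 + (189 * M ^ 4 * C) ^ 2 * K2 * (4 * M ^ 2) + 1).
have c3p : 0 < c3.
  rewrite /c3; have := pow2_ge_0 c0.
  have : 0 <= (189 * M ^ 4 * C) ^ 2 * K2 * (4 * M ^ 2); last lra.
  apply Rmult_le_pos; last by have := pow2_ge_0 M; lra.
  apply Rmult_le_pos => //; exact: pow2_ge_0.
have L_ge : forall x, / c3 * norm x ^ 2 <= L x.
  move=> x; apply (Rmult_le_reg_l c3) => //; rewrite -Rmult_assoc Rinv_r; last lra.
  rewrite Rmult_1_l.
  have A := is_lim_seq_scal_l _ c3 _ (S_lim x).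
  apply (is_lim_seq_le_loc (fun _ => norm x ^ 2) (fun n => c3 * Re (inner (S n x) x))
    (norm x ^ 2) (c3 * L x)) => //; last exact: is_lim_seq_const.
  exists 1%nat => n n1; rewrite S_q; apply tele_lower; lia.
have L_le : forall x, L x <= B * norm x ^ 2.
  move=> x; exact: (is_lim_seq_le _ _ _ _ (fun n => proj2 (S_b n x)) (S_lim x) (is_lim_seq_const _)).
have L_T : forall x, L (T x) <= L x.
  move=> x.
  (* T x = x - (I - T) x, and E_n sends the second part to 0 in the limit. *)
  have lT : forall e, 0 < e -> exists N, forall n, (N <= n)%nat ->
      norm (tele (T := T) n (T x) -v l x) < e.
    move=> e e0; have [N1 HN1] := Hl x (e / 2) ltac:(lra).
    have cc : 0 <= cw * C * norm x.
      apply Rmult_le_pos; last exact: norm_ge_0.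
      apply Rmult_le_pos; [rewrite /cw; nra | exact: (proj1 (proj2 HR))].
    have [N2 HN2] := pow_small (/ 2) (e / (2 * (cw * C * norm x + 1))) ltac:(lra)
      ltac:(apply Rdiv_lt_0_compat; lra).
    exists (N1 + N2)%nat => n Hn.
    have A := HN1 n ltac:(lia); have A2 := HN2 n ltac:(lia).
    apply Rle_lt_trans with (1 := vsub_trans (tele (T := T) n x) _ _).
    have : norm (tele (T := T) n (T x) -v tele (T := T) n x) < e / 2; last lra.
    rewrite -opB.
    have -> : tele (T := T) n (T x -v x) = RtoC (-1) *v tele (T := T) n ((1o -o T) x).
      rewrite -opZ; f_equal; change (T x -v x = RtoC (-1) *v (x -v T x)); exact: vsub_flip.
    rewrite vscal_norm_eq Cmod_R Rabs_Ropp Rabs_R1 Rmult_1_l.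
    apply Rle_lt_trans with (1 := tele_vanish n x).
    rewrite -pow_inv; set k := cw * C * norm x in cc A2 *.
    have P := pow_le (/ 2) n ltac:(lra).
    apply Rle_lt_trans with ((k + 1) * (/ 2) ^ n); first nra.
    have -> : e / 2 = (k + 1) * (e / (2 * (k + 1))) by field; lra.
    apply Rmult_lt_compat_l; lra.
  have lim1 := norm_lim _ _ lT; have lim2 := norm_lim _ _ (Hl (T x)).
  have El : norm (l (T x)) ^ 2 = norm (l x) ^ 2 by exact: (lim_seq_ext_eq _ _ _ _ (fun n => eq_refl) lim2 lim1).
  rewrite /L El; apply Rplus_le_compat_l.
  (* The orbit of T x is that of x without its first term, and every weight is lowered by one. *)
  apply (is_lim_seq_le (weighted T (T x)) (fun n => weighted T x (1 + n)) (Lw (T x)) (Lw x)); last first.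
  - apply (is_lim_seq_ext (fun n => weighted T x (n + 1))); first by move=> n; rewrite Nat.add_comm.
    exact: (proj1 (is_lim_seq_incr_n _ 1 _) (HLw x)).
  - exact: HLw.
  - move=> n; rewrite /weighted rsum_add.
    have : 0 <= rsum (fun k => INR (Datatypes.S k) * orbit T x k ^ 2) 1.
      by apply rsum_ge0 => k _; apply Rmult_le_pos; [exact: pos_INR | exact: pow2_ge_0].
    have : rsum (fun k => INR (Datatypes.S k) * orbit T (T x) k ^ 2) n <=
       rsum (fun k => INR (Datatypes.S (1 + k)) * orbit T x (1 + k) ^ 2) n; last lra.
    apply rsum_le => k _.
    have -> : orbit T (T x) k = orbit T x (1 + k).
      rewrite /orbit; congr norm.
      exact (f_equal (fun a : bicomm T => a x) (orbit_comm T k)).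
    apply Rmult_le_compat_r; [exact: pow2_ge_0 | apply le_INR; lia].
(* As forms 1/c3 <= G <= B, so D = I - G/b has norm at most 1 - 1/(b c3) < 1, and [sqrt_one_minus]
   yields W^2 = G/b. Adding 1/c3 keeps b positive. *)
set b := B + / c3.
have ic : 0 < / c3 by apply Rinv_0_lt_compat.
have b0 : 0 < b by rewrite /b; lra.
set D := 1o -o RtoC (/ b) *s G.
have Dsa : self_adjoint D.
  move=> x y; change (inner (x -v RtoC (/ b) *v G x) y = inner x (y -v RtoC (/ b) *v G y)).
  rewrite innerBl innerBr innerZl innerZr Gsa; f_equal; f_equal; apply C_eq; rewrite /Re /Im /=; ring.
have Dq : forall x, Re (inner (D x) x) = norm x ^ 2 - / b * L x.
  move=> x; change (Re (inner (x -v RtoC (/ b) *v G x) x) = norm x ^ 2 - / b * L x).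
  rewrite innerBl innerZl norm2_inner -GL /Re /=; ring.
have ib : 0 < / b by apply Rinv_0_lt_compat.
have Dn : onorm D <= 1 - / b * / c3.
  have p1 : / b * / c3 <= 1.
    rewrite -(Rinv_l b); last lra.
    by apply Rmult_le_compat_l; [lra | rewrite {1}/b; lra].
  apply self_adjoint_norm => //; first lra.
  move=> x; rewrite Dq; have Lx := L_ge x; have Lx2 := L_le x.
  have q0 := pow2_ge_0 (norm x).
  have A1 := Rmult_le_compat_l _ _ _ (Rlt_le _ _ ib) Lx.
  have A2 := Rmult_le_compat_l _ _ _ (Rlt_le _ _ ib) Lx2.
  have A3 : / b * (B * norm x ^ 2) <= norm x ^ 2.
    apply Rle_trans with (/ b * (b * norm x ^ 2)); last by right; field; lra.
    apply Rmult_le_compat_l; first lra.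
    apply Rmult_le_compat_r => //; rewrite /b; lra.
  rewrite Rabs_pos_eq; lra.
have p2 := Rmult_lt_0_compat _ _ ib ic.
have [W [Wsa [[V [WV VW]] W2]]] := sqrt_one_minus D _ Dsa Dn ltac:(lra).
have Wn : forall x, norm (W x) ^ 2 = / b * L x.
  move=> x; rewrite norm2_inner -Wsa.
  have -> : W (W x) = x -v D x by exact: (f_equal (fun S : bounded_op H => S x) W2).
  change (D x) with (x -v RtoC (/ b) *v G x); rewrite vsub_subK innerZl -GL /Re /=; ring.
exists V, W; split; first by split.
apply onorm_le => [|x]; first lra.
rewrite Rmult_1_l; change (norm (W (T (V x))) <= norm x).
have Ex : x = W (V x) by symmetry; exact: (f_equal (fun S : bounded_op H => S x) WV).
rewrite {2}Ex.
apply Rsqr_incr_0_var; last exact: norm_ge_0.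
rewrite !Rsqr_pow2 !Wn; apply Rmult_le_compat_l; [lra | exact: L_T].
Qed.

End Similarity.

Lemma bop_inv_unique {X : CompleteNormedModule C_AbsRing} (A B : bounded_op X) :
  is_inverse A B -> bop_inv A = B.
Proof.
move=> HB; have [E1 E2] := bop_inv_spec A (ex_intro _ B HB).
transitivity (bop_inv A *o (A *o B)).
  by rewrite (proj1 HB : A *o B = 1o) op1_r.
by rewrite opA (E2 : bop_inv A *o A = 1o) op1_l.
Qed.

(** * Resolvents of Ritt operators *)

Section Resolvent.
Context {X : CompleteNormedModule C_AbsRing}.
Implicit Types A B L T : bounded_op X.

Lemma left_right_inverse A B L : L *o A = 1o -> A *o B = 1o -> is_inverse A B.
Proof.
move=> LA AB; split=> //; change (B *o A = 1o).
have -> : B = L by rewrite -(op1_l B) -LA -opA AB op1_r.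
exact: LA.
Qed.

(** I - T^n = (I - T)(I + ... + T^(n-1)), and the left side is inverted by a Neumann series. *)
Lemma invertible_one_minus_pow T (n : nat) : onorm (T ^o n) < 1 -> invertible (1o -o T).
Proof.
move=> Hn; have [N [[N1 N2] _]] := neumann (T ^o n) _ (Rle_refl _) Hn.
exists (bgeo (T := T) n *o N).
have E : (1o -o T) *o bgeo (T := T) n = 1o -o T ^o n.
  exact (f_equal bico (bgeoE (T := T) n)).
have E' : bgeo (T := T) n *o (1o -o T) = 1o -o T ^o n.
  rewrite -E; exact (f_equal bico (bmul_comm T (bgeo n) (bsub b1 (bT T)))).
apply (left_right_inverse _ _ (N *o bgeo (T := T) n)).
- by rewrite -opA E' N2.
- by rewrite opA E N1.
Qed.

Lemma opZl (k : C) A B : (k *s A) *o B = k *s (A *o B).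
Proof. exact: bop_ext. Qed.

Lemma opZr (k : C) A B : A *o (k *s B) = k *s (A *o B).
Proof. by apply bop_ext => x; exact: (opZ A k (B x)). Qed.

Lemma oscalA (k l : C) A : k *s (l *s A) = (k * l) *s A.
Proof. by apply bop_ext => x; exact: vscalA. Qed.

Lemma oscal1 A : RtoC 1 *s A = A.
Proof. by apply bop_ext => x; exact: vscal1. Qed.

Lemma is_inverse_scal (k : C) A B : k <> 0 -> is_inverse A B -> is_inverse (k *s A) (/ k *s B).
Proof.
move=> k0 [AB BA]; split; [change ((k *s A) *o (/ k *s B) = 1o)|change ((/ k *s B) *o (k *s A) = 1o)].
- rewrite opZl opZr oscalA (AB : A *o B = 1o) Cinv_r //; exact: oscal1.
- rewrite opZl opZr oscalA (BA : B *o A = 1o) Cinv_l //; exact: oscal1.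
Qed.

Definition pencil (l : C) T : bounded_op X := l *s 1o -o T.

Lemma pencil_scal (l : C) T : l <> 0 -> pencil l T = l *s (1o -o / l *s T).
Proof.
move=> l0; apply bop_ext => x.
change (l *v x -v T x = l *v (x -v / l *v T x)).
by rewrite vscalBr vscalA Cinv_r // vscal1.
Qed.

Lemma pow_oscal (k : C) T (n : nat) : (k *s T) ^o n = (Cpow k n) *s (T ^o n).
Proof.
elim: n => [|n IH]; first by rewrite /= oscal1.
change ((k *s T) *o (k *s T) ^o n = (k * Cpow k n) *s (T *o T ^o n)).
by rewrite IH opZl opZr oscalA.
Qed.

(** For power bounded T the powers of T/l tend to 0, so one of them has norm below 1. *)
Lemma invertible_pencil_out T (M : R) (l : C) :
  (forall n, onorm (T ^o n) <= M) -> 1 < Cmod l -> invertible (pencil l T).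
Proof.
move=> HM Hl.
have l0 : l <> 0 by move=> E; move: Hl; rewrite E Cmod_0; lra.
have M0 : 0 <= M by apply Rle_trans with (2 := HM 0%nat); exact: onorm_ge0.
rewrite pencil_scal //.
have il : 0 < / Cmod l < 1.
  split; first by apply Rinv_0_lt_compat; lra.
  by rewrite -Rinv_1; apply Rinv_lt_contravar; lra.
have [n Hn] := pow_small (/ Cmod l) (/ (M + 1)) ltac:(lra) ltac:(apply Rinv_0_lt_compat; lra).
have [B HB] : invertible (1o -o / l *s T).
  apply (invertible_one_minus_pow _ n).
  rewrite pow_oscal onorm_scal_eq Cmod_pow Cmod_inv //.
  have := Hn n (Nat.le_refl n); have := pow_le (/ Cmod l) n ltac:(lra).
  set p := _ ^ n => p0 p1.
  apply Rle_lt_trans with (p * M); first by apply Rmult_le_compat_l.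
  apply Rle_lt_trans with (p * (M + 1)); first nra.
  apply Rlt_le_trans with (/ (M + 1) * (M + 1)); last by right; field; lra.
  by apply Rmult_lt_compat_r; lra.
by exists (/ l *s B); apply is_inverse_scal.
Qed.

Lemma resolventP (l : C) T : invertible (pencil l T) -> is_inverse (pencil l T) (resolvent l T).
Proof. exact: bop_inv_spec. Qed.

Lemma resolvent_comm (l : C) T S : invertible (pencil l T) -> S *o T = T *o S ->
  S *o resolvent l T = resolvent l T *o S.
Proof.
move=> Hi HS; have [E1 E2] := resolventP l T Hi.
have HP : S *o pencil l T = pencil l T *o S.
  exact: (bicoP T (bsub (bscal l b1) (bT T)) S HS).
set P := pencil l T in E1 E2 HP; set Q := resolvent l T in E1 E2 *.
transitivity (Q *o (P *o S) *o Q).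
  by rewrite opA (E2 : Q *o P = 1o) op1_l.
by rewrite -HP -!opA (E1 : P *o Q = 1o) op1_r.
Qed.

(* The first m terms of the Neumann series leave a remainder containing
   T^m (I - T), which is at most half of the unknown norm once m|l - 1| is at
   least twice the Ritt constant. *)
Lemma resolvent_bound_out T (M b : R) (l : C) : ritt_bounds T M b -> 1 < Cmod l ->
  onorm ((l - 1) *s resolvent l T) <= 2 * (M * (2 * b + 2) + M).
Proof.
move=> [M1 [C0 [HM HC]]] Hl.
have l0 : l <> 0 by move=> E; move: Hl; rewrite E Cmod_0; lra.
have Hi := invertible_pencil_out T M l HM Hl.
have d0 : 0 < Cmod (l - 1).
  apply Cmod_gt_0 => E; have E' : l = 1 by rewrite -(Cplus_0_r 1) -E; ring.
  by move: Hl; rewrite E' Cmod_1; lra.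
set d := Cmod (l - 1) in d0 *.
(* m = floor(2b/d) + 1, so that 2b <= m d <= 2b + d. *)
have [m [mp [m1 [m2 m3]]]] : exists m : nat, 0 < INR m /\ 2 * b <= INR m * d /\ INR m * d <= 2 * b + d /\ INR m <= 2 * b / d + 1.
  have c0 : 0 <= 2 * b / d by apply Rdiv_le_0_compat; lra.
  have [m Hm] := nfloor_ex _ c0.
  have E : 2 * b = (2 * b / d) * d by field; lra.
  have m0 := pos_INR m.
  by exists (S m); rewrite S_INR; split; [|split; [|split]]; try nra.
set w := (/ l)%C.
have Hw : Cmod w = / Cmod l by rewrite /w Cmod_inv.
have iw : 0 < Cmod w < 1.
  rewrite Hw; split; first by apply Rinv_0_lt_compat; lra.
  by rewrite -Rinv_1; apply Rinv_lt_contravar; lra.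
set U := w *s T.
have HU : forall n, onorm (U ^o n) <= M.
  move=> n; rewrite pow_oscal onorm_scal_eq Cmod_pow.
  have : Cmod w ^ n <= 1 by rewrite -(pow1 n); apply pow_incr; lra.
  have := pow_le (Cmod w) n ltac:(lra); have := HM n; have := onorm_ge0 (T ^o n); nra.
set Q := resolvent l T.
have [E1 E2] := resolventP l T Hi.
have E1' : pencil l T *o Q = 1o by [].
have E2' : Q *o pencil l T = 1o by [].
set G := bico (bgeo (T := U) m).
have EG : (1o -o U) *o G = 1o -o U ^o m by exact (f_equal bico (bgeoE (T := U) m)).
have EQ : Q = w *s G +o Q *o U ^o m.
  have EP : pencil l T = l *s (1o -o U) by exact: pencil_scal.
  have E3 : pencil l T *o (w *s G) = 1o -o U ^o m.
    by rewrite EP opZl opZr oscalA Cinv_r // oscal1.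
  have E4 : w *s G = Q *o (1o -o U ^o m) by rewrite -E3 opA E2' op1_l.
  by rewrite E4; apply bop_ext => x; rewrite [RHS]/=; change (Q x = Q (x -v (U ^o m) x) +v Q ((U ^o m) x)); rewrite opB vsubK.
have Kd : (l - 1) *s Q = 1o -o Q *o (1o -o T).
  apply bop_ext => x.
  have Ex : x = Q (l *v x -v T x) by symmetry; exact: (f_equal (fun S : bounded_op X => S x) E2').
  change ((l - 1) *v Q x = x -v Q (x -v T x)); rewrite {2}Ex.
  by rewrite !opB opZ vscalBl vscal1 vsub_cancel.
have EK : (l - 1) *s Q = ((l - 1) * w) *s G +o (U ^o m -o (Cpow w m) *s (Q *o (T ^o m *o (1o -o T)))).
  have E5 : (l - 1) *s Q = (l - 1) *s (w *s G) +o ((l - 1) *s Q) *o U ^o m.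
    rewrite {1}EQ opZl; apply bop_ext => x; exact: vscalDr.
  rewrite E5 oscalA Kd; f_equal.
  rewrite /U pow_oscal; apply bop_ext => x.
  set p := Cpow w m; set y := (T ^o m) x.
  change (p *v y -v Q ((p *v y) -v T (p *v y)) = p *v y -v p *v (Q ((T ^o m) (x -v T x)))).
  f_equal; rewrite opZ -vscalBr opZ; do 2 f_equal.
  rewrite /y opB; f_equal.
  exact (f_equal (fun a : bicomm T => a x) (bmul_comm T (bT T) (bpow m))).
set q := onorm ((l - 1) *s Q).
have Eq : q = d * onorm Q by rewrite /q onorm_scal_eq.
have LG : onorm (((l - 1) * w) *s G) <= M * (2 * b + 2).
  rewrite onorm_scal_eq Cmod_mult -/d.
  apply Rle_trans with (d * Cmod w * (INR m * M)).
    apply Rmult_le_compat_l; first by apply Rmult_le_pos; lra.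
    exact: (bgeo_norm M m HU).
  have dw : d * Cmod w <= 2.
    have D : d <= Cmod l + 1.
      apply Rle_trans with (1 := Cmod_triangle l (- (1))); rewrite Cmod_opp Cmod_1; lra.
    rewrite Hw; apply (Rmult_le_reg_r (Cmod l)); first lra.
    rewrite Rmult_assoc Rinv_l; lra.
  have dw2 : d * Cmod w <= d by nra.
  (* If d <= 2 this follows from m d <= 2b + d; otherwise d |w| <= 2 and m <= 2b/d + 1 <= b + 1. *)
  have mw : INR m * (d * Cmod w) <= 2 * b + 2.
    have m0 := pos_INR m.
    case: (Rle_dec d 2) => D2.
      apply Rle_trans with (INR m * d); [by apply Rmult_le_compat_l | lra].
    apply Rle_trans with (INR m * 2); first by apply Rmult_le_compat_l.
    have : 2 * b / d <= b; last lra.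
    apply (Rmult_le_reg_r d) => //; rewrite /Rdiv Rmult_assoc Rinv_l; nra.
  nra.
(* |Q| = q/d and m |T^m (I - T)| <= b, while m d >= 2b. *)
have LR : onorm ((Cpow w m) *s (Q *o (T ^o m *o (1o -o T)))) <= / 2 * q.
  rewrite onorm_scal_eq Cmod_pow.
  apply Rle_trans with (onorm (Q *o (T ^o m *o (1o -o T)))).
    have : Cmod w ^ m <= 1 by rewrite -(pow1 m); apply pow_incr; lra.
    have := onorm_ge0 (Q *o (T ^o m *o (1o -o T))); nra.
  apply Rle_trans with (1 := onorm_mul Q _).
  rewrite Eq; have := HC m; have Q0 := onorm_ge0 Q.
  set a := onorm (T ^o m *o _) => Ha.
  have a0 : 0 <= a by exact: onorm_ge0.
  have : a <= / 2 * d by apply (Rmult_le_reg_l (INR m)) => //; lra.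
  nra.
have := onorm_add_le _ _ _ _ LG (onorm_sub_le _ _ _ _ (HU m) LR).
rewrite -EK -/q; lra.
Qed.

End Resolvent.

(** P' = P (I - Q (P - P')) = (I - (P - P') Q) P with Q the inverse of P. Neumann series invert the
    two brackets and give a right and a left inverse of P'. *)
Lemma inverse_perturb {X : CompleteNormedModule C_AbsRing} (P P' : bounded_op X) (q : R) :
  invertible P -> onorm (P -o P') * onorm (bop_inv P) <= q -> q < 1 ->
  invertible P' /\ onorm (bop_inv P') <= / (1 - q) * onorm (bop_inv P).
Proof.
move=> Hi Hq q1.
have [E1 E2] := bop_inv_spec P Hi; set Q := bop_inv P in Hq E1 E2 *.
have E1' : P *o Q = 1o by [].
have E2' : Q *o P = 1o by [].
have pert : forall D, onorm D <= q -> exists N : bounded_op X,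
    (1o -o D) *o N = 1o /\ N *o (1o -o D) = 1o /\ onorm N <= / (1 - q).
  move=> D HD; have [N [[N1 N2] N3]] := neumann D q HD q1.
  by exists N.
have [N [N1 [N2 N3]]] := pert (Q *o (P -o P'))
  (Rle_trans _ _ _ (onorm_mul _ _) (Rle_trans _ _ _ (Req_le _ _ (Rmult_comm _ _)) Hq)).
have [N' [N1' [N2' N3']]] := pert ((P -o P') *o Q) (Rle_trans _ _ _ (onorm_mul _ _) Hq).
have Ep : P' = P *o (1o -o Q *o (P -o P')).
  apply bop_ext => x; change (P' x = P (x -v Q (P x -v P' x))).
  rewrite opB; have -> : P (Q (P x -v P' x)) = P x -v P' x by exact: (f_equal (fun S : bounded_op X => S _) E1').
  by rewrite vsub_subK.
have Ep2 : P' = (1o -o (P -o P') *o Q) *o P.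
  apply bop_ext => x; change (P' x = P x -v (P (Q (P x)) -v P' (Q (P x)))).
  have -> : Q (P x) = x by exact: (f_equal (fun S : bounded_op X => S _) E2').
  by rewrite vsub_subK.
have Hm : is_inverse P' (N *o Q).
  apply (left_right_inverse _ _ (Q *o N')).
  - by rewrite {1}Ep2 -opA (opA N') N2' op1_l.
  - by rewrite {1}Ep -opA (opA (1o -o _)) N1 op1_l.
split; first by exists (N *o Q).
have -> : bop_inv P' = N *o Q by exact: bop_inv_unique.
by apply onorm_mul_le => //; exact: Rle_refl.
Qed.

Lemma resolvent_perturb {X : CompleteNormedModule C_AbsRing} (T : bounded_op X) (l m : C) (q : R) :
  invertible (pencil l T) -> Cmod (m - l) * onorm (resolvent l T) <= q -> q < 1 ->
  invertible (pencil m T) /\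
  onorm (resolvent m T) <= / (1 - q) * onorm (resolvent l T).
Proof.
move=> Hi Hq; apply inverse_perturb => //; apply Rle_trans with (2 := Hq).
apply Rmult_le_compat_r; first exact: onorm_ge0.
have -> : pencil l T -o pencil m T = (l - m) *s 1o.
  apply bop_ext => x; change ((l *v x -v T x) -v (m *v x -v T x) = (l - m) *v x).
  by rewrite vsub_cancel vscalBl.
have -> : Cmod (m - l) = Cmod (l - m) by rewrite -Cmod_opp; congr Cmod; ring.
apply Rle_trans with (1 := onorm_scal _ _).
have := onorm_one (X := X); have := Cmod_ge_0 (l - m); nra.
Qed.

Lemma Cmod_sub_sym (z w : C) : Cmod (z - w) = Cmod (w - z).
Proof. by rewrite -Cmod_opp; congr Cmod; ring. Qed.

Lemma Cmod_triangle3 (y x z : C) : Cmod (x - z) <= Cmod (x - y) + Cmod (y - z).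
Proof.
have -> : (x - z = (x - y) + (y - z))%C by ring.
exact: Cmod_triangle.
Qed.

(** Outside the closed unit disc this is [resolvent_bound_out]. A point m of the disc that is close
    to the circle, relative to its distance from 1, is compared with the point of modulus 1 + h on
    the same ray. *)
Lemma ritt_resolvent {X : CompleteNormedModule C_AbsRing} (T : bounded_op X) :
  ritt T -> exists K B, 1 <= K /\ 0 <= B /\ forall l : C,
    K * (1 - Cmod l) < Cmod (1 - l) ->
    invertible (pencil l T) /\ onorm ((l - 1) *s resolvent l T) <= B.
Proof.
move=> RT; have [M [b HR]] := ritt_bounded T RT.
have [M1 [b0 [HM _]]] := HR.
set c := 2 * (M * (2 * b + 2) + M).
have c1 : 1 <= c by rewrite /c; nra.
exists (8 * c), (3 * c); split; [lra|split; [lra|]] => m Hm.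
case: (Rlt_le_dec 1 (Cmod m)) => Hm1.
  split; first exact: invertible_pencil_out HM Hm1.
  by have := resolvent_bound_out T M b m HR Hm1; rewrite -/c; lra.
set d := Cmod (1 - m) in Hm.
have d2 : d <= 2.
  by have := Cmod_triangle 1 (- m); rewrite Cmod_opp Cmod_1 -/(Cminus 1 m) -/d; lra.
have dm : 1 - Cmod m < d / (8 * c).
  apply (Rmult_lt_reg_l (8 * c)); first lra.
  by have -> : 8 * c * (d / (8 * c)) = d by field; lra.
have d0 : 0 < d by have := Cmod_ge_0 m; nra.
have dc : d / (8 * c) <= d / 8.
  rewrite /Rdiv; apply Rmult_le_compat_l; first lra.
  apply Rinv_le_contravar; lra.
have m0 : 0 < Cmod m by lra.
(* Chosen so that |m - l| |R(l)| is at most 2h times 2c/d, which is 1/2. *)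
set h := d / (8 * c) in dm dc.
have h0 : 0 < h by apply Rdiv_lt_0_compat; lra.
set l := (RtoC ((1 + h) / Cmod m) * m)%C.
have t0 : 0 < (1 + h) / Cmod m by apply Rdiv_lt_0_compat; lra.
have El : Cmod l = 1 + h.
  rewrite /l Cmod_mult Cmod_R Rabs_pos_eq; last lra.
  by field; lra.
have Elm : Cmod (m - l) <= 2 * h.
  have -> : (m - l = RtoC (1 - (1 + h) / Cmod m) * m)%C.
    by rewrite /l RtoC_minus; ring.
  rewrite Cmod_mult Cmod_R -Rabs_Ropp Rabs_pos_eq.
    have -> : - (1 - (1 + h) / Cmod m) * Cmod m = 1 + h - Cmod m by field; lra.
    lra.
  have : 1 <= (1 + h) / Cmod m; last lra.
  apply (Rmult_le_reg_r (Cmod m)) => //.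
  have -> : (1 + h) / Cmod m * Cmod m = 1 + h by field; lra.
  lra.
have Hl : 1 < Cmod l by rewrite El; lra.
have Hi := invertible_pencil_out T M l HM Hl.
have HB := resolvent_bound_out T M b l HR Hl.
rewrite -/c onorm_scal_eq in HB.
have dl : d - 2 * h <= Cmod (l - 1).
  have := Cmod_triangle3 l 1 m; rewrite (Cmod_sub_sym l m) (Cmod_sub_sym 1 l) -/d; lra.
have dl2 : d / 2 <= Cmod (l - 1) by lra.
have R1 : onorm (resolvent l T) <= 2 * c / d.
  apply (Rmult_le_reg_l (d / 2)); first lra.
  have -> : d / 2 * (2 * c / d) = c by field; lra.
  apply Rle_trans with (2 := HB); apply Rmult_le_compat_r => //; exact: onorm_ge0.
have Hq : Cmod (m - l) * onorm (resolvent l T) <= / 2.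
  apply Rle_trans with (2 * h * (2 * c / d)).
    apply Rmult_le_compat => //; [exact: Cmod_ge_0 | exact: onorm_ge0].
  right; rewrite /h; field; lra.
have [Hinv Hn] := resolvent_perturb T l m (/ 2) Hi Hq ltac:(lra).
split=> //; rewrite onorm_scal_eq Cmod_sub_sym -/d.
have Hn' : onorm (resolvent m T) <= 2 * onorm (resolvent l T).
  by apply Rle_trans with (1 := Hn); right; field.
apply Rle_trans with (d * (2 * onorm (resolvent l T))).
  by apply Rmult_le_compat_l; lra.
have := onorm_ge0 (resolvent l T); set r := onorm _ in HB *; nra.
Qed.

(** * Stolz domains *)

Lemma locally_Cmod (z : C) (P : C -> Prop) :
  locally (T := C_UniformSpace) z P <->
  exists e, 0 < e /\ forall y, Cmod (y - z) < e -> P y.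
Proof.
rewrite locally_C; split.
- by move=> [e He]; exists e; split; [exact: cond_pos | exact: He].
- by move=> [e [e0 He]]; exists (mkposreal e e0).
Qed.

Lemma not_closure (A : C -> Prop) (z : C) :
  ~ closure (U := C_UniformSpace) A z <-> exists e, 0 < e /\ forall y, Cmod (y - z) < e -> ~ A y.
Proof.
rewrite /closure -locally_Cmod; split; first exact: NNPP.
by move=> HL Hn.
Qed.

Lemma sin_01 (g : R) : 0 < g < PI / 2 -> 0 < sin g < 1.
Proof.
move=> Hg; split; first by apply sin_gt_0; have := PI_RGT_0; lra.
rewrite -sin_PI2; apply sin_increasing_1; lra.
Qed.

(** The disc D(0, r) shrunk towards 1 by the factor s; for 0 < s <= 1 these discs make up the Stolz
    domain, which replaces the convex hull by one parameter. *)
Definition stolz_at (r s : R) (z : C) : Prop := Cmod (z - RtoC (1 - s)) < s * r.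

Lemma stolz_intro (g s : R) (z : C) : 0 < s <= 1 -> stolz_at (sin g) s z -> stolz g z.
Proof.
move=> Hs Hz; apply locally_Cmod.
exists (s * sin g - Cmod (z - RtoC (1 - s))); split; first by move: Hz; rewrite /stolz_at; lra.
move=> y Hy B HB HA.
set w := ((y - RtoC (1 - s)) / RtoC s)%C.
have s0 : RtoC s <> 0 by move=> E; injection E; lra.
have -> : y = ((1 - s)%R * 1 + s * w)%C by rewrite /w; field.
apply HB; [apply HA; by left | apply HA; right | lra].
rewrite /w Cmod_div // Cmod_R Rabs_pos_eq; last lra.
apply (Rmult_lt_reg_r s); first lra.
rewrite /Rdiv Rmult_assoc Rinv_l; last lra.
have := Cmod_triangle3 z y (RtoC (1 - s)); rewrite Rmult_1_r; lra.
Qed.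

Lemma stolz_at_comb (r s1 s2 t : R) (z w : C) : 0 <= t <= 1 ->
  Cmod (((1 - t)%R * z + t * w) - RtoC (1 - ((1 - t) * s1 + t * s2))) <=
  (1 - t) * Cmod (z - RtoC (1 - s1)) + t * Cmod (w - RtoC (1 - s2)).
Proof.
move=> Ht.
have -> : (((1 - t)%R * z + t * w) - RtoC (1 - ((1 - t) * s1 + t * s2)) =
  RtoC (1 - t) * (z - RtoC (1 - s1)) + RtoC t * (w - RtoC (1 - s2)))%C.
  by apply C_eq; rewrite /Re /Im /=; ring.
apply Rle_trans with (1 := Cmod_triangle _ _).
by rewrite !Cmod_mult !Cmod_R !Rabs_pos_eq; lra.
Qed.

(** The set consisting of 1 and of all the discs is convex and contains the generators, hence the
    hull; being interior then rules out 1. *)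
Lemma stolz_elim (g : R) (z : C) : 0 < g < PI / 2 -> stolz g z ->
  exists s, 0 < s <= 1 /\ stolz_at (sin g) s z.
Proof.
move=> Hg; have [r0 r1] := sin_01 g Hg.
set r := sin g in r0 r1 *.
set B := fun z : C => z = RtoC 1 \/ exists s, 0 < s <= 1 /\ stolz_at r s z.
have cB : Defs.convex B.
  move=> u w t Hu Hw Ht.
  (* s = 0 stands for the point 1, so that both kinds of points are treated at once. *)
  have main : forall s1 s2, 0 <= s1 <= 1 -> 0 <= s2 <= 1 ->
      (s1 = 0 /\ u = 1 \/ 0 < s1 /\ stolz_at r s1 u) ->
      (s2 = 0 /\ w = 1 \/ 0 < s2 /\ stolz_at r s2 w) -> B ((1 - t)%R * u + t * w)%C.
    move=> s1 s2 H1 H2 Hu' Hw'.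
    have E0 : forall v : C, v = 1 -> Cmod (v - RtoC (1 - 0)) = 0.
      move=> v ->; have -> : (1 - RtoC (1 - 0) = 0)%C by apply C_eq; rewrite /Re /Im /=; ring.
      exact: Cmod_0.
    set s := (1 - t) * s1 + t * s2.
    have L := stolz_at_comb r s1 s2 t u w Ht.
    have s_ge : 0 <= s by rewrite /s; nra.
    case: (Rle_lt_or_eq_dec 0 s s_ge) => Hs.
    + right; exists s; split; first by rewrite /s in Hs *; nra.
      apply Rle_lt_trans with (1 := L).
      have Q : s * r = (1 - t) * (s1 * r) + t * (s2 * r) by rewrite /s; ring.
      rewrite Q.
      have U : Cmod (u - RtoC (1 - s1)) <= s1 * r /\ (0 < s1 -> Cmod (u - RtoC (1 - s1)) < s1 * r).
        case: Hu' => [[-> Eu]|[? Hlt]]; last by split; [exact: Rlt_le|].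
        by rewrite E0 //; split; lra.
      have V : Cmod (w - RtoC (1 - s2)) <= s2 * r /\ (0 < s2 -> Cmod (w - RtoC (1 - s2)) < s2 * r).
        case: Hw' => [[-> Ew]|[? Hlt]]; last by split; [exact: Rlt_le|].
        by rewrite E0 //; split; lra.
      move: U V; set a := Cmod _; set b := Cmod _ => [[U1 U2] [V1 V2]].
      have A1 : (1 - t) * a <= (1 - t) * (s1 * r) by apply Rmult_le_compat_l; lra.
      have A2 : t * b <= t * (s2 * r) by apply Rmult_le_compat_l; lra.
      case: (Rlt_le_dec 0 ((1 - t) * s1)) => P1.
        have [t1 s1p] : 0 < 1 - t /\ 0 < s1 by split; nra.
        have := Rmult_lt_compat_l _ _ _ t1 (U2 s1p); lra.
      have P2 : 0 < t * s2 by rewrite /s in Hs; lra.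
      have [t1 s2p] : 0 < t /\ 0 < s2 by split; nra.
      have := Rmult_lt_compat_l _ _ _ t1 (V2 s2p); lra.
    + left.
      have K1 : (1 - t) * s1 = 0 by rewrite /s in Hs; nra.
      have K2 : t * s2 = 0 by rewrite /s in Hs; nra.
      have one : forall (x : R) (v : C) (k : R), k * x = 0 -> (x = 0 /\ v = 1 \/ 0 < x /\ stolz_at r x v) -> (RtoC k * v = RtoC k)%C.
        move=> x v k Hk [[_ ->]|[x0 _]]; first by ring.
        have -> : k = 0 by nra.
        by ring.
      rewrite (one s1 u) // (one s2 w) //; apply C_eq; rewrite /Re /Im /=; ring.
  have pick : forall v, B v -> exists s, 0 <= s <= 1 /\ (s = 0 /\ v = 1 \/ 0 < s /\ stolz_at r s v).
    move=> v [->|[s [Hs1 Hs2]]]; first by exists 0; split; [lra | left].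
    by exists s; split; [lra | right; split; [lra|]].
  have [s1 [H1 H1']] := pick _ Hu; have [s2 [H2 H2']] := pick _ Hw.
  exact: (main s1 s2).
have hB : forall y, convex_hull (fun z : C => z = RtoC 1 \/ Cmod z < r) y -> B y.
  move=> y Hy; apply Hy => // w [->|Hw]; first by left.
  right; exists 1; split; first lra.
  rewrite /stolz_at; have -> : (w - RtoC (1 - 1) = w)%C by apply C_eq; rewrite /Re /Im /=; ring.
  lra.
move=> /locally_Cmod [e [e0 He]].
have Hz0 : Cmod (z - z) < e by rewrite /Cminus Cplus_opp_r Cmod_0.
case: (hB z (He z Hz0)) => //.
(* 1 is not interior: 1 + e/2 lies in none of the discs. *)
move=> Ez; exfalso.
have Hz1 : Cmod (z + RtoC (e / 2) - z) < e.
  have -> : (z + RtoC (e / 2) - z = RtoC (e / 2))%C by ring.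
  by rewrite Cmod_R Rabs_pos_eq; lra.
case: (hB _ (He _ Hz1)) => [|[s [Hs1 Hs2]]].
- by rewrite Ez => E; injection E; lra.
- move: Hs2; rewrite /stolz_at Ez.
  have -> : (1 + RtoC (e / 2) - RtoC (1 - s) = RtoC (e / 2 + s))%C by apply C_eq; rewrite /Re /Im /=; ring.
  rewrite Cmod_R Rabs_pos_eq; nra.
Qed.

Lemma stolz_mono (a b : R) (z : C) : 0 < a -> a <= b -> b < PI / 2 -> stolz a z -> stolz b z.
Proof.
move=> a0 ab b1 /stolz_elim [|s [Hs Hz]]; first lra.
apply (stolz_intro _ s) => //; apply Rlt_le_trans with (1 := Hz).
apply Rmult_le_compat_l; first lra.
case: (Req_dec a b) => [->|ne]; first lra.
left; apply sin_increasing_1; lra.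
Qed.

Lemma stolz_open (g : R) (z : C) : 0 < g < PI / 2 -> stolz g z ->
  exists e, 0 < e /\ forall y, Cmod (y - z) < e -> stolz g y.
Proof.
move=> Hg /stolz_elim [|s [Hs Hz]] //.
exists (s * sin g - Cmod (z - RtoC (1 - s))); split; first by move: Hz; rewrite /stolz_at; lra.
move=> y Hy; apply (stolz_intro _ s) => //.
have := Cmod_triangle3 z y (RtoC (1 - s)); rewrite /stolz_at; lra.
Qed.

(** Scaling by t maps the disc of parameter s into the disc of parameter 1 - t + t s. *)
Lemma stolz_star (g t : R) (z : C) : 0 < g < PI / 2 -> 0 <= t <= 1 -> stolz g z -> stolz g (RtoC t * z)%C.
Proof.
move=> Hg Ht /stolz_elim [|s [Hs Hz]] //.
have [r0 r1] := sin_01 g Hg.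
apply (stolz_intro _ (1 - t + t * s)); first nra.
rewrite /stolz_at.
have -> : (RtoC t * z - RtoC (1 - (1 - t + t * s)) = RtoC t * (z - RtoC (1 - s)))%C.
  by apply C_eq; rewrite /Re /Im /=; ring.
rewrite Cmod_mult Cmod_R Rabs_pos_eq; last lra.
move: Hz; rewrite /stolz_at; set a := Cmod _ => Hz.
have L : t * a <= t * (s * sin g) by apply Rmult_le_compat_l; lra.
case: (Rlt_le_dec t 1) => t1; first by have := Rmult_lt_0_compat (1 - t) (sin g) ltac:(lra) r0; lra.
have -> : t = 1 by lra.
lra.
Qed.

Lemma stolz_real (g t : R) : 0 < g < PI / 2 -> 0 <= t < 1 -> stolz g (RtoC t).
Proof.
move=> Hg Ht; have [r0 r1] := sin_01 g Hg.
apply (stolz_intro _ (1 - t)); first lra.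
rewrite /stolz_at; have -> : (RtoC t - RtoC (1 - (1 - t)) = 0)%C by apply C_eq; rewrite /Re /Im /=; ring.
rewrite Cmod_0; nra.
Qed.

Lemma one_closure_stolz (g : R) : 0 < g < PI / 2 -> closure (U := C_UniformSpace) (stolz g) (RtoC 1).
Proof.
move=> Hg; apply NNPP => /not_closure [e [e0 He]].
set t := Rmin (e / 2) (1 / 2).
have t1 := Rmin_l (e / 2) (1 / 2); have t2 := Rmin_r (e / 2) (1 / 2).
have t0 : 0 < t by apply Rmin_pos; lra.
apply (He (RtoC (1 - t))); last by apply stolz_real => //; rewrite /t in t0 *; lra.
have -> : (RtoC (1 - t) - 1 = RtoC (- t))%C by apply C_eq; rewrite /Re /Im /=; ring.
rewrite Cmod_R Rabs_Ropp Rabs_pos_eq; rewrite /t in t0 *; lra.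
Qed.

(** On the disc of parameter s, |1 - z| <= s (1 + sin g) and 1 - |z| >= s (1 - sin g). *)
Lemma stolz_Cmod (g : R) (z : C) : 0 < g < PI / 2 -> stolz g z ->
  (1 - sin g) * Cmod (1 - z) <= 2 * (1 - Cmod z).
Proof.
move=> Hg /stolz_elim [|s [Hs Hz]] //; have [r0 r1] := sin_01 g Hg.
move: Hz; rewrite /stolz_at => Hz.
have A : Cmod (1 - z) <= s + s * sin g.
  have := Cmod_triangle3 (RtoC (1 - s)) 1 z; rewrite (Cmod_sub_sym (RtoC (1 - s)) z).
  have -> : (1 - RtoC (1 - s) = RtoC s)%C by apply C_eq; rewrite /Re /Im /=; ring.
  rewrite Cmod_R Rabs_pos_eq; lra.
have B : Cmod z <= (1 - s) + s * sin g.
  have := Cmod_triangle3 (RtoC (1 - s)) z 0.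
  have -> : (RtoC (1 - s) - 0 = RtoC (1 - s))%C by ring.
  have -> : (z - 0 = z)%C by ring.
  rewrite Cmod_R Rabs_pos_eq; lra.
apply Rle_trans with ((1 - sin g) * (s + s * sin g)); first by apply Rmult_le_compat_l; lra.
have : 0 <= s * (1 - sin g) * (1 - sin g) by apply Rmult_le_pos; [apply Rmult_le_pos|]; lra.
nra.
Qed.

(** Converse of [stolz_Cmod], with cos a = 1/(2K). For u = 1 - z, p = Re u and m = |u| the
    hypothesis gives m <= K p, and the disc of parameter s is described by s^2 cos^2 a - 2 s p + m^2
    < 0. *)
Lemma region_stolz (K : R) : 1 <= K -> exists a, 0 < a < PI / 2 /\
  forall z : C, z <> 1 -> Cmod (1 - z) <= K * (1 - Cmod z) -> stolz a z.
Proof.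
move=> K1; set k := / (2 * K).
have k01 : 0 < k <= / 2.
  split; first by apply Rinv_0_lt_compat; lra.
  apply Rinv_le_contravar; lra.
set a := acos k.
have ca : cos a = k by apply cos_acos; lra.
have ab : 0 < a < PI by apply acos_bound_lt; lra.
have a2 : a < PI / 2.
  apply Rnot_le_lt => L.
  have := cos_le_0 a L ltac:(lra); lra.
exists a; split; first lra.
move=> z z1 Hz.
have [r0 r1] := sin_01 a (conj (proj1 ab) a2).
have sc : sin a ^ 2 = 1 - k ^ 2.
  by have := sin2_cos2 a; rewrite !Rsqr_pow2 ca; lra.
set r := sin a in r0 r1 sc *.
set u := (1 - z)%C.
have Ez : z = (1 - u)%C by rewrite /u; ring.
have u0 : 0 < Cmod u.
  by apply Cmod_gt_0 => E; apply z1; rewrite Ez E; ring.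
set p := Re u; set m := Cmod u in u0 *.
have m2 : m ^ 2 = p ^ 2 + Im u ^ 2 by exact: Cmod2_alt.
have z2 : Cmod z ^ 2 = 1 - 2 * p + m ^ 2.
  by rewrite m2 Cmod2_alt Ez /p /Re /Im /=; ring.
have z0 := Cmod_ge_0 z.
rewrite -/u -/m in Hz.
have zle : Cmod z <= 1 by nra.
have mp : m <= K * p.
  have : 1 - Cmod z <= p.
    have : Re z <= Cmod z by apply Rle_trans with (1 := Rle_abs _); exact: re_le_Cmod.
    by rewrite {1}Ez /p /Re /=; lra.
  nra.
have p0 : 0 < p by nra.
have kK : k * K = / 2 by rewrite /k; field; lra.
have at_s : forall s, 0 < s -> s ^ 2 - 2 * s * p + m ^ 2 < s ^ 2 * r ^ 2 -> stolz_at r s z.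
  move=> s s0 L; rewrite /stolz_at.
  apply Rsqr_incrst_0; [|exact: Cmod_ge_0|nra].
  rewrite !Rsqr_pow2 Rpow_mult_distr.
  apply Rle_lt_trans with (2 := L).
  rewrite Cmod2_alt Ez m2 /p /Re /Im /=; right; ring.
case: (Rle_lt_dec (m ^ 2) p) => Hc.
(* For this s the inequality becomes (m cos a / p)^2 < 1, and m cos a / p <= K cos a = 1/2. *)
- apply (stolz_intro _ (m ^ 2 / p)).
    split; first by apply Rdiv_lt_0_compat => //; nra.
    by apply (Rmult_le_reg_r p) => //; rewrite /Rdiv Rmult_assoc Rinv_l; lra.
  apply at_s; first by apply Rdiv_lt_0_compat => //; nra.
  rewrite sc.
  have -> : (m ^ 2 / p) ^ 2 - 2 * (m ^ 2 / p) * p + m ^ 2 = (m ^ 2 / p) ^ 2 - m ^ 2 by field; lra.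
  have : (m ^ 2 / p) ^ 2 * k ^ 2 < m ^ 2; last by lra.
  have -> : (m ^ 2 / p) ^ 2 * k ^ 2 = m ^ 2 * (m * k / p) ^ 2 by field; lra.
  have q0 : 0 < m * k / p by apply Rdiv_lt_0_compat => //; nra.
  have q1 : m * k / p <= / 2.
    apply (Rmult_le_reg_r p) => //; rewrite /Rdiv Rmult_assoc Rinv_l; last lra.
    by rewrite Rmult_1_r -kK; nra.
  have q2 : (m * k / p) ^ 2 < 1 by nra.
  have mm : 0 < m ^ 2 by apply pow_lt.
  by rewrite -{2}(Rmult_1_r (m ^ 2)); apply Rmult_lt_compat_l.
(* Here m <= K p < K m^2, so m K > 1 and 1 - |z| >= 1/K^2: the point lies in the disc of radius sin
   a about 0. *)
- apply (stolz_intro _ 1); first lra.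
  apply at_s; first lra.
  rewrite sc.
  have mK : 1 <= m * K by nra.
  have zK : K * K * Cmod z <= K * K - 1 by nra.
  have k2 : 4 * k ^ 2 * (K * K) = 1 by transitivity (4 * (k * K) ^ 2); [ring | rewrite kK; field].
  have : Cmod z ^ 2 < 1 - k ^ 2; last lra.
  have zk : Cmod z <= 1 - 4 * k ^ 2.
    apply (Rmult_le_reg_l (K * K)); nra.
  have kp : 0 < k ^ 2 by apply pow_lt; lra.
  have : Cmod z ^ 2 <= Cmod z by nra.
  lra.
Qed.

(** * Integration along segments *)

Section Calculus.
Context {V : CompleteNormedModule C_AbsRing}.
Implicit Types f g F : R -> V.

(** Epsilon forms in the norm of V, so that later arguments need not mention the real structure
    [realify V]. *)
Definition vcont f (t : R) := forall e, 0 < e -> exists d, 0 < d /\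
  forall u, Rabs (u - t) < d -> norm (f u -v f t) < e.

Definition vder f (t : R) (l : V) := forall e, 0 < e -> exists d, 0 < d /\
  forall u, Rabs (u - t) < d ->
    norm ((f u -v f t) -v RtoC (u - t) *v l) <= e * Rabs (u - t).

Definition vint f (a b : R) (l : V) := is_RInt (V := realify V) f a b l.

Lemma vcont_continuous f t : vcont f t -> continuous (U := realify V) f t.
Proof.
move=> H; apply (filterlim_locally_ball_norm (U := realify V) f) => e.
have [d [d0 Hd]] := H e (cond_pos e).
by exists (mkposreal d d0) => u Hu; exact: (Hd u Hu).
Qed.

Lemma vder_is_derive f t l : vder f t l -> is_derive (V := realify V) f t l.
Proof.
move=> H; split; first exact: (is_linear_scal_l (V := realify V) l).
move=> x Hx e.
have Ex : t = x by exact: (is_filter_lim_locally_unique (K := R_AbsRing) (V := R_NormedModule) t x Hx).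
rewrite -Ex; have [d [d0 Hd]] := H e (cond_pos e).
by exists (mkposreal d d0) => u Hu; exact: (Hd u Hu).
Qed.

Lemma vint_unique f a b l1 l2 : vint f a b l1 -> vint f a b l2 -> l1 = l2.
Proof.
move=> H1 H2.
by rewrite -(is_RInt_unique (V := realify V) f a b l1 H1) -(is_RInt_unique (V := realify V) f a b l2 H2).
Qed.

Lemma vint_ex f a b : (forall t, Rmin a b <= t <= Rmax a b -> vcont f t) -> exists l, vint f a b l.
Proof.
move=> H; have [l Hl] : ex_RInt (V := realify V) f a b; last by exists l.
by apply (ex_RInt_continuous (V := realify V)) => t Ht; apply vcont_continuous, H.
Qed.

Lemma vint_FTC F f a b : (forall t, Rmin a b <= t <= Rmax a b -> vder F t (f t)) ->
  (forall t, Rmin a b <= t <= Rmax a b -> vcont f t) -> vint f a b (F b -v F a).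
Proof.
move=> HF Hf; apply (is_RInt_derive (V := realify V)) => t Ht.
- by apply vder_is_derive, HF.
- by apply vcont_continuous, Hf.
Qed.

Lemma vint_norm f (g : R -> R) a b l lg : a <= b ->
  (forall t, a <= t <= b -> norm (f t) <= g t) ->
  vint f a b l -> is_RInt g a b lg -> norm l <= lg.
Proof. exact: (norm_RInt_le (V := realify V) f g a b l lg). Qed.

Lemma vint_norm_const f a b l M : a <= b ->
  (forall t, a <= t <= b -> norm (f t) <= M) -> vint f a b l -> norm l <= (b - a) * M.
Proof. exact: (norm_RInt_le_const (V := realify V) f a b l M). Qed.

Lemma vint_ext f g a b l : a <= b ->
  (forall t, a <= t <= b -> f t = g t) -> vint f a b l -> vint g a b l.
Proof.
move=> ab E; apply (is_RInt_ext (V := realify V)) => t.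
by rewrite Rmin_left // Rmax_right // => Ht; apply E; lra.
Qed.

Lemma vint_Chasles f a b c l1 l2 : vint f a b l1 -> vint f b c l2 -> vint f a c (l1 +v l2).
Proof. exact: (is_RInt_Chasles (V := realify V) f a b c l1 l2). Qed.

Lemma vint_sub f g a b l1 l2 : vint f a b l1 -> vint g a b l2 ->
  vint (fun t => f t -v g t) a b (l1 -v l2).
Proof. exact: (is_RInt_minus (V := realify V) f g a b l1 l2). Qed.

Lemma vint_add f g a b l1 l2 : vint f a b l1 -> vint g a b l2 ->
  vint (fun t => f t +v g t) a b (l1 +v l2).
Proof. exact: (is_RInt_plus (V := realify V) f g a b l1 l2). Qed.

Lemma vint_swap f a b l : vint f a b l -> vint f b a (RtoC (-1) *v l).
Proof. by move=> H; rewrite -vopp_scal; exact: (is_RInt_swap (V := realify V) f b a l H). Qed.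

Lemma vint_comp_lin f u v a b l : vint f (u * a + v) (u * b + v) l ->
  vint (fun y => RtoC u *v f (u * y + v)) a b l.
Proof. exact: (is_RInt_comp_lin (V := realify V) f u v a b l). Qed.

Lemma vder_cont f t l : vder f t l -> vcont f t.
Proof.
move=> H e e0; have [d [d0 Hd]] := H 1 Rlt_0_1.
have L0 := norm_ge_0 l.
exists (Rmin d (e / (2 + norm l))); split.
  by apply Rmin_pos => //; apply Rdiv_lt_0_compat; lra.
move=> u Hu.
have H1 := Hd u (Rlt_le_trans _ _ _ Hu (Rmin_l _ _)).
have H2 := Rlt_le_trans _ _ _ Hu (Rmin_r _ _).
apply Rle_lt_trans with (1 := vnorm_le_sub _ (RtoC (u - t) *v l)).
have := vscal_norm (RtoC (u - t)) l; rewrite Cmod_R.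
have : (2 + norm l) * Rabs (u - t) < e.
  have -> : e = (2 + norm l) * (e / (2 + norm l)) by field; lra.
  by apply Rmult_lt_compat_l; lra.
have := Rabs_pos (u - t); nra.
Qed.

End Calculus.

(** A bounded linear map commutes with Riemann sums, hence with their limit. *)
Lemma vint_linear {V V' : CompleteNormedModule C_AbsRing} (L : V -> V') (f : R -> V) a b l :
  is_linear L -> vint f a b l -> vint (fun t => L (f t)) a b (L l).
Proof.
move=> HL Hf.
have LD : forall x y, L (x +v y) = L x +v L y by exact: linear_plus.
have LZ : forall (k : C) x, L (k *v x) = k *v L x by exact: linear_scal.
have L0 : L 0v = 0v by exact: linear_zero.
have [M [M0 HM]] := linear_norm L HL.
have RS : forall ptd, L (Riemann_sum (V := realify V) f ptd) =
    Riemann_sum (V := realify V') (fun t => L (f t)) ptd.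
  move=> ptd; apply (SF_cons_ind (T := R) (fun ptd => L (Riemann_sum (V := realify V) f ptd) =
    Riemann_sum (V := realify V') (fun t => L (f t)) ptd)) => [x|h s IH].
    exact: L0.
  rewrite !Riemann_sum_cons -IH.
  apply: (eq_trans (LD _ _)).
  exact: (f_equal (fun z => z +v L (Riemann_sum (V := realify V) f s)) (LZ (RtoC (SF_h s - fst h)) (f (snd h)))).
apply (filterlim_ext (fun ptd => L (scal (V := realify V) (sign (b - a)) (Riemann_sum (V := realify V) f ptd)))).
  by move=> ptd; rewrite -RS; exact: LZ.
apply filterlim_comp with (1 := Hf).
apply (proj2 (filterlim_locally_ball_norm (U := realify V') (F := locally (T := V) l) L (L l))) => e.
have e0 : 0 < e / M by apply Rdiv_lt_0_compat => //; exact: cond_pos.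
have := locally_ball_norm (V := realify V) l (mkposreal _ e0); apply filter_imp => y Hy.
change (norm (L y -v L l) < e).
have -> : L y -v L l = L (y -v l) by symmetry; exact: linear_minus.
apply Rle_lt_trans with (1 := HM _).
have -> : pos e = M * (e / M) by field; lra.
apply Rmult_lt_compat_l => //.
Qed.

Section ComplexCalculus.
Context {V : CompleteNormedModule C_AbsRing}.
Implicit Types f g F G : C -> V.

Definition ccont f (z : C) := forall e, 0 < e -> exists d, 0 < d /\
  forall y, Cmod (y - z) < d -> norm (f y -v f z) < e.

Definition cder F (z : C) (l : V) := forall e, 0 < e -> exists d, 0 < d /\
  forall y, Cmod (y - z) < d ->
    norm ((F y -v F z) -v (y - z) *v l) <= e * Cmod (y - z).

Definition pder (p : R -> C) (t : R) (p' : C) := forall e, 0 < e -> exists d, 0 < d /\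
  forall u, Rabs (u - t) < d -> Cmod (p u - p t - RtoC (u - t) * p') <= e * Rabs (u - t).

Lemma cder_bound F z l : cder F z l -> exists d, 0 < d /\
  forall y, Cmod (y - z) < d -> norm (F y -v F z) <= (1 + norm l) * Cmod (y - z).
Proof.
move=> H; have [d [d0 Hd]] := H 1 Rlt_0_1; exists d; split=> // y Hy.
apply Rle_trans with (1 := vnorm_le_sub _ ((y - z) *v l)).
have := Hd y Hy; have := vscal_norm (y - z) l; lra.
Qed.

Lemma cder_cont F z l : cder F z l -> ccont F z.
Proof.
move=> H e e0; have [d [d0 Hd]] := cder_bound F z l H.
have L0 := norm_ge_0 l.
exists (Rmin d (e / (1 + norm l))); split.
  by apply Rmin_pos => //; apply Rdiv_lt_0_compat; lra.
move=> y Hy.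
apply Rle_lt_trans with (1 := Hd y (Rlt_le_trans _ _ _ Hy (Rmin_l _ _))).
have -> : e = (1 + norm l) * (e / (1 + norm l)) by field; lra.
apply Rmult_lt_compat_l; first lra.
exact: Rlt_le_trans Hy (Rmin_r _ _).
Qed.

Lemma pder_bound p t p' : pder p t p' -> exists d, 0 < d /\
  forall u, Rabs (u - t) < d -> Cmod (p u - p t) <= (1 + Cmod p') * Rabs (u - t).
Proof.
move=> H; have [d [d0 Hd]] := H 1 Rlt_0_1; exists d; split=> // u Hu.
have -> : (p u - p t = (p u - p t - RtoC (u - t) * p') + RtoC (u - t) * p')%C by ring.
apply Rle_trans with (1 := Cmod_triangle _ _).
rewrite Cmod_mult Cmod_R; have := Hd u Hu; lra.
Qed.

Lemma ccont_path f p t p' : pder p t p' -> ccont f (p t) -> vcont (fun u => f (p u)) t.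
Proof.
move=> Hp Hf e e0; have [d [d0 Hd]] := Hf e e0.
have [d1 [d10 Hd1]] := pder_bound p t p' Hp.
have P0 := Cmod_ge_0 p'.
exists (Rmin d1 (d / (1 + Cmod p'))); split.
  by apply Rmin_pos => //; apply Rdiv_lt_0_compat; lra.
move=> u Hu; apply Hd.
apply Rle_lt_trans with (1 := Hd1 u (Rlt_le_trans _ _ _ Hu (Rmin_l _ _))).
have -> : d = (1 + Cmod p') * (d / (1 + Cmod p')) by field; lra.
apply Rmult_lt_compat_l; first lra.
exact: Rlt_le_trans Hu (Rmin_r _ _).
Qed.

(** [inc] is the increment of the parameter, real along a path and complex in a composition; one
    proof serves both. *)
Lemma cder_chain {U} F (p : U -> C) (t : U) (inc : U -> C) (p' : C) l :
  (forall e, 0 < e -> exists d, 0 < d /\ forall u, Cmod (inc u) < d ->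
    Cmod (p u - p t - inc u * p') <= e * Cmod (inc u)) ->
  cder F (p t) l ->
  forall e, 0 < e -> exists d, 0 < d /\ forall u, Cmod (inc u) < d ->
    norm ((F (p u) -v F (p t)) -v inc u *v (p' *v l)) <= e * Cmod (inc u).
Proof.
move=> Hp HF e e0.
have P0 := Cmod_ge_0 p'; have L0 := norm_ge_0 l.
have [d [d0 Hd]] := HF (e / (2 * (1 + Cmod p'))) ltac:(apply Rdiv_lt_0_compat; lra).
have [d1 [d10 Hd1]] := Hp 1 Rlt_0_1.
have [d2 [d20 Hd2]] := Hp (e / (2 * (1 + norm l))) ltac:(apply Rdiv_lt_0_compat; lra).
exists (Rmin (Rmin d1 d2) (d / (1 + Cmod p'))); split.
  by apply Rmin_pos; [exact: Rmin_pos | apply Rdiv_lt_0_compat; lra].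
move=> u Hu.
have Hu1 : Cmod (inc u) < d1.
  exact: Rlt_le_trans Hu (Rle_trans _ _ _ (Rmin_l _ _) (Rmin_l _ _)).
have Hu2 : Cmod (inc u) < d2.
  exact: Rlt_le_trans Hu (Rle_trans _ _ _ (Rmin_l _ _) (Rmin_r _ _)).
have Hu3 := Rlt_le_trans _ _ _ Hu (Rmin_r _ _).
have B : Cmod (p u - p t) <= (1 + Cmod p') * Cmod (inc u).
  have -> : (p u - p t = (p u - p t - inc u * p') + inc u * p')%C by ring.
  apply Rle_trans with (1 := Cmod_triangle _ _).
  by have := Hd1 u Hu1; rewrite Cmod_mult; lra.
have B' : Cmod (p u - p t) < d.
  apply Rle_lt_trans with (1 := B).
  have -> : d = (1 + Cmod p') * (d / (1 + Cmod p')) by field; lra.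
  by apply Rmult_lt_compat_l; lra.
have -> : (F (p u) -v F (p t)) -v inc u *v (p' *v l) =
  ((F (p u) -v F (p t)) -v (p u - p t) *v l) +v (p u - p t - inc u * p') *v l.
  by rewrite vscalA (vscalBl (p u - p t)); exact: vsub_trans2.
apply Rle_trans with (1 := vadd_norm _ _).
have H1 := Hd (p u) B'; have H2 := vscal_norm (p u - p t - inc u * p') l.
have H3 := Hd2 u Hu2.
have A0 := Cmod_ge_0 (inc u).
have H4 : e / (2 * (1 + Cmod p')) * Cmod (p u - p t) <= e / 2 * Cmod (inc u).
  have -> : e / 2 * Cmod (inc u) = e / (2 * (1 + Cmod p')) * ((1 + Cmod p') * Cmod (inc u)) by field; lra.
  apply Rmult_le_compat_l => //; apply Rlt_le, Rdiv_lt_0_compat; lra.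
have H5 : Cmod (p u - p t - inc u * p') * norm l <= e / 2 * Cmod (inc u).
  apply Rle_trans with (e / (2 * (1 + norm l)) * Cmod (inc u) * (1 + norm l)).
    apply Rmult_le_compat; [exact: Cmod_ge_0 | done | done | lra].
  right; field; lra.
lra.
Qed.

Lemma cder_path F p t p' l : pder p t p' -> cder F (p t) l ->
  vder (fun u => F (p u)) t (p' *v l).
Proof.
move=> Hp HF e e0.
have [|d [d0 Hd]] := cder_chain F p t (fun u => RtoC (u - t)) p' l _ HF e e0.
  by move=> e' e'0; have [d Hd] := Hp e' e'0; exists d; setoid_rewrite Cmod_R.
by exists d; split=> // u Hu; have := Hd u; rewrite Cmod_R; apply.
Qed.

Lemma segment_pder a b t : pder (segment a b) t (b - a).
Proof.
move=> e e0; exists 1; split; first lra.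
move=> u _; rewrite /segment.
have -> : ((1 - u)%R * a + u * b - ((1 - t)%R * a + t * b) - RtoC (u - t) * (b - a) = 0)%C.
  by apply C_eq; rewrite /Re /Im /=; ring.
rewrite Cmod_0; apply Rmult_le_pos; [lra | exact: Rabs_pos].
Qed.

Lemma vscal_vcont (k : C) (h : R -> V) t : vcont h t -> vcont (fun u => k *v h u) t.
Proof.
move=> H e e0; have P0 := Cmod_ge_0 k.
have [d [d0 Hd]] := H (e / (1 + Cmod k)) ltac:(apply Rdiv_lt_0_compat; lra).
exists d; split=> // u Hu; rewrite -vscalBr.
apply Rle_lt_trans with (1 := vscal_norm _ _).
apply Rle_lt_trans with (Cmod k * (e / (1 + Cmod k))).
  by apply Rmult_le_compat_l => //; left; exact: Hd.
apply (Rmult_lt_reg_r (1 + Cmod k)); first lra.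
have -> : Cmod k * (e / (1 + Cmod k)) * (1 + Cmod k) = Cmod k * e by field; lra.
nra.
Qed.

Lemma vscal_path_vcont (k : R -> C) (h : R -> V) t k' : pder k t k' -> vcont h t ->
  vcont (fun u => k u *v h u) t.
Proof.
move=> Hk Hh e e0.
have N0 := norm_ge_0 (h t).
have K0 := Cmod_ge_0 (k t); have K1 := Cmod_ge_0 k'.
have [d1 [d10 H1]] := pder_bound k t k' Hk.
set a := Rmin 1 (e / (2 * (Cmod (k t) + 1))).
have a0 : 0 < a by apply Rmin_pos; [lra | apply Rdiv_lt_0_compat; lra].
have [d2 [d20 H2]] := Hh a a0.
set q := Rmin 1 (e / (2 * (norm (h t) + 1))) / (1 + Cmod k').
have q0 : 0 < q by apply Rdiv_lt_0_compat; [apply Rmin_pos; [lra | apply Rdiv_lt_0_compat; lra] | lra].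
exists (Rmin (Rmin d1 d2) q); split; first by apply Rmin_pos => //; exact: Rmin_pos.
move=> u Hu.
have A1 := H1 u (Rlt_le_trans _ _ _ Hu (Rle_trans _ _ _ (Rmin_l _ _) (Rmin_l _ _))).
have A2 := H2 u (Rlt_le_trans _ _ _ Hu (Rle_trans _ _ _ (Rmin_l _ _) (Rmin_r _ _))).
have A3 := Rlt_le_trans _ _ _ Hu (Rmin_r _ _).
have A4 : Cmod (k u - k t) < e / (2 * (norm (h t) + 1)).
  apply Rle_lt_trans with (1 := A1).
  apply Rlt_le_trans with ((1 + Cmod k') * q); first by apply Rmult_lt_compat_l; lra.
  have -> : (1 + Cmod k') * q = Rmin 1 (e / (2 * (norm (h t) + 1))) by rewrite /q; field; lra.
  exact: Rmin_r.
have A5 : Cmod (k u) <= Cmod (k t) + 1.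
  have -> : k u = (k t + (k u - k t))%C by ring.
  apply Rle_trans with (1 := Cmod_triangle _ _).
  have : Cmod (k u - k t) <= 1; last lra.
  apply Rle_trans with (1 := A1); apply Rle_trans with ((1 + Cmod k') * q).
    by apply Rmult_le_compat_l; lra.
  have -> : (1 + Cmod k') * q = Rmin 1 (e / (2 * (norm (h t) + 1))) by rewrite /q; field; lra.
  exact: Rmin_l.
have A6 := Rlt_le_trans _ _ _ A2 (Rmin_r _ _).
have -> : k u *v h u -v k t *v h t = k u *v (h u -v h t) +v (k u - k t) *v h t.
  by rewrite vscalBr vscalBl; exact: vsub_trans2.
apply Rle_lt_trans with (1 := vadd_norm _ _).
have B1 := vscal_norm (k u) (h u -v h t); have B2 := vscal_norm (k u - k t) (h t).
have C1 : Cmod (k u) * norm (h u -v h t) < e / 2.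
  apply Rle_lt_trans with ((Cmod (k t) + 1) * norm (h u -v h t)).
    by apply Rmult_le_compat_r; [exact: norm_ge_0 | lra].
  have -> : e / 2 = (Cmod (k t) + 1) * (e / (2 * (Cmod (k t) + 1))) by field; lra.
  by apply Rmult_lt_compat_l; lra.
have C2 : Cmod (k u - k t) * norm (h t) <= e / 2.
  apply Rle_trans with (e / (2 * (norm (h t) + 1)) * (norm (h t) + 1)).
    by apply Rmult_le_compat; [exact: Cmod_ge_0 | done | lra | lra].
  by right; field; lra.
lra.
Qed.

Definition seg_fun f a b (t : R) : V := (b - a) *v f (segment a b t).

Definition sint f a b : V := RInt (V := realify V) (seg_fun f a b) 0 1.

Definition on_seg (P : C -> Prop) a b := forall t, 0 <= t <= 1 -> P (segment a b t).

Lemma seg_fun_vcont f a b : on_seg (ccont f) a b -> forall t, 0 <= t <= 1 -> vcont (seg_fun f a b) t.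
Proof.
move=> H t Ht; apply vscal_vcont, (ccont_path f _ _ _ (segment_pder a b t)), H; lra.
Qed.

Lemma sint_spec f a b : on_seg (ccont f) a b -> vint (seg_fun f a b) 0 1 (sint f a b).
Proof.
move=> H; apply (RInt_correct (V := realify V)).
have [|l Hl] := vint_ex (seg_fun f a b) 0 1; last by exists l.
move=> t; rewrite Rmin_left ?Rmax_right; [|lra|lra] => Ht.
exact: seg_fun_vcont.
Qed.

Lemma sint_eq f a b l : vint (seg_fun f a b) 0 1 l -> sint f a b = l.
Proof. exact: (is_RInt_unique (V := realify V)). Qed.

Lemma segment0 a b : segment a b 0 = a.
Proof. by apply C_eq; rewrite /segment /Re /Im /=; ring. Qed.

Lemma segment1 a b : segment a b 1 = b.
Proof. by apply C_eq; rewrite /segment /Re /Im /=; ring. Qed.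

Lemma seg_FTC G g a b : on_seg (fun z => cder G z (g z)) a b -> on_seg (ccont g) a b ->
  vint (seg_fun g a b) 0 1 (G b -v G a).
Proof.
move=> HG Hg.
have := vint_FTC (fun t => G (segment a b t)) (seg_fun g a b) 0 1.
rewrite segment0 segment1 Rmin_left ?Rmax_right; [|lra|lra]; apply => t Ht.
- by apply (cder_path _ _ _ _ _ (segment_pder a b t)), HG.
- exact: seg_fun_vcont.
Qed.

(** Compares the integral of f with the increment of a primitive of a nearby g: an affine function
    in [Goursat], a constant in [primitive_der]. *)
Lemma seg_approx f g G a b e :
  on_seg (fun z => cder G z (g z)) a b -> on_seg (ccont g) a b -> on_seg (ccont f) a b ->
  on_seg (fun z => norm (f z -v g z) <= e) a b ->
  norm (sint f a b -v (G b -v G a)) <= Cmod (b - a) * e.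
Proof.
move=> HG Hg Hf He.
have I := vint_sub _ _ _ _ _ _ (sint_spec f a b Hf) (seg_FTC G g a b HG Hg).
have := vint_norm_const _ 0 1 _ (Cmod (b - a) * e) Rle_0_1 _ I.
rewrite Rminus_0_r Rmult_1_l; apply => t Ht.
rewrite /seg_fun -vscalBr; apply Rle_trans with (1 := vscal_norm _ _).
by apply Rmult_le_compat_l; [exact: Cmod_ge_0 | exact: He].
Qed.

Lemma segment_rev a b t : segment b a t = segment a b (1 - t).
Proof. by apply C_eq; rewrite /segment /Re /Im /=; ring. Qed.

Lemma on_seg_rev P a b : on_seg P a b -> on_seg P b a.
Proof. by move=> H t Ht; rewrite segment_rev; apply H; lra. Qed.

Lemma sint_rev f a b : on_seg (ccont f) a b -> sint f b a = RtoC (-1) *v sint f a b.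
Proof.
move=> H; apply sint_eq.
have I0 := vint_swap _ _ _ _ (sint_spec f a b H).
have I1 : vint (seg_fun f a b) (-1 * 0 + 1) (-1 * 1 + 1) (RtoC (-1) *v sint f a b).
  have -> : -1 * 0 + 1 = 1 by ring.
  by have -> : -1 * 1 + 1 = 0 by ring.
have := vint_comp_lin _ _ _ _ _ _ I1; apply vint_ext; first lra.
move=> t Ht; rewrite /seg_fun vscalA segment_rev; f_equal; last by do 2 f_equal; ring.
by apply C_eq; rewrite /Re /Im /=; ring.
Qed.

Definition mid (a b : C) : C := segment a b (1 / 2).

Lemma segment_left a b t : segment a (mid a b) t = segment a b (1 / 2 * t + 0).
Proof. by apply C_eq; rewrite /mid /segment /Re /Im /=; field. Qed.

Lemma segment_right a b t : segment (mid a b) b t = segment a b (1 / 2 * t + 1 / 2).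
Proof. by apply C_eq; rewrite /mid /segment /Re /Im /=; field. Qed.

Lemma sint_mid f a b : on_seg (ccont f) a b ->
  sint f a b = sint f a (mid a b) +v sint f (mid a b) b.
Proof.
move=> H.
have Hl : on_seg (ccont f) a (mid a b) by move=> t Ht; rewrite segment_left; apply H; lra.
have Hr : on_seg (ccont f) (mid a b) b by move=> t Ht; rewrite segment_right; apply H; lra.
have half : forall u v, 0 <= u <= v -> v <= 1 -> exists l, vint (seg_fun f a b) u v l.
  move=> u v Huv Hv; apply vint_ex => t; rewrite Rmin_left ?Rmax_right; try lra.
  by move=> Ht; apply seg_fun_vcont => //; lra.
have [l1 H1] := half 0 (1 / 2) ltac:(lra) ltac:(lra).
have [l2 H2] := half (1 / 2) 1 ltac:(lra) ltac:(lra).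
rewrite (sint_eq f a b _ (vint_Chasles _ _ _ _ _ _ H1 H2)).
f_equal; symmetry; apply sint_eq.
- have I1 : vint (seg_fun f a b) (1 / 2 * 0 + 0) (1 / 2 * 1 + 0) l1.
    have -> : 1 / 2 * 0 + 0 = 0 by ring.
    by have -> : 1 / 2 * 1 + 0 = 1 / 2 by ring.
  have := vint_comp_lin _ _ _ _ _ _ I1; apply vint_ext; first lra.
  move=> t Ht; rewrite /seg_fun vscalA segment_left; f_equal.
  by apply C_eq; rewrite /mid /segment /Re /Im /=; field.
- have I1 : vint (seg_fun f a b) (1 / 2 * 0 + 1 / 2) (1 / 2 * 1 + 1 / 2) l2.
    have -> : 1 / 2 * 0 + 1 / 2 = 1 / 2 by ring.
    by have -> : 1 / 2 * 1 + 1 / 2 = 1 by field.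
  have := vint_comp_lin _ _ _ _ _ _ I1; apply vint_ext; first lra.
  move=> t Ht; rewrite /seg_fun vscalA segment_right; f_equal.
  by apply C_eq; rewrite /mid /segment /Re /Im /=; field.
Qed.

End ComplexCalculus.

(** * Goursat's theorem and primitives *)

Definition hull3 (a b c z : C) : Prop := exists s t u : R,
  0 <= s /\ 0 <= t /\ 0 <= u /\ s + t + u = 1 /\
  z = (RtoC s * a + RtoC t * b + RtoC u * c)%C.

Lemma hull3_seg_ab a b c t : 0 <= t <= 1 -> hull3 a b c (segment a b t).
Proof.
move=> Ht; exists (1 - t), t, 0; split; [lra|split; [lra|split; [lra|split; [lra|]]]].
by rewrite /segment; ring.
Qed.

Lemma hull3_rot a b c z : hull3 a b c z -> hull3 b c a z.
Proof.
move=> [s [t [u [Hs [Ht [Hu [E ->]]]]]]]; exists t, u, s; do 3 (split=> //); split; [lra | ring].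
Qed.

Lemma hull3_trans a b c x y w z : hull3 a b c x -> hull3 a b c y -> hull3 a b c w ->
  hull3 x y w z -> hull3 a b c z.
Proof.
move=> [s1 [t1 [u1 [? [? [? [? ->]]]]]]] [s2 [t2 [u2 [? [? [? [? ->]]]]]]]
  [s3 [t3 [u3 [? [? [? [? ->]]]]]]] [s [t [u [? [? [? [? ->]]]]]]].
exists (s * s1 + t * s2 + u * s3), (s * t1 + t * t2 + u * t3), (s * u1 + t * u2 + u * u3).
do 3 (split; first by nra).
split; last by rewrite !RtoC_plus !RtoC_mult; ring.
have -> : s * s1 + t * s2 + u * s3 + (s * t1 + t * t2 + u * t3) + (s * u1 + t * u2 + u * u3) =
  s * (s1 + t1 + u1) + t * (s2 + t2 + u2) + u * (s3 + t3 + u3) by ring.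
nra.
Qed.

Lemma hull3_dist a b c z d : Cmod (b - a) <= d -> Cmod (a - c) <= d -> hull3 a b c z -> Cmod (z - a) <= d.
Proof.
move=> Hb Hc [s [t [u [Hs [Ht [Hu [E ->]]]]]]].
have -> : (RtoC s * a + RtoC t * b + RtoC u * c - a = RtoC t * (b - a) + RtoC (- u) * (a - c))%C.
  have -> : s = 1 - t - u by lra.
  by apply C_eq; rewrite /Re /Im /=; ring.
apply Rle_trans with (1 := Cmod_triangle _ _).
rewrite !Cmod_mult !Cmod_R Rabs_Ropp !Rabs_pos_eq //.
have d0 : 0 <= d by apply Rle_trans with (2 := Hb); exact: Cmod_ge_0.
have := Rmult_le_compat_l _ _ _ Ht Hb; have := Rmult_le_compat_l _ _ _ Hu Hc; nra.
Qed.

Lemma hull3_vertex a b c : hull3 a b c a.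
Proof. exists 1, 0, 0; do 3 (split; first lra); split; [lra | ring]. Qed.

Lemma mid_seg_Cmod (a b c : C) : Cmod (mid c a - mid a b) = / 2 * Cmod (c - b).
Proof.
have -> : (mid c a - mid a b = RtoC (/ 2) * (c - b))%C.
  by apply C_eq; rewrite /mid /segment /Re /Im /=; field.
by rewrite Cmod_mult Cmod_R Rabs_pos_eq; lra.
Qed.

Lemma mid_Cmod_l (a b : C) : Cmod (mid a b - a) = / 2 * Cmod (b - a).
Proof.
have -> : (mid a b - a = RtoC (/ 2) * (b - a))%C.
  by apply C_eq; rewrite /mid /segment /Re /Im /=; field.
by rewrite Cmod_mult Cmod_R Rabs_pos_eq; lra.
Qed.

Lemma mid_Cmod_r (a b : C) : Cmod (b - mid a b) = / 2 * Cmod (b - a).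
Proof.
have -> : (b - mid a b = RtoC (/ 2) * (b - a))%C.
  by apply C_eq; rewrite /mid /segment /Re /Im /=; field.
by rewrite Cmod_mult Cmod_R Rabs_pos_eq; lra.
Qed.

Section Goursat.
Context {V : CompleteNormedModule C_AbsRing}.
Variable f : C -> V.

Definition tri (a b c : C) : V := sint f a b +v (sint f b c +v sint f c a).

Record triangle := Triangle { ta : C; tb : C; tc : C }.
Definition thull (x : triangle) := hull3 (ta x) (tb x) (tc x).
Definition tint (x : triangle) := tri (ta x) (tb x) (tc x).
Definition tdiam (x : triangle) (d : R) :=
  Cmod (tb x - ta x) <= d /\ Cmod (tc x - tb x) <= d /\ Cmod (ta x - tc x) <= d.

(** One of the four triangles cut at the midpoints carries at least a quarter of the integral. The
    hypotheses stand inside the existential, so that a choice function is defined on all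
    triangles. *)
Lemma tri_quarter (x : triangle) (d : R) : exists y : triangle,
  tdiam x d -> (forall z, thull x z -> ccont f z) ->
  (forall z, thull y z -> thull x z) /\ tdiam y (d / 2) /\ norm (tint x) <= 4 * norm (tint y).
Proof.
case: (classic (tdiam x d /\ forall z, thull x z -> ccont f z)) => [[Hd Hc]|N]; last first.
  by exists x => H1 H2; case: N.
case: x Hd Hc => a b c [/= D1 [D2 D3]] Hc; rewrite /thull /= in Hc.
have Hab : hull3 a b c (mid a b) by apply hull3_seg_ab; lra.
have Hbc : hull3 a b c (mid b c) by do 2 apply hull3_rot; apply hull3_seg_ab; lra.
have Hca : hull3 a b c (mid c a) by apply hull3_rot; apply hull3_seg_ab; lra.
have Ha := hull3_vertex a b c.
have Hb : hull3 a b c b by do 2 apply hull3_rot; exact: hull3_vertex.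
have Hcc : hull3 a b c c by apply hull3_rot; exact: hull3_vertex.
have cseg : forall u v, hull3 a b c u -> hull3 a b c v -> on_seg (ccont f) u v.
  move=> u v Hu Hv t Ht; apply Hc; apply (hull3_trans a b c u v v) => //.
  exact: hull3_seg_ab.
set y1 := Triangle a (mid a b) (mid c a).
set y2 := Triangle (mid a b) b (mid b c).
set y3 := Triangle (mid c a) (mid b c) c.
set y4 := Triangle (mid b c) (mid c a) (mid a b).
have E : tri a b c = ((tint y1 +v tint y2) +v tint y3) +v tint y4.
  rewrite /tint /tri /= (sint_mid f a b) ?(sint_mid f b c) ?(sint_mid f c a); try exact: cseg.
  rewrite (sint_rev f (mid c a) (mid a b)); last exact: cseg.
  rewrite (sint_rev f (mid a b) (mid b c)); last exact: cseg.
  rewrite (sint_rev f (mid b c) (mid c a)); last exact: cseg.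
  exact: vquarter.
have sub : forall u v w, hull3 a b c u -> hull3 a b c v -> hull3 a b c w ->
    forall z, thull (Triangle u v w) z -> hull3 a b c z.
  by move=> u v w Hu Hv Hw z; exact: hull3_trans.
have m1 := mid_seg_Cmod a b c; have m2 := mid_seg_Cmod b c a; have m3 := mid_seg_Cmod c a b.
have l1 := mid_Cmod_l a b; have l2 := mid_Cmod_l b c; have l3 := mid_Cmod_l c a.
have r1 := mid_Cmod_r a b; have r2 := mid_Cmod_r b c; have r3 := mid_Cmod_r c a.
have four : exists y, (y = y1 \/ y = y2 \/ y = y3 \/ y = y4) /\ norm (tri a b c) <= 4 * norm (tint y).
  have T : norm (tri a b c) <= norm (tint y1) + norm (tint y2) + norm (tint y3) + norm (tint y4).
    rewrite E.
    have := vadd_norm ((tint y1 +v tint y2) +v tint y3) (tint y4).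
    have := vadd_norm (tint y1 +v tint y2) (tint y3).
    have := vadd_norm (tint y1) (tint y2); lra.
  case: (Rle_dec (norm (tri a b c)) (4 * norm (tint y1))) => N1; first by exists y1; split; [left|].
  case: (Rle_dec (norm (tri a b c)) (4 * norm (tint y2))) => N2; first by exists y2; split; [right; left|].
  case: (Rle_dec (norm (tri a b c)) (4 * norm (tint y3))) => N3; first by exists y3; split; [right; right; left|].
  exists y4; split; first by right; right; right.
  lra.
have [y [Hy Hn]] := four; exists y => _ _; split; [|split] => //.
- by case: Hy => [->|[->|[->|->]]] z; apply sub.
- case: Hy => [->|[->|[->|->]]]; rewrite /tdiam /=; do ?split; try lra;
  rewrite Cmod_sub_sym; lra.
Qed.

Lemma cder_quadratic (p : C) (k l : V) (z : C) :
  cder (fun y => (y - p) *v k +v ((y - p) * (y - p) * RtoC (/ 2)) *v l) z (k +v (z - p) *v l).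
Proof.
move=> e e0; have L0 := norm_ge_0 l.
exists (e / (1 + norm l)); split; first by apply Rdiv_lt_0_compat; lra.
move=> y Hy.
have -> : (((y - p) *v k +v ((y - p) * (y - p) * RtoC (/ 2)) *v l) -v
  ((z - p) *v k +v ((z - p) * (z - p) * RtoC (/ 2)) *v l)) -v (y - z) *v (k +v (z - p) *v l) =
  ((y - z) * (y - z) * RtoC (/ 2)) *v l.
  have E : RtoC (/ 2) = (RtoC 1 - RtoC (/ 2))%C.
    by apply C_eq; rewrite /Re /Im /=; field.
  exact: vquadratic.
apply Rle_trans with (1 := vscal_norm _ _).
rewrite !Cmod_mult Cmod_R Rabs_pos_eq; last lra.
have Y0 := Cmod_ge_0 (y - z).
have : Cmod (y - z) * norm l <= e.
  apply Rle_trans with (e / (1 + norm l) * (1 + norm l)); last by right; field; lra.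
  apply Rmult_le_compat => //; [exact: Rlt_le | lra].
nra.
Qed.

(** Nested triangles shrink to a point p near which f is affine up to e |z - p|, and affine
    functions have primitives. The margin h secures differentiability at p, which is only obtained
    as a limit of vertices. *)
Theorem Goursat (a b c : C) (h : R) : 0 < h ->
  (forall z, hull3 a b c z -> forall y, Cmod (y - z) < h -> exists l, cder f y l) ->
  tri a b c = 0v.
Proof.
move=> h0 Hf.
set x0 := Triangle a b c.
set d := Cmod (b - a) + Cmod (c - b) + Cmod (a - c).
have g1 := Cmod_ge_0 (b - a); have g2 := Cmod_ge_0 (c - b); have g3 := Cmod_ge_0 (a - c).
have d0 : 0 <= d by rewrite /d; lra.
have D0 : tdiam x0 d by rewrite /tdiam /d /=; lra.
have Hc0 : forall z, thull x0 z -> ccont f z.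
  move=> z Hz; have [|l Hl] := Hf z Hz z; last exact: cder_cont Hl.
  by rewrite /Cminus Cplus_opp_r Cmod_0.
set nx := fun x e => proj1_sig (constructive_indefinite_description _ (tri_quarter x e)).
have Hnx : forall x e, tdiam x e -> (forall z, thull x z -> ccont f z) ->
  (forall z, thull (nx x e) z -> thull x z) /\ tdiam (nx x e) (e / 2) /\ norm (tint x) <= 4 * norm (tint (nx x e)).
  by move=> x e; exact: (proj2_sig (constructive_indefinite_description _ (tri_quarter x e))).
set t := fix t n := if n is S k then nx (t k) (d / 2 ^ k) else x0.
have P : forall n, 0 < 2 ^ n by move=> n; apply pow_lt; lra.
have Ht : forall n, (forall z, thull (t n) z -> thull x0 z) /\ tdiam (t n) (d / 2 ^ n) /\
    norm (tint x0) <= 4 ^ n * norm (tint (t n)).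
  elim=> [|n [I1 [I2 I3]]].
    by split=> //; split; [rewrite /= /Rdiv Rinv_1 Rmult_1_r | rewrite /=; lra].
  have [J1 [J2 J3]] := Hnx (t n) (d / 2 ^ n) I2 (fun z Hz => Hc0 z (I1 z Hz)).
  split; first by move=> z Hz; apply I1, J1.
  split.
    have -> : d / 2 ^ S n = d / 2 ^ n / 2 by rewrite /=; field; have := P n; lra.
    exact: J2.
  apply Rle_trans with (1 := I3); rewrite [4 ^ S n]/=.
  have -> : 4 * 4 ^ n * norm (tint (t (S n))) = 4 ^ n * (4 * norm (tint (t (S n)))) by ring.
  by apply Rmult_le_compat_l => //; apply pow_le; lra.
have nest : forall n k z, thull (t (n + k)%nat) z -> thull (t n) z.
  move=> n; elim=> [|k IH] z; first by rewrite Nat.add_0_r.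
  rewrite Nat.add_succ_r => Hz; apply IH.
  have [I1 [I2 _]] := Ht (n + k)%nat.
  have [J1 _] := Hnx (t (n + k)%nat) (d / 2 ^ (n + k)) I2 (fun z Hz => Hc0 z (I1 z Hz)).
  exact: J1.
have dist : forall n z, thull (t n) z -> Cmod (z - ta (t n)) <= d / 2 ^ n.
  move=> n z Hz; have [_ [[D1 [_ D3]] _]] := Ht n.
  exact: hull3_dist D1 D3 Hz.
have step : forall n k, Cmod (ta (t (n + k)%nat) - ta (t n)) <= d / 2 ^ n.
  by move=> n k; apply dist, (nest n k), hull3_vertex.
have half : 0 <= / 2 < 1 by lra.
have [|p Hp] := geometric_cv (X := C_CompleteNormedModule) (fun n => ta (t n)) d (/ 2) half.
  move=> n; have := step n 1%nat; rewrite Nat.add_1_r pow_inv; exact.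
have near : forall n, Cmod (p - ta (t n)) <= d / 2 ^ n.
  move=> n; apply le_epsilon => e e0; have [N HN] := Hp e e0.
  have A := HN (n + N)%nat ltac:(lia).
  have A' : Cmod (ta (t (n + N)%nat) - p) < e := A.
  have := step n N; have := Cmod_triangle3 (ta (t (n + N)%nat)) p (ta (t n)).
  rewrite (Cmod_sub_sym p (ta (t (n + N)%nat))); lra.
have small : forall e, 0 < e -> exists n, 2 * (d / 2 ^ n) < e.
  move=> e e0.
  have [N HN] := pow_small (/ 2) (e / (2 * (d + 1))) half ltac:(apply Rdiv_lt_0_compat; lra).
  exists N; have := HN N (Nat.le_refl N); rewrite pow_inv => L.
  have iP : 0 < / 2 ^ N by apply Rinv_0_lt_compat.
  have -> : e = 2 * (d + 1) * (e / (2 * (d + 1))) by field; lra.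
  apply Rle_lt_trans with (2 * (d + 1) * / 2 ^ N); first by rewrite /Rdiv; nra.
  by apply Rmult_lt_compat_l; lra.
have [l Hl] : exists l, cder f p l.
  have [n Hn] := small h h0.
  have Hz : hull3 a b c (ta (t n)) by apply (proj1 (Ht n)); exact: hull3_vertex.
  apply (Hf _ Hz); have := near n; have := Cmod_ge_0 (p - ta (t n)); lra.
(* Three sides of length at most r = d/2^n with error 2 e r give 6 e r^2, and 4^n r^2 = d^2. *)
have bound : forall e, 0 < e -> norm (tint x0) <= e * (6 * d * d).
  move=> e e0; have [dl [dl0 Hdl]] := Hl e e0.
  have [n Hn] := small dl dl0.
  have [I1 [[D1 [D2 D3]] I3]] := Ht n.
  set r := d / 2 ^ n in Hn D1 D2 D3.
  have r0 : 0 <= r by apply Rdiv_le_0_compat.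
  set G := fun y : C => (y - p) *v f p +v ((y - p) * (y - p) * RtoC (/ 2)) *v l.
  set g := fun y : C => f p +v (y - p) *v l.
  have HG : forall z, cder G z (g z) by move=> z; exact: cder_quadratic.
  have Hg : forall z, ccont g z.
    move=> z e1 e10; have L0 := norm_ge_0 l.
    exists (e1 / (1 + norm l)); split; first by apply Rdiv_lt_0_compat; lra.
    move=> y Hy; have -> : g y -v g z = (y - z) *v l by exact: vaffine_diff.
    apply Rle_lt_trans with (1 := vscal_norm _ _).
    have Y0 := Cmod_ge_0 (y - z).
    apply Rle_lt_trans with (Cmod (y - z) * (1 + norm l)); first nra.
    have -> : e1 = e1 / (1 + norm l) * (1 + norm l) by field; lra.
    by apply Rmult_lt_compat_r; lra.
  have close : forall z, thull (t n) z -> norm (f z -v g z) <= e * (2 * r).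
    move=> z Hz; have Dz : Cmod (z - p) <= 2 * r.
      have := dist n z Hz; have := near n; have := Cmod_triangle3 (ta (t n)) z p.
      rewrite (Cmod_sub_sym (ta (t n)) p) -/r; lra.
    have := Hdl z ltac:(lra).
    have -> : (f z -v f p) -v (z - p) *v l = f z -v g z by exact: vsub_assoc2.
    by have := Rmult_le_compat_l _ _ _ (Rlt_le _ _ e0) Dz; lra.
  have edge : forall u v, Cmod (v - u) <= r -> (forall s, 0 <= s <= 1 -> thull (t n) (segment u v s)) ->
      norm (sint f u v -v (G v -v G u)) <= r * (e * (2 * r)).
    move=> u v Huv Hs.
    apply Rle_trans with (Cmod (v - u) * (e * (2 * r))).
      apply (seg_approx f g G); [by move=> s _; exact: HG | by move=> s _; exact: Hg | |].
      - by move=> s Hs'; apply Hc0, I1, Hs.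
      - by move=> s Hs'; apply close, Hs.
    by apply Rmult_le_compat_r => //; nra.
  case: (t n) D1 D2 D3 I3 edge close => A B C' /= D1 D2 D3 I3 edge _.
  have E1 := edge A B D1 (fun s Hs => hull3_seg_ab A B C' s Hs).
  have E2 := edge B C' D2 (fun s Hs => hull3_rot _ _ _ _ (hull3_rot _ _ _ _ (hull3_seg_ab B C' A s Hs))).
  have E3 := edge C' A D3 (fun s Hs => hull3_rot _ _ _ _ (hull3_seg_ab C' A B s Hs)).
  have tl : norm (tint (Triangle A B C')) <= 3 * (r * (e * (2 * r))).
    have -> : tint (Triangle A B C') = (sint f A B -v (G B -v G A)) +v
      ((sint f B C' -v (G C' -v G B)) +v (sint f C' A -v (G A -v G C'))).
      exact: vtri_cancel.
    apply Rle_trans with (1 := vadd_norm _ _).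
    have := vadd_norm (sint f B C' -v (G C' -v G B)) (sint f C' A -v (G A -v G C')); lra.
  apply Rle_trans with (1 := I3).
  apply Rle_trans with (4 ^ n * (3 * (r * (e * (2 * r))))).
    by apply Rmult_le_compat_l => //; apply pow_le; lra.
  right; have -> : 4 ^ n = 2 ^ n * 2 ^ n by rewrite -Rpow_mult_distr; f_equal; ring.
  by rewrite /r; field; have := P n; lra.
apply norm_eq_zero, Rle_antisym; last exact: norm_ge_0.
apply le_epsilon => e e0; rewrite Rplus_0_l.
have dd : 0 <= 6 * d * d by nra.
apply Rle_trans with (1 := bound (e / (6 * d * d + 1)) ltac:(apply Rdiv_lt_0_compat; lra)).
have -> : e / (6 * d * d + 1) * (6 * d * d) = e * (6 * d * d / (6 * d * d + 1)) by field; lra.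
rewrite -{2}(Rmult_1_r e); apply Rmult_le_compat_l; first lra.
apply (Rmult_le_reg_r (6 * d * d + 1)); first lra.
rewrite /Rdiv Rmult_assoc Rinv_l; lra.
Qed.

End Goursat.

(** * Primitives on star-shaped domains *)

Section StarPrimitive.
Context {V : CompleteNormedModule C_AbsRing}.
Variables (D : C -> Prop) (f : C -> V).
Hypothesis D_open : forall z, D z -> exists e, 0 < e /\ forall y, Cmod (y - z) < e -> D y.
Hypothesis D_star : forall (t : R) z, 0 <= t <= 1 -> D z -> D (RtoC t * z)%C.
Hypothesis f_der : forall z, D z -> exists l, cder f z l.

(** The ball at 0 serves the t below t0, for which t z stays in half of it; the ball at z, scaled by
    t, serves the others. *)
Lemma star_tube (z : C) : D z -> exists h, 0 < h /\
  forall t y, 0 <= t <= 1 -> Cmod (y - RtoC t * z) < h -> D y.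
Proof.
move=> Dz; have D0 : D 0 by have := D_star 0 z ltac:(lra) Dz; rewrite Cmult_0_l.
have [e0 [e00 H0]] := D_open 0 D0; have [e1 [e10 H1]] := D_open z Dz.
have Z0 := Cmod_ge_0 z.
set t0 := e0 / (2 * (Cmod z + 1)).
have t00 : 0 < t0 by apply Rdiv_lt_0_compat; lra.
exists (Rmin (t0 * e1) (e0 / 2)); split; first by apply Rmin_pos; [apply Rmult_lt_0_compat | lra].
move=> t y Ht Hy.
have Hy1 := Rlt_le_trans _ _ _ Hy (Rmin_l _ _).
have Hy2 := Rlt_le_trans _ _ _ Hy (Rmin_r _ _).
case: (Rlt_le_dec t t0) => Htt.
- apply H0; have -> : (y - 0 = (y - RtoC t * z) + RtoC t * z)%C by ring.
  apply Rle_lt_trans with (1 := Cmod_triangle _ _).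
  rewrite Cmod_mult Cmod_R Rabs_pos_eq; last lra.
  have : t * Cmod z <= e0 / 2; last lra.
  apply Rle_trans with (t0 * (Cmod z + 1)); first nra.
  by right; rewrite /t0; field; lra.
- have t1 : RtoC t <> 0 by move=> E; injection E; lra.
  have -> : y = (RtoC t * (y / RtoC t))%C by field.
  apply D_star => //; apply H1.
  have -> : (y / RtoC t - z = (y - RtoC t * z) / RtoC t)%C by field.
  rewrite Cmod_div // Cmod_R Rabs_pos_eq; last lra.
  apply (Rmult_lt_reg_r t); first lra.
  rewrite /Rdiv Rmult_assoc Rinv_l; nra.
Qed.

Definition star_primitive (z : C) : V := sint f 0 z.

(** [Goursat] on the triangle 0, z, w turns the increment of the primitive into the integral along
    [z, w]. *)
Lemma primitive_der (z : C) : D z -> cder star_primitive z (f z).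
Proof.
move=> Dz e e0; have [h [h0 Hh]] := star_tube z Dz.
have [l Hl] := f_der z Dz.
have [d [d0 Hd]] := cder_cont f z l Hl e e0.
exists (Rmin d (h / 2)); split; first by apply Rmin_pos; lra.
move=> w Hw.
have Hw1 := Rlt_le_trans _ _ _ Hw (Rmin_l _ _).
have Hw2 := Rlt_le_trans _ _ _ Hw (Rmin_r _ _).
have near : forall y, hull3 0 z w y -> exists t, 0 <= t <= 1 /\ Cmod (y - RtoC t * z) < h / 2.
  move=> y [s [t [u [Hs [Ht [Hu [E ->]]]]]]]; exists (t + u); split; first lra.
  have -> : (RtoC s * 0 + RtoC t * z + RtoC u * w - RtoC (t + u) * z = RtoC u * (w - z))%C.
    by rewrite RtoC_plus; ring.
  rewrite Cmod_mult Cmod_R Rabs_pos_eq //; have := Cmod_ge_0 (w - z); nra.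
have Hder : forall y, hull3 0 z w y -> forall x, Cmod (x - y) < h / 2 -> exists l, cder f x l.
  move=> y Hy x Hx; apply f_der; have [t [Ht Hty]] := near y Hy.
  apply (Hh t) => //; have := Cmod_triangle3 y x (RtoC t * z); lra.
have cc : forall y, hull3 0 z w y -> ccont f y.
  move=> y Hy; have [|l' Hl'] := Hder y Hy y; last exact: cder_cont Hl'.
  by rewrite /Cminus Cplus_opp_r Cmod_0; lra.
have G := Goursat f 0 z w (h / 2) ltac:(lra) Hder.
have c1 : on_seg (ccont f) z w.
  by move=> t Ht; apply cc; do 2 apply hull3_rot; exact: hull3_seg_ab.
have c2 : on_seg (ccont f) 0 w.
  by apply on_seg_rev => t Ht; apply cc; apply hull3_rot; exact: hull3_seg_ab.
have E : star_primitive w -v star_primitive z = sint f z w.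
  by move: G; rewrite /tri (sint_rev f 0 w c2); exact: vtri_close.
rewrite E.
have := seg_approx f (fun _ => f z) (fun y => y *v f z) z w e.
have -> : w *v f z -v z *v f z = (w - z) *v f z by rewrite vscalBl.
rewrite Rmult_comm; apply => //.
- move=> t Ht e' e'0; exists 1; split; first lra.
  move=> y _; rewrite vscalBl vsubv (norm_zero (V := V)).
  apply Rmult_le_pos; [lra | exact: Cmod_ge_0].
- move=> t Ht e' e'0; exists 1; split; first lra.
  by move=> y _; rewrite vsubv (norm_zero (V := V)).
- move=> t Ht; left; apply Hd.
  have -> : (segment z w t - z = RtoC t * (w - z))%C.
    by apply C_eq; rewrite /segment /Re /Im /=; ring.
  rewrite Cmod_mult Cmod_R Rabs_pos_eq; last lra.
  have := Cmod_ge_0 (w - z); nra.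
Qed.

Variable M : R.
Hypothesis f_bound : forall z, D z -> norm (f z) <= M.
Hypothesis D_real : forall t, 0 <= t < 1 -> D (RtoC t).

Lemma primitive_shrink (w : C) (s : R) : 0 <= s <= 1 -> D w ->
  norm (star_primitive w -v star_primitive (RtoC s * w)) <= (1 - s) * Cmod w * M.
Proof.
move=> Hs Dw.
have HD : on_seg D (RtoC s * w) w.
  move=> t Ht; have -> : segment (RtoC s * w) w t = (RtoC ((1 - t) * s + t) * w)%C.
    by apply C_eq; rewrite /segment /Re /Im /=; ring.
  by apply D_star => //; nra.
have I := seg_FTC star_primitive f (RtoC s * w) w (fun t Ht => primitive_der _ (HD t Ht))
  (fun t Ht => let: ex_intro l Hl := f_der _ (HD t Ht) in cder_cont _ _ _ Hl).
have := vint_norm_const _ 0 1 _ ((1 - s) * Cmod w * M) Rle_0_1 _ I.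
rewrite Rminus_0_r Rmult_1_l; apply => t Ht.
apply Rle_trans with (1 := vscal_norm _ _).
have -> : (w - RtoC s * w = RtoC (1 - s) * w)%C by apply C_eq; rewrite /Re /Im /=; ring.
rewrite Cmod_mult Cmod_R Rabs_pos_eq; last lra.
apply Rmult_le_compat_l; last exact: f_bound (HD t Ht).
by apply Rmult_le_pos; [lra | exact: Cmod_ge_0].
Qed.

(** 1 may lie on the boundary of D. As f is bounded, the primitive is uniformly Lipschitz along
    rays, so its values at points w near 1 are compared through s w with s < 1, which is close to s,
    a point of D where the primitive is continuous. *)
Lemma primitive_limit : exists l : V, forall e, 0 < e -> exists d, 0 < d /\
  forall w, D w -> Cmod (w - 1) < d -> norm (star_primitive w -v l) < e.
Proof.
have M0 : 0 <= M.
  by apply Rle_trans with (2 := f_bound _ (D_real 0 ltac:(lra))); exact: norm_ge_0.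
have cauchy : forall e, 0 < e -> exists d, 0 < d /\ forall w w', D w -> D w' ->
    Cmod (w - 1) < d -> Cmod (w' - 1) < d -> norm (star_primitive w -v star_primitive w') < e.
  move=> e e0.
  set k := e / (16 * (M + 1) + e).
  have k01 : 0 < k < 1.
    split; first by apply Rdiv_lt_0_compat; lra.
    apply (Rmult_lt_reg_r (16 * (M + 1) + e)); first lra.
    by rewrite /k /Rdiv Rmult_assoc Rinv_l; lra.
  have kM : k * (2 * M) <= e / 8.
    apply (Rmult_le_reg_r (16 * (M + 1) + e)); first lra.
    have -> : k * (2 * M) * (16 * (M + 1) + e) = e * (2 * M) by rewrite /k; field; lra.
    nra.
  set s := 1 - k.
  have Ds : D (RtoC s) by apply D_real; rewrite /s; lra.
  have [d [d0 Hd]] := cder_cont _ _ _ (primitive_der _ Ds) (e / 4) ltac:(lra).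
  exists (Rmin d 1); split; first by apply Rmin_pos; lra.
  have one : forall w, D w -> Cmod (w - 1) < Rmin d 1 -> norm (star_primitive w -v star_primitive (RtoC s)) < e / 2.
    move=> w Dw Hw.
    have Hw1 := Rlt_le_trans _ _ _ Hw (Rmin_l _ _).
    have Hw2 := Rlt_le_trans _ _ _ Hw (Rmin_r _ _).
    apply Rle_lt_trans with (1 := vsub_trans (star_primitive (RtoC s * w)) _ _).
    have A := primitive_shrink w s ltac:(rewrite /s; lra) Dw.
    have W : Cmod w <= 2.
      have := Cmod_triangle (w - 1) 1; rewrite Cmod_1; have -> : (w - 1 + 1 = w)%C by ring.
      lra.
    have A' : (1 - s) * Cmod w * M <= e / 8.
      apply Rle_trans with (2 := kM); have -> : 1 - s = k by rewrite /s; ring.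
      rewrite Rmult_assoc; apply Rmult_le_compat_l; first lra.
      by apply Rmult_le_compat_r.
    have B : norm (star_primitive (RtoC s * w) -v star_primitive (RtoC s)) < e / 4.
      apply Hd; have -> : (RtoC s * w - RtoC s = RtoC s * (w - 1))%C by ring.
      rewrite Cmod_mult Cmod_R Rabs_pos_eq; last by rewrite /s; lra.
      have : s < 1 by rewrite /s; lra.
      have := Cmod_ge_0 (w - 1); have : 0 <= s by rewrite /s; lra.
      nra.
    lra.
  move=> w w' Dw Dw' Hw Hw'.
  apply Rle_lt_trans with (1 := vsub_trans (star_primitive (RtoC s)) _ _).
  have := one w Dw Hw; have := one w' Dw' Hw'; rewrite (vsub_sym (star_primitive w')); lra.
set u := fun n : nat => RtoC (1 - (/ 2) ^ n).
have Hu : forall n, 0 < (/ 2) ^ n <= 1.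
  move=> n; split; first by apply pow_lt; lra.
  by rewrite -(pow1 n); apply pow_incr; lra.
have uD : forall n, D (u n) by move=> n; apply D_real; have := Hu n; lra.
have u1 : forall n, Cmod (u n - 1) = (/ 2) ^ n.
  move=> n; have -> : (u n - 1 = RtoC (- (/ 2) ^ n))%C by apply C_eq; rewrite /u /Re /Im /=; ring.
  by rewrite Cmod_R Rabs_Ropp Rabs_pos_eq; have := Hu n; lra.
have usmall : forall d, 0 < d -> exists N, forall n, (N <= n)%nat -> Cmod (u n - 1) < d.
  move=> d d0; have [N HN] := pow_small (/ 2) d ltac:(lra) d0.
  by exists N => n Hn; rewrite u1; exact: HN.
have [|l Hl] := cauchy_seq_cv (fun n => star_primitive (u n)).
  move=> e e0; have [d [d0 Hd]] := cauchy e e0; have [N HN] := usmall d d0.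
  by exists N => n m Hn Hm; apply Hd => //; apply HN.
exists l => e e0; have [d [d0 Hd]] := cauchy (e / 2) ltac:(lra).
exists d; split=> // w Dw Hw.
have [N1 HN1] := Hl (e / 2) ltac:(lra); have [N2 HN2] := usmall d d0.
have A := HN1 (N1 + N2)%nat ltac:(lia); have B := HN2 (N1 + N2)%nat ltac:(lia).
apply Rle_lt_trans with (1 := vsub_trans (star_primitive (u (N1 + N2)%nat)) _ _).
have := Hd w _ Dw (uD (N1 + N2)%nat) Hw B; lra.
Qed.

End StarPrimitive.

(** * Integrals along the boundary of a Stolz domain *)

Definition stolz_up (b : R) : C := circle_pt (sin b) (PI / 2 - b).
Definition stolz_low (b : R) : C := circle_pt (sin b) (3 * PI / 2 + b).

Lemma path_deriv_segment (a b : C) (t : R) : path_deriv (segment a b) t = (b - a)%C.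
Proof.
apply C_eq; rewrite /path_deriv /Re /Im /=; apply is_derive_unique.
- apply (is_derive_ext (fun u => (1 - u) * fst a + u * fst b)).
    by move=> u; rewrite /segment /=; ring.
  by auto_derive => //; ring.
- apply (is_derive_ext (fun u => (1 - u) * snd a + u * snd b)).
    by move=> u; rewrite /segment /=; ring.
  by auto_derive => //; ring.
Qed.

Lemma path_deriv_circle (r t : R) : path_deriv (circle_pt r) t = (Ci * circle_pt r t)%C.
Proof.
apply C_eq; rewrite /path_deriv /circle_pt /Re /Im /=; apply is_derive_unique;
  by auto_derive => //; ring.
Qed.

Lemma is_derive_eps (x : R -> R) (t l : R) : is_derive x t l ->
  forall e, 0 < e -> exists d, 0 < d /\ forall u, Rabs (u - t) < d ->
    Rabs (x u - x t - (u - t) * l) <= e * Rabs (u - t).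
Proof.
move=> [_ H] e e0.
have [d Hd] := H t (fun P HP => HP) (mkposreal e e0).
exists d; split; first exact: cond_pos.
move=> u Hu; exact: (Hd u Hu).
Qed.

Lemma pder_pair (x y : R -> R) (t x' y' : R) : is_derive x t x' -> is_derive y t y' ->
  pder (fun u => (x u, y u)) t (x', y').
Proof.
move=> Hx Hy e e0.
have [d1 [d10 H1]] := is_derive_eps x t x' Hx (e / 2) ltac:(lra).
have [d2 [d20 H2]] := is_derive_eps y t y' Hy (e / 2) ltac:(lra).
exists (Rmin d1 d2); split; first exact: Rmin_pos.
move=> u Hu.
have A := H1 u (Rlt_le_trans _ _ _ Hu (Rmin_l _ _)).
have B := H2 u (Rlt_le_trans _ _ _ Hu (Rmin_r _ _)).
set p := x u - x t - (u - t) * x' in A; set q := y u - y t - (u - t) * y' in B.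
have -> : ((x u, y u) - (x t, y t) - RtoC (u - t) * (x', y') = RtoC p + Ci * RtoC q)%C.
  by apply C_eq; rewrite /p /q /Re /Im /=; ring.
apply Rle_trans with (1 := Cmod_triangle _ _).
rewrite Cmod_mult Cmod_Ci !Cmod_R; lra.
Qed.

Lemma circle_pder (r t : R) : pder (circle_pt r) t (Ci * circle_pt r t).
Proof.
have -> : (Ci * circle_pt r t)%C = (- r * sin t, r * cos t).
  by apply C_eq; rewrite /circle_pt /Re /Im /=; ring.
by apply pder_pair; auto_derive => //; ring.
Qed.

(** * Improper integrals *)

Section SingularIntegral.
Context {V : CompleteNormedModule C_AbsRing}.
Implicit Types h : R -> V.

(** Improper at 0, because both segments of the boundary are parametrized from the singular point
    1. *)
Definition sing_int h (v : V) := exists I : R -> V,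
  (forall e, 0 < e < 1 -> vint h e 1 (I e)) /\
  forall eps, 0 < eps -> exists d, 0 < d /\ forall e, 0 < e < d -> e < 1 -> norm (I e -v v) < eps.

Lemma sing_int_gen h v : sing_int h v ->
  is_RInt_gen (V := realify V) h (at_right 0) (at_point 1) v.
Proof.
move=> [I [HI Hv]] P [eps HP].
have Hn := norm_factor_gt_0 (V := V).
have [d [d0 Hd]] := Hv eps (cond_pos eps).
apply (Filter_prod _ _ _ (fun e => 0 < e < Rmin d 1) (fun t => t = 1)).
- have m0 : 0 < Rmin d 1 by apply Rmin_pos; lra.
  exists (mkposreal _ m0) => y Hy y0; split=> //.
  have y0' : 0 < y := y0.
  have : Rabs (y - 0) < Rmin d 1 := Hy.
  rewrite Rminus_0_r Rabs_pos_eq; last exact: Rlt_le.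
  by [].
- by [].
- move=> e t [e0 e1] ->.
  have H1 := Rlt_le_trans _ _ _ e1 (Rmin_l _ _); have H2 := Rlt_le_trans _ _ _ e1 (Rmin_r _ _).
  exists (I e); split; first by apply (HI e); lra.
  apply HP; apply (norm_compat1 (V := V) v (I e)); apply Hd; lra.
Qed.

(** The last segment of the boundary runs towards 1; t -> 1 - t brings it to the form of
    [sing_int]. *)
Lemma sing_int_gen_left (h k : R -> V) v : (forall t, k t = RtoC (-1) *v h (1 - t)) -> sing_int h v ->
  is_RInt_gen (V := realify V) k (at_point 0) (at_left 1) (RtoC (-1) *v v).
Proof.
move=> Hk [I [HI Hv]] P [eps HP].
have [d [d0 Hd]] := Hv eps (cond_pos eps).
apply (Filter_prod _ _ _ (fun t => t = 0) (fun e => 0 < 1 - e < Rmin d 1)).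
- by [].
- have m0 : 0 < Rmin d 1 by apply Rmin_pos; lra.
  exists (mkposreal _ m0) => y Hy y0.
  have y0' : y < 1 := y0.
  have : Rabs (y - 1) < Rmin d 1 := Hy.
  by rewrite -Rabs_Ropp Rabs_pos_eq; lra.
- move=> t e -> [e0 e1].
  have H1 := Rlt_le_trans _ _ _ e1 (Rmin_l _ _); have H2 := Rlt_le_trans _ _ _ e1 (Rmin_r _ _).
  exists (RtoC (-1) *v I (1 - e)); split; last first.
    apply HP; apply (norm_compat1 (V := V) (RtoC (-1) *v v)).
    change (norm ((RtoC (-1) *v I (1 - e)) -v (RtoC (-1) *v v)) < eps).
    rewrite -vscalBr vscal_norm_eq Cmod_R Rabs_Ropp Rabs_R1 Rmult_1_l; apply Hd; lra.
  have I0 := vint_swap _ _ _ _ (HI (1 - e) ltac:(lra)).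
  have I1 : vint h (-1 * 0 + 1) (-1 * e + 1) (RtoC (-1) *v I (1 - e)).
    have -> : -1 * 0 + 1 = 1 by ring.
    by have -> : -1 * e + 1 = 1 - e by ring.
  have := vint_comp_lin _ _ _ _ _ _ I1; apply vint_ext; first by rewrite /=; lra.
  by move=> t' _; rewrite Hk; do 2 f_equal; ring.
Qed.

Lemma sing_int_ext h k v : (forall t, 0 < t <= 1 -> h t = k t) -> sing_int h v -> sing_int k v.
Proof.
move=> E [I [HI Hv]]; exists I; split=> // e He.
by apply (vint_ext h); [lra | move=> t Ht; apply E; lra | exact: HI].
Qed.

Lemma sing_int_add h k v w : sing_int h v -> sing_int k w -> sing_int (fun t => h t +v k t) (v +v w).
Proof.
move=> [I [HI Hv]] [J [HJ Hw]]; exists (fun e => I e +v J e); split.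
  by move=> e He; apply vint_add; auto.
move=> eps e0.
have [d1 [d10 H1]] := Hv (eps / 2) ltac:(lra); have [d2 [d20 H2]] := Hw (eps / 2) ltac:(lra).
exists (Rmin d1 d2); split; first exact: Rmin_pos.
move=> e [He1 He2] He3; rewrite vsubD; apply Rle_lt_trans with (1 := vadd_norm _ _).
have := H1 e (conj He1 (Rlt_le_trans _ _ _ He2 (Rmin_l _ _))) He3.
have := H2 e (conj He1 (Rlt_le_trans _ _ _ He2 (Rmin_r _ _))) He3; lra.
Qed.

Lemma sing_int_norm h v (g : R -> R) K : sing_int h v ->
  (forall t, 0 < t <= 1 -> norm (h t) <= g t) ->
  (forall e, 0 < e < 1 -> exists l, is_RInt g e 1 l /\ l <= K) -> norm v <= K.
Proof.
move=> [I [HI Hv]] Hg HK; apply le_epsilon => eps e0.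
have [d [d0 Hd]] := Hv eps e0.
set e := Rmin d 1 / 2.
have m0 : 0 < Rmin d 1 by apply Rmin_pos; lra.
have m1 := Rmin_l d 1; have m2 := Rmin_r d 1.
have He : 0 < e < 1 by rewrite /e; lra.
have [l [Hl lK]] := HK e He.
have N := vint_norm _ g e 1 _ l ltac:(lra) (fun t Ht => Hg t ltac:(lra)) (HI e He) Hl.
have D := Hd e ltac:(rewrite /e; lra) ltac:(lra).
have := vnorm_le_sub v (I e); rewrite (vsub_sym v); lra.
Qed.

Lemma Rpower_int (s e e' : R) : 0 < s -> 0 < e -> e <= e' ->
  is_RInt (fun t => Rpower t (s - 1)) e e' (/ s * Rpower e' s - / s * Rpower e s).
Proof.
move=> s0 e0 ee.
have der : forall t, 0 < t -> is_derive (fun t => / s * Rpower t s) t (Rpower t (s - 1)).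
  move=> t t0; rewrite /Rpower; auto_derive => //.
  have -> : (s - 1) * ln t = s * ln t - ln t by ring.
  by rewrite /Rminus exp_plus exp_Ropp exp_ln //; field; lra.
apply (is_RInt_derive (fun t => / s * Rpower t s) (fun t => Rpower t (s - 1))) => t;
  rewrite Rmin_left // Rmax_right // => Ht; first by apply der; lra.
apply (ex_derive_continuous (K := R_AbsRing) (V := R_NormedModule)); rewrite /Rpower; auto_derive; lra.
Qed.

(** Integrals over [e, e'] are at most (c/s) e'^s, which gives the Cauchy criterion; the limit is
    taken along e = 2^-n. *)
Lemma sing_int_ex h (c s : R) : 0 < s -> 0 <= c -> (forall t, 0 < t <= 1 -> vcont h t) ->
  (forall t, 0 < t <= 1 -> norm (h t) <= c * Rpower t (s - 1)) -> exists v, sing_int h v.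
Proof.
move=> s0 c0 Hc Hn.
have ex : forall e e', 0 < e -> e <= e' -> e' <= 1 -> exists l, vint h e e' l.
  move=> e e' e0 ee e1; apply vint_ex => t; rewrite Rmin_left // Rmax_right // => Ht.
  by apply Hc; lra.
set I := fun e => epsilon (inhabits (0v : V)) (fun l => vint h e 1 l).
have HI : forall e, 0 < e <= 1 -> vint h e 1 (I e).
  by move=> e He; apply epsilon_spec, ex; lra.
have D : forall e e', 0 < e -> e <= e' -> e' <= 1 -> norm (I e -v I e') <= c / s * Rpower e' s.
  move=> e e' e0 ee e1; have [l Hl] := ex e e' e0 ee e1.
  have E : I e = l +v I e'.
    by apply (vint_unique h e 1); [apply HI; lra | apply (vint_Chasles _ _ e') => //; apply HI; lra].
  rewrite E vsubKr2.
  have J := is_RInt_scal _ _ _ c _ (Rpower_int s e e' s0 e0 ee).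
  have N := vint_norm h (fun t => c * Rpower t (s - 1)) e e' l _ ee
    (fun t Ht => Hn t ltac:(lra)) Hl J.
  apply Rle_trans with (1 := N).
  have P : 0 < Rpower e s by exact: exp_pos.
  have is0 := Rinv_0_lt_compat s s0.
  change (c * (/ s * Rpower e' s - / s * Rpower e s) <= c / s * Rpower e' s).
  have := Rmult_le_pos _ _ c0 (Rlt_le _ _ (Rmult_lt_0_compat _ _ is0 P)); rewrite /Rdiv; lra.
have lim0 : forall eps, 0 < eps -> exists d, 0 < d /\ forall e, 0 < e < d -> c / s * Rpower e s < eps.
  move=> eps ep; set k := eps / (c / s + 1).
  have cs : 0 <= c / s by apply Rdiv_le_0_compat.
  have k0 : 0 < k by apply Rdiv_lt_0_compat; lra.
  exists (Rpower k (/ s)); split; first exact: exp_pos.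
  move=> e [e0 ed].
  have L : Rpower e s < k.
    have -> : k = Rpower (Rpower k (/ s)) s.
      by rewrite Rpower_mult Rinv_l ?Rpower_1; lra.
    by apply Rlt_Rpower_l; lra.
  have P : 0 < Rpower e s by exact: exp_pos.
  apply Rle_lt_trans with ((c / s + 1) * Rpower e s); first nra.
  have -> : eps = (c / s + 1) * k by rewrite /k; field; lra.
  by apply Rmult_lt_compat_l; lra.
have [|v Hv] := cauchy_seq_cv (fun n => I (/ 2 ^ n)).
  move=> eps ep; have [d [d0 Hd]] := lim0 eps ep.
  have [N HN] := pow_small (/ 2) d ltac:(lra) d0.
  have H2 : forall n, 0 < / 2 ^ n <= 1.
    move=> n; rewrite -pow_inv; split; first by apply pow_lt; lra.
    by rewrite -(pow1 n); apply pow_incr; lra.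
  have one : forall n m, (N <= n)%nat -> (N <= m)%nat -> / 2 ^ n <= / 2 ^ m ->
     norm (I (/ 2 ^ n) -v I (/ 2 ^ m)) < eps.
    move=> n m Hn' Hm' L; apply Rle_lt_trans with (1 := D _ _ (proj1 (H2 n)) L (proj2 (H2 m))).
    apply Hd; split; first exact: (proj1 (H2 m)).
    by rewrite -pow_inv; exact: HN.
  exists N => n m Hn' Hm'; case: (Rle_lt_dec (/ 2 ^ n) (/ 2 ^ m)) => L; first exact: one.
  by rewrite vsub_sym; apply one => //; lra.
exists v, I; split; first by move=> e He; apply HI; lra.
move=> eps ep; have [d [d0 Hd]] := lim0 (eps / 2) ltac:(lra).
exists d; split=> // e He e1.
have [N1 HN1] := Hv (eps / 2) ltac:(lra).
have [N2 HN2] := pow_small (/ 2) e ltac:(lra) ltac:(lra).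
set n := (N1 + N2)%nat.
have A := HN1 n ltac:(rewrite /n; lia); have B := HN2 n ltac:(rewrite /n; lia).
rewrite pow_inv in B.
have n0 : 0 < / 2 ^ n by apply Rinv_0_lt_compat, pow_lt; lra.
have L := D _ e n0 (Rlt_le _ _ B) ltac:(lra).
apply Rle_lt_trans with (1 := vsub_trans (I (/ 2 ^ n)) _ _).
rewrite (vsub_sym (I e)); have := Hd e He; lra.
Qed.

End SingularIntegral.

Lemma sing_int_linear {V V' : CompleteNormedModule C_AbsRing} (L : V -> V') (h : R -> V) v :
  is_linear L -> sing_int h v -> sing_int (fun t => L (h t)) (L v).
Proof.
move=> HL [I [HI Hv]]; exists (fun e => L (I e)); split.
  by move=> e He; apply vint_linear; auto.
move=> eps e0; have [M [M0 HM]] := linear_norm L HL.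
have [d [d0 Hd]] := Hv (eps / M) ltac:(apply Rdiv_lt_0_compat; lra).
exists d; split=> // e He e1.
have -> : L (I e) -v L v = L (I e -v v) by symmetry; exact: linear_minus.
apply Rle_lt_trans with (1 := HM _).
have -> : eps = M * (eps / M) by field; lra.
by apply Rmult_lt_compat_l => //; exact: Hd.
Qed.

(** * The boundary curve of a Stolz domain *)

Definition arc_range (b t : R) := PI / 2 - b <= t <= 3 * PI / 2 + b.

(* The boundary of [stolz b] without the point 1. *)
Definition bdry (b : R) (z : C) : Prop :=
  (exists t, 0 < t <= 1 /\ z = segment 1 (stolz_up b) t) \/
  (exists t, arc_range b t /\ z = circle_pt (sin b) t) \/
  (exists t, 0 < t <= 1 /\ z = segment 1 (stolz_low b) t).

Lemma stolz_upE (b : R) : stolz_up b = (sin b * sin b, sin b * cos b).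
Proof.
rewrite /stolz_up /circle_pt cos_minus sin_minus cos_PI2 sin_PI2.
by apply C_eq; rewrite /Re /Im /=; ring.
Qed.

Lemma stolz_lowE (b : R) : stolz_low b = (sin b * sin b, - (sin b * cos b)).
Proof.
rewrite /stolz_low /circle_pt; have -> : 3 * PI / 2 + b = PI + (PI / 2 + b) by field.
rewrite !cos_plus !sin_plus !cos_plus cos_PI sin_PI cos_PI2 sin_PI2.
by apply C_eq; rewrite /Re /Im /=; ring.
Qed.

Lemma stolz_lowC (b : R) : stolz_low b = Cconj (stolz_up b).
Proof. by rewrite stolz_lowE stolz_upE. Qed.

Lemma segment_conj (w : C) (t : R) : segment 1 (Cconj w) t = Cconj (segment 1 w t).
Proof. by apply C_eq; rewrite /segment /Re /Im /=; ring. Qed.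

Lemma stolz_upB (b : R) : (stolz_up b - 1)%C = (RtoC (cos b) * ((- cos b)%R, sin b))%C.
Proof.
have S := sin2_cos2 b; rewrite /Rsqr in S.
by rewrite stolz_upE; apply C_eq; rewrite /Re /Im /=; lra.
Qed.

Lemma Cmod_cossin (x y : R) : x ^ 2 + y ^ 2 = 1 -> Cmod (x, y) = 1.
Proof. by move=> E; rewrite /Cmod /= in E *; rewrite E sqrt_1. Qed.

Section Boundary.
Variable b : R.
Hypothesis Hb : 0 < b < PI / 2.

Let cb : 0 < cos b < 1.
Proof.
split; first by apply cos_gt_0; lra.
rewrite -cos_0; apply cos_decreasing_1; lra.
Qed.

Let sc : sin b ^ 2 + cos b ^ 2 = 1.
Proof. by have := sin2_cos2 b; rewrite !Rsqr_pow2. Qed.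

Lemma Cmod_stolz_upB : Cmod (stolz_up b - 1) = cos b.
Proof.
rewrite stolz_upB Cmod_mult Cmod_R Rabs_pos_eq; last lra.
rewrite Cmod_cossin; [ring | lra].
Qed.

Lemma Cmod_stolz_lowB : Cmod (stolz_low b - 1) = cos b.
Proof.
rewrite stolz_lowC -Cmod_stolz_upB -(Cmod_conj (stolz_up b - 1)); congr Cmod.
by apply C_eq; rewrite /Re /Im /=; ring.
Qed.

(** The boundary is symmetric under conjugation, which exchanges the two segments. *)
Lemma bdry_cases (P : C -> Prop) :
  (forall z, P z -> P (Cconj z)) ->
  (forall t, 0 < t <= 1 -> P (segment 1 (stolz_up b) t)) ->
  (forall t, arc_range b t -> P (circle_pt (sin b) t)) ->
  forall z, bdry b z -> P z.
Proof.
move=> Pc P1 P2 z [[t [Ht ->]]|[[t [Ht ->]]|[t [Ht ->]]]]; [exact: P1 | exact: P2 |].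
by rewrite stolz_lowC segment_conj; apply Pc, P1.
Qed.

Lemma arc_cos (t : R) : arc_range b t -> cos t <= sin b.
Proof.
move=> [H1 H2]; rewrite -cos_shift.
case: (Rle_lt_dec t PI) => L; first by apply cos_decr_1; lra.
have -> : cos t = cos (2 * PI - t).
  by rewrite cos_minus cos_2PI sin_2PI; ring.
apply cos_decr_1; lra.
Qed.

(** On a segment the difference of the squares is cos^2 b (s - t)^2; on the arc it is at least (1 -
    s)^2 cos^2 b, because cos t <= sin b. *)
Lemma bdry_far (z : C) : bdry b z -> forall s, 0 <= s <= 1 -> s * sin b <= Cmod (z - RtoC (1 - s)).
Proof.
have [s0 s1] := sin_01 b Hb.
have sq : forall s w, 0 <= s -> s ^ 2 * sin b ^ 2 <= Re w ^ 2 + Im w ^ 2 -> s * sin b <= Cmod w.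
  move=> s w Hs L; apply Rsqr_incr_0_var; last exact: Cmod_ge_0.
  by rewrite !Rsqr_pow2 Rpow_mult_distr Cmod2_alt.
move: z; apply (bdry_cases (fun z => forall s, 0 <= s <= 1 -> s * sin b <= Cmod (z - RtoC (1 - s)))) => [w Hw s Hs | t Ht s Hs | t Ht s Hs].
- have -> : (Cconj w - RtoC (1 - s) = Cconj (w - RtoC (1 - s)))%C.
    by apply C_eq; rewrite /Re /Im /=; ring.
  by rewrite Cmod_conj; exact: Hw.
- apply sq; first lra.
  have -> : (segment 1 (stolz_up b) t - RtoC (1 - s) = RtoC s + RtoC t * (stolz_up b - 1))%C.
    by apply C_eq; rewrite /segment /Re /Im /=; ring.
  rewrite stolz_upB /Re /Im /=.
  have sc' := sc; set c := cos b in sc' *; set q := sin b in sc' *.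
  have -> : (s + (t * (c * - c - 0 * q) - 0 * (c * q + 0 * - c))) = s - t * c ^ 2 by ring.
  have -> : 0 + (t * (c * q + 0 * - c) + 0 * (c * - c - 0 * q)) = t * c * q by ring.
  have q2 : q * (q * 1) = 1 - c ^ 2 by lra.
  have := Rmult_le_pos _ _ (pow2_ge_0 c) (pow2_ge_0 (s - t)); rewrite /= in q2 *; nra.
- apply sq; first lra.
  have A := arc_cos t Ht.
  have T := sin2_cos2 t; rewrite !Rsqr_pow2 in T.
  rewrite /circle_pt /Re /Im /=.
  have sc' := sc; set c := cos b in sc' *; set q := sin b in sc' s0 s1 A *.
  set x := cos t in A T *; set y := sin t in T *.
  have E : (q * x + - (1 - s)) ^ 2 + (q * y + - 0) ^ 2 = q ^ 2 - 2 * (1 - s) * q * x + (1 - s) ^ 2.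
    have -> : (q * x + - (1 - s)) ^ 2 + (q * y + - 0) ^ 2 = q ^ 2 * (y ^ 2 + x ^ 2) - 2 * (1 - s) * q * x + (1 - s) ^ 2 by ring.
    by rewrite T; ring.
  have M : (1 - s) * q * x <= (1 - s) * q * q by apply Rmult_le_compat_l => //; nra.
  have C2 := Rmult_le_pos _ _ (pow2_ge_0 (1 - s)) (pow2_ge_0 c).
  have q2 : q ^ 2 = 1 - c ^ 2 by lra.
  rewrite /= in E q2 C2 *; nra.
Qed.

Lemma bdry_neq1 (z : C) : bdry b z -> z <> 1.
Proof.
have [s0 s1] := sin_01 b Hb.
move: z; apply (bdry_cases (fun z => z <> 1)) => [w Hw E | t Ht E | t Ht E].
- by apply Hw; rewrite -(Cconj_conj w) E; apply C_eq; rewrite /Re /Im /=; ring.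
- have Z : (RtoC t * (stolz_up b - 1))%C = 0.
    transitivity (segment 1 (stolz_up b) t - 1)%C; last by rewrite E; ring.
    by apply C_eq; rewrite /segment /Re /Im /=; ring.
  have := f_equal Cmod Z; rewrite Cmod_mult Cmod_stolz_upB Cmod_R Cmod_0 Rabs_pos_eq; nra.
- have := arc_cos t Ht; have := f_equal Re E; rewrite /circle_pt /Re /=; nra.
Qed.

(** The discs of angle a have radius s sin a, so [bdry_far] leaves a gap s (sin b - sin a), which
    closes as s -> 0. But a disc coming that close to z must have s comparable with |z - 1|, which
    is positive. *)
Lemma bdry_out (a : R) (z : C) : 0 < a < b -> bdry b z -> ~ closure (U := C_UniformSpace) (stolz a) z.
Proof.
move=> Ha Hz; have F := bdry_far z Hz; have N := bdry_neq1 z Hz.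
have sab : sin a < sin b by apply sin_increasing_1; lra.
have [s0 s1] := sin_01 a ltac:(lra).
set d := sin b - sin a.
have z1 : 0 < Cmod (z - 1).
  apply Cmod_gt_0 => E; apply N.
  by transitivity (1 + (z - 1))%C; [ring | rewrite E; ring].
apply not_closure; exists (d * Cmod (z - 1) / 4); split.
  by apply Rdiv_lt_0_compat; [apply Rmult_lt_0_compat; rewrite /d; lra | lra].
move=> y Hy /stolz_elim [|s [Hs Hys]]; first lra.
rewrite /stolz_at in Hys.
have A := F s ltac:(lra).
have B := Cmod_triangle3 y z (RtoC (1 - s)); rewrite (Cmod_sub_sym z y) in B.
have S1 : s * d < Cmod (y - z) by rewrite /d; lra.
have Y1 : Cmod (y - 1) <= 2 * s.
  have := Cmod_triangle3 (RtoC (1 - s)) y 1.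
  have -> : (RtoC (1 - s) - 1 = RtoC (- s))%C by apply C_eq; rewrite /Re /Im /=; ring.
  rewrite Cmod_R Rabs_Ropp Rabs_pos_eq; nra.
have Z1 := Cmod_triangle3 y z 1; rewrite (Cmod_sub_sym z y) in Z1.
have d1 : d < 1 by have := proj2 (sin_01 b Hb); rewrite /d; lra.
have S2 : s * d < d * Cmod (z - 1) / 4 by lra.
have S3 : s < Cmod (z - 1) / 4.
  by apply (Rmult_lt_reg_r d); [rewrite /d; lra | lra].
nra.
Qed.

Lemma bdry_stolz (g : R) (z : C) : b < g < PI / 2 -> bdry b z -> stolz g z.
Proof.
move=> Hg; have [s0 s1] := sin_01 b Hb.
have sbg : sin b < sin g by apply sin_increasing_1; lra.
have circ : forall t, Cmod (circle_pt (sin b) t) = sin b.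
  move=> t; have -> : circle_pt (sin b) t = (RtoC (sin b) * (cos t, sin t))%C.
    by apply C_eq; rewrite /circle_pt /Re /Im /=; ring.
  rewrite Cmod_mult Cmod_R Rabs_pos_eq; last lra.
  rewrite Cmod_cossin; first ring.
  by have := sin2_cos2 t; rewrite !Rsqr_pow2; lra.
have seg : forall w t, Cmod w = sin b -> 0 < t <= 1 -> stolz g (segment 1 w t).
  move=> w t Hw Ht; apply (stolz_intro _ t) => //; rewrite /stolz_at.
  have -> : (segment 1 w t - RtoC (1 - t) = RtoC t * w)%C.
    by apply C_eq; rewrite /segment /Re /Im /=; ring.
  rewrite Cmod_mult Cmod_R Rabs_pos_eq; [rewrite Hw; nra | lra].
move=> [[t [Ht ->]]|[[t [Ht ->]]|[t [Ht ->]]]].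
- by apply seg => //; exact: circ.
- apply (stolz_intro _ 1); first lra.
  rewrite /stolz_at; have -> : (circle_pt (sin b) t - RtoC (1 - 1) = circle_pt (sin b) t)%C.
    by apply C_eq; rewrite /Re /Im /=; ring.
  by rewrite circ; lra.
- by apply seg => //; exact: circ.
Qed.

Lemma Cmod_circle (t : R) : Cmod (circle_pt (sin b) t) = sin b.
Proof.
have [s0 s1] := sin_01 b Hb.
have -> : circle_pt (sin b) t = (RtoC (sin b) * (cos t, sin t))%C.
  by apply C_eq; rewrite /circle_pt /Re /Im /=; ring.
rewrite Cmod_mult Cmod_R Rabs_pos_eq; last lra.
rewrite Cmod_cossin; first ring.
by have := sin2_cos2 t; rewrite !Rsqr_pow2; lra.
Qed.

Lemma Cmod_seg (w : C) (t : R) : Cmod w = sin b -> 0 <= t <= 1 -> Cmod (segment 1 w t) <= 1 - t * (1 - sin b).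
Proof.
move=> Hw Ht; rewrite /segment; apply Rle_trans with (1 := Cmod_triangle _ _).
by rewrite !Cmod_mult Hw !Cmod_R Rabs_R1 !Rabs_pos_eq; lra.
Qed.

Lemma Cmod_seg1 (w : C) (t : R) : 0 <= t -> Cmod (1 - segment 1 w t) = t * Cmod (w - 1).
Proof.
move=> Ht; rewrite Cmod_sub_sym.
have -> : (segment 1 w t - 1 = RtoC t * (w - 1))%C.
  by apply C_eq; rewrite /segment /Re /Im /=; ring.
by rewrite Cmod_mult Cmod_R Rabs_pos_eq.
Qed.

End Boundary.

Lemma pder_Ci (p : R -> C) (t : R) (p' : C) : pder p t p' -> pder (fun u => (Ci * p u)%C) t (Ci * p')%C.
Proof.
move=> H e e0; have [d [d0 Hd]] := H e e0; exists d; split=> // u Hu.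
have -> : (Ci * p u - Ci * p t - RtoC (u - t) * (Ci * p') = Ci * (p u - p t - RtoC (u - t) * p'))%C by ring.
by rewrite Cmod_mult Cmod_Ci Rmult_1_l; exact: Hd.
Qed.

Section Contour.
Context {V : CompleteNormedModule C_AbsRing}.
Implicit Types f F : C -> V.

Definition arc_fun f (b t : R) : V := (Ci * circle_pt (sin b) t) *v f (circle_pt (sin b) t).

(* Both segments start at 1, hence the sign of the last integral. *)
Definition contour (b : R) f (v : V) := exists v1 v2 v3,
  sing_int (seg_fun f 1 (stolz_up b)) v1 /\
  vint (arc_fun f b) (PI / 2 - b) (3 * PI / 2 + b) v2 /\
  sing_int (seg_fun f 1 (stolz_low b)) v3 /\ v = v1 +v (v2 -v v3).

(** Links the relation [contour] to the integral in the definition of the calculus. *)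
Lemma contour_eq b f v : contour b f v -> stolz_boundary_int b f = v.
Proof.
move=> [v1 [v2 [v3 [H1 [H2 [H3 ->]]]]]].
have E1 : path_int f (segment 1 (stolz_up b)) (at_right 0) (at_point 1) = v1.
  apply (is_RInt_gen_unique (V := realify V)).
  have -> : (fun t => scal (path_deriv (segment 1 (stolz_up b)) t) (f (segment 1 (stolz_up b) t))) = seg_fun f 1 (stolz_up b).
    by apply functional_extensionality => t; rewrite path_deriv_segment.
  exact: sing_int_gen.
have E2 : path_int f (circle_pt (sin b)) (at_point (PI / 2 - b)) (at_point (3 * PI / 2 + b)) = v2.
  apply (is_RInt_gen_unique (V := realify V)).
  have -> : (fun t => scal (path_deriv (circle_pt (sin b)) t) (f (circle_pt (sin b) t))) = arc_fun f b.
    by apply functional_extensionality => t; rewrite path_deriv_circle.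
  by apply (is_RInt_gen_at_point (V := realify V)).
have E3 : path_int f (segment (stolz_low b) 1) (at_point 0) (at_left 1) = RtoC (-1) *v v3.
  apply (is_RInt_gen_unique (V := realify V)).
  apply (sing_int_gen_left (seg_fun f 1 (stolz_low b))) => // t.
  rewrite path_deriv_segment /seg_fun -segment_rev vscalA.
  by congr (@scal _ _ _ _); apply C_eq; rewrite /Re /Im /=; ring.
rewrite /stolz_boundary_int -/(stolz_up b) -/(stolz_low b) E1 E2 E3.
by rewrite -vopp_scal.
Qed.

Lemma contour_unique b f v w : contour b f v -> contour b f w -> v = w.
Proof. by move=> /contour_eq <- /contour_eq. Qed.

Lemma contour_ext b f g v : 0 < b < PI / 2 -> (forall z, bdry b z -> f z = g z) -> contour b f v -> contour b g v.
Proof.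
move=> Hb E [v1 [v2 [v3 [H1 [H2 [H3 ->]]]]]]; exists v1, v2, v3; split; [|split; [|split]] => //.
- apply: sing_int_ext H1 => t Ht; rewrite /seg_fun E //; left; by exists t.
- have P := PI_RGT_0; apply: vint_ext H2; first lra.
  by move=> t Ht; rewrite /arc_fun E //; right; left; exists t.
- apply: sing_int_ext H3 => t Ht; rewrite /seg_fun E //; right; right; by exists t.
Qed.

Lemma contour_add b f g v w : contour b f v -> contour b g w -> contour b (fun z => f z +v g z) (v +v w).
Proof.
move=> [v1 [v2 [v3 [H1 [H2 [H3 ->]]]]]] [w1 [w2 [w3 [K1 [K2 [K3 ->]]]]]].
exists (v1 +v w1), (v2 +v w2), (v3 +v w3); split; [|split; [|split]].
- apply: sing_int_ext (sing_int_add _ _ _ _ H1 K1) => t _; by rewrite /seg_fun vscalDr.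
- have E : arc_fun (fun z => f z +v g z) b = (fun t => arc_fun f b t +v arc_fun g b t).
    by apply functional_extensionality => t; rewrite /arc_fun vscalDr.
  by rewrite E; apply vint_add.
- apply: sing_int_ext (sing_int_add _ _ _ _ H3 K3) => t _; by rewrite /seg_fun vscalDr.
- exact: vcontour_add.
Qed.

Lemma contour_ex b f (c s : R) : 0 < b < PI / 2 -> 0 < s -> 0 <= c ->
  (forall z, bdry b z -> ccont f z) ->
  (forall z, bdry b z -> norm (f z) <= c * Rpower (Cmod (1 - z)) (s - 1)) ->
  exists v, contour b f v.
Proof.
move=> Hb s0 c0 Hc Hn.
have seg : forall w, Cmod (w - 1) = cos b -> (forall t, 0 < t <= 1 -> bdry b (segment 1 w t)) ->
    exists v, sing_int (seg_fun f 1 w) v.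
  move=> w Hw Bw.
  have cb : 0 < cos b by apply cos_gt_0; lra.
  have K0 : 0 < Rpower (cos b) (s - 1) by exact: exp_pos.
  apply (sing_int_ex _ (cos b * c * Rpower (cos b) (s - 1)) s) => //.
  - by apply Rmult_le_pos; [apply Rmult_le_pos; lra | lra].
  - move=> t Ht; apply vscal_vcont, (ccont_path f _ _ _ (segment_pder 1 w t)), Hc, Bw; lra.
  - move=> t Ht; apply Rle_trans with (1 := vscal_norm _ _); rewrite Hw.
    have := Hn _ (Bw t Ht); rewrite Cmod_seg1 ?Hw; last lra.
    rewrite -Rpower_mult_distr; [|lra|lra].
    have -> : cos b * c * Rpower (cos b) (s - 1) * Rpower t (s - 1) =
      cos b * (c * (Rpower t (s - 1) * Rpower (cos b) (s - 1))) by ring.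
    by apply Rmult_le_compat_l; lra.
have [v1 H1] := seg _ (Cmod_stolz_upB b Hb) (fun t Ht => or_introl (ex_intro _ t (conj Ht eq_refl))).
have [v3 H3] := seg _ (Cmod_stolz_lowB b Hb) (fun t Ht => or_intror (or_intror (ex_intro _ t (conj Ht eq_refl)))).
have [|v2 H2] := vint_ex (arc_fun f b) (PI / 2 - b) (3 * PI / 2 + b); last first.
  by exists (v1 +v (v2 -v v3)), v1, v2, v3.
have P := PI_RGT_0.
move=> t; rewrite Rmin_left ?Rmax_right; [|lra|lra] => Ht.
apply (vscal_path_vcont _ _ _ (Ci * (Ci * circle_pt (sin b) t))).
  exact: pder_Ci (circle_pder (sin b) t).
apply (ccont_path f _ _ _ (circle_pder (sin b) t)), Hc; right; left; by exists t.
Qed.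

(** The segments have length cos b <= 1 and the arc has length (PI + 2b) sin b <= 2 PI. *)
Lemma contour_norm b f v (g : R -> R) (K m : R) : 0 < b < PI / 2 -> contour b f v ->
  (forall t, 0 < t <= 1 -> norm (f (segment 1 (stolz_up b) t)) <= g t) ->
  (forall t, 0 < t <= 1 -> norm (f (segment 1 (stolz_low b) t)) <= g t) ->
  (forall e, 0 < e < 1 -> exists l, is_RInt g e 1 l /\ l <= K) ->
  (forall t, arc_range b t -> norm (f (circle_pt (sin b) t)) <= m) ->
  norm v <= 2 * K + 2 * PI * m.
Proof.
move=> Hb [v1 [v2 [v3 [H1 [H2 [H3 ->]]]]]] B1 B3 HK Bm.
have P := PI_RGT_0; have [s0 s1] := sin_01 b Hb.
have cb : 0 < cos b <= 1 by split; [apply cos_gt_0; lra | case: (COS_bound b)].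
have seg : forall w u, Cmod (w - 1) = cos b -> (forall t, 0 < t <= 1 -> norm (f (segment 1 w t)) <= g t) ->
   sing_int (seg_fun f 1 w) u -> norm u <= K.
  move=> w u Hw Bw Hu; apply (sing_int_norm _ _ g K Hu) => // t Ht.
  apply Rle_trans with (1 := vscal_norm _ _); rewrite Hw.
  have := Bw t Ht; have := norm_ge_0 (f (segment 1 w t)); nra.
have N1 := seg _ _ (Cmod_stolz_upB b Hb) B1 H1.
have N3 := seg _ _ (Cmod_stolz_lowB b Hb) B3 H3.
have N2 : norm v2 <= (3 * PI / 2 + b - (PI / 2 - b)) * m.
  apply (vint_norm_const _ _ _ _ _ (ltac:(lra) : PI / 2 - b <= 3 * PI / 2 + b)) with (2 := H2) => t Ht.
  apply Rle_trans with (1 := vscal_norm _ _).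
  rewrite Cmod_mult Cmod_Ci Cmod_circle // Rmult_1_l.
  have := Bm t Ht; have := norm_ge_0 (f (circle_pt (sin b) t)); nra.
have m0 : 0 <= m.
  have Ht : arc_range b PI by rewrite /arc_range; lra.
  by apply Rle_trans with (2 := Bm _ Ht); exact: norm_ge_0.
have N2' : norm v2 <= 2 * PI * m by apply Rle_trans with (1 := N2); apply Rmult_le_compat_r; lra.
have := vadd_norm v1 (v2 -v v3); have := vsub_norm v2 v3; lra.
Qed.

(** The increments of F along the three pieces cancel; at the singular end its value is replaced by
    the limit l. *)
Lemma contour_primitive b f F l : 0 < b < PI / 2 ->
  (forall z, bdry b z -> cder F z (f z)) -> (forall z, bdry b z -> ccont f z) ->
  (forall e, 0 < e -> exists d, 0 < d /\ forall z, bdry b z -> Cmod (z - 1) < d -> norm (F z -v l) < e) ->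
  contour b f 0v.
Proof.
move=> Hb HF Hf Hl.
have P := PI_RGT_0.
have seg : forall w, Cmod (w - 1) = cos b -> (forall t, 0 < t <= 1 -> bdry b (segment 1 w t)) ->
    sing_int (seg_fun f 1 w) (F w -v l).
  move=> w Hw Bw; exists (fun e => F w -v F (segment 1 w e)); split.
    move=> e He.
    have := vint_FTC (fun t => F (segment 1 w t)) (seg_fun f 1 w) e 1.
    rewrite segment1 Rmin_left ?Rmax_right; [|lra|lra]; apply => t Ht.
    - apply (cder_path _ _ _ _ _ (segment_pder 1 w t)), HF, Bw; lra.
    - apply vscal_vcont, (ccont_path f _ _ _ (segment_pder 1 w t)), Hf, Bw; lra.
  move=> eps e0; have [d [d0 Hd]] := Hl eps e0.
  have cb : 0 < cos b <= 1 by split; [apply cos_gt_0; lra | case: (COS_bound b)].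
  exists d; split=> // e He e1.
  have -> : (F w -v F (segment 1 w e)) -v (F w -v l) = l -v F (segment 1 w e) by exact: vsub_cancel2.
  rewrite vsub_sym; apply Hd; first by apply Bw; lra.
  by rewrite Cmod_sub_sym Cmod_seg1 ?Hw; nra.
exists (F (stolz_up b) -v l), (F (stolz_low b) -v F (stolz_up b)), (F (stolz_low b) -v l).
split; [|split; [|split]].
- apply seg => [|t Ht]; [exact: Cmod_stolz_upB | by left; exists t].
- have ab : PI / 2 - b <= 3 * PI / 2 + b by lra.
  apply (vint_FTC (fun t => F (circle_pt (sin b) t)) (arc_fun f b)) => t;
    rewrite Rmin_left // Rmax_right // => Ht.
  + apply (cder_path _ _ _ _ _ (circle_pder (sin b) t)), HF; right; left; by exists t.
  + apply (vscal_path_vcont _ _ _ (Ci * (Ci * circle_pt (sin b) t))).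
      exact: pder_Ci (circle_pder (sin b) t).
    apply (ccont_path f _ _ _ (circle_pder (sin b) t)), Hf; right; left; by exists t.
- apply seg => [|t Ht]; [exact: Cmod_stolz_lowB | by right; right; exists t].
- exact: vcontour_cancel.
Qed.

End Contour.

(** * The functional calculus *)

Lemma ccont_mul {V : CompleteNormedModule C_AbsRing} (k : C -> C) (f : C -> V) (z : C) :
  ccont (V := C_CompleteNormedModule) k z -> ccont f z -> ccont (fun y => k y *v f y) z.
Proof.
move=> Hk Hf e e0.
have N0 := norm_ge_0 (f z); have K0 := Cmod_ge_0 (k z).
have [d1 [d10 H1]] := Hk (Rmin 1 (e / (2 * (norm (f z) + 1))))
  ltac:(apply Rmin_pos; [lra | apply Rdiv_lt_0_compat; lra]).
have [d2 [d20 H2]] := Hf (e / (2 * (Cmod (k z) + 1))) ltac:(apply Rdiv_lt_0_compat; lra).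
exists (Rmin d1 d2); split; first exact: Rmin_pos.
move=> y Hy.
have A := H1 y (Rlt_le_trans _ _ _ Hy (Rmin_l _ _)).
have A' : Cmod (k y - k z) < Rmin 1 (e / (2 * (norm (f z) + 1))) := A.
have A1 := Rlt_le_trans _ _ _ A' (Rmin_l _ _); have A2 := Rlt_le_trans _ _ _ A' (Rmin_r _ _).
have B := H2 y (Rlt_le_trans _ _ _ Hy (Rmin_r _ _)).
have -> : k y *v f y -v k z *v f z = k y *v (f y -v f z) +v (k y - k z) *v f z.
  by rewrite vscalBr vscalBl; exact: vsub_trans2.
apply Rle_lt_trans with (1 := vadd_norm _ _).
have B1 := vscal_norm (k y) (f y -v f z); have B2 := vscal_norm (k y - k z) (f z).
have Ky : Cmod (k y) <= Cmod (k z) + 1.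
  have -> : k y = (k z + (k y - k z))%C by ring.
  by apply Rle_trans with (1 := Cmod_triangle _ _); lra.
have C1 : Cmod (k y) * norm (f y -v f z) < e / 2.
  apply Rle_lt_trans with ((Cmod (k z) + 1) * norm (f y -v f z)).
    by apply Rmult_le_compat_r; [exact: norm_ge_0 | lra].
  have -> : e / 2 = (Cmod (k z) + 1) * (e / (2 * (Cmod (k z) + 1))) by field; lra.
  by apply Rmult_lt_compat_l; lra.
have C2 : Cmod (k y - k z) * norm (f z) <= e / 2.
  apply Rle_trans with (e / (2 * (norm (f z) + 1)) * (norm (f z) + 1)).
    by apply Rmult_le_compat; [exact: Cmod_ge_0 | done | lra | lra].
  by right; field; lra.
lra.
Qed.

Lemma is_derive_cder (f : C -> C) (z l : C) :
  is_derive (K := C_AbsRing) (V := C_NormedModule) f z l -> cder (V := C_CompleteNormedModule) f z l.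
Proof.
move=> [_ H] e e0.
have [d Hd] := H z (fun P HP => HP) (mkposreal e e0).
exists d; split; first exact: cond_pos.
move=> y Hy; exact: (Hd y Hy).
Qed.

Lemma cder_is_derive (f : C -> C) (z l : C) :
  cder (V := C_CompleteNormedModule) f z l -> is_derive (K := C_AbsRing) (V := C_NormedModule) f z l.
Proof.
move=> H; split; first exact: (is_linear_scal_l (V := C_NormedModule) l).
move=> x Hx e.
have Ex : z = x by exact: (is_filter_lim_locally_unique (K := C_AbsRing) (V := AbsRing_NormedModule C_AbsRing) z x Hx).
rewrite -Ex; have [d [d0 Hd]] := H e (cond_pos e).
by exists (mkposreal d d0) => y Hy; exact: (Hd y Hy).
Qed.

Section AffineInverse.
Context {X : CompleteNormedModule C_AbsRing}.
Variables A0 A1 : bounded_op X.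

(** Covers the resolvent (A0 = -T, A1 = I) and its form (I - w T)^-1 near infinity (A0 = I, A1 =
    -T). *)
Definition affine (w : C) : bounded_op X := A0 +o w *s A1.

Lemma affine_sub (y w : C) : affine y -o affine w = (y - w) *s A1.
Proof.
apply bop_ext => x; change ((A0 x +v y *v A1 x) -v (A0 x +v w *v A1 x) = (y - w) *v A1 x).
by rewrite vsubD vsubv v0add vscalBl.
Qed.

(** With Q and S the inverses at w and y, S - Q = -(y - w) S A1 Q; inserting this once more leaves
    the remainder (y - w)^2 S A1 Q A1 Q. *)
Lemma affine_inv_cder (w : C) : invertible (affine w) ->
  cder (V := bop_CompleteNormedModule X) (fun y => bop_inv (affine y)) w
    (RtoC (-1) *s (bop_inv (affine w) *o (A1 *o bop_inv (affine w)))).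
Proof.
move=> Hi e e0.
set Q := bop_inv (affine w).
have Q0 := onorm_ge0 Q; have N0 := onorm_ge0 A1.
set c := onorm A1 * onorm Q.
have c0 : 0 <= c by apply Rmult_le_pos.
set k := 2 * c * c * onorm Q.
have k0 : 0 <= k by rewrite /k; apply Rmult_le_pos => //; nra.
exists (Rmin (/ (2 * (c + 1))) (e / (k + 1))); split.
  by apply Rmin_pos; [apply Rinv_0_lt_compat; lra | apply Rdiv_lt_0_compat; lra].
move=> y Hy.
have H1 := Rlt_le_trans _ _ _ Hy (Rmin_l _ _); have H2 := Rlt_le_trans _ _ _ Hy (Rmin_r _ _).
have Y0 := Cmod_ge_0 (y - w).
have Hq : onorm (affine w -o affine y) * onorm Q <= / 2.
  rewrite onorm_sub_sym affine_sub.
  have L := onorm_scal (y - w) A1.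
  apply Rle_trans with (Cmod (y - w) * c).
    by rewrite /c -Rmult_assoc; apply Rmult_le_compat_r.
  apply Rle_trans with (/ (2 * (c + 1)) * (c + 1)); last by right; field; lra.
  by apply Rmult_le_compat; lra.
have [Hi' Hn] := inverse_perturb (affine w) (affine y) (/ 2) Hi Hq ltac:(lra).
rewrite -/Q in Hn; set S := bop_inv (affine y) in Hn *.
have Hn' : onorm S <= 2 * onorm Q by apply Rle_trans with (1 := Hn); right; field.
have SI := bop_inv_spec _ Hi'; have QI := bop_inv_spec _ Hi.
have S1 : S *o affine y = 1o by exact: proj2 SI.
have Q1 : affine w *o Q = 1o by exact: proj1 QI.
have D1 : S -o Q = RtoC (-1) *s ((y - w) *s (S *o (A1 *o Q))).
  have E : S *o ((affine y -o affine w) *o Q) = Q -o S.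
    apply bop_ext => x; change (S (affine y (Q x) -v affine w (Q x)) = Q x -v S x).
    rewrite opB.
    have -> : affine w (Q x) = x by exact: (f_equal (fun U : bounded_op X => U x) Q1).
    by have -> : S (affine y (Q x)) = Q x by exact: (f_equal (fun U : bounded_op X => U (Q x)) S1).
  have -> : S -o Q = RtoC (-1) *s (Q -o S) by apply bop_ext => x; exact: vsub_flip.
  by rewrite -E affine_sub opZl opZr.
have E : (S -o Q) -o (y - w) *s (RtoC (-1) *s (Q *o (A1 *o Q))) =
  ((y - w) * (y - w)) *s (S *o (A1 *o Q) *o (A1 *o Q)).
  rewrite {1}D1; apply bop_ext => x.
  set u := A1 (Q x).
  change (RtoC (-1) *v ((y - w) *v S u) -v (y - w) *v (RtoC (-1) *v Q u) =
    ((y - w) * (y - w)) *v S (A1 (Q u))).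
  have Du := f_equal (fun U : bounded_op X => U u) D1.
  change (S u -v Q u = RtoC (-1) *v ((y - w) *v S (A1 (Q u)))) in Du.
  rewrite -vscalA; transitivity ((y - w) *v (RtoC (-1) *v (S u -v Q u))).
    by rewrite vscalBr vscalBr !vscalA (Cmult_comm (-1)).
  rewrite Du; f_equal; rewrite vscalA.
  have -> : (RtoC (-1) * RtoC (-1))%C = RtoC 1 by rewrite -RtoC_mult; f_equal; ring.
  exact: vscal1.
change (onorm ((S -o Q) -o (y - w) *s (RtoC (-1) *s (Q *o (A1 *o Q)))) <= e * Cmod (y - w)).
rewrite E; apply Rle_trans with (1 := onorm_scal _ _); rewrite Cmod_mult.
have L : onorm (S *o (A1 *o Q) *o (A1 *o Q)) <= 2 * onorm Q * c * c.
  by apply onorm_mul_le; [apply onorm_mul_le => //|]; exact: onorm_mul.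
apply Rle_trans with (Cmod (y - w) * Cmod (y - w) * k).
  apply Rmult_le_compat_l; first nra.
  by apply Rle_trans with (1 := L); right; rewrite /k; ring.
have : Cmod (y - w) * k <= e; last by nra.
apply Rle_trans with (e / (k + 1) * (k + 1)); last by right; field; lra.
by apply Rmult_le_compat; lra.
Qed.

End AffineInverse.

Section ResolventCalculus.
Context {X : CompleteNormedModule C_AbsRing}.
Variable T : bounded_op X.

Lemma resolvent_cder (l : C) : invertible (pencil l T) ->
  exists d, cder (V := bop_CompleteNormedModule X) (fun y => resolvent y T) l d.
Proof.
move=> Hi.
have E : forall y, pencil y T = affine (RtoC (-1) *s T) 1o y.
  move=> y; apply bop_ext => x; change (y *v x -v T x = RtoC (-1) *v T x +v y *v x).
  by rewrite vaddC /minus vopp_scal.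
have ER : (fun y => resolvent y T) = (fun y => bop_inv (affine (RtoC (-1) *s T) 1o y)).
  by apply functional_extensionality => y; rewrite -E.
rewrite ER; eexists; apply affine_inv_cder; by rewrite -E.
Qed.

Lemma resolvent_ccont (l : C) : invertible (pencil l T) ->
  ccont (V := bop_CompleteNormedModule X) (fun y => resolvent y T) l.
Proof. by move=> /resolvent_cder [d Hd]; exact: cder_cont Hd. Qed.

(** A uniform version of type: one bound on the whole exterior of angle a, from which those for
    larger angles follow. *)
Definition resolvent_off (a B : R) := forall l : C, ~ closure (U := C_UniformSpace) (stolz a) l ->
  invertible (pencil l T) /\ onorm ((l - 1) *s resolvent l T) <= B.

(** [Hinf0] with its constants named, so that they can be followed through sums and products. *)
Definition hol0 (g : R) (phi : C -> C) (M s c : R) :=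
  (forall z, stolz g z -> exists l, cder (V := C_CompleteNormedModule) phi z l) /\
  (forall z, stolz g z -> Cmod (phi z) <= M) /\ 0 < s /\ 0 < c /\
  (forall z, stolz g z -> Cmod (phi z) <= c * Rpower (Cmod (1 - z)) s).

Lemma stolz_Cmod_le1 (g : R) (z : C) : 0 < g < PI / 2 -> stolz g z -> Cmod z <= 1.
Proof.
move=> Hg Hz; have := stolz_Cmod g z Hg Hz; have := sin_01 g Hg; have := Cmod_ge_0 (1 - z); nra.
Qed.

Lemma hol0_mulz (g : R) (phi : C -> C) (M s c : R) : 0 < g < PI / 2 -> hol0 g phi M s c ->
  hol0 g (fun z => (z * phi z)%C) M s c.
Proof.
move=> Hg [H1 [H2 [s0 [c0 H3]]]]; split; [|split; [|split; [|split]]] => //.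
- move=> z Hz; have [l Hl] := H1 z Hz; exists (phi z + z * l)%C => e e0.
  have Z0 := Cmod_ge_0 z.
  have [d1 [d10 K1]] := Hl (e / (2 * (Cmod z + 1))) ltac:(apply Rdiv_lt_0_compat; lra).
  have [d2 [d20 K2]] := cder_cont _ _ _ Hl (e / 2) ltac:(lra).
  exists (Rmin d1 d2); split; first exact: Rmin_pos.
  move=> y Hy.
  have A1 := K1 y (Rlt_le_trans _ _ _ Hy (Rmin_l _ _)).
  have A2 := K2 y (Rlt_le_trans _ _ _ Hy (Rmin_r _ _)).
  have A1' : Cmod (phi y - phi z - (y - z) * l) <= e / (2 * (Cmod z + 1)) * Cmod (y - z) := A1.
  have A2' : Cmod (phi y - phi z) < e / 2 := A2.
  change (Cmod (y * phi y - z * phi z - (y - z) * (phi z + z * l)) <= e * Cmod (y - z)).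
  have -> : (y * phi y - z * phi z - (y - z) * (phi z + z * l) =
    z * (phi y - phi z - (y - z) * l) + (y - z) * (phi y - phi z))%C by ring.
  apply Rle_trans with (1 := Cmod_triangle _ _); rewrite !Cmod_mult.
  have Y0 := Cmod_ge_0 (y - z).
  have B1 : Cmod z * Cmod (phi y - phi z - (y - z) * l) <= e / 2 * Cmod (y - z).
    apply Rle_trans with ((Cmod z + 1) * (e / (2 * (Cmod z + 1)) * Cmod (y - z))).
      by apply Rmult_le_compat; [done | exact: Cmod_ge_0 | lra | done].
    by right; field; lra.
  have B2 : Cmod (y - z) * Cmod (phi y - phi z) <= Cmod (y - z) * (e / 2) by apply Rmult_le_compat_l; lra.
  lra.
- move=> z Hz; rewrite Cmod_mult; have := H2 z Hz; have := stolz_Cmod_le1 g z Hg Hz.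
  have := Cmod_ge_0 z; have := Cmod_ge_0 (phi z); nra.
- move=> z Hz; rewrite Cmod_mult; have := H3 z Hz; have := stolz_Cmod_le1 g z Hg Hz.
  have := Cmod_ge_0 z; have := Cmod_ge_0 (phi z); nra.
Qed.

(** phi has a primitive on the star-shaped domain of angle g, with a limit at 1 because phi is
    bounded. *)
Lemma hol0_Cauchy (b g : R) (phi : C -> C) (M s c : R) : 0 < b < g -> g < PI / 2 ->
  hol0 g phi M s c -> contour (V := C_CompleteNormedModule) b phi (RtoC 0).
Proof.
move=> Hb Hg [H1 [H2 _]].
have Hg' : 0 < g < PI / 2 by lra.
have Hb' : 0 < b < PI / 2 by lra.
have st : forall (t : R) z, 0 <= t <= 1 -> stolz g z -> stolz g (RtoC t * z)%C.
  by move=> t z Ht; exact: stolz_star.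
have op : forall z, stolz g z -> exists e, 0 < e /\ forall y, Cmod (y - z) < e -> stolz g y.
  by move=> z; exact: stolz_open.
have [l Hl] := primitive_limit (V := C_CompleteNormedModule) (stolz g) phi op st H1 M H2 (fun t Ht => stolz_real g t Hg' Ht).
have inS : forall z, bdry b z -> stolz g z by move=> z Hz; apply (bdry_stolz b) => //; lra.
apply (contour_primitive (V := C_CompleteNormedModule) b phi (star_primitive (V := C_CompleteNormedModule) phi) l Hb').
- by move=> z Hz; apply (primitive_der (V := C_CompleteNormedModule) (stolz g)) => //; exact: inS.
- by move=> z Hz; have [d Hd] := H1 z (inS z Hz); exact: cder_cont Hd.
- move=> e e0; have [d [d0 Hd]] := Hl e e0; exists d; split=> // z Hz Hz1.
  by apply Hd => //; exact: inS.
Qed.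

(** Without the factor 1/(2 PI i): v is 2 PI i phi(T). *)
Definition calc (b : R) (phi : C -> C) (v : bounded_op X) :=
  contour (V := bop_CompleteNormedModule X) b (fun l => phi l *s resolvent l T) v.

Lemma calc_fun_calc (b : R) (phi : C -> C) (v : bounded_op X) : calc b phi v ->
  fun_calc b phi T = (/ (2 * PI * Ci))%C *s v.
Proof. by move=> H; rewrite /fun_calc (contour_eq (V := bop_CompleteNormedModule X) _ _ _ H). Qed.

Variables (a B : R).
Hypothesis HB : resolvent_off a B.
Hypothesis Ha : 0 < a.

(** R(z)(I - T) = I - (z - 1) R(z): the factor I - T removes the singularity at 1. *)
Lemma resolvent_range_bound (z : C) : ~ closure (U := C_UniformSpace) (stolz a) z ->
  onorm (resolvent z T *o (1o -o T)) <= 1 + B.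
Proof.
move=> Hz; have [Hi Hn] := HB z Hz.
have [_ E2] := resolventP z T Hi.
have -> : resolvent z T *o (1o -o T) = 1o -o (z - 1) *s resolvent z T.
  apply bop_ext => x.
  have Ex : resolvent z T (z *v x -v T x) = x by exact: (f_equal (fun U : bounded_op X => U x) E2).
  change (resolvent z T (x -v T x) = x -v (z - 1) *v resolvent z T x).
  by rewrite -{3}Ex !opB opZ vscalBl vscal1; exact: vsub_cancel3.
by apply onorm_sub_le => //; exact: onorm_one.
Qed.

Lemma bdry_resolvent (b : R) (z : C) : a < b < PI / 2 -> bdry b z ->
  invertible (pencil z T) /\ Cmod (1 - z) * onorm (resolvent z T) <= B.
Proof.
move=> Hb Hz; have [|Hi Hn] := HB z; first by apply (bdry_out b); [lra | lra | done].
by split=> //; rewrite onorm_scal_eq Cmod_sub_sym in Hn.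
Qed.

Lemma calc_ex (b g : R) (phi : C -> C) (M s c : R) : a < b < g -> g < PI / 2 -> hol0 g phi M s c ->
  exists v, calc b phi v.
Proof.
move=> Hb Hg [H1 [H2 [s0 [c0 H3]]]].
have Hb' : 0 < b < PI / 2 by lra.
have inS : forall z, bdry b z -> stolz g z by move=> z Hz; apply (bdry_stolz b) => //; lra.
have B0 : 0 <= B.
  have Hz : bdry b (circle_pt (sin b) PI) by right; left; exists PI; split=> //; rewrite /arc_range; lra.
  have [_ L] := bdry_resolvent b _ ltac:(lra) Hz; apply Rle_trans with (2 := L).
  by apply Rmult_le_pos; [exact: Cmod_ge_0 | exact: onorm_ge0].
apply (contour_ex (V := bop_CompleteNormedModule X) b _ (c * B) s) => //; first by nra.
- move=> z Hz; have [Hi _] := bdry_resolvent b z ltac:(lra) Hz.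
  have [d Hd] := H1 z (inS z Hz).
  exact: (ccont_mul (V := bop_CompleteNormedModule X) phi _ z (cder_cont _ _ _ Hd) (resolvent_ccont z Hi)).
- move=> z Hz; have [Hi Hn] := bdry_resolvent b z ltac:(lra) Hz.
  have z1 : 0 < Cmod (1 - z).
    apply Cmod_gt_0 => E; apply (bdry_neq1 b Hb' z Hz).
    by transitivity (1 - (1 - z))%C; [ring | rewrite E; ring].
  have -> : Rpower (Cmod (1 - z)) (s - 1) = Rpower (Cmod (1 - z)) s * / Cmod (1 - z).
    by rewrite /Rminus Rpower_plus Rpower_Ropp Rpower_1.
  change (onorm (phi z *s resolvent z T) <= c * B * (Rpower (Cmod (1 - z)) s * / Cmod (1 - z))).
  apply Rle_trans with (1 := onorm_scal _ _).
  have L : onorm (resolvent z T) <= B * / Cmod (1 - z).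
    apply (Rmult_le_reg_l (Cmod (1 - z))) => //.
    by apply Rle_trans with (1 := Hn); right; field; lra.
  apply Rle_trans with (c * Rpower (Cmod (1 - z)) s * (B * / Cmod (1 - z))); last by right; ring.
  apply Rmult_le_compat => //; [exact: Cmod_ge_0 | exact: onorm_ge0 | exact: H3 (inS z Hz)].
Qed.

Lemma is_linear_opmul_r (S : bounded_op X) :
  is_linear (U := bop_NormedModule X) (V := bop_NormedModule X) (fun U => U *o S).
Proof.
split.
- by move=> U W; exact: opD_r.
- by move=> k U; exact: opZl.
- exists (onorm S + 1); split; first by have := onorm_ge0 S; lra.
  move=> U; apply Rle_trans with (1 := onorm_mul U S).
  have := onorm_ge0 U; change (norm U) with (onorm U); lra.
Qed.

Lemma is_linear_opmul_l (S : bounded_op X) :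
  is_linear (U := bop_NormedModule X) (V := bop_NormedModule X) (fun U => S *o U).
Proof.
split.
- by move=> U W; exact: opD_l.
- by move=> k U; exact: opZr.
- exists (onorm S + 1); split; first by have := onorm_ge0 S; lra.
  move=> U; apply Rle_trans with (1 := onorm_mul S U).
  have := onorm_ge0 U; change (norm U) with (onorm U); lra.
Qed.

Lemma is_linear_scal_op (S : bounded_op X) :
  is_linear (U := C_NormedModule) (V := bop_NormedModule X) (fun k => k *s S).
Proof.
have [D Z [M [M0 HM]]] := is_linear_scal_l (V := bop_NormedModule X) S.
by split; [exact: D | exact: Z | exists M; split].
Qed.

Lemma contour_linear {V V' : CompleteNormedModule C_AbsRing} (L : V -> V') b (f : C -> V) v :
  is_linear L -> contour b f v -> contour b (fun z => L (f z)) (L v).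
Proof.
move=> HL [v1 [v2 [v3 [H1 [H2 [H3 ->]]]]]].
have LZ : forall (k : C) x, L (k *v x) = k *v L x by exact: linear_scal.
exists (L v1), (L v2), (L v3); split; [|split; [|split]].
- by apply: sing_int_ext (sing_int_linear L _ _ HL H1) => t _; rewrite /seg_fun LZ.
- have -> : arc_fun (fun z => L (f z)) b = (fun t => L (arc_fun f b t)).
    by apply functional_extensionality => t; rewrite /arc_fun LZ.
  exact: vint_linear.
- by apply: sing_int_ext (sing_int_linear L _ _ HL H3) => t _; rewrite /seg_fun LZ.
- have -> : L (v1 +v (v2 -v v3)) = L v1 +v L (v2 -v v3) by exact: linear_plus.
  by have -> : L (v2 -v v3) = L v2 -v L v3 by exact: linear_minus.
Qed.

Lemma calc_comm (b : R) (phi : C -> C) (v : bounded_op X) : a < b < PI / 2 ->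
  calc b phi v -> v *o T = T *o v.
Proof.
move=> Hb Hv.
apply (contour_unique (V := bop_CompleteNormedModule X) b (fun l => (phi l *s resolvent l T) *o T)).
  exact: (contour_linear (V := bop_CompleteNormedModule X) (V' := bop_CompleteNormedModule X) _ _ _ _ (is_linear_opmul_r T) Hv).
apply: (contour_ext (V := bop_CompleteNormedModule X) b (fun l => T *o (phi l *s resolvent l T))); first lra.
- move=> z Hz; have [Hi _] := bdry_resolvent b z Hb Hz.
  change (T *o (phi z *s resolvent z T) = (phi z *s resolvent z T) *o T).
  by rewrite opZr opZl resolvent_comm.
- exact: (contour_linear (V := bop_CompleteNormedModule X) (V' := bop_CompleteNormedModule X) _ _ _ _ (is_linear_opmul_l T) Hv).
Qed.

(** z R(z) = R(z) T + I, and the integral of phi times I vanishes by Cauchy's theorem. *)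
Lemma calc_mulz (b : R) (phi : C -> C) (v : bounded_op X) : a < b < PI / 2 ->
  contour (V := C_CompleteNormedModule) b phi (RtoC 0) ->
  calc b phi v -> calc b (fun z => (z * phi z)%C) (v *o T).
Proof.
move=> Hb H0 Hv.
have K1 := contour_linear (V := bop_CompleteNormedModule X) (V' := bop_CompleteNormedModule X) _ _ _ _ (is_linear_opmul_r T) Hv.
have K2 := contour_linear (V := C_CompleteNormedModule) (V' := bop_CompleteNormedModule X) _ _ _ _ (is_linear_scal_op 1o) H0.
have K3 := contour_add (V := bop_CompleteNormedModule X) _ _ _ _ _ K1 K2.
have E : v *o T = v *o T +o RtoC 0 *s 1o.
  apply bop_ext => x; change (v (T x) = v (T x) +v RtoC 0 *v x).
  by rewrite v0scal vadd0.
rewrite /calc E; apply: contour_ext K3; first lra.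
move=> z Hz; have [Hi _] := bdry_resolvent b z Hb Hz.
have [E1 E2] := resolventP z T Hi.
change ((phi z *s resolvent z T) *o T +o phi z *s 1o = (z * phi z) *s resolvent z T).
apply bop_ext => x.
have Ex : resolvent z T (z *v x -v T x) = x by exact: (f_equal (fun U : bounded_op X => U x) E2).
change (phi z *v resolvent z T (T x) +v phi z *v x = (z * phi z) *v resolvent z T x).
rewrite -{2}Ex opB opZ vscalBr vscalA (Cmult_comm z); exact: vadd_sub.
Qed.

Lemma calc_pow (b g : R) (phi : C -> C) (M s c : R) (v : bounded_op X) (n : nat) :
  a < b < g -> g < PI / 2 -> hol0 g phi M s c ->
  calc b phi v -> calc b (fun z => (Cpow z n * phi z)%C) (v *o T ^o n).
Proof.
move=> Hb Hg Hphi Hv.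
have main : forall n, hol0 g (fun z => (Cpow z n * phi z)%C) M s c /\ calc b (fun z => (Cpow z n * phi z)%C) (v *o T ^o n).
  elim=> [|k [IH1 IH2]].
    have -> : (fun z => (Cpow z 0 * phi z)%C) = phi.
      by apply functional_extensionality => z; rewrite /=; ring.
    by split=> //; change (calc b phi (v *o 1o)); rewrite op1_r.
  have -> : (fun z => (Cpow z (S k) * phi z)%C) = (fun z => (z * (Cpow z k * phi z))%C).
    by apply functional_extensionality => z; rewrite /=; ring.
  split; first by apply hol0_mulz => //; lra.
  have -> : v *o T ^o (S k) = (v *o T ^o k) *o T.
    rewrite -opA; f_equal; exact: (f_equal bico (bmul_comm T (bT T) (bpow k))).
  apply calc_mulz => //; first lra.
  by apply (hol0_Cauchy b g _ M s c) => //; lra.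
exact: (proj2 (main n)).
Qed.

End ResolventCalculus.

(** * Decay of powers along the contour *)

Lemma Bernoulli_inv (k : R) (n : nat) : 0 <= k <= 1 -> (1 - k) ^ n * (1 + INR n * k) <= 1.
Proof.
move=> Hk; elim: n => [|n IH]; first by rewrite /=; lra.
have P := pow_le (1 - k) n ltac:(lra); have N := pos_INR n.
rewrite S_INR [(1 - k) ^ S n]/=; apply Rle_trans with (2 := IH).
have -> : (1 - k) * (1 - k) ^ n * (1 + (INR n + 1) * k) = (1 - k) ^ n * ((1 - k) * (1 + (INR n + 1) * k)) by ring.
apply Rmult_le_compat_l => //.
have := Rmult_le_pos _ _ N (pow2_ge_0 k); rewrite /=; nra.
Qed.

(** Integration of (1 - t k)^n yields the factor 1/(n + 1) of [calc_orbit_bound]. *)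
Lemma geometric_int (k D : R) (n : nat) (e : R) : 0 < k < 1 -> 0 <= D -> 0 < e < 1 ->
  exists l, is_RInt (fun t => D * (1 - t * k) ^ n) e 1 l /\ l <= D / (k * INR (S n)).
Proof.
move=> Hk HD He.
have N : 0 < INR (S n) by apply lt_0_INR; lia.
have kN : 0 < k * INR (S n) by apply Rmult_lt_0_compat; lra.
set G := fun t => - (D / (k * INR (S n))) * (1 - t * k) ^ S n.
exists (G 1 - G e); split.
- apply (is_RInt_derive G (fun t => D * (1 - t * k) ^ n)) => t _.
    rewrite /G; auto_derive => //.
    rewrite -/(INR (S n)) /=; change (match n with 0%nat => 1 | S _ => INR n + 1 end) with (INR (S n)).
    have -> : 1 + - (t * k) = 1 - t * k by ring.
    by field; lra.
  by apply (ex_derive_continuous (K := R_AbsRing) (V := R_NormedModule)); auto_derive.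
- rewrite /G; set c := D / (k * INR (S n)).
  have c0 : 0 <= c by apply Rdiv_le_0_compat.
  have P1 : 0 <= (1 - 1 * k) ^ S n by apply pow_le; lra.
  have P2 : (1 - e * k) ^ S n <= 1.
    have := Rmult_lt_0_compat e k; have : e * k <= 1 by nra.
    move=> L0 L1; apply Rle_trans with (1 ^ S n); last by rewrite pow1; lra.
    by apply pow_incr; lra.
  move: P1 P2; move: ((1 - 1 * k) ^ S n) ((1 - e * k) ^ S n) => p q P1 P2; nra.
Qed.

(** Interpolates between (1 - x)^n <= 1 and the bound 1/(n x) from [Bernoulli_inv]. *)
Lemma pow_le_Rpower (n : nat) (x th : R) : (0 < n)%nat -> 0 < x < 1 -> 0 < th <= 1 ->
  (1 - x) ^ n <= Rpower (INR n * x) (- th).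
Proof.
move=> n0 Hx Ht.
have N : 0 < INR n by apply lt_0_INR.
have nx : 0 < INR n * x by apply Rmult_lt_0_compat; lra.
have B := Bernoulli_inv x n ltac:(lra).
have P := pow_le (1 - x) n ltac:(lra).
case: (Rle_lt_dec 1 (INR n * x)) => L.
- apply Rle_trans with (Rpower (INR n * x) (- (1))).
    rewrite Rpower_Ropp Rpower_1 //.
    apply (Rmult_le_reg_r (INR n * x)) => //; rewrite Rinv_l; last lra.
    by move: B P; move: ((1 - x) ^ n) => p B P; lra.
  apply Rle_Rpower => //; lra.
- apply Rle_trans with 1.
    by apply Rle_trans with (1 ^ n); [apply pow_incr; lra | rewrite pow1; lra].
  rewrite Rpower_Ropp -Rinv_1; apply Rinv_le_contravar; first exact: exp_pos.
  have -> : 1 = Rpower 1 th by rewrite /Rpower ln_1 Rmult_0_r exp_0.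
  apply Rle_Rpower_l; lra.
Qed.

Section CalculusBounds.
Context {X : CompleteNormedModule C_AbsRing}.
Variables (T : bounded_op X) (a g B : R).
Hypothesis Ha : 0 < a.
Hypothesis Hag : a < g.
Hypothesis Hg : g < PI / 2.
Hypothesis HB : resolvent_off T a B.

(** On the segments of every contour of angle b < g one has |z| <= 1 - t k; since k depends on g
    only, the resulting constants are uniform in b. *)
Let k := 1 - sin g.

Let k01 : 0 < k < 1.
Proof. by rewrite /k; have := sin_01 g ltac:(lra); lra. Qed.

Section OnePhi.
Variables (b : R) (phi : C -> C) (M s c : R) (v : bounded_op X).
Hypothesis Hb : a < b < g.
Hypothesis Hphi : hol0 g phi M s c.
Hypothesis Hv : calc T b phi v.

Let Hb' : 0 < b < PI / 2.
Proof. lra. Qed.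

Let sb : 0 < sin b /\ sin b <= 1 - k.
Proof.
split; first exact: (proj1 (sin_01 b Hb')).
by rewrite /k; have := sin_increasing_1 b g; lra.
Qed.

Let inS z : bdry b z -> stolz g z.
Proof. by move=> Hz; apply (bdry_stolz b) => //; lra. Qed.

Let M0 : 0 <= M.
Proof.
apply Rle_trans with (2 := proj1 (proj2 Hphi) _ (stolz_real g 0 ltac:(lra) ltac:(lra))).
exact: Cmod_ge_0.
Qed.

Let range_bdry z : bdry b z -> onorm (resolvent z T *o (1o -o T)) <= 1 + B.
Proof. by move=> Hz; apply (resolvent_range_bound T a B HB), (bdry_out b); [lra | lra | done]. Qed.

Lemma range_bound_ge0 : 0 <= 1 + B.
Proof.
have Hz : bdry b (circle_pt (sin b) PI).
  by right; left; exists PI; split=> //; rewrite /arc_range; have := PI_RGT_0; lra.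
by apply Rle_trans with (2 := range_bdry _ Hz); exact: onorm_ge0.
Qed.

Lemma Cmod_on_seg (w : C) (t : R) : Cmod w = sin b -> 0 < t <= 1 -> Cmod (segment 1 w t) <= 1 - t * k.
Proof.
move=> Hw Ht; apply Rle_trans with (1 := Cmod_seg b w t Hw ltac:(lra)).
have : t * k <= t * (1 - sin b) by apply Rmult_le_compat_l; lra.
lra.
Qed.

Lemma Cmod_up : Cmod (stolz_up b) = sin b.
Proof. exact: Cmod_circle. Qed.

Lemma Cmod_low : Cmod (stolz_low b) = sin b.
Proof. exact: Cmod_circle. Qed.

Lemma seg_up_bdry (t : R) : 0 < t <= 1 -> bdry b (segment 1 (stolz_up b) t).
Proof. by move=> Ht; left; exists t. Qed.

Lemma seg_low_bdry (t : R) : 0 < t <= 1 -> bdry b (segment 1 (stolz_low b) t).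
Proof. by move=> Ht; right; right; exists t. Qed.

Lemma arc_bdry (t : R) : arc_range b t -> bdry b (circle_pt (sin b) t).
Proof. by move=> Ht; right; left; exists t. Qed.

(** On the contour R(z)(I - T) is bounded and phi is bounded by M, while |z|^n integrates to O(1/(n
    + 1)). *)
Lemma calc_orbit_bound (n : nat) :
  INR (S n) * onorm (v *o T ^o n *o (1o -o T)) <= M * ((1 + B) * ((2 + 2 * PI) / k)).
Proof.
have Hn := calc_pow T a B HB Ha b g phi M s c v n Hb Hg Hphi Hv.
have HA := contour_linear (V := bop_CompleteNormedModule X) (V' := bop_CompleteNormedModule X)
  _ _ _ _ (is_linear_opmul_r (1o -o T)) Hn.
have bound : forall z q, bdry b z -> Cmod z <= q ->
    onorm ((Cpow z n * phi z) *s resolvent z T *o (1o -o T)) <= M * (1 + B) * q ^ n.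
  move=> z q Hz Hq; rewrite opZl.
  apply Rle_trans with (1 := onorm_scal _ _); rewrite Cmod_mult Cmod_pow.
  have -> : M * (1 + B) * q ^ n = q ^ n * M * (1 + B) by ring.
  apply Rmult_le_compat; [|exact: onorm_ge0| |exact: range_bdry].
    by apply Rmult_le_pos; [apply pow_le; exact: Cmod_ge_0 | exact: Cmod_ge_0].
  apply Rmult_le_compat; [apply pow_le; exact: Cmod_ge_0 | exact: Cmod_ge_0 | |].
    by apply pow_incr; split; [exact: Cmod_ge_0|].
  exact: (proj1 (proj2 Hphi)) (inS z Hz).
have D0 : 0 <= M * (1 + B) by apply Rmult_le_pos => //; exact: range_bound_ge0.
have N := contour_norm (V := bop_CompleteNormedModule X) _ _ _ (fun t => M * (1 + B) * (1 - t * k) ^ n)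
  (M * (1 + B) / (k * INR (S n))) (M * (1 + B) * (1 - k) ^ n) Hb' HA
  (fun t Ht => bound _ _ (seg_up_bdry t Ht) (Cmod_on_seg _ _ Cmod_up Ht))
  (fun t Ht => bound _ _ (seg_low_bdry t Ht) (Cmod_on_seg _ _ Cmod_low Ht))
  (fun e He => geometric_int k _ n e k01 D0 He)
  (fun t Ht => bound _ _ (arc_bdry t Ht) (Rle_trans _ _ _ (Req_le _ _ (Cmod_circle b Hb' t)) (proj2 sb))).
have NS : 0 < INR (S n) by apply lt_0_INR; lia.
have P := PI_RGT_0.
have N' : onorm (v *o T ^o n *o (1o -o T)) <=
  2 * (M * (1 + B) / (k * INR (S n))) + 2 * PI * (M * (1 + B) * (1 - k) ^ n) := N.
apply Rle_trans with (1 := Rmult_le_compat_l _ _ _ (Rlt_le _ _ NS) N').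
have Be : INR (S n) * (1 - k) ^ n <= / k.
  apply (Rmult_le_reg_l k); first lra.
  rewrite Rinv_r; last lra.
  apply Rle_trans with (2 := Bernoulli_inv k n ltac:(lra)).
  have Pn := pow_le (1 - k) n ltac:(lra); rewrite S_INR; have := pos_INR n; nra.
have -> : INR (S n) * (2 * (M * (1 + B) / (k * INR (S n))) + 2 * PI * (M * (1 + B) * (1 - k) ^ n)) =
  M * (1 + B) * (2 / k) + 2 * PI * (M * (1 + B)) * (INR (S n) * (1 - k) ^ n) by field; lra.
have -> : M * ((1 + B) * ((2 + 2 * PI) / k)) = M * (1 + B) * (2 / k) + 2 * PI * (M * (1 + B)) * / k by field; lra.
apply Rplus_le_compat_l, Rmult_le_compat_l => //; apply Rmult_le_pos; lra.
Qed.

(** On the segments phi(z) R(z) is O(t^(s-1)). Giving up t^th of this integrability allows |z|^n to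
    be replaced by (n k t)^-th, which decays in n; on the arc |z| <= 1 - k. *)
Lemma calc_pow_vanish (e : R) : 0 < e -> exists N, forall n, (N <= n)%nat -> onorm (v *o T ^o n) <= e.
Proof.
move=> e0; have [_ [_ [s0 [c0 H3]]]] := Hphi.
(* Below s, so that t^(s - th - 1) is integrable, and at most 1, as [pow_le_Rpower] asks. *)
set th := Rmin s 1 / 2.
have m1 := Rmin_l s 1; have m2 := Rmin_r s 1; have m0 : 0 < Rmin s 1 by apply Rmin_pos; lra.
have th0 : 0 < th <= 1 by rewrite /th; lra.
have sth : 0 < s - th by rewrite /th; lra.
have cb : 0 < cos b by apply cos_gt_0; lra.
have P := PI_RGT_0.
have B0 : 0 <= B.
  have Hz : bdry b (circle_pt (sin b) PI) by apply arc_bdry; rewrite /arc_range; lra.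
  have [_ L] := bdry_resolvent T a B HB Ha b _ ltac:(lra) Hz; apply Rle_trans with (2 := L).
  by apply Rmult_le_pos; [exact: Cmod_ge_0 | exact: onorm_ge0].
set D := c * B * Rpower (cos b) (s - 1).
have D0 : 0 <= D by apply Rmult_le_pos; [nra | exact: Rlt_le (exp_pos _)].
have bound : forall n, (0 < n)%nat -> onorm (v *o T ^o n) <=
    2 * (D * Rpower (INR n * k) (- th) / (s - th)) + 2 * PI * (M * B / k * (1 - k) ^ n).
  move=> n n0.
  have NI : 0 < INR n by apply lt_0_INR.
  have nk : 0 < INR n * k by apply Rmult_lt_0_compat; lra.
  have Hn := calc_pow T a B HB Ha b g phi M s c v n Hb Hg Hphi Hv.
  have Rp : 0 < Rpower (INR n * k) (- th) by exact: exp_pos.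
  have seg : forall w t, Cmod w = sin b -> Cmod (w - 1) = cos b -> 0 < t <= 1 -> bdry b (segment 1 w t) ->
      onorm ((Cpow (segment 1 w t) n * phi (segment 1 w t)) *s resolvent (segment 1 w t) T) <=
      D * Rpower (INR n * k) (- th) * Rpower t (s - th - 1).
    move=> w t Hw Hw1 Ht Hz; set z := segment 1 w t in Hz *.
    have [Hi Hr] := bdry_resolvent T a B HB Ha b z ltac:(lra) Hz.
    have Ez : Cmod (1 - z) = t * cos b by rewrite /z Cmod_seg1 ?Hw1; lra.
    have tc : 0 < t * cos b by apply Rmult_lt_0_compat; lra.
    have Lr : onorm (resolvent z T) <= B * / (t * cos b).
      rewrite Ez in Hr; apply (Rmult_le_reg_l (t * cos b)) => //.
      by apply Rle_trans with (1 := Hr); right; field; lra.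
    apply Rle_trans with (1 := onorm_scal _ _); rewrite Cmod_mult Cmod_pow.
    have Lz : Cmod z ^ n <= Rpower (INR n * k) (- th) * Rpower t (- th).
      rewrite Rpower_mult_distr; [|lra|lra].
      have -> : INR n * k * t = INR n * (t * k) by ring.
      apply Rle_trans with ((1 - t * k) ^ n).
        by apply pow_incr; split; [exact: Cmod_ge_0 | exact: Cmod_on_seg].
      by apply pow_le_Rpower => //; nra.
    have Lp : Cmod (phi z) <= c * (Rpower t s * Rpower (cos b) s).
      by rewrite Rpower_mult_distr; [|lra|lra]; rewrite -Ez; exact: H3 (inS z Hz).
    apply Rle_trans with (Rpower (INR n * k) (- th) * Rpower t (- th) * (c * (Rpower t s * Rpower (cos b) s)) * (B * / (t * cos b))).
      apply Rmult_le_compat => //; [|exact: onorm_ge0|].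
        by apply Rmult_le_pos; [apply pow_le; exact: Cmod_ge_0 | exact: Cmod_ge_0].
      by apply Rmult_le_compat => //; [apply pow_le|]; exact: Cmod_ge_0.
    right; rewrite /D.
    have -> : Rpower t (s - th - 1) = Rpower t s * Rpower t (- th) * / t.
      have -> : s - th - 1 = s + - th + - (1) by ring.
      by rewrite !Rpower_plus (Rpower_Ropp t 1) Rpower_1 //; lra.
    have -> : Rpower (cos b) (s - 1) = Rpower (cos b) s * / cos b.
      by rewrite /Rminus Rpower_plus Rpower_Ropp Rpower_1.
    field; lra.
  have arc : forall t, arc_range b t ->
      onorm ((Cpow (circle_pt (sin b) t) n * phi (circle_pt (sin b) t)) *s resolvent (circle_pt (sin b) t) T) <=
      M * B / k * (1 - k) ^ n.
    move=> t Ht; have Hz := arc_bdry t Ht; set z := circle_pt (sin b) t in Hz *.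
    have Ez : Cmod z = sin b by exact: Cmod_circle.
    have [Hi Hr] := bdry_resolvent T a B HB Ha b z ltac:(lra) Hz.
    have L1 : k <= Cmod (1 - z).
      have := Cmod_triangle (1 - z) z; have -> : (1 - z + z = 1)%C by ring.
      rewrite Cmod_1 Ez; lra.
    have Lr : onorm (resolvent z T) <= B / k.
      apply (Rmult_le_reg_l k); first lra.
      apply Rle_trans with (Cmod (1 - z) * onorm (resolvent z T)).
        by apply Rmult_le_compat_r => //; exact: onorm_ge0.
      by apply Rle_trans with (1 := Hr); right; field; lra.
    apply Rle_trans with (1 := onorm_scal _ _); rewrite Cmod_mult Cmod_pow Ez.
    have -> : M * B / k * (1 - k) ^ n = (1 - k) ^ n * M * (B / k) by field; lra.
    apply Rmult_le_compat => //; [|exact: onorm_ge0|].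
      by apply Rmult_le_pos; [apply pow_le; lra | exact: Cmod_ge_0].
    apply Rmult_le_compat; [apply pow_le; lra | exact: Cmod_ge_0 | apply pow_incr; lra |].
    exact: (proj1 (proj2 Hphi)) (inS z Hz).
  have E0 : 0 <= D * Rpower (INR n * k) (- th) by apply Rmult_le_pos; lra.
  apply (contour_norm (V := bop_CompleteNormedModule X) _ _ _
    (fun t => D * Rpower (INR n * k) (- th) * Rpower t (s - th - 1)) _ _ Hb' Hn).
  - by move=> t Ht; apply seg => //; [exact: Cmod_up | exact: Cmod_stolz_upB | exact: seg_up_bdry].
  - by move=> t Ht; apply seg => //; [exact: Cmod_low | exact: Cmod_stolz_lowB | exact: seg_low_bdry].
  - move=> e' He'; exists (D * Rpower (INR n * k) (- th) * (/ (s - th) * Rpower 1 (s - th) - / (s - th) * Rpower e' (s - th))).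
    split.
      exact: (is_RInt_scal _ _ _ (D * Rpower (INR n * k) (- th)) _ (Rpower_int (s - th) e' 1 sth ltac:(lra) ltac:(lra))).
    rewrite /Rdiv; apply Rmult_le_compat_l => //.
    have -> : Rpower 1 (s - th) = 1 by rewrite /Rpower ln_1 Rmult_0_r exp_0.
    have := Rmult_lt_0_compat _ _ (Rinv_0_lt_compat _ sth) (exp_pos ((s - th) * ln e')).
    rewrite /Rpower; lra.
  - exact: arc.
set D2 := 2 * (D / (s - th)).
have D20 : 0 <= D2 by apply Rmult_le_pos; [lra | apply Rdiv_le_0_compat].
set M2 := 2 * PI * (M * B / k).
have M20 : 0 <= M2.
  by apply Rmult_le_pos; [lra | apply Rdiv_le_0_compat; [apply Rmult_le_pos | lra]].
have [N1 HN1] := pow_small (1 - k) (e / (2 * (M2 + 1))) ltac:(lra) ltac:(apply Rdiv_lt_0_compat; lra).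
set q := e / (2 * (D2 + 1)).
have q0 : 0 < q by apply Rdiv_lt_0_compat; lra.
(* n >= R0 gives (n k)^-th <= q. *)
set R0 := Rpower q (- / th) / k.
have [N2 HN2] := nfloor_ex R0 (Rlt_le _ _ (Rdiv_lt_0_compat _ _ (exp_pos _) (proj1 k01))).
exists (N1 + S N2)%nat => n Hn.
have n0 : (0 < n)%nat by lia.
apply Rle_trans with (1 := bound n n0).
have L1 := HN1 n ltac:(lia).
have L2 : Rpower (INR n * k) (- th) <= q.
  have nR : R0 <= INR n.
    have : INR (S N2) <= INR n by apply le_INR; lia.
    rewrite S_INR; lra.
  have nq : Rpower q (- / th) <= INR n * k.
    have -> : Rpower q (- / th) = R0 * k by rewrite /R0; field; lra.
    by apply Rmult_le_compat_r; lra.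
  have -> : q = Rpower (Rpower q (- / th)) (- th).
    rewrite Rpower_mult; have -> : - / th * - th = 1 by field; lra.
    by rewrite Rpower_1.
  rewrite !(Rpower_Ropp _ th); apply Rinv_le_contravar; first exact: exp_pos.
  apply Rle_Rpower_l; [lra | split => //; exact: exp_pos].
have A1 : 2 * (D * Rpower (INR n * k) (- th) / (s - th)) <= e / 2.
  have -> : 2 * (D * Rpower (INR n * k) (- th) / (s - th)) = D2 * Rpower (INR n * k) (- th) by rewrite /D2; field; lra.
  apply Rle_trans with ((D2 + 1) * q).
    by apply Rmult_le_compat => //; [exact: Rlt_le (exp_pos _) | lra].
  by right; rewrite /q; field; lra.
have A2 : 2 * PI * (M * B / k * (1 - k) ^ n) <= e / 2.
  have -> : 2 * PI * (M * B / k * (1 - k) ^ n) = M2 * (1 - k) ^ n by rewrite /M2; ring.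
  apply Rle_trans with ((M2 + 1) * (e / (2 * (M2 + 1)))).
    by apply Rmult_le_compat => //; [apply pow_le; lra | lra | lra].
  by right; field; lra.
lra.
Qed.

End OnePhi.
End CalculusBounds.

(** * Square functions bound the calculus *)

(** v = v (I - E_0) + v (E_0 - E_N) + v E_N. The first part contains v (I - T), the second is
    [tele_bound] with Phi = v, and the third is small because E_N contains T^(3 2^N). *)
Lemma commuting_bound {H : Hilbert} (T : bounded_op H) (M : R) :
  1 <= M -> (forall n, onorm (T ^o n) <= M) ->
  square_estimate T -> square_estimate (adjoint T) ->
  exists R0, 0 <= R0 /\ forall (v : bounded_op H) (D : R), v *o T = T *o v ->
    (forall n, INR (S n) * onorm (v *o T ^o n *o (1o -o T)) <= D) ->
    (forall e, 0 < e -> exists N, forall n, (N <= n)%nat -> onorm (v *o T ^o n) <= e) ->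
    onorm v <= R0 * D.
Proof.
move=> M1 HM [K1 [K10 HK1]] [K2 [K20 HK2]].
set c0 := ((1 + M) * (1 + M)) * (3 * M * (3 * M * (3 * M))).
set W := 1 + ((1 + M) + (1 + M) * (1 + M)).
have W1 : 1 <= W by rewrite /W; nra.
have c00 : 0 <= c0 by rewrite /c0; apply Rmult_le_pos; [nra|]; apply Rmult_le_pos; nra.
have M40 : 0 <= 189 * M ^ 4 by have := pow_le M 4; lra.
have s0 := sqrt_pos (K2 * K1).
have R00 : 0 <= c0 + 189 * M ^ 4 * sqrt (K2 * K1).
  by have := Rmult_le_pos _ _ M40 s0; lra.
exists (c0 + 189 * M ^ 4 * sqrt (K2 * K1)); split=> //.
move=> v D Hc HD Hv.
have D1 : onorm (v *o (1o -o T)) <= D.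
  have := HD 0%nat; change (v *o T ^o 0) with (v *o 1o); rewrite op1_r Rmult_1_l => //.
have D0 : 0 <= D by apply Rle_trans with (2 := D1); exact: onorm_ge0.
have Ho : forall j, 2 ^ j * onorm (v *o orbit_b (T := T) j) <= D.
  move=> j; apply Rle_trans with (2 := HD (2 ^ j)%nat).
  change (2 ^ j * onorm (v *o (T ^o (2 ^ j) *o (1o -o T))) <= INR (S (2 ^ j)) * onorm (v *o T ^o (2 ^ j) *o (1o -o T))).
  rewrite opA; apply Rmult_le_compat_r; first exact: onorm_ge0.
  by rewrite S_INR INR_2pow; lra.
apply le_epsilon => e e0.
have [N HN] := Hv (e / W) ltac:(apply Rdiv_lt_0_compat; lra).
have RD : 0 <= (c0 + 189 * M ^ 4 * sqrt (K2 * K1)) * D by exact: Rmult_le_pos.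
apply onorm_le => [|x]; first lra.
have X0 := norm_ge_0 x.
have Ex : x = (bsub b1 (tele (T := T) 0)) x +v (bsub (tele 0) (tele (T := T) N) x +v tele (T := T) N x).
  exact: (f_equal (fun a : bicomm T => a x) (tele_rest N)).
have P1 : norm (v (bsub b1 (tele (T := T) 0) x)) <= c0 * D * norm x.
  rewrite tele0_factor bmul_comm.
  change (norm ((v *o (1o -o T)) (tele0_c (T := T) x)) <= c0 * D * norm x).
  apply Rle_trans with (1 := onorm_app _ _).
  have -> : c0 * D * norm x = D * (c0 * norm x) by ring.
  apply Rmult_le_compat; [exact: onorm_ge0 | exact: norm_ge_0 | done |].
  apply Rle_trans with (1 := onorm_app _ _).
  by apply Rmult_le_compat_r => //; exact: tele0_c_norm.
have P2 : norm (v (bsub (tele 0) (tele (T := T) N) x)) <= 189 * M ^ 4 * sqrt (K2 * K1) * D * norm x.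
  have L := tele_bound T M K2 M1 K20 HM HK2 v D Hc Ho 0 N x.
  rewrite Nat.add_0_l in L.
  have Q0 : 0 <= 189 * M ^ 4 * sqrt (K2 * K1) * D * norm x.
    by apply Rmult_le_pos => //; apply Rmult_le_pos => //; exact: Rmult_le_pos.
  apply Rsqr_incr_0_var => //; rewrite !Rsqr_pow2.
  apply Rle_trans with (1 := L).
  apply Rle_trans with ((189 * M ^ 4 * D) ^ 2 * K2 * (K1 * norm x ^ 2)).
    apply Rmult_le_compat_l; last by have := HK1 x N.
    by apply Rmult_le_pos => //; exact: pow2_ge_0.
  right; have E := pow2_sqrt (K2 * K1) (Rmult_le_pos _ _ K20 K10).
  transitivity ((189 * M ^ 4 * D) ^ 2 * (K2 * K1) * norm x ^ 2); first by ring.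
  by rewrite -{1}E; ring.
have P3 : norm (v (tele (T := T) N x)) <= e * norm x.
  have -> : tele (T := T) N = bmul (bpow (3 * 2 ^ N)) (tele_w N).
    by rewrite -tele_uE; exact: (tele_expand N).
  change (norm ((v *o T ^o (3 * 2 ^ N)) (tele_w (T := T) N x)) <= e * norm x).
  apply Rle_trans with (1 := onorm_app _ _).
  have -> : e * norm x = e / W * (W * norm x) by field; lra.
  apply Rmult_le_compat; [exact: onorm_ge0 | exact: norm_ge_0 | |].
    by apply HN; have := Nat.pow_gt_lin_r 2 N; lia.
  apply Rle_trans with (1 := onorm_app _ _).
  by apply Rmult_le_compat_r => //; exact: tele_w_norm.
have Ev : v x = v (bsub b1 (tele (T := T) 0) x) +v (v (bsub (tele 0) (tele (T := T) N) x) +v v (tele (T := T) N x)).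
  by rewrite {1}Ex !opD.
rewrite Ev; apply Rle_trans with (1 := vadd_norm _ _).
apply Rle_trans with (1 := Rplus_le_compat _ _ _ _ P1 (Rle_trans _ _ _ (vadd_norm _ _) (Rplus_le_compat _ _ _ _ P2 P3))).
by right; ring.
Qed.

(** * Ritt operators and their types *)

Lemma not_closure_mono (a b : R) (l : C) : 0 < a -> a <= b -> b < PI / 2 ->
  ~ closure (U := C_UniformSpace) (stolz b) l -> ~ closure (U := C_UniformSpace) (stolz a) l.
Proof.
move=> a0 ab b1 /not_closure [e [e0 He]]; apply/not_closure; exists e; split=> // y Hy Ha.
by apply (He y Hy); apply: stolz_mono Ha.
Qed.

Lemma stolz_closure (a : R) (l : C) : stolz a l -> closure (U := C_UniformSpace) (stolz a) l.
Proof.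
move=> Hl; apply NNPP => /not_closure [e [e0 He]]; apply (He l) => //.
have -> : (l - l = 0)%C by ring.
by rewrite Cmod_0.
Qed.

Section RittType.
Context {X : CompleteNormedModule C_AbsRing}.
Variable T : bounded_op X.

Lemma ritt_resolvent_off : ritt T -> exists a B, 0 < a < PI / 2 /\ resolvent_off T a B.
Proof.
move=> /ritt_resolvent [K [B [K1 [B0 HB]]]].
have [a [Ha Hr]] := region_stolz K K1.
exists a, B; split=> // l Hl; apply HB.
case: (Rlt_le_dec (K * (1 - Cmod l)) (Cmod (1 - l))) => // L; case: Hl.
case: (Ceq_dec l 1) => [-> | N]; first exact: one_closure_stolz.
by apply stolz_closure, Hr.
Qed.

Lemma resolvent_off_mono (a b B : R) : 0 < a -> a <= b -> b < PI / 2 ->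
  resolvent_off T a B -> resolvent_off T b B.
Proof. by move=> a0 ab b1 HB l Hl; apply HB; apply: not_closure_mono Hl. Qed.

Lemma resolvent_off_type (a B : R) : 0 < a < PI / 2 -> ritt T ->
  resolvent_off T a B -> ritt_of_type a T.
Proof.
move=> Ha HT HB; split=> //; split=> //; split.
  by move=> l Hl; apply NNPP => /HB [Hi _]; exact: Hl Hi.
move=> b Hb; exists B => l Hl.
exact: (proj2 (resolvent_off_mono a b B ltac:(lra) ltac:(lra) ltac:(lra) HB l Hl)).
Qed.

Lemma ritt_of_type_off (a b : R) : a < b < PI / 2 -> ritt_of_type a T ->
  exists B, resolvent_off T b B.
Proof.
move=> Hb [_ [Ha [HS HR]]]; have [B HB] := HR b Hb; exists B => l Hl; split; last exact: HB.
apply NNPP => Hi; case: (not_closure_mono a b l ltac:(lra) ltac:(lra) ltac:(lra) Hl).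
exact: HS.
Qed.

End RittType.

Lemma Hinf_norm_ub (g M : R) (phi : C -> C) (z : C) : (forall z, stolz g z -> Cmod (phi z) <= M) ->
  stolz g z -> Cmod (phi z) <= Hinf_norm g phi.
Proof.
move=> HM Hz; rewrite /Hinf_norm.
set E := fun r => _.
have [Hu Hl] := Lub_Rbar_correct E.
have L := Hu (Cmod (phi z)) (ex_intro _ z (conj Hz eq_refl)).
have U : Rbar_le (Lub_Rbar E) M by apply Hl => r [y [Hy ->]]; exact: HM.
by case: (Lub_Rbar E) L U => [l | |].
Qed.

Lemma Hinf_norm_le (g M : R) (phi : C -> C) : 0 < g < PI / 2 ->
  (forall z, stolz g z -> Cmod (phi z) <= M) -> Hinf_norm g phi <= M.
Proof.
move=> Hg HM; rewrite /Hinf_norm.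
set E := fun r => _.
have [Hu Hl] := Lub_Rbar_correct E.
have Hz := stolz_real g 0 Hg ltac:(lra).
have L := Hu (Cmod (phi 0)) (ex_intro _ (RtoC 0) (conj Hz eq_refl)).
have U : Rbar_le (Lub_Rbar E) M by apply Hl => r [y [Hy ->]]; exact: HM.
by case: (Lub_Rbar E) L U => [l | |].
Qed.

Lemma Hinf0_hol0 (g : R) (phi : C -> C) : Hinf0 g phi ->
  exists s c, hol0 g phi (Hinf_norm g phi) s c.
Proof.
move=> [H1 [[M HM] [s [c [s0 [c0 H3]]]]]]; exists s, c; split; [|split; [|split; [|split]]] => //.
- by move=> z Hz; have [l Hl] := H1 z Hz; exists l; exact: is_derive_cder.
- by move=> z Hz; exact: (Hinf_norm_ub g M).
Qed.

Lemma Cmod_inv_2PIi : Cmod (/ (2 * PI * Ci)) = / (2 * PI).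
Proof.
have P := PI_RGT_0.
have E : Cmod (2 * PI * Ci) = 2 * PI.
  have -> : (2 * PI * Ci)%C = (RtoC (2 * PI) * Ci)%C by rewrite RtoC_mult.
  rewrite Cmod_mult Cmod_R Rabs_pos_eq; last lra.
  have -> : Cmod Ci = 1 by rewrite /Cmod /Ci /= -[RHS]sqrt_1; f_equal; ring.
  ring.
rewrite Cmod_inv ?E //; move=> Z; rewrite Z Cmod_0 in E; lra.
Qed.

Theorem squares_bounded_calculus {H : Hilbert} (T : bounded_op H) : ritt T ->
  square_estimate T -> square_estimate (adjoint T) ->
  exists g, 0 < g < PI / 2 /\ bounded_Hinf_calculus g T.
Proof.
move=> HT S1 S2.
have [a [B [Ha HB]]] := ritt_resolvent_off T HT.
have [M [C0 [M1 [_ [HM _]]]]] := ritt_bounded T HT.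
have [R0 [R00 HR]] := commuting_bound T M M1 HM S1 S2.
set g := (a + PI / 2) / 2.
have Hg : 0 < g < PI / 2 by rewrite /g; lra.
have ag : a < g by rewrite /g; lra.
have P := PI_RGT_0.
have sg := sin_01 g Hg.
set q := (1 + B) * ((2 + 2 * PI) / (1 - sin g)).
exists g; split=> //; exists a; split=> //; split; first exact: (resolvent_off_type T a B).
(* The absolute value and the 1 make the constant positive, as the definition asks. *)
exists (Rabs (R0 * q) + 1); split; first by have := Rabs_pos (R0 * q); lra.
move=> b phi Hb Hphi.
have [s [c Hh]] := Hinf0_hol0 g phi Hphi.
have [v Hv] := calc_ex T a B HB ltac:(lra) b g phi _ s c Hb ltac:(lra) Hh.
rewrite (calc_fun_calc T b phi v Hv).
have N0 : 0 <= Hinf_norm g phi.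
  apply Rle_trans with (Cmod (phi 0)); first exact: Cmod_ge_0.
  by apply (proj1 (proj2 Hh)), stolz_real => //; lra.
have L : onorm v <= R0 * (Hinf_norm g phi * q).
  apply HR.
  - by apply (calc_comm T a B HB ltac:(lra) b phi) => //; lra.
  - by move=> n; exact: (calc_orbit_bound T a g B ltac:(lra) ag ltac:(lra) HB b phi _ s c v Hb Hh Hv).
  - by move=> e e0; exact: (calc_pow_vanish T a g B ltac:(lra) ag ltac:(lra) HB b phi _ s c v Hb Hh Hv).
apply Rle_trans with (1 := onorm_scal _ _); rewrite Cmod_inv_2PIi.
have I1 : / (2 * PI) <= 1.
  rewrite -Rinv_1; apply Rinv_le_contravar; first lra.
  have := PI2_1; lra.
apply Rle_trans with (1 * onorm v).
  by apply Rmult_le_compat_r => //; exact: onorm_ge0.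
have := Rle_abs (R0 * q); nra.
Qed.

(** * The function 1 - z *)

(** The principal logarithm on the right half-plane, which contains both segments of the
    boundary. *)
Definition clog (z : C) : C := (/ 2 * ln (fst z ^ 2 + snd z ^ 2), atan (snd z / fst z)).

Lemma clog_pder (x y : R -> R) (t x' y' : R) : is_derive x t x' -> is_derive y t y' -> 0 < x t ->
  pder (fun u => clog (x u, y u)) t ((x', y') * / (x t, y t))%C.
Proof.
move=> Hx Hy x0; rewrite /clog /=.
have p0 : 0 < x t * (x t * 1) + y t * (y t * 1).
  by have := pow2_ge_0 (y t); rewrite /= => ?; have := Rmult_lt_0_compat _ _ x0 x0; lra.
have -> : ((x', y') * / (x t, y t))%C =
  ((x t * x' + y t * y') / (x t * (x t * 1) + y t * (y t * 1)),
   (x t * y' - x' * y t) / (x t * (x t * 1) + y t * (y t * 1))).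
  by apply C_eq; rewrite /Re /Im /=; field; lra.
have Ex : ex_derive x t by exists x'.
have Ey : ex_derive y t by exists y'.
have Dx : Derive x t = x' by exact: is_derive_unique.
have Dy : Derive y t = y' by exact: is_derive_unique.
apply pder_pair.
- auto_derive; first by split=> //; split=> //; split.
  rewrite Dx Dy; field; lra.
- auto_derive; first by split=> //; split=> //; split=> //; lra.
  rewrite Dx Dy; field; split; lra.
Qed.

Lemma Cinv_cder (z : C) : z <> 0 ->
  cder (V := C_CompleteNormedModule) (fun y => / y)%C z (- / (z * z))%C.
Proof.
move=> z0 e e0; have Z : 0 < Cmod z by apply Cmod_gt_0.
set k := 2 * / Cmod z * / Cmod z * / Cmod z.
have iZ := Rinv_0_lt_compat _ Z.
have k0 : 0 < k by rewrite /k; apply Rmult_lt_0_compat => //; nra.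
exists (Rmin (Cmod z / 2) (e / k)); split; first by apply Rmin_pos; apply Rdiv_lt_0_compat; lra.
move=> y Hy.
have H1 := Rlt_le_trans _ _ _ Hy (Rmin_l _ _); have H2 := Rlt_le_trans _ _ _ Hy (Rmin_r _ _).
have Y : Cmod z / 2 < Cmod y.
  have := Cmod_triangle y (z - y); have -> : (y + (z - y) = z)%C by ring. rewrite (Cmod_sub_sym z y); lra.
have y0 : y <> 0 by move=> E; rewrite E Cmod_0 in Y; lra.
change (Cmod (/ y - / z - (y - z) * - / (z * z)) <= e * Cmod (y - z)).
have -> : (/ y - / z - (y - z) * - / (z * z) = (y - z) * ((y - z) * (/ y * / z * / z)))%C by field.
rewrite !Cmod_mult !Cmod_inv //.
have Y0 := Cmod_ge_0 (y - z).
rewrite (Rmult_comm e); apply Rmult_le_compat_l => //.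
have iY : / Cmod y <= 2 * / Cmod z.
  have -> : 2 * / Cmod z = / (Cmod z / 2) by field; lra.
  by apply Rinv_le_contravar; lra.
apply Rle_trans with (e / k * k); last by right; field; lra.
apply Rmult_le_compat; [done | | lra |].
  have : 0 < / Cmod y by apply Rinv_0_lt_compat; lra.
  by move=> ?; apply Rmult_le_pos; nra.
rewrite /k; apply Rmult_le_compat_r; first lra.
by apply Rmult_le_compat_r; lra.
Qed.

Section LogIntegral.
Variable b : R.
Hypothesis Hb : 0 < b < PI / 2.

Lemma contour_inv_seg (w : C) : 0 < fst w ->
  sing_int (V := C_CompleteNormedModule) (seg_fun (V := C_CompleteNormedModule) (fun z => / z)%C 1 w) (clog w).
Proof.
move=> w0.
set x := fun t : R => 1 - t + t * fst w; set y := fun t : R => t * snd w.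
have E : forall t, segment 1 w t = (x t, y t).
  by move=> t; apply C_eq; rewrite /segment /x /y /Re /Im /=; ring.
have x0 : forall t, 0 <= t <= 1 -> 0 < x t.
  by move=> t Ht; rewrite /x; case: (Req_dec t 0) => [-> | N]; nra.
have D : forall t, 0 <= t <= 1 -> pder (fun u => clog (segment 1 w u)) t ((w - 1) * / segment 1 w t)%C.
  move=> t Ht.
  have -> : (fun u => clog (segment 1 w u)) = (fun u => clog (x u, y u)).
    by apply functional_extensionality => u; rewrite E.
  rewrite E; have -> : (w - 1)%C = (fst w - 1, snd w) by apply C_eq; rewrite /Re /Im /=; ring.
  apply clog_pder; [| | exact: x0]; rewrite /x /y; auto_derive => //; ring.
have D' : forall t, 0 <= t <= 1 -> vder (V := C_CompleteNormedModule) (fun u => clog (segment 1 w u)) t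
   (seg_fun (V := C_CompleteNormedModule) (fun z => / z)%C 1 w t) by move=> t Ht; exact: D.
have c1 : clog 1 = 0%C.
  apply C_eq; rewrite /clog /Re /Im /=.
    have -> : 1 * (1 * 1) + 0 * (0 * 1) = 1 by ring.
    by rewrite ln_1; ring.
  by rewrite /Rdiv Rmult_0_l atan_0.
exists (fun e => clog w -v clog (segment 1 w e)); split.
- move=> e He.
  have := vint_FTC (V := C_CompleteNormedModule) (fun t => clog (segment 1 w t)) (seg_fun (V := C_CompleteNormedModule) (fun z => / z)%C 1 w) e 1.
  rewrite segment1 Rmin_left ?Rmax_right; [|lra|lra]; apply => t Ht; first by apply D'; lra.
  apply (vscal_vcont (V := C_CompleteNormedModule)).
  have N : segment 1 w t <> 0.
    rewrite E => Q; have N1 : x t = 0 := f_equal fst Q.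
    by have := x0 t ltac:(lra); lra.
  apply (ccont_path (V := C_CompleteNormedModule) (fun z => / z)%C _ _ _ (segment_pder 1 w t)).
  exact: (cder_cont (V := C_CompleteNormedModule) _ _ _ (Cinv_cder _ N)).
- move=> eps e0.
  have [d [d0 Hd]] := vder_cont (V := C_CompleteNormedModule) _ _ _ (D' 0 ltac:(lra)) eps e0.
  exists d; split=> // e He e1.
  have L := Hd e ltac:(rewrite Rminus_0_r Rabs_pos_eq; lra); rewrite segment0 c1 in L.
  have L' : Cmod (clog (segment 1 w e) - 0) < eps := L.
  change (Cmod (clog w - clog (segment 1 w e) - clog w) < eps).
  have -> : (clog w - clog (segment 1 w e) - clog w = - (clog (segment 1 w e) - 0))%C by ring.
  by rewrite Cmod_opp.
Qed.

(** On the segments the logarithm is a primitive; the real parts cancel and the angle 2 (PI/2 - b)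
    remains. The arc adds PI + 2b. *)
Lemma contour_inv : contour (V := C_CompleteNormedModule) b (fun z => / z)%C (2 * PI * Ci)%C.
Proof.
have P := PI_RGT_0; have [s0 s1] := sin_01 b Hb.
have cb : 0 < cos b by apply cos_gt_0; lra.
have at1 : atan (cos b / sin b) = PI / 2 - b.
  have -> : cos b / sin b = tan (PI / 2 - b) by rewrite /tan sin_shift cos_shift.
  by apply atan_tan; lra.
have cu : clog (stolz_up b) = (/ 2 * ln (fst (stolz_up b) ^ 2 + snd (stolz_up b) ^ 2), PI / 2 - b).
  rewrite /clog; f_equal; rewrite stolz_upE /=.
  by have -> : sin b * cos b / (sin b * sin b) = cos b / sin b by field; lra.
have cl : clog (stolz_low b) = (/ 2 * ln (fst (stolz_up b) ^ 2 + snd (stolz_up b) ^ 2), - (PI / 2 - b)).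
  rewrite /clog; f_equal.
    by rewrite stolz_lowE stolz_upE /=; do 2 f_equal; ring.
  rewrite stolz_lowE /=; have -> : - (sin b * cos b) / (sin b * sin b) = - (cos b / sin b) by field; lra.
  by rewrite atan_opp at1.
have ss : 0 < sin b * sin b by apply Rmult_lt_0_compat.
exists (clog (stolz_up b)), (RtoC (PI + 2 * b) * Ci)%C, (clog (stolz_low b)).
split; [|split; [|split]].
- by apply contour_inv_seg; rewrite stolz_upE.
- have F := vint_FTC (V := C_CompleteNormedModule) (fun t => RtoC t * Ci)%C (fun _ => Ci) (PI / 2 - b) (3 * PI / 2 + b).
  have G : vint (V := C_CompleteNormedModule) (fun _ => Ci) (PI / 2 - b) (3 * PI / 2 + b) (RtoC (PI + 2 * b) * Ci)%C.
    have Ev : forall v w : C, v = w -> vint (V := C_CompleteNormedModule) (fun _ => Ci) (PI / 2 - b) (3 * PI / 2 + b) v ->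
      vint (V := C_CompleteNormedModule) (fun _ => Ci) (PI / 2 - b) (3 * PI / 2 + b) w by move=> v w ->.
    apply (Ev (RtoC (3 * PI / 2 + b) * Ci - RtoC (PI / 2 - b) * Ci)%C); first by apply C_eq; rewrite /Re /Im /=; field.
    apply F => t _ e e0; exists 1; split; try lra; move=> u _.
    - change (Cmod (RtoC u * Ci - RtoC t * Ci - RtoC (u - t) * Ci) <= e * Rabs (u - t)).
      have -> : (RtoC u * Ci - RtoC t * Ci - RtoC (u - t) * Ci = 0)%C by apply C_eq; rewrite /Re /Im /=; ring.
      by rewrite Cmod_0; apply Rmult_le_pos; [lra | exact: Rabs_pos].
    - change (Cmod (Ci - Ci) < e); have -> : (Ci - Ci = 0)%C by ring.
      by rewrite Cmod_0.
  apply: vint_ext G; first lra.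
  move=> t Ht; change (Ci = Ci * circle_pt (sin b) t * / circle_pt (sin b) t)%C; field.
  by move=> E; have := Cmod_circle b Hb t; rewrite E Cmod_0; lra.
- by apply contour_inv_seg; rewrite stolz_lowE.
- rewrite cu cl; move: (/ 2 * ln _)%R => q.
  change (2 * PI * Ci = ((q, PI / 2 - b)%R : C) + (RtoC (PI + 2 * b) * Ci - ((q, - (PI / 2 - b))%R : C)))%C.
  by apply C_eq; rewrite /Re /Im /=; field.
Qed.

End LogIntegral.

Lemma cder_comp {V : CompleteNormedModule C_AbsRing} (F : C -> V) (h : C -> C) (z h' : C) (l : V) :
  cder (V := C_CompleteNormedModule) h z h' -> cder F (h z) l -> cder (fun y => F (h y)) z (h' *v l).
Proof. by move=> Hh HF e e0; exact: (cder_chain F h z (fun y => (y - z)%C) h' l Hh HF e e0). Qed.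

Lemma cder_linear {V V' : CompleteNormedModule C_AbsRing} (L : V -> V') (f : C -> V) z l :
  is_linear L -> cder f z l -> cder (fun y => L (f y)) z (L l).
Proof.
move=> HL Hf e e0; have [M [M0 HM]] := linear_norm L HL.
have [d [d0 Hd]] := Hf (e / M) ltac:(apply Rdiv_lt_0_compat; lra).
exists d; split=> // y Hy.
have -> : (L (f y) -v L (f z)) -v (y - z) *v L l = L ((f y -v f z) -v (y - z) *v l).
  symmetry; transitivity (L (f y -v f z) -v L ((y - z) *v l)); first exact: linear_minus.
  have -> : L ((y - z) *v l) = (y - z) *v L l by exact: linear_scal.
  by have -> : L (f y -v f z) = L (f y) -v L (f z) by exact: linear_minus.
apply Rle_trans with (1 := HM _).
have -> : e * Cmod (y - z) = M * (e / M * Cmod (y - z)) by field; lra.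
by apply Rmult_le_compat_l; [lra | exact: Hd].
Qed.

(** * Inversion of the exterior of a Stolz domain *)

Lemma Cinv_involutive (z : C) : z <> 0 -> (/ / z)%C = z.
Proof. by move=> N; field. Qed.

Lemma Cinv_neq0 (z : C) : z <> 0 -> (/ z)%C <> 0.
Proof. by move=> N E; have := Cinv_r z N; rewrite E Cmult_0_r => Q; have := f_equal fst Q; rewrite /=; lra. Qed.

Lemma stolz_far (a : R) (z : C) : 0 < a < PI / 2 -> 1 < Cmod z -> ~ closure (U := C_UniformSpace) (stolz a) z.
Proof.
move=> Ha Hz; apply/not_closure; exists (Cmod z - 1); split; first lra.
move=> y Hy /(stolz_Cmod_le1 a y Ha) L.
have := Cmod_triangle y (z - y); have -> : (y + (z - y) = z)%C by ring.
by rewrite (Cmod_sub_sym z y); lra.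
Qed.

(* The image under [1/z] of the complement of the closed Stolz domain; the
   point 0 stands for infinity. *)
Definition inv_exterior (a : R) (w : C) : Prop :=
  w = 0 \/ ~ closure (U := C_UniformSpace) (stolz a) (/ w)%C.

Section InvExterior.
Variable a : R.
Hypothesis Ha : 0 < a < PI / 2.

Lemma inv_exterior_small (w : C) : Cmod w < 1 -> inv_exterior a w.
Proof.
move=> Hw; case: (Ceq_dec w 0) => [-> | N]; [by left | right].
have W := proj1 (Cmod_gt_0 w) N.
apply stolz_far => //; rewrite Cmod_inv // -Rinv_1; apply Rinv_lt_contravar; lra.
Qed.

Lemma inv_exterior_open (w : C) : inv_exterior a w ->
  exists e, 0 < e /\ forall y, Cmod (y - w) < e -> inv_exterior a y.
Proof.
case: (Ceq_dec w 0) => [-> _ | N [//|]].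
  exists 1; split; first lra.
  move=> y; have -> : (y - 0 = y)%C by ring.
  exact: inv_exterior_small.
move=> /not_closure [e [e0 He]].
have [d [d0 Hd]] := cder_cont (V := C_CompleteNormedModule) _ _ _ (Cinv_cder w N) (e / 2) ltac:(lra).
exists d; split=> // y Hy; right; apply/not_closure; exists (e / 2); split; first lra.
move=> u Hu; apply He.
have L : Cmod (/ y - / w) < e / 2 := Hd y Hy.
have -> : (u - / w = (u - / y) + (/ y - / w))%C by ring.
by apply Rle_lt_trans with (1 := Cmod_triangle _ _); lra.
Qed.

(** Replacing w by t w moves 1/w away from 0 on its ray, and the Stolz domain is star-shaped about
    0. *)
Lemma inv_exterior_star (t : R) (w : C) : 0 <= t <= 1 -> inv_exterior a w -> inv_exterior a (RtoC t * w)%C.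
Proof.
move=> Ht; case: (Ceq_dec w 0) => [-> _ | N [//|]]; first by left; ring.
case: (Req_dec t 0) => [-> _ | t0]; first by left; ring.
move=> /not_closure [e [e0 He]]; right; apply/not_closure; exists e; split=> // y Hy Sy.
have T0 : RtoC t <> 0 by move=> E; apply t0; exact: (f_equal fst E).
apply (He (RtoC t * y)%C); last exact: stolz_star.
have -> : (RtoC t * y - / w = RtoC t * (y - / (RtoC t * w)))%C by field; split.
rewrite Cmod_mult Cmod_R Rabs_pos_eq; last lra.
have := Cmod_ge_0 (y - / (RtoC t * w)); nra.
Qed.

End InvExterior.

Section ExteriorIntegral.
Context {X : CompleteNormedModule C_AbsRing}.
Variables (T : bounded_op X) (a B : R).
Hypothesis Ha : 0 < a < PI / 2.
Hypothesis HB : resolvent_off T a B.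

Let S w := bop_inv (affine 1o (RtoC (-1) *s T) w).

Lemma affine_pencil (w : C) : w <> 0 -> affine 1o (RtoC (-1) *s T) w = w *s pencil (/ w)%C T.
Proof.
move=> N; apply bop_ext => x.
change (x +v w *v (RtoC (-1) *v T x) = w *v ((/ w) *v x -v T x)).
rewrite vscalBr !vscalA Cinv_r // vscal1 (Cmult_comm w) -vscalA.
by rewrite /minus vopp_scal.
Qed.

Lemma affine_inverse (w : C) : inv_exterior a w -> w <> 0 ->
  is_inverse (affine 1o (RtoC (-1) *s T) w) ((/ w) *s resolvent (/ w)%C T).
Proof.
move=> [//|Hw] N; have [Hi _] := HB _ Hw; have [E1 E2] := resolventP _ _ Hi.
rewrite affine_pencil //; split.
- change ((w *s pencil (/ w) T) *o ((/ w) *s resolvent (/ w) T) = 1o).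
  rewrite opZl opZr E1; apply bop_ext => x; change (w *v ((/ w) *v x) = x).
  by rewrite vscalA Cinv_r // vscal1.
- change (((/ w) *s resolvent (/ w) T) *o (w *s pencil (/ w) T) = 1o).
  rewrite opZl opZr E2; apply bop_ext => x; change ((/ w) *v (w *v x) = x).
  by rewrite vscalA Cinv_l // vscal1.
Qed.

Lemma affine_inverse0 : is_inverse (affine 1o (RtoC (-1) *s T) 0) 1o.
Proof.
have -> : affine 1o (RtoC (-1) *s T) 0 = 1o.
  apply bop_ext => x; change (x +v RtoC 0 *v (RtoC (-1) *v T x) = x).
  by rewrite v0scal vadd0.
by split; exact: op1_l.
Qed.

Lemma affine_invE (w : C) : inv_exterior a w -> w <> 0 -> S w = (/ w) *s resolvent (/ w)%C T.
Proof. by move=> Hw N; apply bop_inv_unique, affine_inverse. Qed.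

Lemma affine_inv0 : S 0 = 1o.
Proof. by apply bop_inv_unique, affine_inverse0. Qed.

Lemma affine_invertible (w : C) : inv_exterior a w -> invertible (affine 1o (RtoC (-1) *s T) w).
Proof.
move=> Hw; case: (Ceq_dec w 0) => [-> | N]; eexists; first exact: affine_inverse0.
exact: affine_inverse.
Qed.

Let A : bounded_op X := 1o -o T.

(** With l = 1/w: for |l| <= 2 the factor I - T compensates the singularity at 1, and for |l| > 2
    the resolvent bound gives |l R(l)| <= 2B. *)
Lemma exterior_bound : exists M, forall w, inv_exterior a w -> onorm ((T *o A) *o S w) <= M.
Proof.
have B0 : 0 <= B.
  have N2 : 1 < Cmod (RtoC 2) by rewrite Cmod_R Rabs_pos_eq; lra.
  have [_ L] := HB _ (stolz_far a (RtoC 2) Ha N2).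
  by apply Rle_trans with (2 := L); exact: onorm_ge0.
have T0 := onorm_ge0 T; have A0 := onorm_ge0 A.
have TA := Rmult_le_pos _ _ T0 A0.
exists (onorm T * onorm A + onorm T * (2 * (1 + B)) + onorm T * onorm A * (2 * B)) => w Hw.
have TB : 0 <= onorm T * (2 * (1 + B)) by apply Rmult_le_pos; lra.
have TAB : 0 <= onorm T * onorm A * (2 * B) by apply Rmult_le_pos; lra.
case: (Ceq_dec w 0) => [E | N].
  rewrite E affine_inv0 op1_r; have := onorm_mul T A; lra.
have [//|Hl] := Hw; have [Hi Hn] := HB _ Hl.
rewrite affine_invE //; set l := (/ w)%C in Hl Hi Hn *.
case: (Rle_lt_dec (Cmod l) 2) => Hl2.
- have E : A *o resolvent l T = resolvent l T *o A.
    by apply (resolvent_comm l T A Hi); exact: (f_equal bico (bmul_comm T (bsub b1 (bT T)) (bT T))).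
  have L : onorm (T *o (l *s (A *o resolvent l T))) <= onorm T * (2 * (1 + B)).
    apply onorm_mul_le; first exact: Rle_refl.
    rewrite onorm_scal_eq E.
    apply Rmult_le_compat; [exact: Cmod_ge_0 | exact: onorm_ge0 | done |].
    exact: (resolvent_range_bound T a B HB).
  have -> : (T *o A) *o (l *s resolvent l T) = T *o (l *s (A *o resolvent l T)).
    by rewrite -opA opZr.
  lra.
- have L : onorm (l *s resolvent l T) <= 2 * B.
    rewrite onorm_scal_eq in Hn; rewrite onorm_scal_eq.
    have L1 : Cmod l <= 2 * Cmod (l - 1).
      have := Cmod_triangle (l - 1) 1; have -> : (l - 1 + 1 = l)%C by ring.
      rewrite Cmod_1; lra.
    have R0 := onorm_ge0 (resolvent l T).
    have := Rmult_le_compat_r _ _ _ R0 L1; lra.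
  have := onorm_mul_le _ _ _ _ (onorm_mul T A) L; lra.
Qed.

(** If G is a primitive of T (I - T)(I - w T)^-1, then -G(1/z) is one of the integrand, because (I -
    T/z)^-1 = z R(z) and the derivative of 1/z is -1/z^2. *)
Lemma contour_exterior (b : R) : a < b < PI / 2 ->
  contour (V := bop_CompleteNormedModule X) b (fun z => (/ z)%C *s ((T *o A) *o resolvent z T)) 0o.
Proof.
move=> Hb; set V := bop_CompleteNormedModule X.
set k : C -> V := fun w => (T *o A) *o S w.
have kder : forall w, inv_exterior a w -> exists l, cder k w l.
  move=> w Hw; have D := affine_inv_cder _ _ w (affine_invertible w Hw).
  by eexists; exact: (cder_linear (V := V) (V' := V) _ _ _ _ (is_linear_opmul_l (T *o A)) D).
have [M HM] := exterior_bound.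
have star : forall (t : R) z, 0 <= t <= 1 -> inv_exterior a z -> inv_exterior a (RtoC t * z)%C.
  by move=> t z; exact: inv_exterior_star.
have real1 : forall t, 0 <= t < 1 -> inv_exterior a (RtoC t).
  by move=> t Ht; apply inv_exterior_small => //; rewrite Cmod_R Rabs_pos_eq; lra.
have [l Hl] := primitive_limit (V := V) (inv_exterior a) k (inv_exterior_open a Ha) star kder M HM real1.
have nz : forall z, bdry b z -> z <> 0.
  move=> z Hz E; apply (bdry_out b ltac:(lra) a z ltac:(lra) Hz).
  by rewrite E; apply stolz_closure, stolz_real; lra.
have inv_in : forall z, bdry b z -> inv_exterior a (/ z)%C.
  by move=> z Hz; right; rewrite Cinv_involutive; [apply (bdry_out b) => //; lra | exact: nz].
have kE : forall z, bdry b z -> RtoC (-1) *s ((- / (z * z))%C *s k (/ z)%C) = (/ z)%C *s ((T *o A) *o resolvent z T).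
  move=> z Hz; have Nz := nz z Hz.
  rewrite /k affine_invE; [|exact: inv_in|exact: Cinv_neq0].
  rewrite Cinv_involutive // opZr; apply bop_ext => x.
  change (RtoC (-1) *v ((- / (z * z)) *v (z *v (T (A (resolvent z T x))))) = (/ z) *v T (A (resolvent z T x))).
  have -> : RtoC (-1) = (- RtoC 1)%C by rewrite -RtoC_opp.
  by rewrite !vscalA; f_equal; field.
set G := star_primitive k.
have GD : forall w, inv_exterior a w -> cder G w (k w) by exact: (primitive_der (V := V) (inv_exterior a) k (inv_exterior_open a Ha) star kder).
apply (contour_primitive (V := V) b _ (fun z => RtoC (-1) *s G (/ z)%C) (RtoC (-1) *s l)); first lra.
- move=> z Hz; rewrite -kE //.
  apply (cder_linear (V := V) (V' := V) (fun U => RtoC (-1) *s U)).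
    exact: (is_linear_scal_r (V := bop_NormedModule X) (RtoC (-1)) Cmult_comm).
  by apply (cder_comp (V := V) G (fun y => / y)%C); [apply Cinv_cder, nz | apply GD, inv_in].
- move=> z Hz; have [Hi _] := bdry_resolvent T a B HB ltac:(lra) b z Hb Hz.
  apply (ccont_mul (V := V) (fun z => / z)%C (fun z => (T *o A) *o resolvent z T)).
    exact: (cder_cont (V := C_CompleteNormedModule) _ _ _ (Cinv_cder z (nz z Hz))).
  have [d Hd] := resolvent_cder T z Hi.
  exact: (cder_cont _ _ _ (cder_linear (V := V) (V' := V) _ _ _ _ (is_linear_opmul_l (T *o A)) Hd)).
- move=> e e0; have [d [d0 Hd]] := Hl e e0.
  (* |z - 1| < 1/2 gives |z| > 1/2, so that |1/z - 1| < 2 |z - 1| < d. *)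
  exists (Rmin (/ 2) (d / 2)); split; first by apply Rmin_pos; lra.
  move=> z Hz Hz1.
  have H1 := Rlt_le_trans _ _ _ Hz1 (Rmin_l _ _); have H2 := Rlt_le_trans _ _ _ Hz1 (Rmin_r _ _).
  have Zh : / 2 < Cmod z.
    have := Cmod_triangle z (1 - z); have -> : (z + (1 - z) = 1)%C by ring.
    by rewrite Cmod_1 (Cmod_sub_sym 1 z); lra.
  have L : norm (G (/ z)%C -v l) < e.
    apply Hd; first exact: inv_in.
    have -> : (/ z - 1 = (1 - z) * / z)%C by field; exact: nz.
    rewrite Cmod_mult Cmod_inv; last exact: nz.
    rewrite (Cmod_sub_sym 1 z); apply (Rmult_lt_reg_r (Cmod z)); first lra.
    rewrite Rmult_assoc Rinv_l; last lra.
    have : d * / 2 < d * Cmod z by apply Rmult_lt_compat_l.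
    lra.
  have -> : (RtoC (-1) *s G (/ z)%C) -v (RtoC (-1) *s l) = RtoC (-1) *s (G (/ z)%C -o l).
    by symmetry; exact: (vscalBr (X := bop_NormedModule X)).
  change (onorm (RtoC (-1) *s (G (/ z)%C -o l)) < e).
  by rewrite onorm_scal_eq Cmod_R Rabs_Ropp Rabs_R1 Rmult_1_l.
Qed.

Lemma contour_one (b : R) : 0 < b < PI / 2 -> contour (V := C_CompleteNormedModule) b (fun _ => RtoC 1) (RtoC 0).
Proof.
move=> Hb; apply (contour_primitive (V := C_CompleteNormedModule) b _ (fun z => z) (RtoC 1)) => //.
- move=> z _ e e0; exists 1; split; first lra; move=> y _.
  change (Cmod (y - z - (y - z) * 1) <= e * Cmod (y - z)).
  have -> : (y - z - (y - z) * 1 = 0)%C by ring.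
  by rewrite Cmod_0; apply Rmult_le_pos; [lra | exact: Cmod_ge_0].
- move=> z _ e e0; exists 1; split; first lra; move=> y _.
  change (Cmod (1 - 1) < e); have -> : (1 - 1 = 0)%C by ring.
  by rewrite Cmod_0.
- by move=> e e0; exists e.
Qed.

(* [(1 - z) R(z) = A / z - 1 + A T R(z) / z], whose last term decays like
   [1 / z^2] at infinity. *)
Lemma calc_one_minus (b : R) : a < b < PI / 2 -> calc T b (fun z => (1 - z)%C) ((2 * PI * Ci)%C *s A).
Proof.
move=> Hb; set V := bop_CompleteNormedModule X.
have Hb' : 0 < b < PI / 2 by lra.
have K1 := contour_linear (V := C_CompleteNormedModule) (V' := V) _ _ _ _ (is_linear_scal_op (RtoC (-1) *s 1o)) (contour_one b Hb').
have K2 := contour_linear (V := C_CompleteNormedModule) (V' := V) _ _ _ _ (is_linear_scal_op A) (contour_inv b Hb').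
have K := contour_add (V := V) _ _ _ _ _ K1 (contour_add (V := V) _ _ _ _ _ K2 (contour_exterior b Hb)).
have E : (2 * PI * Ci)%C *s A = RtoC 0 *s (RtoC (-1) *s 1o) +o ((2 * PI * Ci)%C *s A +o 0o).
  apply bop_ext => x; change ((2 * PI * Ci) *v A x = RtoC 0 *v (RtoC (-1) *v x) +v ((2 * PI * Ci) *v A x +v 0v)).
  by rewrite v0scal v0add vadd0.
rewrite /calc E; apply: contour_ext K => // z Hz.
have [Hi _] := bdry_resolvent T a B HB ltac:(lra) b z Hb Hz.
have [E1 E2] := resolventP z T Hi.
have Nz : z <> 0.
  move=> E0; apply (bdry_out b Hb' a z ltac:(lra) Hz).
  by rewrite E0; apply stolz_closure, stolz_real; lra.
change (RtoC 1 *s (RtoC (-1) *s 1o) +o ((/ z)%C *s A +o (/ z)%C *s ((T *o A) *o resolvent z T)) = (1 - z) *s resolvent z T).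
apply bop_ext => x.
set y := resolvent z T x.
have Ex : z *v y -v T y = x by exact: (f_equal (fun U : bounded_op X => U x) E1).
have AT : T *o A = A *o T by exact: (f_equal bico (bmul_comm T (bT T) (bsub b1 (bT T)))).
change (RtoC 1 *v (RtoC (-1) *v x) +v ((/ z) *v A x +v (/ z) *v (T *o A) y) = (1 - z) *v y).
rewrite AT; change (RtoC 1 *v (RtoC (-1) *v x) +v ((/ z) *v A x +v (/ z) *v A (T y)) = (1 - z) *v y).
have E3 : A x +v A (T y) = z *v A y by rewrite -opD -Ex vsubK opZ.
rewrite -vscalDr E3 (vscalA (/ z)%C) Cinv_l // !vscal1.
change (RtoC (-1) *v x +v (y -v T y) = (1 - z) *v y).
rewrite -{1}Ex; exact: vone_minus.
Qed.

End ExteriorIntegral.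

(** * The calculus bounds square functions *)

(** 1 - r^m = (1 - r)(1 + ... + r^(m-1)), and each of the m powers is at least r^m. *)
Lemma geometric_block (r : R) (m : nat) : 0 <= r <= 1 -> INR m * r ^ m * (1 - r) <= 1 - r ^ m.
Proof.
move=> Hr; elim: m => [|m IH]; first by rewrite /=; lra.
rewrite S_INR /=; have P := pow_le r m (proj1 Hr).
have P1 : r ^ m <= 1 by apply Rle_trans with (1 ^ m); [apply pow_incr | rewrite pow1; lra].
have L1 := Rmult_le_compat_l r _ _ (proj1 Hr) IH.
have L2 : 0 <= (1 - r) * (1 - r * r ^ m) by apply Rmult_le_pos; nra.
nra.
Qed.

(** Term j + 1 is 2 r^(2^j) times the term at j, hence by [geometric_block] at most 2 (r^(2^j) -
    r^(2^(j+1))); these bounds telescope. *)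
Lemma dyadic_geometric_sum (r : R) (N : nat) : 0 <= r <= 1 ->
  rsum (fun j => 2 ^ j * r ^ (2 ^ j) * (1 - r)) N <= 2.
Proof.
move=> Hr; case: N => [|N]; first by rewrite /=; lra.
have P : forall m, 0 <= r ^ m by move=> m; apply pow_le; lra.
suff : rsum (fun j => 2 ^ j * r ^ (2 ^ j) * (1 - r)) (S N) <= 2 * (1 - r ^ (2 ^ N)).
  by have := P (2 ^ N)%nat; lra.
elim: N => [|N IH]; first by rewrite /=; nra.
rewrite [rsum _ (S (S N))]/=.
apply Rle_trans with (1 := Rplus_le_compat_r _ _ _ IH).
have E : r ^ (2 ^ N + (2 ^ N + 0)) = r ^ (2 ^ N) * r ^ (2 ^ N) by rewrite Nat.add_0_r pow_add.
change (2 * 2 ^ N)%R with (2 ^ S N)%R; rewrite /= E.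
have G := geometric_block r (2 ^ N) Hr; rewrite INR_2pow in G.
have := Rmult_le_compat_l _ _ _ (P (2 ^ N)%nat) G; lra.
Qed.

Lemma hol0_add_scal (g : R) (phi psi : C -> C) (M M' s c c' : R) (k : C) :
  hol0 g phi M s c -> hol0 g psi M' s c' ->
  hol0 g (fun z => phi z + k * psi z)%C (M + Cmod k * M') s (c + Cmod k * c').
Proof.
move=> [H1 [H2 [s0 [c0 H3]]]] [K1 [K2 [_ [c0' K3]]]]; have K0 := Cmod_ge_0 k.
split; [|split; [|split; [|split]]] => //.
- move=> z Hz; have [l Hl] := H1 z Hz; have [l' Hl'] := K1 z Hz.
  exists (l + k * l')%C => e e0.
  have [d1 [d10 D1]] := Hl (e / 2) ltac:(lra).
  have [d2 [d20 D2]] := Hl' (e / (2 * (Cmod k + 1))) ltac:(apply Rdiv_lt_0_compat; lra).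
  exists (Rmin d1 d2); split; first exact: Rmin_pos.
  move=> y Hy.
  have A1 : Cmod (phi y - phi z - (y - z) * l) <= e / 2 * Cmod (y - z) := D1 y (Rlt_le_trans _ _ _ Hy (Rmin_l _ _)).
  have A2 : Cmod (psi y - psi z - (y - z) * l') <= e / (2 * (Cmod k + 1)) * Cmod (y - z) :=
    D2 y (Rlt_le_trans _ _ _ Hy (Rmin_r _ _)).
  change (Cmod (phi y + k * psi y - (phi z + k * psi z) - (y - z) * (l + k * l')) <= e * Cmod (y - z)).
  have -> : (phi y + k * psi y - (phi z + k * psi z) - (y - z) * (l + k * l') =
    (phi y - phi z - (y - z) * l) + k * (psi y - psi z - (y - z) * l'))%C by ring.
  apply Rle_trans with (1 := Cmod_triangle _ _); rewrite Cmod_mult.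
  have A3 : Cmod k * Cmod (psi y - psi z - (y - z) * l') <= e / 2 * Cmod (y - z).
    apply Rle_trans with ((Cmod k + 1) * (e / (2 * (Cmod k + 1)) * Cmod (y - z))).
      by apply Rmult_le_compat; [done | exact: Cmod_ge_0 | lra | done].
    by right; field; lra.
  lra.
- move=> z Hz; apply Rle_trans with (1 := Cmod_triangle _ _); rewrite Cmod_mult.
  by apply Rplus_le_compat; [exact: H2 | apply Rmult_le_compat_l => //; exact: K2].
- by have := Rmult_le_pos _ _ K0 (Rlt_le _ _ c0'); lra.
- move=> z Hz; apply Rle_trans with (1 := Cmod_triangle _ _); rewrite Cmod_mult.
  rewrite Rmult_plus_distr_r Rmult_assoc.
  by apply Rplus_le_compat; [exact: H3 | apply Rmult_le_compat_l => //; exact: K3].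
Qed.

Lemma hol0_zero (g : R) : hol0 g (fun _ => RtoC 0) 0 1 1.
Proof.
have R0 : forall u, 0 < Rpower u 1 by move=> u; exact: exp_pos.
split; [|split; [|split; [|split]]]; try lra.
- move=> z _; exists (RtoC 0) => e e0; exists 1; split; first lra; move=> y _.
  change (Cmod (0 - 0 - (y - z) * 0) <= e * Cmod (y - z)).
  have -> : (0 - 0 - (y - z) * 0 = 0)%C by ring.
  by rewrite Cmod_0; apply Rmult_le_pos; [lra | exact: Cmod_ge_0].
- by move=> z _; rewrite Cmod_0; lra.
- by move=> z _; rewrite Cmod_0; have := R0 (Cmod (1 - z)); lra.
Qed.

Lemma hol0_pow (g : R) (n : nat) : 0 < g < PI / 2 -> hol0 g (fun z => Cpow z n * (1 - z))%C 2 1 1.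
Proof.
move=> Hg; elim: n => [|n IH].
  split; [|split; [|split; [|split]]]; try lra.
  - move=> z _; exists (- RtoC 1)%C => e e0; exists 1; split; first lra; move=> y _.
    change (Cmod (1 * (1 - y) - 1 * (1 - z) - (y - z) * - RtoC 1) <= e * Cmod (y - z)).
    have -> : (1 * (1 - y) - 1 * (1 - z) - (y - z) * - RtoC 1 = 0)%C by ring.
    by rewrite Cmod_0; apply Rmult_le_pos; [lra | exact: Cmod_ge_0].
  - move=> z Hz; rewrite /= Cmult_1_l; apply Rle_trans with (1 := Cmod_triangle _ _).
    by rewrite Cmod_opp Cmod_1; have := stolz_Cmod_le1 g z Hg Hz; lra.
  - move=> z Hz; rewrite /= Cmult_1_l Rmult_1_l.
    case: (Rle_lt_or_eq_dec 0 _ (Cmod_ge_0 (1 - z))) => [L | <-]; last exact: Rlt_le (exp_pos _).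
    by rewrite Rpower_1 //; lra.
have := hol0_mulz g _ _ _ _ Hg IH.
have -> // : (fun z => z * (Cpow z n * (1 - z)))%C = (fun z => Cpow z (S n) * (1 - z))%C.
by apply functional_extensionality => z; rewrite /=; ring.
Qed.

Lemma hol0_Hinf0 (g : R) (phi : C -> C) (M s c : R) : hol0 g phi M s c -> Hinf0 g phi.
Proof.
move=> [H1 [H2 [s0 [c0 H3]]]]; split; [|split].
- by move=> z Hz; have [l Hl] := H1 z Hz; exists l; exact: cder_is_derive.
- by exists M.
- by exists s, c.
Qed.

Section DyadicSums.
Context {X : CompleteNormedModule C_AbsRing}.
Variable T : bounded_op X.

(* [phi] is a sum of the functions [2^j z^(2^j) (1 - z)], [j < N], with some
   choice of signs, and [U] is [phi(T)]. *)
Inductive signed_sum : nat -> (C -> C) -> bounded_op X -> Prop :=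
| signed_sum0 : signed_sum 0 (fun _ => RtoC 0) 0o
| signed_sumS N phi U (k : R) : (k = 1 \/ k = -1) -> signed_sum N phi U ->
    signed_sum (S N) (fun z => phi z + RtoC (k * 2 ^ N) * (Cpow z (2 ^ N) * (1 - z)))%C
      (U +o RtoC (k * 2 ^ N) *s (T ^o (2 ^ N) *o (1o -o T))).

(** In a Stolz domain |1 - z| is comparable with 1 - |z|, so after the signs are dropped
    [dyadic_geometric_sum] applies. *)
Lemma signed_sum_bound (g : R) N phi U : 0 < g < PI / 2 -> signed_sum N phi U ->
  forall z, stolz g z -> Cmod (phi z) <= 4 / (1 - sin g).
Proof.
move=> Hg HS z Hz; have [s0 s1] := sin_01 g Hg.
have Z1 := stolz_Cmod_le1 g z Hg Hz; have Z0 := Cmod_ge_0 z.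
have L := stolz_Cmod g z Hg Hz.
have D := dyadic_geometric_sum (Cmod z) N (conj Z0 Z1).
set q := 2 / (1 - sin g).
have q0 : 0 < q by apply Rdiv_lt_0_compat; lra.
have L' : Cmod (1 - z) <= q * (1 - Cmod z).
  apply (Rmult_le_reg_l (1 - sin g)); first lra.
  by apply Rle_trans with (1 := L); right; rewrite /q; field; lra.
apply Rle_trans with (q * rsum (fun j => 2 ^ j * Cmod z ^ (2 ^ j) * (1 - Cmod z)) N); last first.
  apply Rle_trans with (q * 2); first by apply Rmult_le_compat_l; lra.
  by right; rewrite /q; field; lra.
clear D; elim: HS => [|{}N {}phi {}U k Hk HS IH]; first by rewrite Cmod_0 /=; lra.
rewrite [rsum _ (S N)]/= Rmult_plus_distr_l; apply Rle_trans with (1 := Cmod_triangle _ _).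
apply Rplus_le_compat => //.
have P2 := pow_lt 2 N ltac:(lra).
have -> : Cmod (RtoC (k * 2 ^ N) * (Cpow z (2 ^ N) * (1 - z))) = 2 ^ N * Cmod z ^ (2 ^ N) * Cmod (1 - z).
  rewrite !Cmod_mult Cmod_pow Cmod_R Rabs_mult (Rabs_pos_eq (2 ^ N)); last lra.
  have -> : Rabs k = 1 by case: Hk => ->; rewrite ?Rabs_Ropp Rabs_R1.
  ring.
apply Rle_trans with (2 ^ N * Cmod z ^ (2 ^ N) * (q * (1 - Cmod z))); last by right; ring.
by apply Rmult_le_compat_l => //; apply Rmult_le_pos; [lra | exact: pow_le].
Qed.

Lemma signed_sum_hol0 (g : R) N phi U : 0 < g < PI / 2 -> signed_sum N phi U ->
  exists M c, hol0 g phi M 1 c.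
Proof.
move=> Hg; elim=> [|{}N {}phi {}U k Hk HS [M [c IH]]]; first by exists 0, 1; exact: hol0_zero.
by eexists; eexists; exact: hol0_add_scal IH (hol0_pow g (2 ^ N) Hg).
Qed.

(** Combines [calc_one_minus] with multiplication by powers of z and linearity of the integral. *)
Lemma signed_sum_calc (a B b : R) N phi U : 0 < a < PI / 2 -> resolvent_off T a B ->
  a < b < PI / 2 -> signed_sum N phi U -> calc T b phi ((2 * PI * Ci)%C *s U).
Proof.
move=> Ha HB Hb; set V := bop_CompleteNormedModule X.
have Hb' : 0 < b < PI / 2 by lra.
have K1 := calc_one_minus T a B Ha HB b Hb.
set g := (b + PI / 2) / 2; have Hg : 0 < g < PI / 2 by rewrite /g; lra.
have bg : b < g by rewrite /g; lra.
have K1' : calc T b (fun z => Cpow z 0 * (1 - z))%C ((2 * PI * Ci)%C *s (1o -o T)).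
  have -> // : (fun z => Cpow z 0 * (1 - z))%C = (fun z => 1 - z)%C.
  by apply functional_extensionality => z; rewrite /=; ring.
have H0 : hol0 g (fun z => 1 - z)%C 2 1 1.
  have := hol0_pow g 0 Hg.
  have -> // : (fun z => Cpow z 0 * (1 - z))%C = (fun z => 1 - z)%C.
  by apply functional_extensionality => z; rewrite /=; ring.
elim=> [|{}N {}phi {}U k Hk HS IH].
  have L := contour_linear (V := V) (V' := V) _ _ _ _ (is_linear_zero (U := bop_NormedModule X) (V := bop_NormedModule X)) K1.
  have -> : (2 * PI * Ci)%C *s (0o : bounded_op X) = 0o by exact: (vscal0 (X := bop_NormedModule X)).
  apply: contour_ext L => // z _; symmetry; exact: (v0scal (X := bop_NormedModule X)).
have Kn := calc_pow T a B HB ltac:(lra) b g _ _ _ _ _ (2 ^ N) ltac:(lra) ltac:(lra) H0 K1.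
have L := contour_linear (V := V) (V' := V) _ _ _ _
  (is_linear_scal_r (V := bop_NormedModule X) (RtoC (k * 2 ^ N)) Cmult_comm) Kn.
have Ls := contour_add (V := V) _ _ _ _ _ IH L.
have AT : (1o -o T) *o T ^o (2 ^ N) = T ^o (2 ^ N) *o (1o -o T).
  exact: (f_equal bico (bmul_comm T (bsub b1 (bT T)) (bpow (2 ^ N)))).
have E : (2 * PI * Ci)%C *s (U +o RtoC (k * 2 ^ N) *s (T ^o (2 ^ N) *o (1o -o T))) =
  (2 * PI * Ci)%C *s U +o RtoC (k * 2 ^ N) *s ((2 * PI * Ci)%C *s (1o -o T) *o T ^o (2 ^ N)).
  rewrite opZl AT; apply bop_ext => x; set y := (T ^o (2 ^ N) *o (1o -o T)) x.
  change ((2 * PI * Ci) *v (U x +v RtoC (k * 2 ^ N) *v y) = (2 * PI * Ci) *v U x +v RtoC (k * 2 ^ N) *v ((2 * PI * Ci) *v y)).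
  by rewrite vscalDr !vscalA (Cmult_comm (RtoC (k * 2 ^ N))).
rewrite /calc E; apply: contour_ext Ls => // z _.
apply bop_ext => x; set y := resolvent z T x.
change (phi z *v y +v RtoC (k * 2 ^ N) *v ((Cpow z (2 ^ N) * (1 - z)) *v y) = (phi z + RtoC (k * 2 ^ N) * (Cpow z (2 ^ N) * (1 - z))) *v y).
by rewrite vscalA -vscalDl.
Qed.

Lemma signed_sum_norm (g : R) : 0 < g < PI / 2 -> bounded_Hinf_calculus g T ->
  exists K, 0 <= K /\ forall N phi U, signed_sum N phi U -> onorm U <= K.
Proof.
move=> Hg [a [ag [HT [K [K0 HK]]]]].
have Ha : 0 < a < PI / 2 by case: HT => _ [].
(* Type a bounds the resolvent off strictly larger angles, so an angle a' between a and the contour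
   angle b is inserted. *)
set b := (a + g) / 2; set a' := (a + b) / 2.
have ab : a < a' < b by rewrite /a' /b; lra.
have bg : a < b < g by rewrite /b; lra.
have [B HB] := ritt_of_type_off T a a' ltac:(lra) HT.
have [s0 s1] := sin_01 g Hg.
have q0 : 0 < 4 / (1 - sin g) by apply Rdiv_lt_0_compat; lra.
exists (K * (4 / (1 - sin g))); split; first by apply Rmult_le_pos; lra.
move=> N phi U HS.
have [M [c Hh]] := signed_sum_hol0 g N phi U Hg HS.
have L := HK b phi bg (hol0_Hinf0 _ _ _ _ _ Hh).
have Kc := signed_sum_calc a' B b N phi U ltac:(lra) HB ltac:(lra) HS.
rewrite (calc_fun_calc T b phi _ Kc) in L.
have P := PI_RGT_0.
have N0 : (2 * PI * Ci)%C <> 0.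
  move=> E; have := Cmod_inv_2PIi.
  have := f_equal Im E; rewrite /Im /=; lra.
have EU : (/ (2 * PI * Ci))%C *s ((2 * PI * Ci)%C *s U) = U.
  by apply bop_ext => x; change ((/ (2 * PI * Ci)) *v ((2 * PI * Ci) *v U x) = U x); rewrite vscalA Cinv_l // vscal1.
rewrite EU in L; apply Rle_trans with (1 := L); apply Rmult_le_compat_l; first lra.
by apply Hinf_norm_le => //; exact: signed_sum_bound HS.
Qed.

End DyadicSums.

Section SignAveraging.
Context {H : Hilbert}.
Variable T : bounded_op H.

(* By the parallelogram law, one of the two signs does not decrease the sum of
   squares. *)
Lemma signed_sum_large (L : bounded_op H -> bounded_op H) (x : H) (N : nat) :
  (forall U V (k : R), L (U +o RtoC k *s V) = L U +o RtoC k *s L V) ->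
  exists phi U, signed_sum T N phi U /\
    rsum (fun j => (2 ^ j * norm (L (T ^o (2 ^ j) *o (1o -o T)) x)) ^ 2) N <= norm (L U x) ^ 2.
Proof.
move=> HL; elim: N => [|N [phi [U [HS IH]]]].
  by exists (fun _ => RtoC 0), 0o; split; [exact: signed_sum0 | exact: pow2_ge_0].
set V := T ^o (2 ^ N) *o (1o -o T).
have P2 := pow_lt 2 N ltac:(lra).
have step : forall k, (k = 1 \/ k = -1) ->
    norm (L U x) ^ 2 + (2 ^ N * norm (L V x)) ^ 2 <= norm (L U x +v RtoC (k * 2 ^ N) *v L V x) ^ 2 ->
    exists phi U, signed_sum T (S N) phi U /\
    rsum (fun j => (2 ^ j * norm (L (T ^o (2 ^ j) *o (1o -o T)) x)) ^ 2) (S N) <= norm (L U x) ^ 2.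
  move=> k Hk Lk; eexists; eexists; split; first exact: (signed_sumS T N phi U k Hk HS).
  rewrite HL [rsum _ (S N)]/=; apply Rle_trans with (2 := Lk); exact: Rplus_le_compat_r.
have PL := parallelogram (L U x) (RtoC (2 ^ N) *v L V x).
rewrite norm2_scal Cmod_R (Rabs_pos_eq (2 ^ N)) in PL; last lra.
rewrite -Rpow_mult_distr in PL.
have E1 : RtoC (1 * 2 ^ N) = RtoC (2 ^ N) by rewrite Rmult_1_l.
have E2 : L U x -v RtoC (2 ^ N) *v L V x = L U x +v RtoC (-1 * 2 ^ N) *v L V x.
  by rewrite /minus vopp_scal vscalA -RtoC_mult.
rewrite E2 in PL.
case: (Rle_lt_dec (norm (L U x) ^ 2 + (2 ^ N * norm (L V x)) ^ 2) (norm (L U x +v RtoC (1 * 2 ^ N) *v L V x) ^ 2)) => Hd.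
  by apply (step 1) => //; left.
apply (step (-1)); first by right.
rewrite E1 in Hd; lra.
Qed.

(** The map L of [signed_sum_large] is the identity for T and the adjoint for T*; adjoints have the
    same norm, so one bound on signed sums serves both. *)
Theorem bounded_calculus_squares (g : R) : 0 < g < PI / 2 -> bounded_Hinf_calculus g T ->
  square_estimate T /\ square_estimate (adjoint T).
Proof.
move=> Hg HT; have [K [K0 HK]] := signed_sum_norm T g Hg HT.
have main : forall x (r : R), 0 <= r -> r <= K * norm x -> r ^ 2 <= K ^ 2 * norm x ^ 2.
  by move=> x r r0 L; rewrite -Rpow_mult_distr; exact: sq_le_sq.
split; (exists (K ^ 2); split; first exact: pow2_ge_0) => x J.
- have [|phi [U [HS L]]] := signed_sum_large (fun U => U) x J; first by [].
  apply Rle_trans with (1 := L); apply main; first exact: norm_ge_0.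
  apply Rle_trans with (1 := onorm_app U x).
  by apply Rmult_le_compat_r; [exact: norm_ge_0 | exact: HK HS].
- have [|phi [U [HS L]]] := signed_sum_large (fun U => adjoint U) x J.
    (* The adjoint is conjugate linear, but the coefficients k are real. *)
    by move=> U V k; rewrite adjoint_plus adjoint_scal; do 2 f_equal; apply C_eq; rewrite /Re /Im /=; ring.
  apply Rle_trans with (norm (adjoint U x) ^ 2).
    apply Rle_trans with (2 := L); apply Req_le, rsum_ext => j _.
    by rewrite /dyadic /orbit adjoint_orbit_op.
  apply main; first exact: norm_ge_0.
  apply Rle_trans with (1 := onorm_app _ x); rewrite norm_adjoint.
  by apply Rmult_le_compat_r; [exact: norm_ge_0 | exact: HK HS].
Qed.

End SignAveraging.

Lemma adjoint_power_bounded {H : Hilbert} (T : bounded_op H) : power_bounded T -> power_bounded (adjoint T).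
Proof.
move=> [M HM]; exists M => n.
change (onorm (adjoint T ^o n) <= M); rewrite -adjoint_pow norm_adjoint; exact: HM.
Qed.

Lemma square_functions_estimate {H : Hilbert} (T : bounded_op H) : power_bounded T ->
  ((exists c : R, 0 < c /\
      (forall x : H, Rbar_le (sqfun_norm T x) (c * norm x)) /\
      (forall y : H, Rbar_le (sqfun_norm (adjoint T) y) (c * norm y)))
   <-> (square_estimate T /\ square_estimate (adjoint T))).
Proof.
move=> HT; have HT' := adjoint_power_bounded T HT; split.
- move=> [c [c0 [H1 H2]]]; split; [apply sq_bound_estimate | apply sq_bound_estimate] => //; by exists c.
- move=> [/(sq_bound_estimate T HT) [c1 [c10 H1]] /(sq_bound_estimate _ HT') [c2 [c20 H2]]].
  exists (c1 + c2); split; first lra.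
  by split=> x; have N := norm_ge_0 x; [apply Rbar_le_trans with (1 := H1 x) | apply Rbar_le_trans with (1 := H2 x)]; rewrite /=; nra.
Qed.

Theorem theorem8p1 (H : Hilbert) (T : bounded_op H) (HT : power_bounded T) :
  ((ritt T /\ exists g : R, 0 < g < PI / 2 /\ bounded_Hinf_calculus g T)
   <->
   (exists c : R, 0 < c /\
      (forall x : H, Rbar_le (sqfun_norm T x) (c * norm x)) /\
      (forall y : H, Rbar_le (sqfun_norm (adjoint T) y) (c * norm y))))
  /\
  ((exists c : R, 0 < c /\
      (forall x : H, Rbar_le (sqfun_norm T x) (c * norm x)) /\
      (forall y : H, Rbar_le (sqfun_norm (adjoint T) y) (c * norm y)))
   <->
   (ritt T /\ exists V : bounded_op H, invertible V /\
      norm (mult (bop_inv V) (mult T V)) <= 1)).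
Proof.
have SE := square_functions_estimate T HT.
split; split.
- by move=> [_ [g [Hg HC]]]; apply SE; exact: bounded_calculus_squares Hg HC.
- move=> /SE [S1 S2]; have RT := square_estimate_ritt T HT S1; split=> //.
  exact: squares_bounded_calculus.
- move=> /SE [S1 S2]; have RT := square_estimate_ritt T HT S1; split=> //.
  have [M [C HR]] := ritt_bounded T RT.
  move: S1 S2 => [K1 [K10 HK1]] [K2 [K20 HK2]].
  have [V [W [VW L]]] := similar_to_contraction T M C K1 K2 HR K10 K20 HK1 HK2.
  exists V; split; first by exists W.
  by rewrite (bop_inv_unique V W VW).
- move=> [RT [V [Vi L]]]; apply SE.
  have [VW WV] := bop_inv_spec V Vi.
  exact: similar_contraction_squares RT VW WV L.
Qed.
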